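(* Let $E$ be a complex Banach space such that $E'$ has the bounded approximation property, and let $r,q,s,p$ be exponents satisfying the standing assumptions of the context. Let $E'$ be separable and let $T\in[\mathcal{H}_{\widetilde{N}b,((r,q);(s,p))}(E)]'$ be a continuous linear functional which is not a scalar multiple of $\delta_{0}$. Then $\bar{\Gamma}(T)$, defined by $\bar{\Gamma}(T)(f)=T\ast f$, is a convolution operator on $\mathcal{H}_{\widetilde{N}b,((r,q);(s,p))}(E)$ that is not a scalar multiple of the identity, hence hypercyclic.
   Context: Exponents: $r,q\in(1,\infty)$, $s,p\in[1,\infty)$, $r\le q$, $s'\le p'$ (where $\frac1t+\frac1{t'}=1$), and $1\le\frac1q+\frac n{p'}$ for every $n\in\mathbb{N}$ (equivalently for $n=1$). $\mathcal{P}(^{n}E)$ is the space of continuous $n$-homogeneous polynomials $E\to\mathbb{C}$ with the sup norm on the unit ball, $\mathcal{P}(^{0}E)=\mathbb{C}$; $\varphi^{n}(x)=\varphi(x)^{n}$ for $\varphi\in E'$. Lorentz sequences: for a Banach space $X$ and a bounded sequence $x$ in $X$, $a_{X,n}(x)=\inf\{\|x-u\|_{\infty}: u\in c_{00}(X),\ u \text{ has fewer than } n \text{ nonzero terms}\}$ ($c_{00}(X)$: finitely nonzero sequences). For $0<u,v<\infty$, $\ell_{(u,v)}(X)$ is the space of bounded sequences $x$ with $\|x\|_{(u,v)}=\|(n^{1/u-1/v}a_{X,n}(x))_{n}\|_{\ell_v}<\infty$; $\ell_{(u,v)}=\ell_{(u,v)}(\mathbb{C})$. $\ell^{w}_{(u,v)}(X)$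 is the space of sequences $(x_j)$ in $X$ with $(\varphi(x_j))_j\in\ell_{(u,v)}$ for all $\varphi\in X'$, with $\|(x_j)\|_{w,(u,v)}=\sup_{\|\varphi\|\le1}\|(\varphi(x_j))_j\|_{(u,v)}$. Lorentz nuclear polynomials ($n\in\mathbb{N}$): $\mathcal{P}_{N,((r,q);(s,p))}(^{n}E)$ is the space of $P=\sum_{j}\lambda_{j}\varphi_{j}^{n}y_{j}$ with $(\lambda_j)\in\ell_{(r,q)}$, $(\varphi_j)\in\ell^{w}_{(s',p')}(E')$, $(y_j)\in\ell_{\infty}$, with quasi-norm $\|P\|_{N}=\inf\|(\lambda_j)\|_{(r,q)}\|(\varphi_j)\|_{w,(s',p')}^{n}\|(y_j)\|_{\infty}$ over all such representations; $\|P\|\le\|P\|_N$. Lorentz summing polynomials: $\mathcal{P}_{as((r',q');(s',p'))}(^{n}E')$ is the space of $Q\in\mathcal{P}(^{n}E')$ with $(Q(\varphi_j))_j\in\ell_{(r',q')}$ whenever $(\varphi_j)\in\ell^{w}_{(s',p')}(E')$. Since $E'$ has the bounded approximation property, a known theorem says that the Borel transform $\mathcal{B}(S)(\varphi)=S(\varphi^{n})$ is a topological isomorphism from $\mathcal{P}_{N,((r,q);(s,p))}(^{n}E)'$ onto $\mathcal{P}_{as((r',q');(s',p'))}(^{n}E')$. Lorentz quasi-nuclear polynomials: put $\langle P,Q\rangle=\mathcal{B}^{-1}(Q)(P)$, let $U=\{P:\|P\|_{N}\le1\}$, $U^{\circ}=\{Q\in\mathcal{P}_{as((r',q');(s',p'))}(^{n}E'):|\langle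 P,Q\rangle|\le1\ \forall P\in U\}$, $U^{\circ\circ}=\{P\in\mathcal{P}_{N,((r,q);(s,p))}(^{n}E):|\langle P,Q\rangle|\le1\ \forall Q\in U^{\circ}\}$. The gauge $p_{U^{\circ\circ}}(P)=\inf\{\delta>0:P\in\delta U^{\circ\circ}\}$ is a norm with $\|P\|\le p_{U^{\circ\circ}}(P)\le\|P\|_N$, and $(\mathcal{P}_{\widetilde{N},((r,q);(s,p))}(^{n}E),\|\cdot\|_{\widetilde{N}})$ is the completion of $(\mathcal{P}_{N,((r,q);(s,p))}(^{n}E),p_{U^{\circ\circ}})$, regarded by the paper as a subspace of $\mathcal{P}(^{n}E)$ through the continuous extension of the inclusion. For $n=0$ it is $\mathbb{C}$ with the modulus. $\mathcal{H}_{\widetilde{N}b,((r,q);(s,p))}(E)$ is the space of entire $f\colon E\to\mathbb{C}$, $f=\sum_m\frac1{m!}\hat{d}^{m}f(0)$ (Taylor series at $0$, $\hat{d}^mf(0)\in\mathcal{P}(^{m}E)$), such that $\hat{d}^{m}f(0)\in\mathcal{P}_{\widetilde{N},((r,q);(s,p))}(^{m}E)$ for all $m\in\mathbb{N}_{0}$ and $\lim_{m}(\frac1{m!}\|\hat{d}^{m}f(0)\|_{\widetilde{N}})^{1/m}=0$. It is a Fréchet space with the seminorms $\|f\|_{\rho}=\sum_{m=0}^{\infty}\frac{\rho^{m}}{m!}\|\hat{d}^{m}f(0)\|_{\widetilde{N}}$, $\rho>0$. Write $\mathcal{H}=\mathcal{H}_{\widetilde{N}b,((r,q);(s,p))}(E)$,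 $\mathcal{H}'$ for its topological dual, and $\tau_{a}f(x)=f(x-a)$ for $a\in E$ (then $\tau_a f\in\mathcal{H}$). A convolution operator on $\mathcal{H}$ is a continuous linear $L\colon\mathcal{H}\to\mathcal{H}$ with $L(\tau_{a}f)=\tau_{a}(Lf)$ for all $a\in E$, $f\in\mathcal{H}$. For $T\in\mathcal{H}'$ and $f\in\mathcal{H}$, the convolution product is $(T\ast f)(x)=T(\tau_{-x}f)$, $x\in E$. $\delta_{0}\in\mathcal{H}'$ is $\delta_{0}(f)=f(0)$. A map $g\colon X\to X$ on a topological space is hypercyclic if $\{x,g(x),g^{2}(x),\dots\}$ is dense in $X$ for some $x\in X$. *)

(* Defs.v *)
From HB Require Import structures.
From mathcomp Require Import all_boot all_order all_algebra complex.
From mathcomp Require Import all_classical all_reals all_analysis.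

Set Implicit Arguments.
Unset Strict Implicit.
Unset Printing Implicit Defensive.

Import Order.TTheory GRing.Theory Num.Theory numFieldNormedType.Exports.

Local Open Scope classical_set_scope.
Local Open Scope ring_scope.
Local Open Scope complex_scope.

(* The norm of a [normedModType R[i]] takes its values in R[i]; [rnorm] is the
   same number as an element of R.  Scalar-valued maps have codomain [R[i]^o],
   the normed space R[i] over itself. *)
Definition rnorm {R : realType} {V : normedModType R[i]} (x : V) : R :=
  complex.Re `|x|.

Section rnorm_theory.
Context {R : realType} {V : normedModType R[i]}.
Implicit Types x y : V.

Lemma rnormE x : `|x| = (rnorm x)%:C.
Proof. by rewrite /rnorm RRe_real// ger0_real. Qed.

Lemma rnorm_ge0 x : 0 <= rnorm x.
Proof. by rewrite -lecR -rnormE normr_ge0. Qed.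

Lemma rnormD x y : rnorm (x + y) <= rnorm x + rnorm y.
Proof. by rewrite -lecR rmorphD /= -!rnormE ler_normD. Qed.

Lemma rnorm0_eq0 x : rnorm x = 0 -> x = 0.
Proof. by move=> x0; apply: normr0_eq0; rewrite rnormE x0. Qed.

Lemma rnorm0 : rnorm (0 : V) = 0.
Proof. by rewrite /rnorm normr0. Qed.

Lemma rnormZ (a : R[i]^o) x : rnorm (a *: x) = rnorm a * rnorm x.
Proof.
by apply: (@complexI R); rewrite rmorphM /= -!rnormE normrZ.
Qed.

End rnorm_theory.

Section dual.
Context {R : realType} (E : normedModType R[i]).

Definition is_dual : {pred (E -> R[i]^o)} :=
  [pred f : E -> R[i]^o | `[< linear f /\ continuous f >]].

Record dual : Type :=
  Dual { dual_fun :> E -> R[i]^o ; dual_funP : dual_fun \in is_dual }.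

HB.instance Definition _ := [isSub for dual_fun].
HB.instance Definition _ := [Choice of dual by <:].

Lemma is_dual_submod_closed : submod_closed is_dual.
Proof.
split; first by apply/asboolP; split; [move=> a u v; rewrite scaler0 addr0
  | exact: cst_continuous].
move=> a f g /asboolP[lf cf] /asboolP[lg cg]; apply/asboolP; split.
  move=> b u v.
  rewrite [LHS](_ : _ = a *: f (b *: u + v) + g (b *: u + v))//.
  rewrite [RHS](_ : _ = b *: (a *: f u + g u) + (a *: f v + g v))//.
  by rewrite lf lg !scalerDr !scalerA [a * b]mulrC addrACA.
move=> x; apply: (@continuousD _ _ _ (a \*: f) g).
  by apply: continuousZ; [exact: cst_continuous|exact: cf].
exact: cg.
Qed.

HB.instance Definition _ :=
  GRing.isSubmodClosed.Build _ _ is_dual is_dual_submod_closed.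
HB.instance Definition _ := [SubChoice_isSubLmodule of dual by <:].

Implicit Types (f g : dual) (x : E).

Lemma dual_linear (f : dual) : linear f.
Proof. by have /asboolP[] := dual_funP f. Qed.

Lemma dual_fun0 f : f 0 = 0.
Proof.
by have := dual_linear f (-1) 0 0; rewrite scaler0 addr0 scaleN1r addNr.
Qed.

Lemma dual_continuous (f : dual) : continuous f.
Proof. by have /asboolP[] := dual_funP f. Qed.

Lemma dualE (a : R[i]) (f g : dual) x : (a *: f + g) x = a *: f x + g x.
Proof. by []. Qed.

Lemma dualP (f g : dual) : (forall x, f x = g x) -> f = g.
Proof. by move=> fg; apply: val_inj; exact/funext. Qed.

Definition dual_unit_values (f : dual) : set R :=
  [set rnorm (f x) | x in [set x : E | rnorm x <= 1]].

Definition dual_norm (f : dual) : R := sup (dual_unit_values f).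

Lemma dual_unit_values_neq0 f : dual_unit_values f !=set0.
Proof. by exists (rnorm (f 0)), 0 => //=; rewrite rnorm0. Qed.

Lemma dual_unit_values_ubound f : has_ubound (dual_unit_values f).
Proof.
pose lf := GRing.isLinear.Build _ _ _ _ _ (dual_linear f).
pose F : {linear E -> R[i]^o} := HB.pack (dual_fun f) lf.
have /linear_boundedP : bounded_near F (nbhs 0).
  by apply/linear_bounded_continuous; exact: dual_continuous.
move=> /pinfty_ex_gt0[M M0 MF]; exists (complex.Re M) => _ [x x1 <-].
rewrite -lecR RRe_real ?gtr0_real// -rnormE (le_trans (MF x))//.
rewrite -[leRHS]mulr1 ler_wpM2l ?(ltW M0)//.
by rewrite rnormE -(rmorph1 (real_complex R)) lecR.
Qed.

Lemma le_dual_norm f x : rnorm x <= 1 -> rnorm (f x) <= dual_norm f.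
Proof.
by move=> x1; apply: ub_le_sup; [exact: dual_unit_values_ubound|exists x].
Qed.

Lemma dual_norm_ge0 f : 0 <= dual_norm f.
Proof.
have : rnorm (0 : E) <= 1 by rewrite rnorm0.
by move=> /(le_dual_norm f); apply: le_trans; exact: rnorm_ge0.
Qed.

Lemma dual_normD f g : dual_norm (f + g) <= dual_norm f + dual_norm g.
Proof.
apply: ge_sup; first exact: dual_unit_values_neq0.
by move=> _ [x x1 <-]; rewrite (le_trans (rnormD _ _))// lerD// le_dual_norm.
Qed.

Lemma dual_normZ_le (a : R[i]^o) f :
  dual_norm (a *: f) <= rnorm a * dual_norm f.
Proof.
apply: ge_sup; first exact: dual_unit_values_neq0.
move=> _ [x x1 <-].
rewrite [X in rnorm X](_ : _ = a *: f x)// rnormZ.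
by rewrite ler_wpM2l ?rnorm_ge0// le_dual_norm.
Qed.

Lemma dual_normZ (a : R[i]^o) f : dual_norm (a *: f) = rnorm a * dual_norm f.
Proof.
have [->|a0] := eqVneq a 0.
  rewrite rnorm0 mul0r scale0r; apply/le_anti; rewrite dual_norm_ge0 andbT.
  apply: ge_sup; first exact: dual_unit_values_neq0.
  by move=> _ [x x1 <-]; rewrite [X in rnorm X](_ : _ = 0)// rnorm0.
apply/le_anti; rewrite dual_normZ_le /=.
have na0 : 0 < rnorm a.
  by rewrite lt_def rnorm_ge0 andbT; apply: contra a0 => /eqP/rnorm0_eq0/eqP.
rewrite -ler_pdivlMl//; have := dual_normZ_le a^-1 (a *: f).
rewrite scalerA mulVf// scale1r => /le_trans; apply.
rewrite ler_wpM2r ?dual_norm_ge0// -lecR -rnormE.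
by rewrite rmorphV ?unitfE ?gt_eqF//= -rnormE normfV.
Qed.

Lemma dual_norm0_eq0 f : dual_norm f = 0 -> f = 0.
Proof.
move=> f0; apply/dualP => x; have [->|x0] := eqVneq x 0.
  exact: dual_fun0.
have nx0 : `|x| != 0 by rewrite normr_eq0.
have : rnorm (f (`|x|^-1 *: x)) <= 0.
  rewrite -f0; apply: le_dual_norm; rewrite rnormZ -lecR rmorphM /= -!rnormE.
  by rewrite normfV normr_id mulVf// rmorph1.
move=> fx; have /rnorm0_eq0 : rnorm (f (`|x|^-1 *: x)) = 0.
  by apply/le_anti; rewrite fx rnorm_ge0.
have := dual_linear f (`|x|^-1) x 0; rewrite addr0 dual_fun0 addr0 => ->.
move=> /eqP; rewrite scaler_eq0 invr_eq0 (negbTE nx0) /= => /eqP ->.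
by [].
Qed.

Let dual_cnorm (f : dual) : R[i] := (dual_norm f)%:C.

Let dual_cnormD f g : dual_cnorm (f + g) <= dual_cnorm f + dual_cnorm g.
Proof. by rewrite /dual_cnorm -rmorphD lecR dual_normD. Qed.

Let dual_cnormZ (a : R[i]) f : dual_cnorm (a *: f) = `|a| * dual_cnorm f.
Proof. by rewrite /dual_cnorm dual_normZ rmorphM /= -rnormE. Qed.

Let dual_cnorm0_eq0 f : dual_cnorm f = 0 -> f = 0.
Proof. by move=> /complexI /dual_norm0_eq0. Qed.

HB.instance Definition _ := Lmodule_isNormed.Build R[i] dual
  dual_cnormD dual_cnormZ dual_cnorm0_eq0.

End dual.

Definition separable (X : topologicalType) : Prop :=
  exists2 D : set X, countable D & dense D.

Definition finite_rank {R : realType} {X : normedModType R[i]}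
    (A : X -> X) : Prop :=
  exists n (b : 'I_n -> X), forall x, exists c : 'I_n -> R[i],
    A x = \sum_i c i *: b i.

Definition bounded_approximation_property {R : realType}
    (X : normedModType R[i]) : Prop :=
  exists2 lambda : R, 1 <= lambda &
    forall (K : set X) (eps : R), compact K -> 0 < eps ->
    exists A : {linear X -> X}, [/\ finite_rank A,
      forall x, rnorm (A x) <= lambda * rnorm x &
      forall x, K x -> rnorm (A x - x) < eps].

Definition linear_on {K : pzRingType} {U V : lmodType K} (A : set U)
    (L : U -> V) : Prop :=
  forall (a : K) f g, A f -> A g -> L (a *: f + g) = a *: L f + L g.

Section homogeneous_polynomials.
Context {R : realType} {E : normedModType R[i]}.
Implicit Types (P f : E -> R[i]^o) (n m : nat) (a : E).

Definition multilinear n (A : ('I_n -> E) -> R[i]^o) : Prop :=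
  forall (i : 'I_n) (x : 'I_n -> E),
    linear (fun u : E => A (fun j => if j == i then u else x j)).

(* Continuous n-homogeneous polynomials; for n = 0 these are the constants,
   since the domain of A is then a singleton. *)
Definition hpoly n : set (E -> R[i]^o) :=
  [set P | continuous P /\
     exists2 A : ('I_n -> E) -> R[i]^o,
       multilinear A & forall x, P x = A (fun=> x)].

Definition supnorm P : R :=
  sup [set rnorm (P x) | x in [set x | rnorm x <= 1]].

(* c m is the m-th homogeneous term at a: f(x) = \sum_m c_m(x - a), uniformly
   on some ball around a. *)
Definition taylor_expansion f a (c : nat -> E -> R[i]^o) : Prop :=
  (forall m, hpoly m (c m)) /\
  exists2 rho : R, 0 < rho & forall eps : R, 0 < eps ->
    \forall N \near \oo, forall x, rnorm (x - a) < rho ->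
      rnorm (f x - \sum_(m < N) c m (x - a)) < eps.

Definition entire f : Prop := forall a, exists c, taylor_expansion f a c.

Definition taylor_term f a : nat -> E -> R[i]^o :=
  xget (fun=> 0) [set c | taylor_expansion f a c].

Definition dhat m f a : E -> R[i]^o := m`!%:R *: taylor_term f a m.

Definition translation a f : E -> R[i]^o := fun x => f (x - a).

End homogeneous_polynomials.

Section lorentz.
Context {R : realType} {X : normedModType R[i]}.
Implicit Types (x : nat -> X) (u v : R).

Definition bounded_seq x : Prop := exists M : R, forall j, rnorm (x j) <= M.

Definition linfty_norm x : R := sup [set rnorm (x j) | j in [set: nat]].

(* a_{X,n}(x), meaningful for n >= 1 *)
Definition approx_number n x : R :=
  inf [set linfty_norm (fun j => x j - y j) | y in
    [set y : nat -> X |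
       exists2 k, (k < n)%N & ([set j | y j != 0%R] #= `I_k)%card]].

Definition lorentz_norm u v x : \bar R :=
  ((\sum_(1 <= n <oo)
      ((n%:R `^ (u^-1 - v^-1) * approx_number n x) `^ v)%:E) `^ v^-1)%E.

Definition lorentz u v : set (nat -> X) :=
  [set x | bounded_seq x /\ (lorentz_norm u v x < +oo)%E].

End lorentz.

Section weak_lorentz.
Context {R : realType} {X : normedModType R[i]}.
Implicit Types (x : nat -> X) (u v : R).

Definition wlorentz u v : set (nat -> X) :=
  [set x | forall phi : dual X, lorentz u v (fun j => phi (x j))].

Definition wlorentz_norm u v x : \bar R :=
  ereal_sup [set lorentz_norm u v (fun j => phi (x j)) | phi in
    [set phi : dual X | rnorm phi <= 1]].

End weak_lorentz.

(* The standing conditions on the exponents force s, p > 1, so that all the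
   conjugate exponents which occur as Lorentz indices are finite. *)
Definition conj_exp {R : realType} (t : R) : R := fine (hoelder_conjugate t%:E).

(* The ambient type of the space H of entire functions of quasi-nuclear
   bounded type, which is its subset [HNb_set] below; the exponents are there
   to determine the topology. *)
Definition HNb {R : realType} (E : normedModType R[i]) (r q s p : R) : Type :=
  E -> R[i]^o.

Section lorentz_nuclear.
Context {R : realType} (E : normedModType R[i]) (r q s p : R).
Local Notation r' := (conj_exp r).
Local Notation q' := (conj_exp q).
Local Notation s' := (conj_exp s).
Local Notation p' := (conj_exp p).
Implicit Types (n m : nat) (P : E -> R[i]^o) (Q : dual E -> R[i]^o).

Definition nuclear_rep n P (lambda : nat -> R[i]^o) (phi : nat -> dual E)
    (y : nat -> R[i]^o) : Prop :=
  [/\ lorentz r q lambda, wlorentz s' p' phi, bounded_seq y &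
      forall x, (fun N => \sum_(j < N) lambda j * phi j x ^+ n * y j)
        @ \oo --> P x].

Definition nuclear n : set (E -> R[i]^o) :=
  [set P | hpoly n P /\ exists lambda phi y, nuclear_rep n P lambda phi y].

Definition nuclear_norm n P : \bar R :=
  ereal_inf [set z | exists lambda phi y, nuclear_rep n P lambda phi y /\
    z = (lorentz_norm r q lambda * wlorentz_norm s' p' phi ^+ n
         * (linfty_norm y)%:E)%E].

(* Functionals on [nuclear n] are total functions of which only the values on
   [nuclear n] are used. *)
Definition nuclear_dual n (S : (E -> R[i]^o) -> R[i]^o) : Prop :=
  linear_on (nuclear n) S /\
  forall P0, nuclear n P0 -> forall eps : R, 0 < eps ->
    exists2 delta : R, 0 < delta & forall P, nuclear n P ->
      (nuclear_norm n (P - P0)%R < delta%:E)%E -> rnorm (S P - S P0) < eps.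

Definition summing n : set (dual E -> R[i]^o) :=
  [set Q | hpoly n Q /\ forall phi : nat -> dual E,
     wlorentz s' p' phi -> lorentz r' q' (fun j => Q (phi j))].

Definition borel n (S : (E -> R[i]^o) -> R[i]^o) : dual E -> R[i]^o :=
  fun phi => S (fun x => phi x ^+ n).

Definition borel_inv n Q : (E -> R[i]^o) -> R[i]^o :=
  xget (fun=> 0) [set S | nuclear_dual n S /\ borel n S = Q].

Definition pairing n P Q : R[i]^o := borel_inv n Q P.

Definition nuclear_ball n : set (E -> R[i]^o) :=
  [set P | nuclear n P /\ (nuclear_norm n P <= 1)%E].

Definition nuclear_polar n : set (dual E -> R[i]^o) :=
  [set Q | summing n Q /\
     forall P, nuclear_ball n P -> rnorm (pairing n P Q) <= 1].

Definition nuclear_bipolar n : set (E -> R[i]^o) :=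
  [set P | nuclear n P /\
     forall Q, nuclear_polar n Q -> rnorm (pairing n P Q) <= 1].

Definition bipolar_gauge n P : R :=
  inf [set delta : R | 0 < delta /\
    exists2 P', nuclear_bipolar n P' & P = delta%:C *: P'].

(* An element of the completion of (nuclear n, bipolar_gauge n) is the class
   of a Cauchy sequence Ps; its image under the continuous extension of the
   inclusion is the limit P of Ps in (hpoly n, supnorm), and its norm is the
   limit of the gauges of Ps. *)
Definition completion_rep n (Ps : nat -> E -> R[i]^o) P : Prop :=
  [/\ forall k, nuclear n (Ps k),
      forall eps : R, 0 < eps -> exists N, forall k l, (N <= k)%N ->
        (N <= l)%N -> bipolar_gauge n (Ps k - Ps l) < eps &
      (fun k => supnorm (Ps k - P)) @ \oo --> (0 : R)].

Definition quasi_nuclear n : set (E -> R[i]^o) :=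
  if n is 0%N then hpoly 0
  else [set P | hpoly n P /\ exists Ps, completion_rep n Ps P].

(* All Ps representing a given P have the same limit of gauges when the
   extended inclusion is injective, as it is if [dual E] has the bounded
   approximation property; in general the infimum is the norm of the image as
   a quotient of the completion. *)
Definition quasi_nuclear_norm n P : R :=
  if n is 0%N then rnorm (P 0)
  else inf [set l : R | exists2 Ps, completion_rep n Ps P &
         (fun k => bipolar_gauge n (Ps k)) @ \oo --> l].

Local Notation HNb := (HNb E r q s p).

Definition HNb_set : set HNb :=
  [set f | [/\ entire f,
      forall m, quasi_nuclear m (dhat m f 0) &
      (fun m => (m`!%:R^-1 * quasi_nuclear_norm m (dhat m f 0)) `^ m%:R^-1)
        @ \oo --> (0 : R)]].

Definition HNb_seminorm (rho : R) (f : HNb) : \bar R :=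
  (\sum_(0 <= m <oo)
     (rho ^+ m / m`!%:R * quasi_nuclear_norm m (dhat m f 0))%:E)%E.

HB.instance Definition _ := GRing.Lmodule.copy HNb (E -> R[i]^o).
HB.instance Definition _ := isPointed.Build HNb 0.

Definition HNb_ball (i : HNb * (R * R)) : set HNb :=
  [set g | HNb_set g /\ (HNb_seminorm i.2.1 (g - i.1)%R < i.2.2%:E)%E].

(* The locally convex topology of H: generated by the open balls
   {g in H : ||g - f||_rho < eps} with f in H and rho, eps > 0. *)
HB.instance Definition _ := @isSubBaseTopological.Build HNb
  (HNb * (R * R))%type
  [set i | [/\ HNb_set i.1, 0 < i.2.1 & 0 < i.2.2]] HNb_ball.

(* Maps from H are total functions on [HNb] of which only the values on
   [HNb_set] are used. *)
Definition HNb_dual (T : HNb -> R[i]^o) : Prop :=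
  linear_on HNb_set T /\ {within HNb_set, continuous T}.

Definition convolution_operator (L : HNb -> HNb) : Prop :=
  [/\ forall f, HNb_set f -> HNb_set (L f),
      linear_on HNb_set L,
      {within HNb_set, continuous L} &
      forall a f, HNb_set f -> L (translation a f) = translation a (L f)].

Definition convolution_product (T : HNb -> R[i]^o) (f : HNb) : HNb :=
  fun x => T (translation (- x) f).

Definition Gamma_bar (T : HNb -> R[i]^o) : HNb -> HNb :=
  fun f => convolution_product T f.

End lorentz_nuclear.

Definition hypercyclic_on {X : topologicalType} (A : set X) (g : X -> X) :
    Prop :=
  exists2 x, A x & A `<=` closure [set iter k g x | k in [set: nat]].

(* Main.v *)
Require Import Defs.
From mathcomp Require Import all_boot all_order all_algebra complex.
From mathcomp Require Import all_classical all_reals all_analysis.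
From mathcomp Require Import cyclic.
From mathcomp Require separable cyclotomic.
From mathcomp Require Import ring lra.
Import Order.TTheory GRing.Theory Num.Theory numFieldNormedType.Exports.

Set Implicit Arguments.
Unset Strict Implicit.
Unset Printing Implicit Defensive.

Local Open Scope classical_set_scope.
Local Open Scope ring_scope.

(** The operator [f |-> T * f] commutes with translations, so that every
    exponential [exp o phi], with [phi] a continuous functional, is an
    eigenvector, with eigenvalue [h phi = T (exp o phi)] ([symbol],
    [conv_expsum]).  If [h] were constant, [T] would be a multiple of the
    evaluation at 0 on the exponentials, hence everywhere, since they span a
    dense subspace.  So [h] is a nonconstant entire function on some complex
    line, and Liouville's theorem, applied to it and to its reciprocal, shows
    that both [|h| < 1] and [|h| > 1] have solutions; they form open sets.  The
    exponentials with frequencies in any nonempty open set already span a dense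
    subspace ([approximable_all]), because an exponential can be interpolated at
    nodes on a small circle with coefficients that the factorials in its Taylor
    series absorb.  Combinations of exponentials with [|h| < 1] are damped by the
    iterates of the operator, and those with [|h| > 1] are images under the
    iterates of arbitrarily small combinations; so the orbit of a vector close to
    a given one comes close to a given target ([transitivity]).  As the dual is
    separable, countably many targets suffice, and a limit of successive
    perturbations is a hypercyclic vector ([hypercyclic_criterion]).

    Two facts about the space have to be established first.  One is that the
    convolution product by [T] maps the space continuously into itself.  In terms
    of homogeneous polynomials, it contracts a polynomial of degree [l + k] by
    the restriction of [T] to degree [k], which is bounded by the bipolar gauge;
    that the gauge of the contraction is bounded by that of the polynomial
    ([gauge_contract]) is proved by duality: pairing the contraction with an
    element [Q] of the polar is pairing the polynomial with the product of [Q]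
    and the Borel transform of the restriction, and a product is summing as soon
    as one factor is.  Bounded functionals with summing Borel transform are
    bounded by the gauge, by the definition of the polar.  This rests on
    Hoelder's inequality for Lorentz sequences, on the uniform boundedness
    principle for the weak Lorentz norm ([wlorentz_norm_finite]) and on the order
    continuity of the Lorentz norm, by which functionals are determined by their
    values on powers.  Translations are the special case where [T] is the
    evaluation at a point.

    The other fact is a description of the space without completions: its
    elements are the pointwise limits of sequences of finite sums of monomials
    [c *: phi ^ m] that are Cauchy for all the seminorms
    [sup_m rho ^ m * gauge (degree m)] ([rep], [hb], [rep_HNb_set], [terms_hb]).
    That a function of the space is the limit of the sequence assembled from
    approximations of its Taylor terms at 0 is the identity theorem for entire
    functions ([entire_zero]).  Neighbourhoods, continuity and completeness are
    then expressed by [hb] ([nbhs_hb], [hb_nbhs], [hb_complete]). *)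

(** * Complex scalars *)

Section scalars.
Context {R : realType}.
Local Open Scope complex_scope.
Local Notation C := R[i]^o.
Implicit Types (z w : C) (u v : nat -> C).

Lemma rnormM z w : rnorm (z * w) = rnorm z * rnorm w.
Proof. exact: (rnormZ z (w : C)). Qed.

Lemma rnormR (a : R) : rnorm (a%:C : C) = `|a|.
Proof. by rewrite /rnorm normc_def /= expr0n /= addr0 sqrtr_sqr. Qed.

Lemma rnorm1 : rnorm (1 : C) = 1.
Proof. by have := rnormR 1; rewrite normr1. Qed.

Lemma rnormX z n : rnorm (z ^+ n) = rnorm z ^+ n.
Proof. by elim: n => [|n IH]; rewrite ?rnorm1// !exprS rnormM IH. Qed.

Lemma rnorm_nat n : rnorm (n%:R : C) = n%:R.
Proof.
have -> : (n%:R : C) = (n%:R)%:C by rewrite rmorph_nat.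
by rewrite rnormR ger0_norm.
Qed.

Lemma rnormV z : rnorm (z^-1) = (rnorm z)^-1.
Proof.
have [->|z0] := eqVneq z 0; first by rewrite invr0 rnorm0 invr0.
have : rnorm z * rnorm z^-1 = 1 by rewrite -rnormM mulfV// rnorm1.
move=> h; have nz : rnorm z != 0.
  by apply/eqP => nz; move: h; rewrite nz mul0r => /esym/eqP; rewrite oner_eq0.
by apply: (mulfI nz); rewrite h mulfV.
Qed.

Lemma rnormN (V : normedModType R[i]) (x : V) : rnorm (- x) = rnorm x.
Proof. by rewrite /rnorm normrN. Qed.

Lemma rnormBC (V : normedModType R[i]) (x y : V) : rnorm (x - y) = rnorm (y - x).
Proof. by rewrite -rnormN opprB. Qed.

Lemma rnormB (V : normedModType R[i]) (x y : V) :
  rnorm (x - y) <= rnorm x + rnorm y.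
Proof. by rewrite (le_trans (rnormD _ _))// rnormN. Qed.

Lemma rnorm_triangle (V : normedModType R[i]) (x y z : V) :
  rnorm (x - z) <= rnorm (x - y) + rnorm (y - z).
Proof.
by apply: le_trans (rnormD _ _); rewrite addrA subrK.
Qed.

Lemma rnormZr (V : normedModType R[i]) (a : R) (x : V) :
  rnorm (a%:C *: x) = `|a| * rnorm x.
Proof. by rewrite (rnormZ (a%:C : C)) rnormR. Qed.

Lemma rnormZc (V : normedModType R[i]) (a : R[i]) (x : V) :
  rnorm (a *: x) = rnorm (a : C) * rnorm x.
Proof. exact: rnormZ. Qed.

Lemma rnorm_gt0 (V : normedModType R[i]) (x : V) : (0 < rnorm x) = (x != 0).
Proof.
rewrite lt_def rnorm_ge0 andbT; congr negb; apply/eqP/eqP => [/rnorm0_eq0//|->].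
exact: rnorm0.
Qed.

Lemma rnorm_sum (V : normedModType R[i]) (I : Type) (s : seq I) (P : pred I)
    (F : I -> V) :
  rnorm (\sum_(i <- s | P i) F i) <= \sum_(i <- s | P i) rnorm (F i).
Proof.
elim/big_ind2 : _ => [|x a y b xa yb|//]; first by rewrite rnorm0.
by rewrite (le_trans (rnormD _ _))// lerD.
Qed.

Lemma rnorm_prod (I : Type) (s : seq I) (P : pred I) (F : I -> C) :
  rnorm (\prod_(i <- s | P i) F i) = \prod_(i <- s | P i) rnorm (F i).
Proof.
elim/big_ind2 : _ => [|x a y b xa yb|//]; first by rewrite rnorm1.
by rewrite rnormM xa yb.
Qed.

(** Convergence of complex sequences, with real distances instead of the norm
    with values in [R[i]]. *)
Definition cvgs u z : Prop :=
  forall e : R, 0 < e -> exists N, forall n, (N <= n)%N -> rnorm (u n - z) < e.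

Lemma cvgsP u z : u @ \oo --> (z : C) <-> cvgs u z.
Proof.
split=> [/cvgrPdist_lt h e e0|h].
  have e0' : 0 < (e%:C : R[i]) by rewrite ltcR.
  have [N _ hN] := h _ e0'; exists N => n Nn.
  by rewrite rnormBC -ltcR -rnormE; exact: hN.
apply/cvgrPdist_lt => e e0.
have eR : e = (complex.Re e)%:C by rewrite RRe_real// gtr0_real.
have e1 : 0 < complex.Re e by rewrite -ltcR -eR.
have [N hN] := h _ e1.
exists N => // n /= Nn; rewrite eR rnormE ltcR rnormBC; exact: hN.
Qed.

Lemma cvgs_cst z : cvgs (fun=> z) z.
Proof. by move=> e e0; exists 0%N => n _; rewrite subrr rnorm0. Qed.

Lemma cvgsD u v z w : cvgs u z -> cvgs v w -> cvgs (fun n => u n + v n) (z + w).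
Proof.
move=> hu hv e e0; have e2 : 0 < e / 2 by rewrite divr_gt0.
have [N hN] := hu _ e2; have [M hM] := hv _ e2; exists (maxn N M) => n.
rewrite geq_max => /andP[Nn Mn]; rewrite opprD addrACA.
by rewrite (le_lt_trans (rnormD _ _))// (splitr e) ltrD// ?hN ?hM.
Qed.

Lemma cvgsM z u w : cvgs u w -> cvgs (fun n => z * u n) (z * w).
Proof.
move=> hu e e0; have z1 : 0 < rnorm z + 1 by rewrite ltr_wpDl ?rnorm_ge0.
have [N hN] := hu (e / (rnorm z + 1)) (divr_gt0 e0 z1).
exists N => n Nn; rewrite -mulrBr rnormM.
have := hN _ Nn; rewrite ltr_pdivlMr// => h; apply: le_lt_trans h.
by rewrite mulrC ler_wpM2l ?rnorm_ge0// lerDl.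
Qed.

Lemma cvgsN u w : cvgs u w -> cvgs (fun n => - u n) (- w).
Proof.
by move=> hu e /hu[N hN]; exists N => n /hN; rewrite -opprD rnormN.
Qed.

Lemma cvgsB u v z w : cvgs u z -> cvgs v w -> cvgs (fun n => u n - v n) (z - w).
Proof. by move=> hu hv; apply: cvgsD => //; exact: cvgsN. Qed.

Lemma cvgs_sum (I : Type) (s : seq I) (P : pred I) (F : I -> nat -> C) (l : I -> C) :
  (forall i, P i -> cvgs (F i) (l i)) ->
  cvgs (fun n => \sum_(i <- s | P i) F i n) (\sum_(i <- s | P i) l i).
Proof.
move=> h; elim: s => [|i s IH].
  by rewrite big_nil; under [X in cvgs X]eq_fun do rewrite big_nil; exact: cvgs_cst.
rewrite big_cons; under [X in cvgs X]eq_fun do rewrite big_cons.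
by case: ifPn => // Pi; apply: cvgsD => //; exact: h.
Qed.

Lemma cvgs_dist_le u z w (c : R) N : cvgs u z ->
  (forall n, (N <= n)%N -> rnorm (u n - w) <= c) -> rnorm (z - w) <= c.
Proof.
move=> hu h; apply/ler_addgt0Pr => e e0; have [M hM] := hu _ e0.
rewrite (le_trans (rnorm_triangle _ (u (maxn N M)) _))// addrC lerD//.
  by apply: h; rewrite leq_maxl.
by rewrite rnormBC ltW// hM// leq_maxr.
Qed.

Lemma cvgs_le u z (c : R) N : cvgs u z ->
  (forall n, (N <= n)%N -> rnorm (u n) <= c) -> rnorm z <= c.
Proof.
move=> hu h; have := @cvgs_dist_le u z 0 c N hu; rewrite subr0; apply.
by move=> n /h; rewrite subr0.
Qed.

Lemma cvgs_uniq u z w : cvgs u z -> cvgs u w -> z = w.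
Proof.
move=> hz hw; apply/eqP; rewrite -subr_eq0; apply/eqP/rnorm0_eq0/le_anti.
rewrite rnorm_ge0 andbT; apply/ler_addgt0Pr => e e0; rewrite add0r.
have [M hM] := hw _ e0; apply: (cvgs_dist_le (N := M) hz) => n Mn.
exact/ltW/hM.
Qed.

Lemma cvgs_sub u z (k : nat -> nat) :
  (forall n, (n <= k n)%N) -> cvgs u z -> cvgs (u \o k) z.
Proof.
move=> nk hu e /hu[N hN]; exists N => n Nn; apply: hN.
exact: leq_trans (nk n).
Qed.

Lemma ge_rnorm_Re z : `|complex.Re z| <= rnorm z.
Proof. by rewrite -lecR -rnormE normc_ge_Re. Qed.

Lemma ge_rnorm_Im z : `|complex.Im z| <= rnorm z.
Proof.
have := ge_rnorm_Re ((- 'i) * z : C).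
rewrite rnormM rnormN [rnorm ('i : C)](_ : _ = 1) ?mul1r; last first.
  by rewrite /rnorm normc_def /= expr0n /= add0r expr1n sqrtr1.
by rewrite [X in `|X|](_ : _ = complex.Im z)//; case: z => a b /=; ring.
Qed.

Lemma rnorm_le_ReIm z : rnorm z <= `|complex.Re z| + `|complex.Im z|.
Proof.
rewrite {1}[z]complexE (le_trans (rnormD _ _))// rnormM !rnormR.
rewrite [rnorm ('i : C)](_ : _ = 1) ?mul1r; last first.
  by rewrite /rnorm normc_def /= expr0n /= add0r expr1n sqrtr1.
exact: lexx.
Qed.

Lemma cauchy_cvgs u :
  (forall e : R, 0 < e -> exists N, forall n m, (N <= n)%N -> (N <= m)%N ->
    rnorm (u n - u m) < e) -> exists z, cvgs u z.
Proof.
move=> h.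
have part (f : C -> R) : (forall a b, `|f a - f b| <= rnorm (a - b)) ->
    exists l : R, (f \o u) @ \oo --> l.
  move=> fle; exists (lim ((f \o u) @ \oo)).
  apply: cauchy_cvg; apply/cauchy_ballP => e e0.
  have [N hN] := h _ e0.
  pose A := [set f (u n) | n in [set n | (N <= n)%N]].
  exists (A, A); first by split; exists N => // n /= Nn; exists n.
  move=> [x y] /= [[n Nn <-] [m Nm <-]].
  by rewrite /ball /= (le_lt_trans (fle _ _))// hN.
have [a ha] : exists l : R, (complex.Re (R:=R) \o u) @ \oo --> l.
  by apply: part => x y; rewrite -raddfB; exact: ge_rnorm_Re.
have [b hb] : exists l : R, (complex.Im (R:=R) \o u) @ \oo --> l.
  by apply: part => x y; rewrite -raddfB; exact: ge_rnorm_Im.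
exists (a +i* b) => e e0; have e2 : 0 < e / 2 by rewrite divr_gt0.
have [N _ hN] := ((iffLR (cvgrPdist_lt _ _) ha) _ e2).
have [M _ hM] := ((iffLR (cvgrPdist_lt _ _) hb) _ e2).
exists (maxn N M) => n; rewrite geq_max => /andP[Nn Mn].
rewrite (le_lt_trans (rnorm_le_ReIm _))// (splitr e) ltrD//.
  by have := hN _ Nn; rewrite distrC /=; case: (u n).
by have := hM _ Mn; rewrite distrC /=; case: (u n).
Qed.

End scalars.

(** * Coefficient extraction and polarization *)

Section coefficients.
Context {R : realType}.
Local Open Scope complex_scope.
Local Notation C := R[i]^o.

Lemma complex_prim_root_exists n :
  (0 < n)%N -> exists w : R[i], n.-primitive_root w.
Proof.
pose P : {poly R[i]} := 'X^n - 1; have [s Ds] := closed_field_poly_normal P.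
move=> n0; rewrite (monicP _) ?monicXnsubC// scale1r in Ds.
have sn1 : all n.-unity_root s by apply/allP => z; rewrite -root_prod_XsubC -Ds.
have sz_s : (n < (size s).+1)%N.
  by rewrite -(size_prod_XsubC s id) -Ds size_XnsubC.
have [|w] := hasP (has_prim_root n0 sn1 _ sz_s); last by exists w.
by rewrite -separable.separable_prod_XsubC -Ds cyclotomic.separable_Xn_sub_1// pnatr_eq0 -lt0n.
Qed.

Lemma rnorm_unity_root n (w : R[i]) : n.-primitive_root w -> rnorm (w : C) = 1.
Proof.
move=> w1; have /eqP := rnormX (w : C) n; rewrite (prim_expr_order w1) rnorm1.
rewrite eq_sym pexprn_eq1 ?rnorm_ge0 => // /orP[/eqP n0|/eqP//].
by have := prim_order_gt0 w1; rewrite n0.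
Qed.

(** Discrete Fourier inversion over the [N]-th roots of unity: a coefficient
    is an average of values on the unit circle.  This is the only form of
    Cauchy's integral formula used below. *)
Lemma coef_extraction N l : (l < N)%N ->
  exists c z : 'I_N -> R[i], [/\ forall i, rnorm (z i : C) = 1,
    forall i, rnorm (c i : C) = N%:R^-1 &
    forall p : {poly R[i]}, (size p <= N)%N -> p`_l = \sum_i c i * p.[z i]].
Proof.
move=> lN; have N0 : (0 < N)%N by apply: leq_ltn_trans lN.
have [w w1] := complex_prim_root_exists N0.
have wn := rnorm_unity_root w1.
exists (fun i => N%:R^-1 * (w ^- l) ^+ i), (fun i => w ^+ i); split=> [i|i|p sp].
- by rewrite (rnormX (w : C)) wn expr1n.
- rewrite (rnormM (N%:R^-1 : C)) (rnormX (w ^- l : C)) (rnormV (w ^+ l : C)).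
  by rewrite (rnormX (w : C)) wn expr1n invr1 expr1n mulr1 rnormV rnorm_nat.
have w0 : w != 0 by apply: contra_eqN wn => /eqP ->; rewrite rnorm0 eq_sym oner_eq0.
have N1 : N%:R != 0 :> R[i] by rewrite pnatr_eq0 -lt0n.
pose x (k : 'I_N) := w ^+ k / w ^+ l.
have -> : \sum_(i < N) N%:R^-1 * w ^- l ^+ i * p.[w ^+ i] =
    \sum_(k < N) N%:R^-1 * p`_k * \sum_(i < N) x k ^+ i.
  under eq_bigr do rewrite (horner_coef_wide _ sp) mulr_sumr.
  rewrite exchange_big /=; apply: eq_bigr => k _; rewrite mulr_sumr.
  apply: eq_bigr => i _; rewrite /x exprMn -!exprM [(i * k)%N]mulnC; ring.
rewrite (bigD1 (Ordinal lN))//= [X in _ + X]big1 => [|k kl].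
  rewrite addr0; under eq_bigr do rewrite /x /= divff ?expf_neq0// expr1n.
  by rewrite sumr_const card_ord mulrAC mulVf// mul1r.
have x1 : x k != 1.
  apply: contra kl => /eqP xk1.
  have : w ^+ k = w ^+ l by rewrite -[LHS](mulfVK (expf_neq0 l w0)) -/(x k) xk1 mul1r.
  by move=> /eqP; rewrite (eq_prim_root_expr w1) !modn_small// => /eqP kl; apply/eqP/val_inj.
have xN : x k ^+ N = 1.
  by rewrite exprMn exprVn -!exprM ![(_ * N)%N]mulnC !exprM (prim_expr_order w1)
     !expr1n invr1 mulr1.
have := subrX1 (x k) N; rewrite xN subrr => /esym/eqP.
by rewrite mulf_eq0 subr_eq0 (negbTE x1) /= => /eqP ->; rewrite mulr0.
Qed.

(** The coefficients of [p] at the radius [r] are averages of its values, by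
    [coef_extraction] for the rescaled polynomial. *)
Lemma cauchy_estimate (p : {poly R[i]}) (r M : R) l : 0 <= r ->
  (forall z : C, rnorm z = r -> rnorm (p.[z] : C) <= M) ->
  rnorm (p`_l : C) * r ^+ l <= M.
Proof.
move=> r0 h.
have M0 : 0 <= M.
  by apply: le_trans (h (r%:C) _); rewrite ?rnorm_ge0// rnormR ger0_norm.
pose q : {poly R[i]} := \poly_(i < size p) (p`_i * r%:C ^+ i).
have qE z : q.[z] = p.[r%:C * z].
  rewrite horner_poly horner_coef; apply: eq_bigr => i _; rewrite exprMn; ring.
have [lp|pl] := ltnP l (size p); last by rewrite nth_default// rnorm0 mul0r.
have [c [z [z1 c1 /(_ q (size_poly _ _))]]] := coef_extraction lp.
rewrite coef_poly lp => ql.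
have -> : rnorm (p`_l : C) * r ^+ l = rnorm (p`_l * r%:C ^+ l : C).
  by rewrite (rnormM (p`_l : C)) (rnormX (r%:C : C)) rnormR ger0_norm.
rewrite ql (le_trans (rnorm_sum _ _ (fun i => c i * q.[z i] : C)))//.
have np : (size p)%:R != 0 :> R by rewrite pnatr_eq0 -lt0n (leq_ltn_trans _ lp).
apply: (@le_trans _ _ (\sum_(i < size p) (size p)%:R^-1 * M)).
  apply: ler_sum => i _; rewrite (rnormM (c i : C)) c1 ler_wpM2l ?invr_ge0//.
  by rewrite qE h// (rnormM (r%:C : C)) rnormR z1 ger0_norm ?mulr1.
by rewrite sumr_const card_ord -[X in X <= _]mulr_natl mulrA mulfV// mul1r.
Qed.

End coefficients.

(** Inclusion-exclusion over the set of values of a map from ['I_n] to itself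
    keeps the surjective maps, that is, the permutations. *)
Lemma polarization (K : comNzRingType) n (t : 'I_n -> K) :
  \sum_(S : {set 'I_n}) (-1) ^+ (n - #|S|) * (\sum_(i in S) t i) ^+ n =
  n`!%:R * \prod_i t i.
Proof.
have powE (S : {set 'I_n}) : (\sum_(i in S) t i) ^+ n =
    \sum_(f : {ffun 'I_n -> 'I_n})
      (\prod_i (if i \in S then 1 else (i \notin codom f)%:R)) * \prod_k t (f k).
  rewrite [LHS](_ : _ = \prod_(k < n) \sum_i (if i \in S then t i else 0)).
    2: by rewrite prodr_const card_ord -big_mkcond.
  rewrite (bigA_distr_bigA (fun _ i => if i \in S then t i else 0)) /=.
  apply: eq_bigr => f _; have [fS|] := boolP [forall k, f k \in S].
    rewrite [X in _ = X * _]big1 ?mul1r => [|i _].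
      by apply: eq_bigr => k _; rewrite (forallP fS k).
    case: ifPn => // iS; case: (boolP (i \in codom f)) => //= /codomP[k ik].
    by rewrite ik (forallP fS k) in iS.
  rewrite negb_forall => /existsP[k kS].
  rewrite (bigD1 k)//= (negbTE kS) mul0r (bigD1 (f k))//= (negbTE kS) codom_f.
  by rewrite !mul0r.
have signE (S : {set 'I_n}) : (-1) ^+ (n - #|S|) =
    \prod_i (if i \in S then 1 else -1 : K).
  rewrite [LHS](_ : _ = \prod_(i in ~: S) (-1)).
    by rewrite big_mkcond; apply: eq_bigr => i _; rewrite inE; case: (i \in S).
  by rewrite prodr_const [#|~: S|]cardsCs finset.setCK card_ord.
have sumE (S : {set 'I_n}) : (-1) ^+ (n - #|S|) * (\sum_(i in S) t i) ^+ n =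
    \sum_(f : {ffun 'I_n -> 'I_n}) (-1) ^+ (n - #|S|) *
      (\prod_i (if i \in S then 1 else (i \notin codom f)%:R) * \prod_k t (f k)).
  by rewrite powE mulr_sumr.
rewrite (eq_bigr _ (fun S _ => sumE S)) exchange_big /=.
have inner (f : {ffun 'I_n -> 'I_n}) :
    \sum_(S : {set 'I_n}) (-1) ^+ (n - #|S|) *
      (\prod_i (if i \in S then 1 else (i \notin codom f)%:R) * \prod_k t (f k)) =
    if injectiveb f then \prod_k t k else 0.
  have prodE (S : {set 'I_n}) : (-1) ^+ (n - #|S|) *
      (\prod_i (if i \in S then 1 else (i \notin codom f)%:R) * \prod_k t (f k)) =
      \prod_i (if i \in S then 1 else - (i \notin codom f)%:R) * \prod_k t (f k).
    rewrite signE mulrA -big_split /=; congr (_ * _); apply: eq_bigr => i _.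
    by case: ifP => _; rewrite ?mul1r ?mulN1r.
  rewrite (eq_bigr _ (fun S _ => prodE S)) -mulr_suml -bigA_distr /=.
  have [/injectiveP finj|finj] := boolP (injectiveb f).
    rewrite big1 ?mul1r => [|i _]; first by rewrite [RHS](reindex_inj finj).
    rewrite [i \in _](_ : _ = true) ?subr0//.
    by rewrite (inj_card_onto finj) ?card_ord.
  have [i ic] : exists i, i \notin codom f.
    apply/existsP; apply: contraR finj; rewrite negb_exists => /forallP fs.
    apply/injectiveP => x y fxy.
    have /image_injP h : #|fintype.image f 'I_n| == #|'I_n|.
      by apply/eqP/eq_card => i; have := fs i; rewrite negbK => ->; rewrite inE.
    exact: (h x y).
  by rewrite (bigD1 i)//= ic subrr !mul0r.
rewrite (eq_bigr _ (fun f _ => inner f)).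
rewrite -big_mkcond /= sumr_const -[LHS]mulr_natl; congr (_%:R * _).
have := card_inj_ffuns ('I_n) ('I_n); rewrite card_ord ffactnn => <-.
by apply: eq_card => f; rewrite !inE.
Qed.

(** * Lorentz sequence spaces *)

Lemma inf_ge0 (R : realType) (S : set R) : (forall x, S x -> 0 <= x) -> 0 <= inf S.
Proof.
move=> S0; have [->|/set0P S1] := eqVneq S set0; first by rewrite inf0.
exact: lb_le_inf.
Qed.

Section approximation_numbers.
Context {R : realType} {V : normedModType R[i]}.
Implicit Types (x y : nat -> V) (n : nat) (t c : R) (A : seq nat).

Lemma le_linfty_norm x j : bounded_seq x -> rnorm (x j) <= linfty_norm x.
Proof.
by move=> [M xM]; apply: ub_le_sup; [exists M => _ [i _ <-]|exists j].
Qed.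

Lemma linfty_norm_le x c : (forall j, rnorm (x j) <= c) -> linfty_norm x <= c.
Proof.
move=> xc; apply: ge_sup; first by exists (rnorm (x 0%N)), 0%N.
by move=> _ [j _ <-].
Qed.

Lemma linfty_norm_ge0 x : 0 <= linfty_norm x.
Proof.
rewrite /linfty_norm; set S := (X in sup X).
have [[S1 S2]|nS] := pselect (has_sup S); last by rewrite sup_out.
by apply: (le_trans (rnorm_ge0 (x 0%N))); apply: ub_le_sup => //; exists 0%N.
Qed.

Lemma bounded_seqB x y : bounded_seq x -> bounded_seq y ->
  bounded_seq (fun j => x j - y j).
Proof.
move=> [M xM] [N yN]; exists (M + N) => j.
by rewrite (le_trans (rnormB _ _))// lerD.
Qed.

Lemma bounded_seqD x y : bounded_seq x -> bounded_seq y ->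
  bounded_seq (fun j => x j + y j).
Proof.
move=> [M xM] [N yN]; exists (M + N) => j.
by rewrite (le_trans (rnormD _ _))// lerD.
Qed.

Lemma bounded_seq_le x (W : normedModType R[i]) (y : nat -> W) c : 0 <= c ->
  (forall j, rnorm (x j) <= c * rnorm (y j)) -> bounded_seq y -> bounded_seq x.
Proof.
move=> c0 xy [M yM]; exists (c * M) => j.
by rewrite (le_trans (xy j))// ler_wpM2l.
Qed.

Let approx_set n x : set R := [set linfty_norm (fun j => x j - y j) | y in
  [set y : nat -> V |
     exists2 k, (k < n)%N & ([set j | y j != 0%R] #= `I_k)%card]].

Lemma approx_number_ge0 n x : 0 <= approx_number n x.
Proof.
rewrite /approx_number; apply: inf_ge0 => _ [y _ <-]; exact: linfty_norm_ge0.
Qed.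

Lemma approx_set_lbound n x : has_lbound (approx_set n x).
Proof. by exists 0 => _ [y _ <-]; exact: linfty_norm_ge0. Qed.

Lemma approx_number_le n x A t : (size A < n)%N ->
  0 <= t -> (forall j, j \notin A -> rnorm (x j) <= t) -> approx_number n x <= t.
Proof.
move=> An t0 xt; pose y j := if j \in A then x j else 0.
apply: (@le_trans _ _ (linfty_norm (fun j => x j - y j))); last first.
  apply: linfty_norm_le => j; rewrite /y; case: ifPn => jA.
    by rewrite subrr rnorm0.
  by rewrite subr0 xt.
apply: ge_inf; [exact: approx_set_lbound|exists y => //].
have sub : [set j | y j != 0] `<=` [set` A].
  by move=> j /=; rewrite /y; case: ifPn => //; rewrite eqxx.
have /finite_setP[k yk] := sub_finite_set sub (finite_seq A).
exists k => //; apply: leq_ltn_trans An.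
rewrite -card_le_II; apply: (@card_le_trans _ _ _ [set j | y j != 0]).
  by move: yk; rewrite card_eq_le => /andP[].
apply: (card_le_trans (subset_card_le sub)).
have -> : [set` A] = nth 0%N A @` `I_(size A).
  apply/seteqP; split=> [j /= jA|_ /= [i iA <-]]; last exact: mem_nth.
  by exists (index j A); rewrite ?nth_index//= index_mem.
exact: card_image_le.
Qed.

Lemma approx_number_lt n x t : (0 < n)%N -> bounded_seq x ->
  approx_number n x < t ->
  exists2 A, (size A < n)%N & forall j, j \notin A -> rnorm (x j) < t.
Proof.
move=> n0 bx /inf_lt h.
have [|_ [y [k kn yk] <-] lt] := h _.
  exists (linfty_norm (fun j => x j - (fun=> 0) j)), (fun=> 0) => //.
  by exists 0%N => //; rewrite II0 card_eq0; apply/eqP/seteqP; split=> j //=; rewrite eqxx.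
have [A sA yA] : exists2 A, (size A <= k)%N & forall j, y j != 0 -> j \in A.
  move: yk; rewrite card_eq_sym => /pcard_eqP/bijPex[f /= ff].
  exists [seq f i | i <- iota 0 k]; first by rewrite size_map size_iota.
  move=> j yj; have [i ik <-] := set_bij_surj ff yj.
  by apply: map_f; rewrite mem_iota.
exists A; first exact: leq_ltn_trans kn.
move=> j jA; have yj : y j = 0 by apply/eqP/negPn; apply: contra jA => /yA.
apply: le_lt_trans lt; rewrite -[x j]subr0 -yj.
apply: (le_linfty_norm (x := fun j => x j - y j)); apply: bounded_seqB => //.
exists (\sum_(i <- A) rnorm (y i)) => i.
have [->|/yA iA] := eqVneq (y i) 0.
  by rewrite rnorm0 sumr_ge0// => ? _; exact: rnorm_ge0.
by rewrite (big_rem i)//= lerDl sumr_ge0// => ? _; exact: rnorm_ge0.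
Qed.

Lemma le_approx_number1 x j : bounded_seq x -> rnorm (x j) <= approx_number 1 x.
Proof.
move=> bx; apply/ler_addgt0Pr => e e0.
have [A] := @approx_number_lt 1 x _ isT bx (ltr_pwDr e0 (lexx _)).
by case: A => // _ /(_ j isT)/ltW.
Qed.

(** If fewer than [n] entries exceeded [t], removing them would bound the
    approximation number by [t]. *)
Lemma lt_approx_number n x t : 0 <= t -> t < approx_number n x ->
  exists s : seq nat, [/\ uniq s, size s = n & forall j, j \in s -> t < rnorm (x j)].
Proof.
move=> t0 tx; suff: forall k, (k <= n)%N -> exists s : seq nat,
    [/\ uniq s, size s = k & forall j, j \in s -> t < rnorm (x j)] by apply.
elim=> [_|k IH kn]; first by exists [::].
have [s [us sk st]] := IH (ltnW kn).
have [j [js xj]] : exists j, j \notin s /\ t < rnorm (x j).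
  apply: contrapT => h; have : approx_number n x <= t.
    apply: (approx_number_le (A := s)) => //; first by rewrite sk.
    by move=> j js; rewrite leNgt; apply/negP => xj; apply: h; exists j.
  by rewrite leNgt tx.
exists (j :: s); split; rewrite /= ?sk ?js//.
by move=> i; rewrite inE => /predU1P[->//|/st].
Qed.

Lemma approx_number_ge n x t (s : seq nat) : (0 < n)%N -> bounded_seq x -> uniq s ->
  (n <= size s)%N -> (forall j, j \in s -> t <= rnorm (x j)) -> t <= approx_number n x.
Proof.
move=> n0 bx us ns st; rewrite leNgt; apply/negP => /(approx_number_lt n0 bx)[A An xA].
have /allPn[j js jA] : ~~ all (mem A) s.
  apply/negP => /allP sA; have := uniq_leq_size us sA.
  by rewrite leqNgt (leq_trans An).
by have := xA j jA; rewrite ltNge st.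
Qed.

End approximation_numbers.

Lemma approx_number_dom (R : realType) (V W : normedModType R[i]) n
    (x : nat -> V) (y : nat -> W) (c : R) : (0 < n)%N ->
  0 <= c -> (forall j, rnorm (x j) <= c * rnorm (y j)) -> bounded_seq y ->
  approx_number n x <= c * approx_number n y.
Proof.
move=> n0 c0 xy yb; apply/ler_addgt0Pr => e e0.
have c1 : 0 < c + 1 by rewrite ltr_wpDl.
have lt : approx_number n y < approx_number n y + e / (c + 1).
  by rewrite ltrDl divr_gt0.
have [A An yA] := approx_number_lt n0 yb lt.
apply: (approx_number_le An).
  by rewrite addr_ge0 ?mulr_ge0 ?approx_number_ge0// ltW.
move=> j jA; rewrite (le_trans (xy j))//.
apply: (@le_trans _ _ (c * (approx_number n y + e / (c + 1)))).
  by rewrite ler_wpM2l// ltW// yA.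
rewrite mulrDr lerD2l mulrCA -[leRHS]mulr1 ler_wpM2l ?(ltW e0)//.
by rewrite ler_pdivrMr// mul1r lerDl.
Qed.

Section lorentz_sums.
Context {R : realType}.
Implicit Types (u v t c M : R) (n N : nat).

Definition lorentz_term (V : normedModType R[i]) u v (x : nat -> V) n : R :=
  (n%:R `^ (u^-1 - v^-1) * approx_number n x) `^ v.

Definition lorentz_sum (V : normedModType R[i]) u v N (x : nat -> V) : R :=
  \sum_(1 <= n < N.+1) lorentz_term u v x n.

Lemma lorentz_term_ge0 (V : normedModType R[i]) u v (x : nat -> V) n :
  0 <= lorentz_term u v x n.
Proof. exact: powR_ge0. Qed.

Lemma lorentz_sum_ge0 (V : normedModType R[i]) u v (x : nat -> V) N :
  0 <= lorentz_sum u v N x.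
Proof. by apply: sumr_ge0 => n _; exact: lorentz_term_ge0. Qed.

Lemma lorentz_sum_le (V : normedModType R[i]) u v (x : nat -> V) N N' : (N <= N')%N ->
  lorentz_sum u v N x <= lorentz_sum u v N' x.
Proof.
move=> NN; rewrite /lorentz_sum (big_cat_nat (n := N.+1) (p := N'.+1))//= lerDl.
by apply: sumr_ge0 => n _; exact: lorentz_term_ge0.
Qed.

Lemma lorentz_norm_leP (V : normedModType R[i]) u v (x : nat -> V) M : 0 < v -> 0 <= M ->
  (lorentz_norm u v x <= M%:E)%E <-> forall N, lorentz_sum u v N x <= M `^ v.
Proof.
move=> v0 M0; have v1 : 0 <= v^-1 by rewrite invr_ge0 ltW.
have vn : v != 0 by rewrite gt_eqF.
rewrite /lorentz_norm; set S := (X in (X `^ _)%E).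
have S0 : (0 <= S)%E by apply: nneseries_ge0 => n _ _; rewrite lee_fin; exact: powR_ge0.
have sumS N : ((lorentz_sum u v N x)%:E <= S)%E.
  rewrite /lorentz_sum -sumEFin; apply: nneseries_lim_ge => n _ _.
  by rewrite lee_fin; exact: powR_ge0.
split=> [SM N|h].
  rewrite -lee_fin (le_trans (sumS N))//.
  have -> : S = ((S `^ v^-1) `^ v)%E by rewrite -poweRrM mulVf// poweRe1.
  rewrite -poweR_EFin; apply: gt0_ler_poweR => //; first exact: ltW.
  - by rewrite in_itv /= poweR_ge0 leey.
  - by rewrite in_itv /= lee_fin M0 leey.
have SM : (S <= (M `^ v)%:E)%E.
  apply: lime_le; first by apply: is_cvg_nneseries => n _ _; rewrite lee_fin; exact: powR_ge0.
  apply: nearW => N; rewrite sumEFin lee_fin; case: N => [|N]; last exact: h.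
  by rewrite big_geq// powR_ge0.
have -> : M%:E = ((M `^ v)%:E `^ v^-1)%E by rewrite poweR_EFin -powRrM mulfV// powRr1.
apply: gt0_ler_poweR => //; rewrite in_itv /= ?S0 ?leey//.
by rewrite lee_fin powR_ge0.
Qed.

Lemma lorentz_norm_ge0 (V : normedModType R[i]) u v (x : nat -> V) :
  (0 <= lorentz_norm u v x)%E.
Proof. exact: poweR_ge0. Qed.

Lemma lorentz_bound (V : normedModType R[i]) u v (x : nat -> V) :
  (lorentz_norm u v x < +oo)%E -> exists2 M, 0 <= M & (lorentz_norm u v x <= M%:E)%E.
Proof.
move=> h; have f : lorentz_norm u v x \is a fin_num.
  by rewrite ge0_fin_numE// lorentz_norm_ge0.
by exists (fine (lorentz_norm u v x)); rewrite ?fine_ge0 ?lorentz_norm_ge0// fineK.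
Qed.

Lemma lorentz_sum_dom (V W : normedModType R[i]) u v (x : nat -> V) (y : nat -> W) c N :
  0 < v -> 0 <= c -> (forall j, rnorm (x j) <= c * rnorm (y j)) -> bounded_seq y ->
  lorentz_sum u v N x <= c `^ v * lorentz_sum u v N y.
Proof.
move=> v0 c0 xy yb; rewrite /lorentz_sum mulr_sumr.
rewrite !big_nat; apply: ler_sum => n /andP[n1 _].
rewrite /lorentz_term -powRM ?mulr_ge0 ?powR_ge0 ?approx_number_ge0//.
apply: ge0_ler_powR; rewrite ?nnegrE ?mulr_ge0 ?powR_ge0 ?approx_number_ge0//; first exact: ltW.
rewrite mulrCA ler_wpM2l ?powR_ge0//.
exact: approx_number_dom.
Qed.

Lemma lorentz_dom (V W : normedModType R[i]) u v (x : nat -> V) (y : nat -> W) c :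
  0 < v -> 0 <= c -> (forall j, rnorm (x j) <= c * rnorm (y j)) ->
  lorentz u v y -> lorentz u v x.
Proof.
move=> v0 c0 xy [yb /lorentz_bound[M M0 /(lorentz_norm_leP _ _ v0 M0) yM]].
split; first exact: bounded_seq_le xy yb.
apply: (@le_lt_trans _ _ (c * M)%:E); last exact: ltry.
apply/lorentz_norm_leP; rewrite ?mulr_ge0// => N.
rewrite (le_trans (lorentz_sum_dom _ _ v0 c0 xy yb))// powRM//.
by rewrite ler_wpM2l ?powR_ge0.
Qed.

End lorentz_sums.

(** When [u <= v] the weights [n `^ (u^-1 - v^-1)] are nondecreasing and at
    least 1, so that the Lorentz space embeds in the space of [v]-summable
    sequences. *)
Section weighted.
Context {R : realType} (u v : R) (u0 : 0 < u) (uv : u <= v).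
Implicit Types (M : R) (n N : nat).

Let v0 : 0 < v. Proof. exact: lt_le_trans uv. Qed.
Let e0 : 0 <= u^-1 - v^-1.
Proof. by rewrite subr_ge0 lef_pV2. Qed.
Let vge0 : 0 <= v. Proof. exact: ltW. Qed.

Lemma approx_le_lorentz_term (V : normedModType R[i]) (x : nat -> V) n : (0 < n)%N ->
  approx_number n x `^ v <= lorentz_term u v x n.
Proof.
move=> n0; rewrite /lorentz_term.
apply: ge0_ler_powR; rewrite ?nnegrE ?mulr_ge0 ?powR_ge0 ?approx_number_ge0//.
rewrite -[leLHS]mul1r ler_wpM2r ?approx_number_ge0//.
have := @ler_powR _ (n%:R : R) _ _ _ e0; rewrite powRr0; apply.
by rewrite ler1n.
Qed.

Lemma le_lorentz_norm (V : normedModType R[i]) (x : nat -> V) M j : bounded_seq x -> 0 <= M ->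
  (lorentz_norm u v x <= M%:E)%E -> rnorm (x j) <= M.
Proof.
move=> xb M0 /(lorentz_norm_leP _ _ v0 M0)/(_ 1%N); rewrite /lorentz_sum big_nat1 => h.
apply: (le_trans (le_approx_number1 j xb)).
have := le_trans (approx_le_lorentz_term x (isT : (0 < 1)%N)) h.
move=> /(@ge0_ler_powR _ v^-1); rewrite -!powRrM mulfV ?gt_eqF//.
by rewrite !powRr1 ?approx_number_ge0//; apply; rewrite ?nnegrE ?powR_ge0 ?invr_ge0.
Qed.

(** The exceptional index sets of two summands unite, so that an approximation
    number of the sum is bounded by those of the summands at half the index; a
    weight grows by a bounded factor when the index doubles. *)
Lemma lorentz_sumD (V : normedModType R[i]) (x y : nat -> V) N :
  bounded_seq x -> bounded_seq y ->
  lorentz_sum u v N (fun j => x j + y j) <=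
    2 * 2 `^ v * 2 `^ v * 2 `^ v `^ (u^-1 - v^-1) *
      (lorentz_sum u v N x + lorentz_sum u v N y).
Proof.
move=> xb yb; set e := u^-1 - v^-1; set z := fun j => _.
set K := 2 `^ v * 2 `^ v * 2 `^ v `^ e.
have K0 : 0 <= K by rewrite !mulr_ge0 ?powR_ge0.
have zN : lorentz_sum u v N z <= lorentz_sum u v N.*2 z.
  by apply: lorentz_sum_le; rewrite -addnn leq_addr.
apply: (le_trans zN).
have pair n m : (0 < n)%N -> (0 < m)%N -> (m <= n.*2)%N -> (n.*2 <= m.+1)%N ->
    lorentz_term u v z m <= K * (lorentz_term u v x n + lorentz_term u v y n).
  move=> n0 m0 m2n nm.
  set a := approx_number n x; set b := approx_number n y.
  have a0 : 0 <= a by exact: approx_number_ge0.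
  have b0 : 0 <= b by exact: approx_number_ge0.
  have zab : approx_number m z <= a + b.
    apply/ler_addgt0Pr => d d0; have d2 : 0 < d / 2 by rewrite divr_gt0.
    have [A An xA] := @approx_number_lt _ _ n x (a + d / 2) n0 xb ltac:(by rewrite ltrDl).
    have [B Bn yB] := @approx_number_lt _ _ n y (b + d / 2) n0 yb ltac:(by rewrite ltrDl).
    apply: (@approx_number_le _ _ _ _ (A ++ B)).
    - rewrite size_cat; have := leq_add An Bn.
      by rewrite addSn addnS addnn => /leq_trans/(_ nm).
    - by rewrite !addr_ge0// ltW.
    - move=> j; rewrite mem_cat negb_or => /andP[jA jB].
      rewrite (le_trans (rnormD _ _))// [d in leRHS]splitr addrACA.
      by rewrite lerD// ltW ?xA ?yB.
  have w : m%:R `^ e <= 2 `^ e * n%:R `^ e.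
    rewrite -powRM//; apply: ge0_ler_powR; rewrite ?nnegrE//.
    by rewrite -natrM ler_nat mul2n.
  have ab : (a + b) `^ v <= 2 `^ v * (a `^ v + b `^ v).
    have key (c d : R) : 0 <= c -> c <= d -> (c + d) `^ v <= 2 `^ v * (c `^ v + d `^ v).
      move=> c0 cd; have d0 := le_trans c0 cd.
      apply: (@le_trans _ _ (2 `^ v * d `^ v)).
        rewrite -powRM//; apply: ge0_ler_powR; rewrite ?nnegrE ?addr_ge0 ?mulr_ge0//.
        by rewrite mulr_natl mulr2n lerD2r.
      by apply: ler_wpM2l; [exact: powR_ge0|rewrite lerDr; exact: powR_ge0].
    have [le_ab|/ltW le_ba] := leP a b; first exact: key a0 le_ab.
    by rewrite addrC [X in _ * X]addrC; exact: key b0 le_ba.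
  apply: (@le_trans _ _ ((2 `^ e * n%:R `^ e * (a + b)) `^ v)).
    apply: ge0_ler_powR; rewrite ?nnegrE ?mulr_ge0 ?powR_ge0 ?approx_number_ge0 ?addr_ge0//.
    by rewrite ler_pM ?powR_ge0 ?approx_number_ge0.
  rewrite /lorentz_term -/e -/a -/b !powRM ?mulr_ge0 ?powR_ge0 ?addr_ge0//.
  rewrite -mulrDr.
  have -> : 2 `^ e `^ v = 2 `^ v `^ e :> R by rewrite powRAC.
  rewrite /K; set A := 2 `^ v `^ e; set B := n%:R `^ e `^ v.
  have A0 : 0 <= A by exact: powR_ge0.
  have B0 : 0 <= B by exact: powR_ge0.
  have v21 : 1 <= 2 `^ v :> R.
    by have := @ler_powR _ (2 : R) (ler1n _ _) _ _ vge0; rewrite powRr0.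
  apply: (@le_trans _ _ (A * B * (2 `^ v * (a `^ v + b `^ v)))).
    exact: (ler_wpM2l (mulr_ge0 A0 B0) ab).
  rewrite [leRHS](_ : _ = 2 `^ v * (A * B * (2 `^ v * (a `^ v + b `^ v)))); last first.
    by clearbody A B; move: (2 `^ v) (a `^ v) (b `^ v) => t1 t2 t3; ring.
  by rewrite ler_peMl ?mulr_ge0 ?powR_ge0// addr_ge0 ?powR_ge0.
rewrite /lorentz_sum -[_ + _ in leRHS]big_split /=.
rewrite [2 * 2 `^ v * _ * _](_ : _ = 2 * K); last by rewrite /K; ring.
elim: N {zN} => [|N IH]; first by rewrite !big_geq// mulr0.
rewrite doubleS (@big_nat_recr _ _ _ N.*2.+2)//= (@big_nat_recr _ _ _ N.*2.+1)//=.
rewrite (@big_nat_recr _ _ _ N.+1)//= [leRHS]mulrDr -addrA lerD//.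
by rewrite [2 * K]mulr_natl mulr2n mulrDl lerD// pair// doubleS.
Qed.

End weighted.

Section lorentz_more.
Context {R : realType}.
Implicit Types (u v t c M : R) (n N : nat).

(** Deleting entries, inserting zeros and permuting do not increase the
    approximation numbers: every nonzero entry of [y] occurs in [x], at a
    position that determines its position in [y]. *)
Lemma approx_number_spread (V W : normedModType R[i]) (x : nat -> V) (y : nat -> W)
    (g : nat -> nat) n : (0 < n)%N -> bounded_seq x ->
  (forall j, y j != 0 -> exists2 i, j = g i & rnorm (y j) <= rnorm (x i)) ->
  approx_number n y <= approx_number n x.
Proof.
move=> n0 xb h; apply/ler_addgt0Pr => e e0.
have [A An xA] := @approx_number_lt _ _ n x _ n0 xb (ltr_pwDr e0 (lexx _)).
apply: (@approx_number_le _ _ _ _ (map g A)).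
- by rewrite size_map.
- by rewrite addr_ge0 ?approx_number_ge0// ltW.
- move=> j jA; have [->|/h[i ji yx]] := eqVneq (y j) 0.
    by rewrite rnorm0 addr_ge0 ?approx_number_ge0// ltW.
  rewrite (le_trans yx)// ltW// xA//; apply: contra jA => iA.
  by rewrite ji map_f.
Qed.

Lemma lorentz_sum_spread (V W : normedModType R[i]) u v (x : nat -> V) (y : nat -> W)
    (g : nat -> nat) N : 0 < v -> bounded_seq x ->
  (forall j, y j != 0 -> exists2 i, j = g i & rnorm (y j) <= rnorm (x i)) ->
  lorentz_sum u v N y <= lorentz_sum u v N x.
Proof.
move=> v0 xb h; rewrite /lorentz_sum !big_nat; apply: ler_sum => n /andP[n1 _].
apply: ge0_ler_powR; rewrite ?nnegrE ?mulr_ge0 ?powR_ge0 ?approx_number_ge0//.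
  exact: ltW.
by rewrite ler_wpM2l ?powR_ge0//; exact: approx_number_spread h.
Qed.

Lemma bounded_seq_spread (V W : normedModType R[i]) (x : nat -> V) (y : nat -> W)
    (g : nat -> nat) : bounded_seq x ->
  (forall j, y j != 0 -> exists2 i, j = g i & rnorm (y j) <= rnorm (x i)) ->
  bounded_seq y.
Proof.
move=> [M xM] h; exists M => j; have [->|/h[i _ yx]] := eqVneq (y j) 0.
  by rewrite rnorm0 (le_trans (rnorm_ge0 (x 0%N))).
exact: le_trans (xM i).
Qed.

Lemma lorentz_norm_spread (V W : normedModType R[i]) u v (x : nat -> V) (y : nat -> W)
    (g : nat -> nat) M : 0 < v -> 0 <= M -> bounded_seq x ->
  (forall j, y j != 0 -> exists2 i, j = g i & rnorm (y j) <= rnorm (x i)) ->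
  (lorentz_norm u v x <= M%:E)%E -> (lorentz_norm u v y <= M%:E)%E.
Proof.
move=> v0 M0 xb h /(lorentz_norm_leP _ _ v0 M0) xM.
apply/lorentz_norm_leP => // N.
exact: le_trans (lorentz_sum_spread _ _ v0 xb h) (xM N).
Qed.

Lemma lorentz_spread (V W : normedModType R[i]) u v (x : nat -> V) (y : nat -> W)
    (g : nat -> nat) : 0 < v ->
  (forall j, y j != 0 -> exists2 i, j = g i & rnorm (y j) <= rnorm (x i)) ->
  lorentz u v x -> lorentz u v y.
Proof.
move=> v0 h [xb /lorentz_bound[M M0 xM]]; split.
  exact: bounded_seq_spread xb h.
exact: le_lt_trans (lorentz_norm_spread v0 M0 xb h xM) (ltry _).
Qed.

Lemma seq_argmin (T : eqType) (f : T -> R) (s : seq T) : s != [::] ->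
  exists2 j, j \in s & forall i, i \in s -> f j <= f i.
Proof.
elim: s => // a [|b s] IH _.
  by exists a; rewrite ?mem_head// => i; rewrite inE => /eqP ->.
have [//|j js jm] := IH; have [fa|/ltW fj] := leP (f a) (f j).
  exists a; rewrite ?mem_head// => i; rewrite inE => /predU1P[->//|/jm].
  exact: le_trans.
exists j; first by rewrite inE js orbT.
by move=> i; rewrite inE => /predU1P[->//|/jm].
Qed.

(** The decreasing rearrangement dominates: the [n]-th largest of finitely many
    entries is at most the [n]-th approximation number. *)
Lemma sum_powR_le_approx (V : normedModType R[i]) v (x : nat -> V) (s : seq nat) :
  0 <= v -> bounded_seq x -> uniq s ->
  \sum_(j <- s) rnorm (x j) `^ v <= \sum_(1 <= n < (size s).+1) approx_number n x `^ v.
Proof.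
move=> v0 xb; have [n] := ubnP (size s); elim: n s => // n IH s sn us.
have [->|s0] := eqVneq s [::]; first by rewrite big_nil sumr_ge0// => *; rewrite powR_ge0.
have [j js jm] := seq_argmin (fun j => rnorm (x j)) s0.
have s1 : (0 < size s)%N by case: (s) s0.
rewrite (big_rem j)//= (big_nat_recr (size s))//= addrC lerD//.
  have sz : (size (rem j s)).+1 = size s by rewrite size_rem// prednK.
  have := IH (rem j s); rewrite sz; apply; last exact: rem_uniq.
  by rewrite -ltnS; exact: sn.
apply: ge0_ler_powR; rewrite ?nnegrE ?rnorm_ge0 ?approx_number_ge0//.
exact: (@approx_number_ge _ _ _ _ _ s).
Qed.

Lemma sum_powR_le_lorentz (V : normedModType R[i]) u v (x : nat -> V) M N :
  0 < u -> u <= v -> 0 <= M -> bounded_seq x -> (lorentz_norm u v x <= M%:E)%E ->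
  \sum_(j < N) rnorm (x j) `^ v <= M `^ v.
Proof.
move=> u0 uv M0 xb; have v0 := lt_le_trans u0 uv.
move=> /(lorentz_norm_leP _ _ v0 M0)/(_ N); apply: le_trans.
have := @sum_powR_le_approx _ v x (iota 0 N) (ltW v0) xb (iota_uniq _ _).
rewrite size_iota -(big_mkord xpredT (fun j => rnorm (x j) `^ v)) /index_iota subn0.
move=> /le_trans; apply; rewrite /lorentz_sum !big_nat.
by apply: ler_sum => n /andP[n1 _]; exact: approx_le_lorentz_term.
Qed.

(** Young's inequality and the two embeddings into summable sequences. *)
Lemma lorentz_holder (V W : normedModType R[i]) r q q' s p (x : nat -> V) (y : nat -> W)
    (a b : R) N : 0 < r -> r <= q -> 0 < s -> s <= p -> p <= q' -> q^-1 + q'^-1 = 1 ->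
  0 <= a -> 0 <= b -> bounded_seq x -> bounded_seq y ->
  (lorentz_norm r q x <= a%:E)%E -> (lorentz_norm s p y <= b%:E)%E ->
  \sum_(j < N) rnorm (x j) * rnorm (y j) <= a * b.
Proof.
move=> r0 rq s0 sp pq qq a0 b0 xb yb xa yle.
have q0 := lt_le_trans r0 rq; have p0 := lt_le_trans s0 sp.
have q'0 := lt_le_trans p0 pq.
have xja j := le_lorentz_norm r0 rq j xb a0 xa.
have yjb j := le_lorentz_norm s0 sp j yb b0 yle.
have [aE|an] := eqVneq a 0.
  rewrite aE mul0r big1// => j _.
  by have := xja j; rewrite aE => xj; rewrite (@le_anti _ _ (rnorm (x j)) 0) ?mul0r// xj rnorm_ge0.
have [bE|bn] := eqVneq b 0.
  rewrite bE mulr0 big1// => j _.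
  by have := yjb j; rewrite bE => yj; rewrite (@le_anti _ _ (rnorm (y j)) 0) ?mulr0// yj rnorm_ge0.
have a1 : 0 < a by rewrite lt_def an.
have b1 : 0 < b by rewrite lt_def bn.
have ai : 0 <= a^-1 by rewrite invr_ge0.
have bi : 0 <= b^-1 by rewrite invr_ge0.
suff h : \sum_(j < N) (rnorm (x j) / a) * (rnorm (y j) / b) <= 1.
  rewrite -[leRHS]mulr1; apply: le_trans (ler_wpM2l (mulr_ge0 a0 b0) h).
  rewrite mulr_sumr; apply: ler_sum => j _.
  by rewrite mulrACA -{1}[rnorm (x j)](mulVKf an) -{1}[rnorm (y j)](mulVKf bn)
    [a * _]mulrC [b * _]mulrC !mulrA -[leRHS]mulrA le_eqVlt; apply/orP; left;
    apply/eqP; field; rewrite an bn.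
apply: (@le_trans _ _ (\sum_(j < N) (rnorm (x j) `^ q * a^-1 `^ q / q +
    rnorm (y j) `^ p * b^-1 `^ p / q'))).
  apply: ler_sum => j _.
  have := @conjugate_powR _ (rnorm (x j) / a) (rnorm (y j) / b) q q'.
  move=> /(_ (mulr_ge0 (rnorm_ge0 _) ai) (mulr_ge0 (rnorm_ge0 _) bi) q0 q'0 qq).
  move=> /le_trans; apply; rewrite powRM ?rnorm_ge0//.
  rewrite lerD2l ler_wpM2r ?invr_ge0 ?(ltW q'0)// -powRM ?rnorm_ge0//.
  have [->|yn] := eqVneq (rnorm (y j)) 0.
    by rewrite !mul0r !powR0// gt_eqF.
  apply: ger_powR => //; rewrite mulr_gt0 ?invr_gt0//=; last by rewrite lt_def yn rnorm_ge0.
  by rewrite ler_pdivrMr// mul1r.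
rewrite big_split /= -!mulr_suml.
have -> : 1 = 1 * q^-1 + 1 * q'^-1 by rewrite !mul1r.
have sumle c t (z : nat -> R) : 0 < c -> 0 < t -> \sum_(j < N) z j <= c `^ t ->
    (\sum_(j < N) z j) * c^-1 `^ t <= 1.
  move=> c0 t0 zc; have : c `^ t * c^-1 `^ t = 1.
    by rewrite -powRM ?invr_ge0 ?(ltW c0)// mulfV ?gt_eqF// powR1.
  by move=> <-; rewrite ler_wpM2r ?powR_ge0.
rewrite lerD// ler_wpM2r ?invr_ge0 ?(ltW q0) ?(ltW q'0)//.
  apply: (sumle a q (fun j => rnorm (x j) `^ q)) => //.
  exact: (sum_powR_le_lorentz N r0).
apply: (sumle b p (fun j => rnorm (y j) `^ p)) => //.
exact: (sum_powR_le_lorentz N s0).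
Qed.

Lemma lorentz_embedding (V : normedModType R[i]) u v u' v' (x : nat -> V) :
  0 < u -> u <= v -> v <= v' -> v' <= u' -> lorentz u v x -> lorentz u' v' x.
Proof.
move=> u0 uv vv vu [xb /lorentz_bound[M M0 xM]].
have v0 := lt_le_trans u0 uv; have v'0 := lt_le_trans v0 vv.
have u'0 := lt_le_trans v'0 vu.
split=> //; have /(lorentz_norm_leP _ _ v0 M0) xS := xM.
pose K := M `^ v * M `^ (v' - v).
have K0 : 0 <= K by rewrite mulr_ge0 ?powR_ge0.
apply: (@le_lt_trans _ _ ((K `^ v'^-1)%:E)); last exact: ltry.
apply/lorentz_norm_leP; rewrite ?powR_ge0// => N.
rewrite -powRrM mulVf ?gt_eqF// powRr1// /K mulrC.
apply: (le_trans _ (ler_wpM2l (powR_ge0 _ _) (xS N))).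
rewrite /lorentz_sum mulr_sumr !big_nat; apply: ler_sum => n /andP[n1 _].
have a0 := approx_number_ge0 n x.
have aM : approx_number n x <= M.
  apply: (@approx_number_le _ _ _ _ [::]) => // j _.
  exact: (le_lorentz_norm u0 uv).
apply: (@le_trans _ _ (approx_number n x `^ v')).
  apply: ge0_ler_powR; rewrite ?nnegrE ?mulr_ge0 ?powR_ge0//; first exact: ltW.
  rewrite -[leRHS]mul1r ler_wpM2r//.
  have := @ler_powR _ (n%:R : R) _ _ _ (_ : u'^-1 - v'^-1 <= 0); rewrite powRr0; apply.
    by rewrite ler1n.
  by rewrite subr_le0 lef_pV2.
apply: (@le_trans _ _ (M `^ (v' - v) * approx_number n x `^ v)); last first.
  by rewrite ler_wpM2l ?powR_ge0//; exact: approx_le_lorentz_term.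
have [->|an] := eqVneq (approx_number n x) 0.
  by rewrite powR0 ?gt_eqF// mulr_ge0 ?powR_ge0.
have -> : approx_number n x `^ v' = approx_number n x `^ (v' - v) * approx_number n x `^ v.
  by rewrite -powRD ?subrK// an implybT.
by rewrite ler_wpM2r ?powR_ge0//; apply: ge0_ler_powR; rewrite ?nnegrE// subr_ge0.
Qed.

Lemma lorentzD (V : normedModType R[i]) u v (x y : nat -> V) : 0 < u -> u <= v ->
  lorentz u v x -> lorentz u v y -> lorentz u v (fun j => x j + y j).
Proof.
move=> u0 uv [xb /lorentz_bound[M M0 xM]] [yb /lorentz_bound[L L0 yL]].
have v0 := lt_le_trans u0 uv.
split; first exact: bounded_seqD.
pose K : R := 2 * 2 `^ v * 2 `^ v * 2 `^ v `^ (u^-1 - v^-1) * (M `^ v + L `^ v).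
have K0 : 0 <= K by rewrite !mulr_ge0 ?powR_ge0// addr_ge0 ?powR_ge0.
apply: (@le_lt_trans _ _ ((K `^ v^-1)%:E)); last exact: ltry.
apply/lorentz_norm_leP; rewrite ?powR_ge0// => N.
rewrite -powRrM mulVf ?gt_eqF// powRr1//.
apply: (le_trans (lorentz_sumD u0 uv N xb yb)).
rewrite /K ler_wpM2l ?mulr_ge0 ?powR_ge0// lerD//.
  by have /(lorentz_norm_leP _ _ v0 M0) := xM.
by have /(lorentz_norm_leP _ _ v0 L0) := yL.
Qed.

Definition interleave (T : Type) (x y : nat -> T) (j : nat) : T :=
  if odd j then y j./2 else x j./2.

Lemma lorentz_interleave (V : normedModType R[i]) u v (x y : nat -> V) : 0 < u -> u <= v ->
  lorentz u v x -> lorentz u v y -> lorentz u v (interleave x y).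
Proof.
move=> u0 uv hx hy; have v0 := lt_le_trans u0 uv.
pose x' j : V := if odd j then 0 else x j./2.
pose y' j : V := if odd j then y j./2 else 0.
have hx' : lorentz u v x'.
  apply: (lorentz_spread (x := x) (g := double)) => // j.
  rewrite /x'; case: ifPn; rewrite ?eqxx// => jo _; exists j./2 => //.
  by rewrite -[LHS]odd_double_half (negbTE jo).
have hy' : lorentz u v y'.
  apply: (lorentz_spread (x := y) (g := fun i => i.*2.+1)) => // j.
  rewrite /y'; case: ifPn; rewrite ?eqxx// => jo _; exists j./2 => //.
  by rewrite -[LHS]odd_double_half jo.
have -> : interleave x y = (fun j => x' j + y' j).
  by apply/funext => j; rewrite /interleave /x' /y'; case: ifP; rewrite ?add0r ?addr0.
exact: lorentzD.
Qed.

Lemma bounded_interleave (V : normedModType R[i]) (x y : nat -> V) :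
  bounded_seq x -> bounded_seq y -> bounded_seq (interleave x y).
Proof.
move=> [M xM] [L yL]; exists (Num.max M L) => j; rewrite /interleave le_max.
by case: ifP; rewrite ?xM ?yL ?orbT.
Qed.

End lorentz_more.

Section lorentz_limits.
Context {R : realType}.
Implicit Types (u v t c M : R) (n N : nat).

Definition seq_tail (V : normedModType R[i]) (x : nat -> V) (N j : nat) : V :=
  if (N <= j)%N then x j else 0.

Lemma seq_tail_spread (V : normedModType R[i]) (x : nat -> V) N j :
  seq_tail x N j != 0 -> exists2 i, j = id i & rnorm (seq_tail x N j) <= rnorm (x i).
Proof.
by move=> _; exists j => //; rewrite /seq_tail; case: ifP => //; rewrite rnorm0 rnorm_ge0.
Qed.

Lemma powR_small v c : 0 < v -> 0 < c -> exists2 e : R, 0 < e & e `^ v <= c.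
Proof.
move=> v0 c0; exists (c `^ v^-1); first exact: powR_gt0.
by rewrite -powRrM mulVf ?gt_eqF// powRr1// ltW.
Qed.

(** Order continuity of the Lorentz norm: only finitely many terms of the
    defining series are large, and each of them is controlled by the first
    approximation number of the tail, which tends to 0. *)
Lemma lorentz_tail (V : normedModType R[i]) u v (x : nat -> V) c : 0 < u -> u <= v ->
  lorentz u v x -> 0 < c ->
  exists N0, forall N, (N0 <= N)%N -> (lorentz_norm u v (seq_tail x N) <= c%:E)%E.
Proof.
move=> u0 uv [xb /lorentz_bound[M M0]] + c0; have v0 := lt_le_trans u0 uv.
have vge0 := ltW v0.
move=> /(lorentz_norm_leP _ _ v0 M0) xM.
pose d := c `^ v / 2; have d0 : 0 < d by rewrite divr_gt0 ?powR_gt0.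
have [K KM] : exists K, forall L, lorentz_sum u v L x <= lorentz_sum u v K x + d.
  pose S := [set lorentz_sum u v L x | L in [set: nat]].
  have hS : has_sup S.
    by split; [exists (lorentz_sum u v 0 x), 0%N|exists (M `^ v) => _ [L _ <-]].
  have [_ [K _ <-] lt] := sup_adherent d0 hS; exists K => L.
  rewrite -lerBlDr; apply: (le_trans _ (ltW lt)); rewrite lerD2r.
  by apply: ub_le_sup; [exact: hS.2|exists L].
pose W := \sum_(1 <= n < K.+1) n%:R `^ (u^-1 - v^-1) `^ v : R.
have W0 : 0 <= W by rewrite sumr_ge0// => *; exact: powR_ge0.
have W1 : 0 < W + 1 by rewrite ltr_wpDl.
have [e e0 ev] := powR_small v0 (divr_gt0 d0 W1).
(* the approximation numbers tend to 0 because the weights are at least 1 *)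
have [n n1 xn] : exists2 n, (0 < n)%N & approx_number n x < e.
  apply: contrapT => h; have {}h n : (0 < n)%N -> e <= approx_number n x.
    by move=> n0; rewrite leNgt; apply/negP => lt; apply: h; exists n.
  have : forall n, n%:R * e `^ v <= M `^ v.
    move=> n; apply: le_trans (xM n).
    have -> : n%:R * e `^ v = \sum_(1 <= i < n.+1) e `^ v.
      by rewrite sumr_const_nat subSS subn0 mulr_natl.
    rewrite /lorentz_sum !big_nat; apply: ler_sum => i /andP[i0 _].
    apply: le_trans (approx_le_lorentz_term u0 uv x i0).
    by apply: ge0_ler_powR; rewrite ?nnegrE ?approx_number_ge0 ?(ltW e0) ?h.
  move=> /(_ (Num.bound (M `^ v / e `^ v))); apply/negP; rewrite -ltNge.
  by rewrite -ltr_pdivrMr ?powR_gt0// archi_boundP// divr_ge0 ?powR_ge0.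
have [A An xA] := approx_number_lt n1 xb xn.
exists (\max_(j <- A) j.+1) => N AN.
have tb : bounded_seq (seq_tail x N) := bounded_seq_spread xb (@seq_tail_spread _ x N).
have te j : rnorm (seq_tail x N j) <= e.
  rewrite /seq_tail; case: ifPn => [Nj|_]; last by rewrite rnorm0 ltW.
  rewrite ltW// xA//; apply/negP => jA.
  have := leq_trans (leq_bigmax_seq (F := fun j => j.+1) _ jA isT) (leq_trans AN Nj).
  by rewrite ltnn.
apply/lorentz_norm_leP; rewrite ?ltW// => L.
have -> : c `^ v = d + d by rewrite -splitr.
have split_sum (z : nat -> V) (bz : bounded_seq z) : lorentz_sum u v (K + L) z =
    lorentz_sum u v K z + \sum_(K.+1 <= n < (K + L).+1) lorentz_term u v z n.
  by rewrite /lorentz_sum (big_cat_nat (n := K.+1))//= ltnS leq_addr.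
apply: (@le_trans _ _ (lorentz_sum u v (K + L) (seq_tail x N))).
  by apply: lorentz_sum_le; rewrite leq_addl.
rewrite split_sum// lerD//.
  apply: (@le_trans _ _ (W * e `^ v)).
    rewrite /W mulr_suml /lorentz_sum !big_nat; apply: ler_sum => i /andP[i0 _].
    rewrite -powRM ?powR_ge0 ?(ltW e0)//; apply: ge0_ler_powR => //.
    - by rewrite nnegrE mulr_ge0 ?powR_ge0 ?approx_number_ge0.
    - by rewrite nnegrE mulr_ge0 ?powR_ge0 ?(ltW e0).
    - by rewrite ler_wpM2l ?powR_ge0//; apply: (@approx_number_le _ _ _ _ [::]) => //; exact: ltW.
  apply: (@le_trans _ _ (W * (d / (W + 1)))); first by rewrite ler_wpM2l.
  by rewrite mulrCA ler_piMr ?(ltW d0)// ler_pdivrMr// mul1r lerDl.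
apply: (@le_trans _ _ (\sum_(K.+1 <= n < (K + L).+1) lorentz_term u v x n)).
  apply: ler_sum_nat => i /andP[i0 _].
  apply: ge0_ler_powR; rewrite ?nnegrE ?mulr_ge0 ?powR_ge0 ?approx_number_ge0//.
  rewrite ler_wpM2l ?powR_ge0//; apply: (approx_number_spread (g := id)) => //.
    exact: leq_ltn_trans i0.
  by move=> j; exact: seq_tail_spread.
by have := KM (K + L)%N; rewrite split_sum// lerD2l.
Qed.

(** Lower semicontinuity for coordinatewise convergence. *)
Lemma lorentz_sum_lsc (V : normedModType R[i]) u v (x : nat -> V) M N : 0 < v ->
  0 <= M -> M < lorentz_sum u v N x ->
  exists (J : seq nat) (d : R), 0 < d /\ forall y : nat -> V, bounded_seq y ->
    (forall j, j \in J -> rnorm (y j - x j) < d) -> M < lorentz_sum u v N y.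
Proof.
move=> v0 M0; set S := lorentz_sum u v N x => MS; have S0 := le_lt_trans M0 MS.
pose th := ((M + S) / 2 / S) `^ v^-1.
have b0 : 0 <= (M + S) / 2 / S.
  by rewrite mulr_ge0 ?invr_ge0 ?(ltW S0)// mulr_ge0// addr_ge0 ?(ltW S0).
have th0 : 0 < th by apply: powR_gt0; rewrite !divr_gt0// ltr_wpDl.
have thv : th `^ v = (M + S) / 2 / S.
  by rewrite -powRrM mulVf ?gt_eqF// powRr1.
have th1 : th < 1.
  suff : th < 1 `^ v^-1 by rewrite powR1.
  apply: gt0_ltr_powR; rewrite ?invr_gt0 ?nnegrE//.
  by rewrite ltr_pdivrMr// mul1r ltr_pdivrMr// mulr_natr mulr2n ltrD2r.
have step n : (0 < n)%N -> exists (J : seq nat) (d : R), 0 < d /\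
    forall y : nat -> V, bounded_seq y ->
    (forall j, j \in J -> rnorm (y j - x j) < d) ->
    th * approx_number n x <= approx_number n y.
  move=> n0; have [a0|an] := eqVneq (approx_number n x) 0.
    exists [::], 1; split=> // y _ _; rewrite a0 mulr0; exact: approx_number_ge0.
  have a0 : 0 < approx_number n x by rewrite lt_def an approx_number_ge0.
  have lt : th * approx_number n x < approx_number n x by rewrite gtr_pMl.
  have [s [us sn sx]] := lt_approx_number (mulr_ge0 (ltW th0) (ltW a0)) lt.
  have sn0 : s != [::] by rewrite -size_eq0 sn -lt0n.
  have [j js jm] := seq_argmin (fun j => rnorm (x j)) sn0.
  exists s, (rnorm (x j) - th * approx_number n x); split; first by rewrite subr_gt0 sx.
  move=> y yb yx; apply: (approx_number_ge n0 yb us); first by rewrite sn.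
  move=> i is_; have := yx i is_; have := jm i is_.
  have := rnorm_triangle (x i) (y i) 0; rewrite !subr0 [rnorm (x i - _)]rnormBC.
  lra.
have gen L : exists (J : seq nat) (d : R), 0 < d /\
    forall y : nat -> V, bounded_seq y ->
    (forall j, j \in J -> rnorm (y j - x j) < d) ->
    forall n, (0 < n <= L)%N -> th * approx_number n x <= approx_number n y.
  elim: L => [|L IH].
    by exists [::], 1; split=> // y _ _ n; rewrite leqn0; case: n.
  have [J [d [d0 h]]] := IH; have [J' [d' [d'0 h']]] := step L.+1 isT.
  exists (J ++ J'), (Num.min d d'); split; first by rewrite lt_min d0.
  move=> y yb yx n /andP[n0]; rewrite leq_eqVlt => /predU1P[->|nN].
    by apply: h' => // j jJ; have := yx j; rewrite mem_cat jJ orbT lt_min => /(_ isT)/andP[].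
  apply: h => //; last by rewrite n0.
  by move=> j jJ; have := yx j; rewrite mem_cat jJ lt_min => /(_ isT)/andP[].
have [J [d [d0 h]]] := gen N.
exists J, d; split; [exact: d0|move=> y yb yx].
apply: (@lt_le_trans _ _ (th `^ v * S)).
  rewrite thv mulfVK ?gt_eqF// ltr_pdivlMr// mulr_natr mulr2n ltrD2l//.
rewrite /S /lorentz_sum mulr_sumr !big_nat; apply: ler_sum => n /andP[n0 nN].
rewrite /lorentz_term -powRM ?mulr_ge0 ?powR_ge0 ?approx_number_ge0 ?(ltW th0)//.
apply: ge0_ler_powR; rewrite ?nnegrE ?mulr_ge0 ?powR_ge0 ?approx_number_ge0 ?(ltW th0) ?(ltW v0)//.
by rewrite mulrCA ler_wpM2l ?powR_ge0// h// n0.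
Qed.

End lorentz_limits.

(** * Dual spaces and uniform boundedness *)

(** Dependent choice along a sequence, with an invariant. *)
Lemma sequential_choice (X : Type) (P : nat -> X -> Prop) (Q : nat -> X -> X -> Prop) x0 :
  P 0%N x0 -> (forall n x, P n x -> exists2 y, P n.+1 y & Q n x y) ->
  exists f : nat -> X, f 0%N = x0 /\ forall n, P n (f n) /\ Q n (f n) (f n.+1).
Proof.
move=> P0 step.
have /choice[g hg] : forall z : nat * X, exists y, P z.1 z.2 -> P z.1.+1 y /\ Q z.1 z.2 y.
  move=> [n x] /=; have [/step[y Py Qy]|nP] := pselect (P n x); first by exists y.
  by exists x.
pose f := fix f n := if n is m.+1 then g (m, f m) else x0.
have Pf n : P n (f n) by elim: n => // n /(hg (n, _))[].
by exists f; split=> // n; split=> //; exact: (hg (n, f n) (Pf n)).2.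
Qed.

Section dual_theory.
Context {R : realType}.
Local Open Scope complex_scope.
Local Notation C := R[i]^o.

Lemma continuous_rnorm (V W : normedModType R[i]) (f : V -> W) :
  (forall x e, 0 < e -> exists2 d : R, 0 < d &
     forall y, rnorm (y - x) < d -> rnorm (f y - f x) < e) -> continuous f.
Proof.
move=> h x; apply/cvgrPdist_lt => e e0.
have eR : e = (complex.Re e)%:C by rewrite RRe_real// gtr0_real.
have e1 : 0 < complex.Re e by rewrite -ltcR -eR.
have [d d0 hd] := h x _ e1; apply/(iffRL (nbhs_normP _ _)); exists d%:C; first by rewrite /= ltcR.
move=> y; rewrite /= !rnormE ltcR eR ltcR rnormBC => /hd.
by rewrite rnormBC.
Qed.

Lemma rnorm_continuous (V W : normedModType R[i]) (f : V -> W) x e : continuous f ->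
  0 < e -> exists2 d : R, 0 < d & forall y, rnorm (y - x) < d -> rnorm (f y - f x) < e.
Proof.
move=> cf e0; have e0' : 0 < e%:C by rewrite ltcR.
have [d /= d0 hd] := iffLR (nbhs_normP _ _) ((iffLR (cvgrPdist_lt _ _) (cf x)) _ e0').
have dR : d = (complex.Re d)%:C by rewrite RRe_real// gtr0_real.
exists (complex.Re d); first by rewrite -ltcR -dR.
move=> y yx; rewrite rnormBC -ltcR -rnormE; apply: hd => /=.
by rewrite dR rnormE ltcR rnormBC.
Qed.

Section dual_bounds.
Context {X : normedModType R[i]}.
Implicit Types (f g : dual X) (x : X).

Lemma rnorm_dualE f : rnorm f = dual_norm f.
Proof. by []. Qed.

Lemma dualD f x y : f (x + y) = f x + f y.
Proof. by have := dual_linear f 1 x y; rewrite !scale1r. Qed.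

Lemma dualZ f (a : R[i]) x : f (a *: x) = a *: f x.
Proof. by have := dual_linear f a x 0; rewrite !addr0 dual_fun0 addr0. Qed.

Lemma dual_bound f x : rnorm (f x) <= rnorm f * rnorm x.
Proof.
have [->|x0] := eqVneq x 0; first by rewrite dual_fun0 !rnorm0 mulr0.
have nx : 0 < rnorm x by rewrite rnorm_gt0.
have := @le_dual_norm _ _ f ((rnorm x)^-1%:C *: x).
rewrite rnormZr ger0_norm ?invr_ge0 ?(ltW nx)// mulVf ?gt_eqF// => /(_ (lexx _)).
by rewrite dualZ rnormZr ger0_norm ?invr_ge0 ?(ltW nx)// mulrC ler_pdivrMr.
Qed.

Lemma dual_norm_le f (c : R) : 0 <= c -> (forall x, rnorm (f x) <= c * rnorm x) ->
  rnorm f <= c.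
Proof.
move=> c0 h; rewrite rnorm_dualE; apply: ge_sup; first exact: dual_unit_values_neq0.
by move=> _ [x x1 <-]; rewrite (le_trans (h x))// -[leRHS]mulr1 ler_wpM2l.
Qed.

Lemma is_dual_bounded (f : X -> C) (c : R) : linear f ->
  (forall x, rnorm (f x) <= c * rnorm x) -> f \in @is_dual R X.
Proof.
move=> lf fc; apply/asboolP; split=> //; apply: continuous_rnorm => x e e0.
have c1 : 0 < `|c| + 1 by rewrite ltr_wpDl.
exists (e / (`|c| + 1)); first by rewrite divr_gt0.
move=> y; rewrite ltr_pdivlMr// mulrC => yx.
have -> : f y - f x = f (y - x).
  by have := lf (-1) x y; rewrite !scaleN1r ![- _ + _]addrC => ->.
apply: le_lt_trans yx; rewrite (le_trans (fc _))// ler_wpM2r ?rnorm_ge0//.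
by rewrite (le_trans (ler_norm _))// lerDl.
Qed.

Lemma dual_complete (f : nat -> dual X) :
  (forall e : R, 0 < e -> exists N, forall n m, (N <= n)%N -> (N <= m)%N ->
    rnorm (f n - f m) < e) ->
  exists g : dual X, forall e : R, 0 < e -> exists N, forall n, (N <= n)%N ->
    rnorm (g - f n) <= e.
Proof.
move=> h.
have /choice[G hG] : forall x, exists z : C, cvgs (fun n => f n x) z.
  move=> x; apply: cauchy_cvgs => e e0.
  have x1 : 0 < rnorm x + 1 by rewrite ltr_wpDl ?rnorm_ge0.
  have [N hN] := h _ (divr_gt0 e0 x1); exists N => n m Nn Nm.
  have := hN _ _ Nn Nm; rewrite ltr_pdivlMr// => lt; apply: le_lt_trans lt.
  apply: le_trans (dual_bound (f n - f m) x) _.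
  by rewrite ler_wpM2l ?rnorm_ge0// lerDl.
have lG : linear G.
  move=> a x y; apply: (cvgs_uniq (hG _)).
  have := cvgsD (cvgsM a (hG x)) (hG y); congr cvgs.
  by apply/funext => n; rewrite (dual_linear (f n)).
have dist e N : (forall n m, (N <= n)%N -> (N <= m)%N -> rnorm (f n - f m) < e) ->
    forall n, (N <= n)%N -> forall x, rnorm (G x - f n x) <= e * rnorm x.
  move=> hN n Nn x; apply: (cvgs_dist_le (N := N) (hG x)) => m Nm.
  apply: le_trans (dual_bound (f m - f n) x) _.
  by rewrite ler_wpM2r ?rnorm_ge0// ltW// hN.
have [N hN] := h 1 ltr01.
have Gb x : rnorm (G x) <= (1 + rnorm (f N)) * rnorm x.
  have := rnorm_triangle (G x) (f N x) 0; rewrite !subr0 => /le_trans; apply.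
  by rewrite mulrDl lerD ?dual_bound// (dist 1 N).
exists (Dual (is_dual_bounded lG Gb)) => e e0; have [M hM] := h _ e0.
exists M => n Mn; apply: dual_norm_le; first exact: ltW.
by move=> x; exact: (dist e M hM).
Qed.

End dual_bounds.

Definition dual_eval (X : normedModType R[i]) (x : X) : dual (dual X).
Proof.
apply: (@Dual _ _ (fun f : dual X => f x)).
apply: (@is_dual_bounded _ _ (rnorm x)) => [a f g//|f].
rewrite mulrC; exact: (dual_bound f x).
Defined.

Lemma rnorm_dual_eval (X : normedModType R[i]) (x : X) : rnorm (dual_eval x) <= rnorm x.
Proof.
apply: dual_norm_le => [|f]; first exact: rnorm_ge0.
rewrite mulrC; exact: (dual_bound f x).
Qed.

(** The uniform boundedness principle for the (quasi-normed) Lorentz spaces.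
    If the weak norm were infinite, every ball of the dual would contain a
    functional with an arbitrarily large finite Lorentz sum; largeness is an
    open condition, and the limit of a nested sequence of balls would be a
    functional whose image of the sequence has infinite Lorentz norm. *)
Lemma wlorentz_norm_finite (X : normedModType R[i]) (u v : R) (phi : nat -> X) :
  0 < u -> u <= v -> wlorentz u v phi ->
  exists2 M : R, 0 <= M & (wlorentz_norm u v phi <= M%:E)%E.
Proof.
move=> u0 uv wphi; have v0 := lt_le_trans u0 uv.
pose S N (psi : dual X) := lorentz_sum u v N (fun j => psi (phi j) : C).
have bd (psi : dual X) : bounded_seq (fun j => psi (phi j) : C) by have [] := wphi psi.
have [[M hM]|unbdd] := pselect (exists M : R, forall (psi : dual X) N, rnorm psi <= 1 -> S N psi <= M).
  have M0 : 0 <= M.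
    apply: le_trans (hM 0 0%N _); last by rewrite rnorm0.
    exact: lorentz_sum_ge0.
  exists (M `^ v^-1); first exact: powR_ge0.
  apply: ub_ereal_sup => _ [psi psi1 <-]; apply/lorentz_norm_leP; rewrite ?powR_ge0// => N.
  by rewrite -powRrM mulVf ?gt_eqF// powRr1// hM.
exfalso.
have [K K0 SD] : exists2 K : R, 0 <= K & forall N (f g : dual X), S N (f + g) <= K * (S N f + S N g).
  exists (2 * 2 `^ v * 2 `^ v * 2 `^ v `^ (u^-1 - v^-1)); first by rewrite !mulr_ge0 ?powR_ge0.
  by move=> N f g; exact: (lorentz_sumD u0 uv N (bd f) (bd g)).
have SZ N (c : R) (f : dual X) : S N (c%:C *: f) <= `|c| `^ v * S N f.
  apply: lorentz_sum_dom => // j.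
  by rewrite [X in rnorm X <= _](_ : _ = c%:C *: f (phi j))// rnormZr.
have large M (psi : dual X) (d : R) : 0 <= M -> 0 < d -> exists (psi' : dual X) N, rnorm (psi' - psi) <= d /\ M < S N psi'.
  move=> M0 d0; apply: contrapT => h.
  have {}h psi' N : rnorm (psi' - psi) <= d -> S N psi' <= M.
    by move=> le; rewrite leNgt; apply/negP => lt; apply: h; exists psi', N.
  apply: unbdd; exists (`|d^-1| `^ v * (K * (M + `|-1| `^ v * M))) => chi N chi1.
  have -> : chi = d^-1%:C *: (d%:C *: chi).
    by rewrite scalerA -rmorphM/= mulVf ?gt_eqF// scale1r.
  apply: le_trans (SZ _ _ _) _; rewrite ler_wpM2l ?powR_ge0//.
  have -> : d%:C *: chi = (psi + d%:C *: chi) + (-1)%:C *: psi.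
    by rewrite rmorphN1 scaleN1r addrAC subrr add0r.
  apply: le_trans (SD _ _ _) _; rewrite ler_wpM2l// lerD//.
    by rewrite h// addrAC subrr add0r rnormZr gtr0_norm// -[leRHS]mulr1 ler_wpM2l// ltW.
  apply: le_trans (SZ _ _ _) _; rewrite ler_wpM2l ?powR_ge0// h//.
  by rewrite subrr rnorm0 ltW.
have step n (z : dual X * R) : 0 < z.2 -> exists2 z' : dual X * R, 0 < z'.2 &
    [/\ rnorm (z'.1 - z.1) <= z.2 / 2, z'.2 <= z.2 / 2 &
      forall psi : dual X, rnorm (psi - z'.1) <= z'.2 -> exists N, n%:R < S N psi].
  case: z => psi d /= d0; have d2 : 0 < d / 2 by rewrite divr_gt0.
  have [psi' [N [le lt]]] := large n%:R psi _ (ler0n _ _) d2.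
  have [J [c [c0 hc]]] := lorentz_sum_lsc v0 (ler0n _ _) lt.
  have [B B0 hB] : exists2 B : R, 0 < B & forall j, j \in J -> rnorm (phi j) <= B.
    elim: J {hc} => [|j J [B B0 hB]]; first by exists 1.
    exists (Num.max B (rnorm (phi j))); first by rewrite lt_max B0.
    move=> i; rewrite inE le_max => /predU1P[->|/hB ->//].
    by rewrite lexx orbT.
  have cB : 0 < c / 2 / B by rewrite !divr_gt0.
  exists (psi', Num.min (d / 2) (c / 2 / B)); rewrite /= ?lt_min ?d2//.
  split=> //; first by rewrite ge_min lexx.
  move=> f; rewrite le_min => /andP[_ fc]; exists N; apply: hc => // j jJ.
  apply: le_lt_trans (dual_bound (f - psi') (phi j)) _.
  apply: (@le_lt_trans _ _ (c / 2)); last by rewrite ltr_pdivrMr// ltr_pMr// ltr1n.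
  by rewrite -[leRHS](divfK (lt0r_neq0 B0)) ler_pM ?rnorm_ge0// hB.
pose z0 : dual X * R := (0, 1).
have [f [_ hf]] := @sequential_choice _ (fun _ z => 0 < z.2) _ z0 (ltr01 : 0 < z0.2) step.
have f0 n : 0 < (f n).2 by have [] := hf n.
have nest n m psi : rnorm (psi - (f (n + m)%N).1) <= (f (n + m)%N).2 ->
    rnorm (psi - (f n).1) <= (f n).2.
  elim: m => [|m IH]; first by rewrite addn0.
  rewrite addnS => le; apply: IH; have [_ [le1 le2 _]] := hf (n + m)%N.
  rewrite (le_trans (rnorm_triangle _ (f (n + m).+1).1 _))//.
  by rewrite [leRHS]splitr lerD// (le_trans le).
have fn n m : (n <= m)%N -> rnorm ((f m).1 - (f n).1) <= (f n).2.
  by move=> /subnKC <-; apply: (nest n (m - n)%N); rewrite subrr rnorm0 ltW.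
have f2 n : (f n).2 <= 2^-1 ^+ n * (f 0%N).2.
  elim: n => [|n IH]; first by rewrite expr0 mul1r.
  have [_ [_ le _]] := hf n; rewrite (le_trans le)// exprS -mulrA mulrC.
  by rewrite ler_wpM2l.
have [g hg] : exists g : dual X, forall e : R, 0 < e -> exists N, forall n, (N <= n)%N ->
    rnorm (g - (f n).1) <= e.
  apply: dual_complete => e e0.
  have [N hN] : exists N, (f N).2 < e / 2.
    have : (fun n => 2^-1 ^+ n * (f 0%N).2) @ \oo --> (0 * (f 0%N).2 : R).
      by apply: cvgMl; apply: cvg_expr; rewrite ger0_norm ?invr_ge0// invf_lt1 ?ltr1n.
    rewrite mul0r => /cvgrPdist_lt/(_ _ (divr_gt0 e0 (ltr0n _ 2)))[N _ /(_ N (leqnn N))].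
    rewrite /= sub0r normrN => lt; exists N; apply: le_lt_trans (f2 N) _.
    exact: le_lt_trans (ler_norm _) lt.
  exists N => n m Nn Nm.
  rewrite (le_lt_trans (rnorm_triangle _ (f N).1 _))// (splitr e).
  by rewrite ltrD// ?[rnorm ((f N).1 - _)]rnormBC (le_lt_trans (fn _ _ _)).
have gn n : rnorm (g - (f n).1) <= (f n).2.
  apply/ler_addgt0Pr => e e0; have [N hN] := hg _ e0.
  rewrite (le_trans (rnorm_triangle _ (f (maxn N n)).1 _))// addrC lerD//.
    by rewrite fn// leq_maxr.
  by rewrite hN// leq_maxl.
have [_ /lorentz_bound[M M0 /(lorentz_norm_leP _ _ v0 M0) gM]] := wphi g.
have [_ [_ _ h]] := hf (Num.bound (M `^ v)).
have [N lt] := h g (gn _).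
have := le_lt_trans (ltW (archi_boundP (powR_ge0 M v))) lt.
by rewrite ltNge gM.
Qed.

End dual_theory.

(** * Continuous homogeneous polynomials *)

Section series.
Context {R : realType}.
Local Notation C := R[i]^o.

Lemma summable_cvgs (u : nat -> C) (M : R) :
  (forall N, \sum_(j < N) rnorm (u j) <= M) ->
  exists z : C, cvgs (fun N => \sum_(j < N) u j) z.
Proof.
move=> uM; apply: cauchy_cvgs => e e0.
pose S := [set \sum_(j < N) rnorm (u j) | N in [set: nat]].
have hS : has_sup S.
  by split; [exists (\sum_(j < 0) rnorm (u j)), 0%N|exists M => _ [N _ <-]].
have [_ [K _ <-] lt] := sup_adherent e0 hS; exists K.
have key n m : (K <= n)%N -> (n <= m)%N ->
    rnorm (\sum_(j < m) u j - \sum_(j < n) u j) < e.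
  move=> Kn nm; rewrite -!(big_mkord xpredT u) (big_cat_nat (n := n) (p := m))//=.
  rewrite addrAC subrr add0r (le_lt_trans (rnorm_sum _ _ _))//.
  have hm : \sum_(j < m) rnorm (u j) <= sup S.
    by apply: ub_le_sup; [exact: hS.2|exists m].
  have hn : \sum_(j < K) rnorm (u j) <= \sum_(j < n) rnorm (u j).
    rewrite -!(big_mkord xpredT (fun j => rnorm (u j))) (big_cat_nat (n := K) (p := n))//=.
    by rewrite lerDl sumr_ge0// => *; exact: rnorm_ge0.
  move: hm; rewrite -!(big_mkord xpredT (fun j => rnorm (u j))).
  rewrite (big_cat_nat (n := n) (p := m))//= big_mkord.
  by move: lt hn; lra.
move=> n m Kn Km; have [nm|/ltnW mn] := leqP n m.
  by rewrite rnormBC key.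
by rewrite key.
Qed.

Lemma rnorm_series_le (u : nat -> C) (z : C) (M : R) :
  cvgs (fun N => \sum_(j < N) u j) z ->
  (forall N, \sum_(j < N) rnorm (u j) <= M) -> rnorm z <= M.
Proof.
move=> uz uM; apply: (cvgs_le (N := 0%N) uz) => n _.
exact: le_trans (rnorm_sum _ _ _) (uM n).
Qed.

End series.

Section linear_on_sets.
Context {K : pzRingType} {U V : lmodType K} (A : set U) (L : U -> V).
Hypothesis A0 : A 0.
Hypothesis AP : forall (a : K) f g, A f -> A g -> A (a *: f + g).
Hypothesis lL : linear_on A L.

Lemma linear_on0 : L 0 = 0.
Proof.
have := lL 1 A0 A0; rewrite !scale1r !addr0 => h.
by apply: (addrI (L 0)); rewrite addr0 -h.
Qed.

Lemma linear_on_sum (I : Type) (t : seq I) (c : I -> K) (F : I -> U) :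
  (forall i, A (F i)) ->
  A (\sum_(i <- t) c i *: F i) /\
  L (\sum_(i <- t) c i *: F i) = \sum_(i <- t) c i *: L (F i).
Proof.
move=> AF; elim: t => [|i t [IH1 IH2]]; first by rewrite !big_nil linear_on0.
by rewrite !big_cons; split; [exact: AP|rewrite lL// IH2].
Qed.

Lemma linear_onZ a f : A f -> L (a *: f) = a *: L f.
Proof. by move=> Af; rewrite -[a *: f]addr0 lL// linear_on0 addr0. Qed.

Lemma linear_onB f g : A f -> A g -> L (f - g) = L f - L g.
Proof.
move=> Af Ag; have := lL (-1) Ag Af; rewrite !scaleN1r => h.
by rewrite addrC h addrC.
Qed.

Lemma closedZ a f : A f -> A (a *: f).
Proof. by move=> Af; rewrite -[a *: f]addr0; exact: AP. Qed.

Lemma closedB f g : A f -> A g -> A (f - g).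
Proof. by move=> Af Ag; rewrite addrC -scaleN1r; exact: AP. Qed.

End linear_on_sets.

Section homogeneous.
Context {R : realType} {E : normedModType R[i]}.
Local Notation C := R[i]^o.
Implicit Types (P Q : E -> C) (n m : nat).

Lemma multilinear_lin n (A B : ('I_n -> E) -> C) (a : R[i]) :
  multilinear A -> multilinear B -> multilinear (fun x => a *: A x + B x).
Proof.
move=> hA hB i x b u v; rewrite /= (hA i x b u v) (hB i x b u v).
by rewrite !scalerDr !scalerA [a * b]mulrC addrACA.
Qed.

Lemma hpoly_lin n P Q (a : R[i]) : hpoly n P -> hpoly n Q -> hpoly n (a *: P + Q).
Proof.
move=> [cP [A mA PA]] [cQ [B mB QB]]; split; last first.
  exists (fun x => a *: A x + B x); first exact: multilinear_lin.
  by move=> x; rewrite -PA -QB.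
move=> x; apply: (@continuousD _ _ _ (a \*: P) Q); last exact: cQ.
by apply: continuousZ; [exact: cst_continuous|exact: cP].
Qed.

Lemma hpoly0 n : hpoly n (0 : E -> C).
Proof.
split; first exact: cst_continuous.
by exists (fun=> 0) => // i x a u v; rewrite scaler0 addr0.
Qed.

Lemma hpolyZ n P (a : R[i]) : hpoly n P -> hpoly n (a *: P).
Proof. by move=> hP; rewrite -[a *: P]addr0; apply: hpoly_lin => //; exact: hpoly0. Qed.

Lemma hpolyD n P Q : hpoly n P -> hpoly n Q -> hpoly n (P + Q).
Proof. by move=> hP hQ; have := hpoly_lin 1 hP hQ; rewrite scale1r. Qed.

Lemma hpolyB n P Q : hpoly n P -> hpoly n Q -> hpoly n (P - Q).
Proof.
by move=> hP hQ; rewrite addrC -scaleN1r; exact: hpoly_lin.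
Qed.

Lemma multilinear_slot0 n (A : ('I_n -> E) -> C) i (y : 'I_n -> E) :
  multilinear A -> A (fun j => if j == i then 0 else y j) = 0.
Proof.
move=> mA.
by have /= := mA i y (-1) 0 0; rewrite scaler0 addr0 scaleN1r addNr.
Qed.

Lemma multilinear_scale n (A : ('I_n -> E) -> C) (a : 'I_n -> R[i]) (x : 'I_n -> E) :
  multilinear A -> A (fun i => a i *: x i) = (\prod_i a i) * A x.
Proof.
move=> mA.
have scale1 i (y : 'I_n -> E) : A (fun j => if j == i then a i *: y i else y j) = a i * A y.
  have := mA i y (a i) (y i) 0; rewrite addr0 /= multilinear_slot0// addr0 => ->.
  congr (a i * A _); apply/funext => j.
  by case: eqP => // ->.
suff h : forall k, (k <= n)%N -> A (fun i => if (i < k)%N then a i *: x i else x i) =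
    (\prod_(i < n | (i < k)%N) a i) * A x.
  have <- : \prod_(i < n | (i < n)%N) a i = \prod_i a i.
    by apply: eq_bigl => i; rewrite ltn_ord.
  by rewrite -(h n)//; congr (A _); apply/funext => i; rewrite ltn_ord.
elim=> [_|k IH kn].
  by rewrite big_pred0// mul1r; congr (A _); apply/funext => i; rewrite ltn0.
pose i := Ordinal kn.
rewrite (bigD1 i)//= -mulrA (eq_bigl (fun j : 'I_n => (j < k)%N)); last first.
  by move=> j; rewrite -val_eqE /= ltnS; case: (ltngtP j k).
rewrite -IH ?(ltnW kn)// -(scale1 i).
congr (A _); apply/funext => j; rewrite -val_eqE /= ltnn ltnS leq_eqVlt.
by case: eqP => [jk|//]; rewrite (_ : j = i)//; exact: val_inj.
Qed.

Lemma hpoly_scale n P (a : R[i]) x : hpoly n P -> P (a *: x) = a ^+ n * P x.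
Proof.
move=> [_ [A mA PA]]; rewrite !PA (multilinear_scale (fun=> a) (fun=> x) mA).
by rewrite prodr_const card_ord.
Qed.

Lemma hpoly_bounded n P : hpoly n P ->
  exists2 M : R, 0 <= M & forall x, rnorm (P x) <= M * rnorm x ^+ n.
Proof.
move=> hP; have [cP _] := hP.
have [d d0 hd] := rnorm_continuous 0 cP ltr01.
pose c : R := d / 2; have c0 : 0 < c by rewrite divr_gt0.
pose B := 1 + rnorm (P 0).
have Bx x : rnorm x <= c -> rnorm (P x) <= B.
  move=> xc; have := rnorm_triangle (P x) (P 0) 0; rewrite !subr0 => /le_trans; apply.
  rewrite lerD2r ltW// hd// subr0 (le_lt_trans xc)// /c.
  by rewrite ltr_pdivrMr// ltr_pMr// ltr1n.
have B0 : 0 <= B by rewrite addr_ge0 ?rnorm_ge0.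
exists (B / c ^+ n) => [|x]; first by rewrite divr_ge0// exprn_ge0// ltW.
have [->|x0] := eqVneq x 0.
  rewrite rnorm0 expr0n; case: n hP B0 c0 Bx => [|n] hP B0 c0 Bx /=.
    by rewrite expr0 divr1 mulr1 Bx// rnorm0 ltW.
  by have := hpoly_scale 0 0 hP; rewrite scale0r expr0n mul0r => ->; rewrite rnorm0 mulr0.
have nx : 0 < rnorm x by rewrite rnorm_gt0.
have cx : 0 < c / rnorm x by rewrite divr_gt0.
have := Bx ((c / rnorm x)%:C%C *: x).
rewrite rnormZr ger0_norm ?(ltW cx)// divfK ?gt_eqF// => /(_ (lexx _)).
rewrite (hpoly_scale _ _ hP) rnormM (rnormX ((c / rnorm x)%:C%C : C)) rnormR.
rewrite ger0_norm ?(ltW cx)// exprMn exprVn -mulrA => h.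
rewrite mulrA -ler_pdivrMr ?exprn_gt0// ler_pdivlMr ?exprn_gt0//.
by rewrite mulrC mulrCA mulrC.
Qed.

Lemma supnorm_le P (c : R) : (forall x, rnorm x <= 1 -> rnorm (P x) <= c) -> supnorm P <= c.
Proof.
move=> h; apply: ge_sup; first by exists (rnorm (P 0)), 0 => //=; rewrite rnorm0.
by move=> _ [x x1 <-]; exact: h.
Qed.

Lemma le_supnorm n P x : hpoly n P -> rnorm (P x) <= supnorm P * rnorm x ^+ n.
Proof.
move=> hP; have [M M0 PM] := hpoly_bounded hP.
have sup1 y : rnorm y <= 1 -> rnorm (P y) <= supnorm P.
  move=> y1; apply: ub_le_sup; last by exists y.
  exists M => _ [z z1 <-]; rewrite (le_trans (PM z))// -[leRHS]mulr1 ler_wpM2l//.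
  by rewrite exprn_ile1// rnorm_ge0.
have [->|x0] := eqVneq x 0.
  rewrite rnorm0 expr0n; case: n hP PM => [|n] hP PM /=.
    by rewrite mulr1 sup1// rnorm0.
  by have := PM 0; rewrite rnorm0 expr0n /= !mulr0.
have nx : 0 < rnorm x by rewrite rnorm_gt0.
have := sup1 ((rnorm x)^-1%:C%C *: x).
rewrite rnormZr ger0_norm ?invr_ge0 ?(ltW nx)// mulVf ?gt_eqF// => /(_ (lexx _)).
rewrite (hpoly_scale _ _ hP) rnormM (rnormX ((rnorm x)^-1%:C%C : C)) rnormR.
by rewrite ger0_norm ?invr_ge0 ?(ltW nx)// exprVn mulrC ler_pdivrMr ?exprn_gt0.
Qed.

End homogeneous.

(** * Lorentz nuclear polynomials *)

Section exponents.
Context {R : realType}.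
Implicit Types (r q s p : R).

(** The order relations between the exponents and their conjugates that the
    standing assumptions provide. *)
Record admissible_exponents r q s p : Prop := AdmissibleExponents {
  adm_r0 : 0 < r;
  adm_rq : r <= q;
  adm_s0 : 0 < conj_exp s;
  adm_sp : conj_exp s <= conj_exp p;
  adm_pq : conj_exp p <= conj_exp q;
  adm_qr : conj_exp q <= conj_exp r;
  adm_conj : q^-1 + (conj_exp q)^-1 = 1 }.

Lemma conj_expE r : 1 < r -> conj_exp r = r / (r - 1).
Proof.
move=> r1; have r0 : 0 < r := lt_trans ltr01 r1.
rewrite /conj_exp /hoelder_conjugate /= gt_eqF ?lte_fin//.
by rewrite -EFinD inver subr_eq0 gt_eqF//= .
Qed.

Lemma admissible_exponentsP r q s p : 1 < r -> 1 < q -> 1 <= s -> 1 <= p -> r <= q ->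
  (hoelder_conjugate s%:E <= hoelder_conjugate p%:E)%E ->
  (1 <= (q%:E)^-1 + 1%:R%:E / hoelder_conjugate p%:E)%E ->
  admissible_exponents r q s p.
Proof.
move=> r1 q1 s1 p1 rq sp qp.
have r0 : 0 < r := lt_trans ltr01 r1.
have q0 : 0 < q := lt_trans ltr01 q1.
have pgt1 : 1 < p.
  rewrite lt_def p1 andbT; apply/eqP => pE; move: qp.
  rewrite pE hoelder_conjugate1 invey mule0 adde0 inver gt_eqF// lee_fin.
  by rewrite leNgt invf_lt1// q1.
have sgt1 : 1 < s.
  rewrite lt_def s1 andbT; apply/eqP => sE; move: sp.
  rewrite sE hoelder_conjugate1 leye_eq => /eqP /hoelder_conjugate_eqy [pE].
  by rewrite pE ltxx in pgt1.
have conjE (t : R) : 1 < t -> hoelder_conjugate t%:E = (conj_exp t)%:E.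
  move=> t1; rewrite conj_expE// /hoelder_conjugate /= gt_eqF ?lte_fin ?(lt_trans ltr01 t1)//.
  by rewrite -EFinD inver subr_eq0 gt_eqF//= .
have conj0 (t : R) : 1 < t -> 0 < conj_exp t.
  by move=> t1; rewrite conj_expE// divr_gt0 ?subr_gt0// (lt_trans ltr01 t1).
have conjV (t : R) : 1 < t -> (conj_exp t)^-1 = 1 - t^-1.
  move=> t1; rewrite conj_expE// invf_div mulrBl mulfV ?mul1r//.
  by rewrite gt_eqF// (lt_trans ltr01 t1).
have p'0 := conj0 _ pgt1.
have qp' : 1 <= q^-1 + (conj_exp p)^-1.
  move: qp; rewrite conjE// mul1e !inver !gt_eqF//. 
split => //.
- exact: conj0.
- by rewrite -lee_fin -!conjE.
- rewrite -[leLHS]invrK -[leRHS]invrK lef_pV2 ?posrE ?invr_gt0 ?conj0// !conjV//.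
  by move: qp'; rewrite conjV//; lra.
- rewrite -[leLHS]invrK -[leRHS]invrK lef_pV2 ?posrE ?invr_gt0 ?conj0// !conjV//.
  by rewrite lerD2l lerN2 lef_pV2.
- by rewrite conjV// addrC subrK.
Qed.

End exponents.

Section nuclear_representations.
Context {R : realType} (E : normedModType R[i]) (r q s p : R).
Hypothesis adm : admissible_exponents r q s p.
Local Notation C := R[i]^o.
Local Notation s' := (conj_exp s).
Local Notation p' := (conj_exp p).
Implicit Types (n m : nat) (P : E -> C) (lam y : nat -> C) (phi : nat -> dual E).
Let r0 := adm_r0 adm.
Let rq := adm_rq adm.
Let s0 := adm_s0 adm.
Let sp := adm_sp adm.
Let p0 : 0 < p' := lt_le_trans s0 sp.

Definition bounded_rep n P lam phi y (a b c : R) : Prop :=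
  [/\ nuclear_rep r q s p n P lam phi y,
      [/\ 0 <= a, 0 <= b & 0 <= c],
      (lorentz_norm r q lam <= a%:E)%E,
      (wlorentz_norm s' p' phi <= b%:E)%E & linfty_norm y <= c].

(** Real upper bounds of the nuclear quasi-norm: the norms of a representation
    are replaced by real bounds, so that no product of extended reals occurs. *)
Definition nuclear_value n P (z : R) : Prop :=
  exists lam phi y a b c, bounded_rep n P lam phi y a b c /\ a * b ^+ n * c <= z.

Lemma nuclear_rep_bounded n P lam phi y : nuclear_rep r q s p n P lam phi y ->
  exists a b c, [/\ bounded_rep n P lam phi y a b c,
    lorentz_norm r q lam = a%:E, wlorentz_norm s' p' phi = b%:E & linfty_norm y = c].
Proof.
move=> rep; have [lamL phiW yb _] := rep.
have [a a0 la] := lorentz_bound lamL.2.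
have [b b0 wb] := wlorentz_norm_finite s0 sp phiW.
have w0 : (0 <= wlorentz_norm s' p' phi)%E.
  apply: le_trans (lorentz_norm_ge0 s' p' (fun j => (0 : dual (dual E)) (phi j) : C)) _.
  by apply: ereal_sup_ubound; exists 0 => //=; rewrite rnorm0.
have la0 := lorentz_norm_ge0 r q lam.
have f1 : lorentz_norm r q lam \is a fin_num.
  by rewrite ge0_fin_numE// (le_lt_trans la)// ltry.
have f2 : wlorentz_norm s' p' phi \is a fin_num.
  by rewrite ge0_fin_numE// (le_lt_trans wb)// ltry.
exists (fine (lorentz_norm r q lam)), (fine (wlorentz_norm s' p' phi)), (linfty_norm y).
rewrite /bounded_rep !fineK//; split=> //; split=> //.
by split; rewrite ?fine_ge0 ?linfty_norm_ge0.
Qed.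

Lemma nuclear_normE (a b c : R) n :
  (a%:E * b%:E ^+ n * c%:E)%E = (a * b ^+ n * c)%:E.
Proof. by rewrite -EFin_expe -!EFinM. Qed.

Lemma nuclear_value_norm n P (z : R) : nuclear_value n P z ->
  (nuclear_norm r q s p n P <= z%:E)%E.
Proof.
move=> [lam [phi [y [a [b [c [[rep [a0 b0 c0] la pb yc] le]]]]]]].
have [a' [b' [c' [[_ [a'0 b'0 c'0] _ _ _] ea eb ec]]]] := nuclear_rep_bounded rep.
apply: (@le_trans _ _ (a' * b' ^+ n * c')%:E).
  apply: ereal_inf_lbound; exists lam, phi, y; split=> //.
  by rewrite ea eb ec nuclear_normE.
rewrite lee_fin (le_trans _ le)//.
rewrite ea lee_fin in la; rewrite eb lee_fin in pb; rewrite ec in yc.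
by rewrite !ler_pM ?mulr_ge0 ?exprn_ge0// lerXn2r.
Qed.

Lemma nuclear_norm_value n P (z : R) : (nuclear_norm r q s p n P < z%:E)%E ->
  nuclear_value n P z.
Proof.
move=> /ereal_inf_lt[_ [lam [phi [y [rep ->]]]]].
have [a [b [c [br ea eb ec]]]] := nuclear_rep_bounded rep.
rewrite ea eb ec nuclear_normE lte_fin => lt.
by exists lam, phi, y, a, b, c; split=> //; exact: ltW.
Qed.

Lemma nuclear_valueP n P : nuclear r q s p n P -> exists2 z : R, 0 <= z & nuclear_value n P z.
Proof.
move=> [_ [lam [phi [y rep]]]]; have [a [b [c [br _ _ _]]]] := nuclear_rep_bounded rep.
have [_ [a0 b0 c0] _ _ _] := br.
by exists (a * b ^+ n * c); rewrite ?mulr_ge0 ?exprn_ge0//; exists lam, phi, y, a, b, c.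
Qed.

Lemma nuclear_value_ge0 n P z : nuclear_value n P z -> 0 <= z.
Proof.
move=> [lam [phi [y [a [b [c [[_ [a0 b0 c0] _ _ _] le]]]]]]].
by rewrite (le_trans _ le)// !mulr_ge0// exprn_ge0.
Qed.

Lemma nuclear_value_le n P z z' : z <= z' -> nuclear_value n P z -> nuclear_value n P z'.
Proof.
move=> zz [lam [phi [y [a [b [c [br le]]]]]]].
by exists lam, phi, y, a, b, c; split=> //; exact: le_trans zz.
Qed.

(** * Pointwise estimates for a representation *)

Lemma wlorentz_pair phi (b : R) (psi : dual (dual E)) : 0 <= b ->
  wlorentz s' p' phi -> (wlorentz_norm s' p' phi <= b%:E)%E ->
  (lorentz_norm s' p' (fun j => psi (phi j) : C) <= (rnorm psi * b)%:E)%E.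
Proof.
move=> b0 wphi wb; have [psi0|psin] := eqVneq (rnorm psi) 0.
  apply/lorentz_norm_leP; rewrite ?psi0 ?mul0r// => N.
  rewrite powR0 ?gt_eqF// /lorentz_sum big1// => n _.
  rewrite /lorentz_term (rnorm0_eq0 psi0) (_ : approx_number _ _ = 0) ?mulr0 ?powR0 ?gt_eqF//.
  case: n => [|n].
    rewrite /approx_number (_ : [set linfty_norm _ | _ in _] = set0) ?inf0//.
    by apply/seteqP; split=> // z [u [k]].
  apply/le_anti; rewrite approx_number_ge0 andbT.
  by apply: (@approx_number_le _ _ _ _ [::]) => // j _; rewrite rnorm0.
have n0 : 0 < rnorm psi by rewrite lt_def psin rnorm_ge0.
have i0 : 0 <= (rnorm psi)^-1 by rewrite invr_ge0 ltW.
have : (lorentz_norm s' p' (fun j => (((rnorm psi)^-1)%:C%C *: psi) (phi j) : C) <= b%:E)%E.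
  apply: le_trans wb; apply: ereal_sup_ubound; exists (((rnorm psi)^-1)%:C%C *: psi) => //=.
  by rewrite rnormZr ger0_norm// mulVf.
move=> /(lorentz_norm_leP _ _ p0 b0) h; apply/lorentz_norm_leP => //.
  by rewrite mulr_ge0 ?rnorm_ge0.
move=> N; rewrite powRM ?rnorm_ge0//.
apply: (le_trans _ (ler_wpM2l (powR_ge0 _ _) (h N))).
apply: lorentz_sum_dom; rewrite ?rnorm_ge0//; last by have [] := wphi (((rnorm psi)^-1)%:C%C *: psi).
move=> j; rewrite [X in _ <= _ * rnorm X](_ : _ = ((rnorm psi)^-1)%:C%C *: psi (phi j))//.
by rewrite rnormZr ger0_norm// mulrA mulfV// mul1r.
Qed.

Lemma wlorentz_eval phi (b : R) (x : E) : 0 <= b ->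
  wlorentz s' p' phi -> (wlorentz_norm s' p' phi <= b%:E)%E ->
  (lorentz_norm s' p' (fun j => phi j x : C) <= (rnorm x * b)%:E)%E.
Proof.
move=> b0 wphi wb.
apply: le_trans (@wlorentz_pair phi b (dual_eval x) b0 wphi wb) _.
by rewrite lee_fin ler_wpM2r// rnorm_dual_eval.
Qed.

Lemma wlorentz_eval_le phi (b : R) (x : E) j : 0 <= b ->
  wlorentz s' p' phi -> (wlorentz_norm s' p' phi <= b%:E)%E ->
  rnorm (phi j x) <= rnorm x * b.
Proof.
move=> b0 wphi wb; apply: (le_lorentz_norm (x := fun j => phi j x : C) s0 sp).
- by have [] := wphi (dual_eval x).
- by rewrite mulr_ge0 ?rnorm_ge0.
- exact: wlorentz_eval.
Qed.

Lemma wlorentz_norm_le phi (b : R) j : 0 <= b ->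
  wlorentz s' p' phi -> (wlorentz_norm s' p' phi <= b%:E)%E -> rnorm (phi j) <= b.
Proof.
move=> b0 wphi wb; apply: dual_norm_le => // x; rewrite mulrC.
exact: wlorentz_eval_le.
Qed.

Lemma nuclear_rep_sum lam phi (a b : R) (x : E) N : 0 <= a -> 0 <= b ->
  lorentz r q lam -> (lorentz_norm r q lam <= a%:E)%E ->
  wlorentz s' p' phi -> (wlorentz_norm s' p' phi <= b%:E)%E ->
  \sum_(j < N) rnorm (lam j) * rnorm (phi j x) <= a * (rnorm x * b).
Proof.
move=> a0 b0 [lb _] la wphi wb.
apply: (lorentz_holder (y := fun j => phi j x : C) N r0 rq s0 sp (adm_pq adm) (adm_conj adm)) => //.
- by rewrite mulr_ge0 ?rnorm_ge0.
- by have [] := wphi (dual_eval x).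
- exact: wlorentz_eval.
Qed.

(** Hoelder's inequality for the coefficients and one factor of each power; the
    other factors are bounded by the weak norm. *)
Lemma nuclear_value_eval n P z x : nuclear_value n.+1 P z ->
  rnorm (P x) <= z * rnorm x ^+ n.+1.
Proof.
move=> [lam [phi [y [a [b [c [[[lamL wphi yb Pl] [a0 b0 c0] la wb yc] le]]]]]]].
apply: (le_trans _ (ler_wpM2r (exprn_ge0 _ (rnorm_ge0 _)) le)).
move: (Pl x) => /cvgsP Px.
apply: (rnorm_series_le (u := fun j => lam j * phi j x ^+ n.+1 * y j) Px) => N.
apply: (@le_trans _ _ (\sum_(j < N) rnorm (lam j) * rnorm (phi j x) * ((rnorm x * b) ^+ n * c))).
  apply: ler_sum => j _; rewrite !rnormM rnormX exprS !mulrA.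
  have yj : rnorm (y j) <= c by rewrite (le_trans (le_linfty_norm j yb)).
  have pj : rnorm (phi j x) ^+ n <= (rnorm x * b) ^+ n.
    by rewrite lerXn2r ?nnegrE ?rnorm_ge0 ?mulr_ge0 ?rnorm_ge0// wlorentz_eval_le.
  by rewrite ler_pM ?mulr_ge0 ?exprn_ge0 ?rnorm_ge0// ler_wpM2l ?mulr_ge0 ?rnorm_ge0.
rewrite -mulr_suml.
apply: (@le_trans _ _ (a * (rnorm x * b) * ((rnorm x * b) ^+ n * c))).
  apply: ler_wpM2r; last exact: nuclear_rep_sum.
  by rewrite mulr_ge0 ?exprn_ge0// mulr_ge0 ?rnorm_ge0.
by rewrite le_eqVlt; apply/orP; left; apply/eqP; rewrite exprMn !exprS; ring.
Qed.

End nuclear_representations.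

Section bounded_multilinear.
Context {R : realType} {E : normedModType R[i]}.
Local Notation C := R[i]^o.

Lemma multilinearB n (A : ('I_n -> E) -> C) (i : 'I_n) (x : 'I_n -> E) u v :
  multilinear A ->
  A (fun j => if j == i then u - v else x j) =
  A (fun j => if j == i then u else x j) - A (fun j => if j == i then v else x j).
Proof.
move=> mA; have /= := mA i x (-1) v u; rewrite !scaleN1r [u - v]addrC => ->.
by rewrite addrC.
Qed.

(** Telescoping one variable at a time. *)
Lemma hpoly_multilinear n (A : ('I_n -> E) -> C) (K : R) : multilinear A ->
  (forall x, rnorm (A x) <= K * \prod_i rnorm (x i)) -> hpoly n (fun x => A (fun=> x)).
Proof.
move=> mA AK; split; last by exists A.
apply: continuous_rnorm => x e e0.
pose M := rnorm x + 1; have M1 : 1 <= M by rewrite lerDr rnorm_ge0.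
have M0 : 0 <= M := le_trans ler01 M1.
pose B := n%:R * (`|K| * M ^+ n) + 1.
have B0 : 0 < B by rewrite ltr_wpDl// mulr_ge0// mulr_ge0// exprn_ge0.
exists (Num.min 1 (e / B)); first by rewrite lt_min ltr01 divr_gt0.
move=> y; rewrite lt_min => /andP[yx1]; rewrite ltr_pdivlMr// => yxe.
have yM : rnorm y <= M.
  have := rnorm_triangle y x 0; rewrite !subr0 => /le_trans; apply.
  by rewrite addrC lerD2l ltW.
have xM : rnorm x <= M by rewrite lerDl.
pose h k := A (fun i => if (i < k)%N then y else x).
have step k : (k < n)%N -> rnorm (h k.+1 - h k) <= `|K| * M ^+ n * rnorm (y - x).
  move=> kn; pose i := Ordinal kn.
  have -> : h k.+1 = A (fun j => if j == i then y else if (j < k)%N then y else x).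
    rewrite /h; congr (A _); apply/funext => j; rewrite -val_eqE /= ltnS leq_eqVlt.
    by case: eqP.
  have -> : h k = A (fun j => if j == i then x else if (j < k)%N then y else x).
    rewrite /h; congr (A _); apply/funext => j; rewrite -val_eqE /=.
    by case: eqP => // ->; rewrite ltnn.
  rewrite -multilinearB// (le_trans (AK _))// (bigD1 i)//= eqxx.
  rewrite -mulrA [rnorm (y - x) * _]mulrC.
  apply: (@le_trans _ _ (`|K| * (\prod_(j | j != i)
       rnorm (if j == i then y - x else if (j < k)%N then y else x) * rnorm (y - x)))).
    by rewrite ler_wpM2r ?ler_norm// mulr_ge0 ?rnorm_ge0// prodr_ge0// => *; rewrite rnorm_ge0.
  rewrite ler_wpM2l// ler_wpM2r ?rnorm_ge0//.
  apply: (@le_trans _ _ (\prod_(j < n | j != i) M)).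
    apply: ler_prod => j ji; rewrite rnorm_ge0 (negbTE ji) /=.
    by case: ifP.
  rewrite prodr_const; apply: ler_weXn2l => //.
  by rewrite -[leqRHS](card_ord n) max_card.
have -> : A (fun=> y) = h n.
  by rewrite /h; congr (A _); apply/funext => j; rewrite ltn_ord.
have -> : A (fun=> x) = h 0%N by [].
have tel k : (k <= n)%N -> rnorm (h k - h 0%N) <= k%:R * (`|K| * M ^+ n * rnorm (y - x)).
  elim: k => [|k IH] kn; first by rewrite subrr rnorm0 mul0r.
  rewrite (le_trans (rnorm_triangle _ (h k) _))// -natr1 mulrDl mul1r addrC lerD ?step//.
  exact: IH (ltnW kn).
apply: (le_lt_trans (tel n (leqnn n))); apply: le_lt_trans yxe.
rewrite mulrA [leRHS]mulrC ler_wpM2r ?rnorm_ge0//.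
by rewrite lerDl.
Qed.

End bounded_multilinear.

Section nuclear_space.
Context {R : realType} (E : normedModType R[i]) (r q s p : R).
Hypothesis adm : admissible_exponents r q s p.
Local Notation C := R[i]^o.
Local Notation p' := (conj_exp p).
Implicit Types (n m : nat) (P : E -> C) (lam y : nat -> C) (phi : nat -> dual E).
Let r0 := adm_r0 adm.
Let rq := adm_rq adm.
Let s0 := adm_s0 adm.
Let sp := adm_sp adm.
Let q0 : 0 < q := lt_le_trans r0 rq.
Let p0 : 0 < p' := lt_le_trans s0 sp.
Local Notation nuclear := (nuclear r q s p).
Local Notation nuclear_rep := (nuclear_rep r q s p).
Local Notation nuclear_value := (nuclear_value r q s p).

Lemma nuclear_rep_hpoly n P lam phi y : nuclear_rep n.+1 P lam phi y -> hpoly n.+1 P.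
Proof.
move=> rep; have [a [b [c [[[lamL wphi yb Pl] [a0 b0 c0] la wb yc] _ _ _]]]] :=
  nuclear_rep_bounded adm rep.
pose t (x : 'I_n.+1 -> E) j := lam j * (\prod_i phi j (x i)) * y j : C.
pose K := a * b * b ^+ n * c.
have tK x N : \sum_(j < N) rnorm (t x j) <= K * \prod_i rnorm (x i).
  apply: (@le_trans _ _ (\sum_(j < N) rnorm (lam j) * rnorm (phi j (x ord0)) *
     (b ^+ n * (\prod_(i < n) rnorm (x (lift ord0 i))) * c))).
    apply: ler_sum => j _; rewrite !rnormM rnorm_prod big_ord_recl !mulrA.
    have yj : rnorm (y j) <= c by rewrite (le_trans (le_linfty_norm j yb)).
    have pj : \prod_(i < n) rnorm (phi j (x (lift ord0 i))) <=
        b ^+ n * \prod_(i < n) rnorm (x (lift ord0 i)).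
      rewrite -[X in _ ^+ X](card_ord n) -prodr_const -big_split /=.
      apply: ler_prod => i _; rewrite rnorm_ge0 mulrC.
      exact: (wlorentz_eval_le adm).
    rewrite -!mulrA ler_wpM2l ?rnorm_ge0// ler_wpM2l ?rnorm_ge0//.
    by rewrite mulrA ler_pM ?rnorm_ge0// prodr_ge0// => *; rewrite rnorm_ge0.
  rewrite -mulr_suml [X in _ <= _ * X]big_ord_recl.
  apply: (@le_trans _ _ (a * (rnorm (x ord0) * b) *
     (b ^+ n * (\prod_(i < n) rnorm (x (lift ord0 i))) * c))).
    apply: ler_wpM2r; last exact: (nuclear_rep_sum adm).
    by rewrite !mulr_ge0 ?exprn_ge0// prodr_ge0// => *; rewrite rnorm_ge0.
  by rewrite le_eqVlt; apply/orP; left; apply/eqP; rewrite /K; ring.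
have /choice[A hA] : forall x, exists z : C, cvgs (fun N => \sum_(j < N) t x j) z.
  by move=> x; apply: summable_cvgs (tK x).
have mA : multilinear A.
  move=> i x a' u v; apply: (cvgs_uniq (hA _)).
  have tP w j : t (fun k => if k == i then w else x k) j =
      lam j * (phi j w * \prod_(k | k != i) phi j (x k)) * y j.
    rewrite /t (bigD1 i)//= eqxx; congr (_ * (_ * _) * _).
    by apply: eq_bigr => k /negbTE ->.
  have := cvgsD (cvgsM a' (hA (fun k => if k == i then u else x k)))
    (hA (fun k => if k == i then v else x k)).
  congr cvgs; apply/funext => N; rewrite mulr_sumr -big_split /=.
  apply: eq_bigr => j _; rewrite !tP dual_linear.
  by rewrite -[a' *: _]/(a' * _) !mulrDl !mulrDr !mulrDl; congr (_ + _); ring.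
have AK x : rnorm (A x) <= K * \prod_i rnorm (x i).
  exact: rnorm_series_le (hA x) (tK x).
have -> : P = (fun x => A (fun=> x)); last exact: hpoly_multilinear mA AK.
apply/funext => x; apply: (cvgs_uniq (proj1 (cvgsP _ _) (Pl x))).
have := hA (fun=> x); congr cvgs; apply/funext => N; apply: eq_bigr => j _.
by rewrite /t prodr_const card_ord.
Qed.

Lemma nuclear_repZ n P lam phi y (a : R[i]) : nuclear_rep n P lam phi y ->
  nuclear_rep n (a *: P) lam phi (fun j => a * y j).
Proof.
move=> [lamL wphi yb Pl]; split; [exact: lamL|exact: wphi| |].
  apply: (@bounded_seq_le _ _ (fun j => a * y j : C) _ y (rnorm (a : C))).
  - exact: rnorm_ge0.
  - by move=> j; rewrite (rnormM (a : C)).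
  - exact: yb.
move=> x; apply/cvgsP; have := cvgsM a (proj1 (cvgsP _ _) (Pl x)).
by congr cvgs; apply/funext => N; rewrite mulr_sumr; apply: eq_bigr => j _; ring.
Qed.

Lemma nuclear_valueZ n P (a : R[i]) z : nuclear_value n P z ->
  nuclear_value n (a *: P) (rnorm (a : C) * z).
Proof.
move=> [lam [phi [y [b [c [d [[rep [b0 c0 d0] la wb yc] le]]]]]]].
have yb : bounded_seq y by case: rep.
exists lam, phi, (fun j => a * y j), b, c, (rnorm (a : C) * d); split.
  split; [exact: nuclear_repZ| |exact: la|exact: wb|].
    by split; rewrite ?mulr_ge0 ?rnorm_ge0.
  apply: linfty_norm_le => j; rewrite (rnormM (a : C)) ler_wpM2l ?rnorm_ge0//.
  by rewrite (le_trans _ yc)// le_linfty_norm.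
by rewrite mulrCA -mulrA mulrA in le *; rewrite ler_wpM2l ?rnorm_ge0.
Qed.

Lemma sum_interleave (u v : nat -> C) N :
  \sum_(j < N.*2) interleave u v j = \sum_(j < N) u j + \sum_(j < N) v j.
Proof.
elim: N => [|N IH]; first by rewrite !big_ord0 addr0.
rewrite doubleS !big_ord_recr /= IH /interleave /= odd_double /= doubleK.
by rewrite uphalf_double addrACA addrA.
Qed.

Lemma nuclear_repD n P Q lam phi y lam' phi' y' : nuclear_rep n.+1 P lam phi y ->
  nuclear_rep n.+1 Q lam' phi' y' ->
  nuclear_rep n.+1 (P + Q) (interleave lam lam') (interleave phi phi') (interleave y y').
Proof.
move=> rep rep'; have [lamL wphi yb Pl] := rep; have [lamL' wphi' yb' Ql] := rep'.
split.
- exact: lorentz_interleave.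
- move=> psi; have -> : (fun j => psi (interleave phi phi' j)) =
      interleave (fun j => psi (phi j)) (fun j => psi (phi' j)).
    by apply/funext => j; rewrite /interleave; case: ifP.
  exact: (lorentz_interleave s0 sp (wphi psi) (wphi' psi)).
- exact: bounded_interleave.
- move=> x; apply/cvgsP.
  pose u j := lam j * phi j x ^+ n.+1 * y j; pose v j := lam' j * phi' j x ^+ n.+1 * y' j.
  have uP : cvgs (fun N => \sum_(j < N) u j) (P x) by apply/cvgsP; exact: Pl.
  have vQ : cvgs (fun N => \sum_(j < N) v j) (Q x) by apply/cvgsP; exact: Ql.
  have -> : (fun N => \sum_(j < N) interleave lam lam' j *
      (interleave phi phi' j) x ^+ n.+1 * interleave y y' j) =
      (fun N => \sum_(j < N) interleave u v j).
    apply/funext => N; apply: eq_bigr => j _; rewrite /interleave /u /v.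
    by case: ifP.
  have half e : 0 < e -> exists N, forall n, (N <= n)%N ->
      rnorm (\sum_(j < n) u j + \sum_(j < n) v j - (P x + Q x)) < e /\ rnorm (u n) < e.
    move=> e0; have [N hN] := cvgsD uP vQ e0.
    have e2 : 0 < e / 2 by rewrite divr_gt0.
    have [M hM] := uP _ e2; exists (maxn N M) => k; rewrite geq_max => /andP[Nk Mk].
    split; first exact: hN.
    have -> : u k = (\sum_(j < k.+1) u j - P x) - (\sum_(j < k) u j - P x).
      by rewrite big_ord_recr /=; ring.
    rewrite (le_lt_trans (rnormB _ _))// (splitr e) ltrD// hM//.
    exact: leq_trans Mk (leqnSn _).
  move=> e e0; have e2 : 0 < e / 2 by rewrite divr_gt0.
  have [N hN] := half _ e2; exists N.*2.+1 => k Nk.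
  have Nk2 : (N <= k./2)%N.
    by have := half_leq Nk; rewrite /= uphalf_double.
  have [h1 h2] := hN _ Nk2; rewrite -[k]odd_double_half.
  case: (odd k); rewrite /= ?add0n ?add1n.
    rewrite big_ord_recr /= sum_interleave /interleave odd_double /= doubleK addrAC.
    by rewrite (le_lt_trans (rnormD _ _))// (splitr e) ltrD.
  by rewrite sum_interleave (lt_trans h1)// ltr_pdivrMr// ltr_pMr// ltr1n.
Qed.

Lemma nuclear_of_rep n P lam phi y : nuclear_rep n.+1 P lam phi y -> nuclear n.+1 P.
Proof.
by move=> rep; split; [exact: nuclear_rep_hpoly rep|exists lam, phi, y].
Qed.

Lemma nuclear_value_nuclear n P z : nuclear_value n.+1 P z -> nuclear n.+1 P.
Proof.
by move=> [lam [phi [y [a [b [c [[rep _ _ _ _] _]]]]]]]; exact: nuclear_of_rep rep.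
Qed.

Lemma nuclear_lin n P Q (a : R[i]) : nuclear n.+1 P -> nuclear n.+1 Q ->
  nuclear n.+1 (a *: P + Q).
Proof.
move=> [_ [lam [phi [y rep]]]] [_ [lam' [phi' [y' rep']]]].
exact: nuclear_of_rep (nuclear_repD (nuclear_repZ a rep) rep').
Qed.

(** * Powers of functionals *)

Definition power n (phi : dual E) : E -> C := fun x => phi x ^+ n.

Lemma lorentz_norm_single (V : normedModType R[i]) (u v : R) (z : V) : 0 < v ->
  (lorentz_norm u v (fun j => if j == 0%N then z else 0%R) <= (rnorm z)%:E)%E.
Proof.
move=> v0; set x := fun j => _; apply/lorentz_norm_leP; rewrite ?rnorm_ge0// => N.
have xz j : rnorm (x j) <= rnorm z by rewrite /x; case: ifP; rewrite ?rnorm0 ?rnorm_ge0.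
case: N => [|N]; first by rewrite /lorentz_sum big_geq// powR_ge0.
rewrite /lorentz_sum big_nat_recl// big_nat big1 ?addr0.
  apply: ge0_ler_powR; rewrite ?nnegrE ?mulr_ge0 ?powR_ge0 ?approx_number_ge0 ?rnorm_ge0 ?(ltW v0)//.
  rewrite powR1 mul1r; apply: (@approx_number_le _ _ _ _ [::]) => //; exact: rnorm_ge0.
move=> i /andP[i1 _]; rewrite /lorentz_term (_ : approx_number _ _ = 0) ?mulr0 ?powR0 ?gt_eqF//.
apply/le_anti; rewrite approx_number_ge0 andbT.
apply: (@approx_number_le _ _ _ _ [:: 0%N]) => // j.
by rewrite inE /x => /negbTE ->; rewrite rnorm0.
Qed.

Lemma power_value n (phi : dual E) : nuclear_value n.+1 (power n.+1 phi) (rnorm phi ^+ n.+1).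
Proof.
pose lam j : C := if j == 0%N then 1 else 0.
pose ph j : dual E := if j == 0%N then phi else 0.
have lam1 : (lorentz_norm r q lam <= 1%:E)%E.
  by have := lorentz_norm_single r (1 : C) q0; rewrite rnorm1.
have phE (psi : dual (dual E)) : (fun j => psi (ph j) : C) = (fun j => if j == 0%N then psi phi : C else 0).
  by apply/funext => j; rewrite /ph; case: ifP => // _; exact: dual_fun0.
have bs (V : normedModType R[i]) (z : V) : bounded_seq (fun j => if j == 0%N then z else 0).
  by exists (rnorm z) => j; case: ifP; rewrite ?rnorm0 ?rnorm_ge0.
exists lam, ph, (fun=> 1), 1, (rnorm phi), 1; split; last by rewrite mul1r mulr1.
split; [|by split; rewrite ?ler01 ?rnorm_ge0|exact: lam1| |].
- split.
  + by split; [exact: bs|rewrite (le_lt_trans lam1)// ltry].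
  + move=> psi; rewrite phE; split; first exact: bs.
    by rewrite (le_lt_trans (lorentz_norm_single _ _ p0))// ltry.
  + by exists 1 => j; rewrite rnorm1.
  + move=> x; apply/cvgsP => e e0; exists 1%N => -[//|N _].
    rewrite big_ord_recl big1 => [|j _]; last by rewrite /lam /= !mul0r.
    by rewrite /lam /ph /= addr0 mul1r mulr1 subrr rnorm0.
- apply: ub_ereal_sup => _ [psi psi1 <-]; rewrite phE.
  apply: (le_trans (lorentz_norm_single _ _ p0)); rewrite lee_fin.
  by rewrite (le_trans (dual_bound _ _))// -[leRHS]mul1r ler_wpM2r ?rnorm_ge0.
- by apply: linfty_norm_le => j; rewrite rnorm1.
Qed.

Lemma nuclear_power n (phi : dual E) : nuclear n.+1 (power n.+1 phi).
Proof. exact: nuclear_value_nuclear (power_value n phi). Qed.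

Lemma nuclear0 n : nuclear n.+1 (0 : E -> C).
Proof.
have -> : (0 : E -> C) = power n.+1 0 by apply/funext => x; rewrite /power expr0n.
exact: nuclear_power.
Qed.

(** * Partial sums of a representation *)

(** The difference is represented by the same functionals, with the first [N]
    coefficients replaced by 0. *)
Lemma partial_sum_tail n P lam phi y (a b c : R) N (t : R) : bounded_rep r q s p n.+1 P lam phi y a b c ->
  0 <= t -> (lorentz_norm r q (seq_tail lam N) <= t%:E)%E ->
  nuclear_value n.+1 (\sum_(j < N) (lam j * y j) *: power n.+1 (phi j) - P) (t * b ^+ n.+1 * c).
Proof.
move=> [[lamL wphi yb Pl] [a0 b0 c0] la wb yc] t0 lt.
exists (seq_tail lam N), phi, (fun j => - y j), t, b, c; split; last exact: lexx.
split; [|by split|exact: lt|exact: wb|].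
- split; [|exact: wphi| |].
  + apply: (lorentz_spread (x := lam) (g := id)) => // j; exact: seq_tail_spread.
  + by case: yb => M yM; exists M => j; rewrite rnormN.
  + move=> x; apply/cvgsP.
    have := cvgsB (cvgs_cst (\sum_(j < N) lam j * phi j x ^+ n.+1 * y j)) (proj1 (cvgsP _ _) (Pl x)).
    have -> : (\sum_(j < N) (lam j * y j) *: power n.+1 (phi j) - P) x =
        \sum_(j < N) lam j * phi j x ^+ n.+1 * y j - P x.
      rewrite -[LHS]/((\sum_(j < N) (lam j * y j) *: power n.+1 (phi j)) x - P x).
      rewrite fct_sumE; congr (_ - _); apply: eq_bigr => j _.
      by rewrite -[LHS]/(lam j * y j * phi j x ^+ n.+1); ring.
    move=> h e /h[M hM]; exists (maxn N M) => k; rewrite geq_max => /andP[Nk Mk].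
    have := hM k Mk; congr (rnorm (_ - _) < e).
    rewrite -!(big_mkord xpredT (fun j => lam j * phi j x ^+ n.+1 * y j)).
    rewrite -(big_mkord xpredT (fun j => seq_tail lam N j * phi j x ^+ n.+1 * - y j)).
    have cut (F : nat -> C) : \sum_(0 <= j < k) F j = \sum_(0 <= j < N) F j + \sum_(N <= j < k) F j.
      by rewrite (big_cat_nat (n := N) (p := k)).
    rewrite (cut (fun j => lam j * phi j x ^+ n.+1 * y j)).
    rewrite (cut (fun j => (seq_tail lam N j : C) * phi j x ^+ n.+1 * - y j)).
    rewrite opprD addrA subrr add0r.
    rewrite [X in _ = X + _]big_nat [X in _ = X + _]big1 ?add0r => [|j /andP[_ jN]]; last first.
      by rewrite /seq_tail leqNgt jN !mul0r.
    rewrite -sumrN big_nat [RHS]big_nat; apply: eq_bigr => j /andP[Nj _].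
    by rewrite /seq_tail Nj mulrN.
- by apply: linfty_norm_le => j; rewrite rnormN (le_trans (le_linfty_norm j yb)).
Qed.

(** A continuous functional on the nuclear polynomials is determined by its
    values on powers, through any representation. *)
Lemma nuclear_dual_series n P lam phi y (S : (E -> C) -> C) :
  nuclear_rep n.+1 P lam phi y -> nuclear_dual r q s p n.+1 S ->
  cvgs (fun N => \sum_(j < N) lam j * y j * S (power n.+1 (phi j))) (S P).
Proof.
move=> rep [lS cS].
have [a [b [c [br _ _ _]]]] := nuclear_rep_bounded adm rep.
have [[lamL wphi yb Pl] [a0 b0 c0] la wb yc] := br.
have nP : nuclear n.+1 P := nuclear_of_rep rep.
move=> e e0; have [d d0 hd] := cS P nP e e0.
pose K := b ^+ n.+1 * c + 1; have K0 : 0 < K by rewrite ltr_wpDl// mulr_ge0// exprn_ge0.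
have [N0 hN] := lorentz_tail r0 rq lamL (divr_gt0 d0 K0); exists N0 => N N0N.
have lin := linear_on_sum (nuclear0 n) (fun a f g => @nuclear_lin n f g a) lS (enum 'I_N)
   (fun j : 'I_N => lam j * y j) (fun j => nuclear_power n (phi j)).
rewrite !big_enum /= in lin; case: lin => nF SF.
rewrite -[X in rnorm (X - _)]SF; apply: hd => //.
apply: (@le_lt_trans _ _ (d / K * b ^+ n.+1 * c)%:E).
  apply: (nuclear_value_norm adm); apply: (partial_sum_tail br); last exact: hN.
  by rewrite ltW// divr_gt0.
rewrite lte_fin -mulrA mulrAC ltr_pdivrMr// ltr_pM2l// ltrDl//.
Qed.

End nuclear_space.

(** * Products of functionals *)

Section products.
Context {R : realType}.
Local Open Scope complex_scope.
Local Notation C := R[i]^o.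

Lemma multilinear_unit_bound (E : normedModType R[i]) n (A : ('I_n -> E) -> C) (K : R) :
  multilinear A -> (forall x, (forall i, rnorm (x i) <= 1) -> rnorm (A x) <= K) ->
  forall x, rnorm (A x) <= K * \prod_i rnorm (x i).
Proof.
move=> mA AK x; have K0 : 0 <= K.
  by apply: le_trans (AK (fun=> 0) _); rewrite ?rnorm_ge0// => i; rewrite rnorm0.
have [x0|/existsNP[i /negP]] := pselect (forall i, x i != 0); last first.
  rewrite negbK => /eqP xi.
  rewrite [A x](_ : _ = 0) ?rnorm0; first by rewrite mulr_ge0// prodr_ge0// => *; rewrite rnorm_ge0.
  rewrite -(multilinear_slot0 i x mA); congr (A _); apply/funext => j.
  by case: eqP => // ->.
have nx i : 0 < rnorm (x i) by rewrite rnorm_gt0.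
pose u i := (rnorm (x i))^-1%:C *: x i.
have -> : x = (fun i => (rnorm (x i))%:C *: u i).
  apply/funext => i; rewrite /u scalerA -rmorphM /= mulfV ?scale1r//.
  by rewrite gt_eqF.
rewrite multilinear_scale// (rnormM (\prod_i _ : C)) (rnorm_prod _ _ (fun i => (rnorm (x i))%:C : C)).
rewrite mulrC.
have -> : \prod_i rnorm ((rnorm (x i))%:C : C) = \prod_i rnorm (x i).
  by apply: eq_bigr => i _; rewrite rnormR ger0_norm ?rnorm_ge0.
have -> : \prod_i rnorm ((rnorm (x i))%:C *: u i) = \prod_i rnorm (x i).
  by apply: eq_bigr => i _; rewrite /u scalerA -rmorphM /= mulfV ?scale1r// gt_eqF.
rewrite ler_wpM2r//; first by rewrite prodr_ge0// => *; rewrite rnorm_ge0.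
apply: AK => i; rewrite /u rnormZr ger0_norm ?invr_ge0 ?rnorm_ge0// mulVf//.
by rewrite gt_eqF.
Qed.

Lemma hpolyM (E : normedModType R[i]) n m (P Q : E -> C) :
  hpoly n P -> hpoly m Q -> hpoly (n + m) (fun x => P x * Q x).
Proof.
move=> hP hQ; have [cP [A mA PA]] := hP; have [cQ [B mB QB]] := hQ; split.
  by move=> x; apply: cvgM; [exact: cP|exact: cQ].
exists (fun x => A (fun i => x (lshift m i)) * B (fun i => x (rshift n i))).
  move=> i x a u v; case: (split_ordP i) => j ->.
    have eA w : (fun i0 => if lshift m i0 == lshift m j then w else x (lshift m i0)) =
        (fun i0 => if i0 == j then w else x (lshift m i0)).
      by apply/funext => k; rewrite (inj_eq (@lshift_inj _ _)).
    have eB w : (fun i0 => if rshift n i0 == lshift m j then w else x (rshift n i0)) =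
        (fun i0 => x (rshift n i0)).
      by apply/funext => k; rewrite eq_rlshift.
    have /= mAj := mA j (fun i0 => x (lshift m i0)) a u v.
    by rewrite /= !eA !eB mAj mulrDl -scalerAl.
  have eA w : (fun i0 => if lshift m i0 == rshift n j then w else x (lshift m i0)) =
      (fun i0 => x (lshift m i0)).
    by apply/funext => k; rewrite eq_lrshift.
  have eB w : (fun i0 => if rshift n i0 == rshift n j then w else x (rshift n i0)) =
      (fun i0 => if i0 == j then w else x (rshift n i0)).
    by apply/funext => k; rewrite (inj_eq (@rshift_inj _ _)).
  have /= mBj := mB j (fun i0 => x (rshift n i0)) a u v.
  by rewrite /= !eA !eB mBj mulrDr -scalerAr.
by move=> x; rewrite PA QB.
Qed.

Section one_space.
Context {E : normedModType R[i]}.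
Implicit Types (phi psi : dual E) (n m : nat).

Lemma dual_sum (I : Type) (s : seq I) (P : pred I) (F : I -> dual E) x :
  (\sum_(i <- s | P i) F i) x = \sum_(i <- s | P i) F i x.
Proof. by elim/big_rec2 : _ => // i y z _ <-. Qed.

Lemma prod_powerE n (phi : 'I_n -> dual E) :
  (fun x => \prod_i phi i x) =
  \sum_(S : {set 'I_n}) ((n`!%:R)^-1 * (-1) ^+ (n - #|S|)) *: power n (\sum_(i in S) phi i)
  :> (E -> C).
Proof.
apply/funext => x; rewrite fct_sumE.
have nf : n`!%:R != 0 :> R[i] by rewrite pnatr_eq0 -lt0n fact_gt0.
apply: (mulfI nf); rewrite -(polarization (fun i => phi i x)) mulr_sumr.
apply: eq_bigr => S _; rewrite -[((_ * _) *: power n _) x]/((_ * _) * (_ ^+ n)).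
by rewrite dual_sum !mulrA mulfV// mul1r.
Qed.

Lemma hpoly_eval_power n (x : E) : hpoly n (fun phi : dual E => phi x ^+ n : C).
Proof.
pose A (phi : 'I_n -> dual E) : C := \prod_i phi i x.
have -> : (fun phi : dual E => phi x ^+ n : C) = (fun phi => A (fun=> phi)).
  by apply/funext => phi; rewrite /A prodr_const card_ord.
apply: (@hpoly_multilinear _ _ n A (rnorm x ^+ n)).
  move=> i phi a u v.
  have rest w : A (fun j => if j == i then w else phi j) = w x * \prod_(j | j != i) phi j x.
    by rewrite /A (bigD1 i)//= eqxx; congr (_ * _); apply: eq_bigr => j /negbTE ->.
  by rewrite !rest dualE mulrDl -scalerAl.
move=> phi; rewrite /A rnorm_prod.
rewrite -[X in _ ^+ X](card_ord n) -prodr_const -big_split /=; apply: ler_prod => i _.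
by rewrite rnorm_ge0 mulrC dual_bound.
Qed.

(** The Borel transform of a bounded functional is a polynomial: its polar form
    evaluates the functional at products, which are combinations of powers. *)
Lemma hpoly_borel n (N : set (E -> C)) (t : (E -> C) -> C) (A : R) :
  N 0 -> (forall (a : R[i]) f g, N f -> N g -> N (a *: f + g)) ->
  (forall phi : dual E, N (power n phi)) -> linear_on N t ->
  (forall phi : dual E, rnorm (t (power n phi)) <= A * rnorm phi ^+ n) ->
  hpoly n (fun phi : dual E => t (power n phi)).
Proof.
move=> N0 NP Npow lt tA.
pose pr (phi : 'I_n -> dual E) : E -> C := fun x => \prod_i phi i x.
have prE (phi : 'I_n -> dual E) : N (pr phi) /\ t (pr phi) =
    \sum_(S : {set 'I_n}) ((n`!%:R)^-1 * (-1) ^+ (n - #|S|)) *: t (power n (\sum_(i in S) phi i)).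
  rewrite /pr prod_powerE.
  have := linear_on_sum N0 NP lt (enum {: {set 'I_n}})
    (fun S : {set 'I_n} => (n`!%:R)^-1 * (-1) ^+ (n - #|S|))
    (fun S : {set 'I_n} => Npow (\sum_(i in S) phi i)).
  by rewrite !big_enum.
have -> : (fun phi : dual E => t (power n phi)) = (fun phi => t (pr (fun=> phi))).
  apply/funext => phi; congr t; apply/funext => x.
  by rewrite /pr /power prodr_const card_ord.
have mA : multilinear (fun phi : 'I_n -> dual E => t (pr phi)).
  move=> i phi a u v; rewrite /= -lt; [|exact: (prE _).1|exact: (prE _).1].
  congr t; apply/funext => x; rewrite /pr.
  rewrite -[RHS]/(a * (\prod_(j < n) (if j == i then u else phi j) x) +
     \prod_(j < n) (if j == i then v else phi j) x).
  have rest w : \prod_j (if j == i then w else phi j) x = w x * \prod_(j | j != i) phi j x.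
    by rewrite (bigD1 i)//= eqxx; congr (_ * _); apply: eq_bigr => j /negbTE ->.
  by rewrite !rest dualE mulrA -mulrDl.
have tA' phi : rnorm (t (power n phi)) <= `|A| * rnorm phi ^+ n.
  by rewrite (le_trans (tA _))// ler_wpM2r ?exprn_ge0 ?rnorm_ge0// ler_norm.
pose K := \sum_(S : {set 'I_n}) rnorm ((n`!%:R)^-1 * (-1) ^+ (n - #|S|) : C) * (`|A| * n%:R ^+ n).
apply: (hpoly_multilinear mA (K := K)); apply: multilinear_unit_bound => // phi phi1.
rewrite (prE phi).2 (le_trans (rnorm_sum _ _ _))//; apply: ler_sum => S _.
rewrite rnormZc ler_wpM2l ?rnorm_ge0// (le_trans (tA' _))// ler_wpM2l//.
rewrite lerXn2r ?nnegrE ?rnorm_ge0// (le_trans (rnorm_sum _ _ _))//.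
apply: (@le_trans _ _ (\sum_(i in S) 1)); first exact: ler_sum.
by rewrite sumr_const ler_nat -[leqRHS](card_ord n) max_card.
Qed.

End one_space.

Lemma coef_binomial (K : comNzRingType) (a b : K) n j :
  ((a%:P * 'X + b%:P) ^+ n)`_j = a ^+ j * b ^+ (n - j) *+ 'C(n, j).
Proof.
rewrite addrC exprDn coef_sum.
have term (i : 'I_n.+1) : ((b%:P ^+ (n - i) * (a%:P * 'X) ^+ i) *+ 'C(n, i))`_j =
    if (i : nat) == j then a ^+ j * b ^+ (n - j) *+ 'C(n, j) else 0.
  rewrite coefMn exprMn -!rmorphXn /= mulrA -rmorphM /= coefCM coefXn eq_sym.
  by case: eqP => [->|_]; rewrite ?mulr1 ?mulr0 ?mul0rn// mulrC.
under eq_bigr do rewrite term.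
have [nj|jn] := ltnP n j.
  rewrite big1 => [|i _]; first by rewrite bin_small.
  by rewrite ltn_eqF// (leq_ltn_trans _ nj)// -ltnS.
rewrite (bigD1 (inord j))//= inordK// eqxx big1 ?addr0// => i ij.
case: eqP => // e; case/negP: ij; apply/eqP/val_inj; by rewrite /= inordK.
Qed.

Lemma size_binomial (K : comNzRingType) (a b : K) n :
  (size ((a%:P * 'X + b%:P) ^+ n : {poly K})%R <= n.+1)%N.
Proof.
apply/leq_sizeP => j nj; rewrite coef_binomial bin_small//.
Qed.

End products.

(** * The bipolar gauge *)

Section gauge.
Context {R : realType} (E : normedModType R[i]) (r q s p : R).
Hypothesis adm : admissible_exponents r q s p.
Local Open Scope complex_scope.
Local Notation C := R[i]^o.
Local Notation q' := (conj_exp q).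
Local Notation s' := (conj_exp s).
Local Notation p' := (conj_exp p).
Implicit Types (n m : nat) (P : E -> C) (S t : (E -> C) -> C) (Q : dual E -> C).
Let s0 := adm_s0 adm.
Let sp := adm_sp adm.
Let p0 : 0 < p' := lt_le_trans s0 sp.
Let q'0 : 0 < q' := lt_le_trans p0 (adm_pq adm).
Local Notation nuclear := (nuclear r q s p).
Local Notation nuclear_value := (nuclear_value r q s p).
Local Notation nuclear_dual := (nuclear_dual r q s p).
Local Notation summing := (summing r q s p).
Local Notation pairing := (pairing r q s p).
Local Notation nuclear_polar := (@nuclear_polar R E r q s p).
Local Notation gauge := (@bipolar_gauge R E r q s p).

Let N0 n := @nuclear0 R E r q s p adm n.
Let NP n := fun (a : R[i]) f g => @nuclear_lin R E r q s p adm n f g a.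

(** Continuity with an explicit constant, which the bounds by the gauge inherit. *)
Definition bounded_functional n (A : R) S : Prop :=
  linear_on (nuclear n) S /\
  forall P z, nuclear n P -> nuclear_value n P z -> rnorm (S P) <= A * z.

Lemma bounded_functional_dual n (A : R) S :
  bounded_functional n.+1 A S -> nuclear_dual n.+1 S.
Proof.
move=> [lS bS]; split=> // P0 nP0 e e0.
have A1 : 0 < `|A| + 1 by rewrite ltr_wpDl.
exists (e / (`|A| + 1)); first by rewrite divr_gt0.
move=> P nP lt; have nB := closedB (@NP n) nP nP0.
rewrite -(linear_onB lS)//.
have /(nuclear_norm_value adm) v := lt.
apply: (le_lt_trans (bS _ _ nB v)); rewrite mulrCA gtr_pMr//.
by rewrite ltr_pdivrMr// mul1r (le_lt_trans (ler_norm _))// ltrDl.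
Qed.

Lemma nuclear_dual_unique n S S' : nuclear_dual n.+1 S -> nuclear_dual n.+1 S' ->
  borel n.+1 S = borel n.+1 S' -> forall P, nuclear n.+1 P -> S P = S' P.
Proof.
move=> dS dS' SS P [_ [lam [phi [y rep]]]].
apply: (cvgs_uniq (nuclear_dual_series adm rep dS)).
have := nuclear_dual_series adm rep dS'; congr cvgs; apply/funext => N.
by apply: eq_bigr => j _; congr (_ * _); have /(congr1 (@^~ (phi j))) := SS.
Qed.

(** By continuity a functional is determined by its values on powers, so that
    the functional chosen in the definition of the pairing is [S] itself, as far
    as nuclear polynomials are concerned. *)
Lemma pairing_borel n S P : nuclear_dual n.+1 S -> nuclear n.+1 P ->
  pairing n.+1 P (borel n.+1 S) = S P.
Proof.
move=> dS nP; rewrite /Defs.pairing /borel_inv; case: xgetP => [S' _ [dS' e]|/(_ S)].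
  exact: nuclear_dual_unique e _ nP.
by case.
Qed.

Lemma borel_invP n Q : (nuclear_dual n.+1 (borel_inv r q s p n.+1 Q) /\
    borel n.+1 (borel_inv r q s p n.+1 Q) = Q) \/
  borel_inv r q s p n.+1 Q = (fun=> 0) :> ((E -> C) -> C).
Proof. by rewrite /borel_inv; case: xgetP => [S _ h|]; [left|right]. Qed.

Lemma pairing_linear n Q : linear_on (nuclear n.+1) (fun P => pairing n.+1 P Q).
Proof.
move=> a f g nf ng; rewrite /Defs.pairing; case: (borel_invP n Q) => [[[lS _] _]|->].
  exact: lS.
by rewrite scaler0 addr0.
Qed.

Lemma polar_pairing n Q P z : nuclear_polar n.+1 Q -> nuclear n.+1 P ->
  nuclear_value n.+1 P z -> rnorm (pairing n.+1 P Q) <= z.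
Proof.
move=> [_ hQ] nP v; apply/ler_addgt0Pr => e e0.
have z0 := nuclear_value_ge0 v; have z1 : 0 < z + e by rewrite ltr_wpDl.
pose c := (z + e)^-1; have c0 : 0 < c by rewrite invr_gt0.
have ball : nuclear_ball r q s p n.+1 (c%:C *: P).
  split; first exact: (closedZ (N0 n) (@NP n)).
  apply: (nuclear_value_norm adm); apply: (nuclear_value_le _ (nuclear_valueZ c%:C v)).
  by rewrite rnormR gtr0_norm// mulrC ler_pdivrMr// mul1r lerDl ltW.
have := hQ _ ball; rewrite (linear_onZ (N0 n) (@pairing_linear n Q))//.
by rewrite rnormZr gtr0_norm// mulrC ler_pdivrMr// mul1r.
Qed.

(** Membership in a multiple of the bipolar is tested on the polar: the gauge is
    the supremum of the pairings with the elements of the polar. *)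
Lemma bipolar_scale n P (c : R) : 0 < c -> nuclear n.+1 P ->
  (exists2 P', @nuclear_bipolar R E r q s p n.+1 P' & P = c%:C *: P') <->
  (forall Q, nuclear_polar n.+1 Q -> rnorm (pairing n.+1 P Q) <= c).
Proof.
move=> c0 nP; split=> [[P' [nP' h] ->] Q /h le|h].
  rewrite (linear_onZ (N0 n) (@pairing_linear n Q))// rnormZr gtr0_norm//.
  by rewrite -[leRHS]mulr1 ler_wpM2l// ltW.
exists (c^-1%:C *: P); last by rewrite scalerA -rmorphM /= mulfV ?scale1r// gt_eqF.
split; first exact: (closedZ (N0 n) (@NP n)).
move=> Q /h le; rewrite (linear_onZ (N0 n) (@pairing_linear n Q))// rnormZr.
by rewrite gtr0_norm ?invr_gt0// mulrC ler_pdivrMr// mul1r.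
Qed.

Lemma gauge_ge0 n P : 0 <= gauge n P.
Proof. by apply: inf_ge0 => d [/ltW]. Qed.

Lemma gauge_le n P (c : R) : nuclear n.+1 P -> 0 <= c ->
  (forall Q, nuclear_polar n.+1 Q -> rnorm (pairing n.+1 P Q) <= c) -> gauge n.+1 P <= c.
Proof.
move=> nP c0 h; apply/ler_addgt0Pr => e e0; apply: ge_inf.
  by exists 0 => d [/ltW].
have ce : 0 < c + e by rewrite ltr_wpDl.
split=> //; apply/bipolar_scale => // Q /h/le_trans; apply.
by rewrite lerDl ltW.
Qed.

Lemma gauge_ge n P Q : nuclear n.+1 P -> nuclear_polar n.+1 Q ->
  rnorm (pairing n.+1 P Q) <= gauge n.+1 P.
Proof.
move=> nP hQ; apply: lb_le_inf.
  have [z z0 v] := nuclear_valueP adm nP.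
  have z1 : 0 < z + 1 by rewrite ltr_wpDl.
  exists (z + 1); split=> //; apply/bipolar_scale => // Q' hQ'.
  by rewrite (le_trans (polar_pairing hQ' nP v))// lerDl.
by move=> d [d0 /(bipolar_scale d0 nP)/(_ _ hQ)].
Qed.

Lemma gauge_value n P z : nuclear_value n.+1 P z -> gauge n.+1 P <= z.
Proof.
move=> v; have nP := nuclear_value_nuclear adm v.
apply: gauge_le => // [|Q hQ]; first exact: nuclear_value_ge0 v.
exact: polar_pairing v.
Qed.

Lemma gauge_lin n (a : R[i]) f g : nuclear n.+1 f -> nuclear n.+1 g ->
  gauge n.+1 (a *: f + g) <= rnorm (a : C) * gauge n.+1 f + gauge n.+1 g.
Proof.
move=> nf ng; apply: gauge_le; first exact: NP.
  by rewrite addr_ge0 ?mulr_ge0 ?rnorm_ge0 ?gauge_ge0.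
move=> Q hQ; rewrite pairing_linear// (le_trans (rnormD _ _))// rnormZc.
by rewrite lerD ?ler_wpM2l ?rnorm_ge0// gauge_ge.
Qed.

Lemma gauge_power n (phi : dual E) : gauge n.+1 (power n.+1 phi) <= rnorm phi ^+ n.+1.
Proof. exact: gauge_value (power_value adm n phi). Qed.

Lemma summingZ n (a : R[i]) Q : summing n Q -> summing n (a *: Q).
Proof.
move=> [hQ lQ]; split; first exact: hpolyZ.
move=> phi wphi; apply: (lorentz_dom (y := fun j => Q (phi j)) (c := rnorm (a : C))).
- exact: q'0.
- exact: rnorm_ge0.
- by move=> j; rewrite -[(a *: Q) _]/(a * Q (phi j)) (rnormM (a : C)).
- exact: lQ.
Qed.

(** Divided by its bound, the functional has its Borel transform in the polar. *)
Lemma summing_functional_gauge n (A : R) S : bounded_functional n.+1 A S -> 0 <= A ->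
  summing n.+1 (borel n.+1 S) ->
  forall P, nuclear n.+1 P -> rnorm (S P) <= A * gauge n.+1 P.
Proof.
move=> bS A0 sS P nP; have dS := bounded_functional_dual bS.
suff h e : 0 < e -> rnorm (S P) <= (A + e) * gauge n.+1 P.
  apply/ler_addgt0Pr => e e0.
  have g1 : 0 < gauge n.+1 P + 1 by rewrite ltr_wpDl ?gauge_ge0.
  apply: (le_trans (h _ (divr_gt0 e0 g1))); rewrite mulrDl lerD2l.
  by rewrite mulrAC ler_pdivrMr// ler_wpM2l ?(ltW e0)// lerDl.
move=> e0; have Ae : 0 < A + e by rewrite ltr_wpDl.
pose c := (A + e)^-1; have c0 : 0 < c by rewrite invr_gt0.
pose Sc : (E -> C) -> C := fun P => c%:C *: S P.
have bSc : bounded_functional n.+1 1 Sc.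
  split; first by move=> a f g nf ng; rewrite /Sc bS.1// scalerDr !scalerA [_ * a]mulrC.
  move=> P' z nP' v; rewrite /Sc rnormZr gtr0_norm// mul1r mulrC ler_pdivrMr//.
  rewrite (le_trans (bS.2 _ _ nP' v))// mulrC ler_wpM2l ?(nuclear_value_ge0 v)//.
  by rewrite lerDl ltW.
have dSc := bounded_functional_dual bSc.
have pol : nuclear_polar n.+1 (borel n.+1 Sc).
  split; first exact: (summingZ c%:C sS).
  move=> P' [nP' n1]; rewrite pairing_borel//; apply/ler_addgt0Pr => d d0.
  have v : nuclear_value n.+1 P' (1 + d).
    apply: (nuclear_norm_value adm); rewrite (le_lt_trans n1)// lte_fin.
    by rewrite ltrDl.
  by have := bSc.2 _ _ nP' v; rewrite mul1r.
have := gauge_ge nP pol; rewrite pairing_borel// /Sc rnormZr gtr0_norm//.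
by rewrite mulrC ler_pdivrMr// mulrC.
Qed.

Lemma eval_bounded n (x : E) :
  bounded_functional n.+1 (rnorm x ^+ n.+1) (fun P => P x).
Proof.
split=> // P z _ v; rewrite mulrC; exact: (nuclear_value_eval adm).
Qed.

Lemma eval_summing n (x : E) : summing n.+1 (borel n.+1 (fun P => P x)).
Proof.
split; first exact: hpoly_eval_power.
move=> phi wphi; have lx : lorentz s' p' (fun j => phi j x : C) := wphi (dual_eval x).
have [[M xM] _] := lx.
have M0 : 0 <= M := le_trans (rnorm_ge0 _) (xM 0%N).
have dom j : rnorm (phi j x ^+ n.+1 : C) <= M ^+ n * rnorm (phi j x).
  by rewrite rnormX exprSr ler_wpM2r ?rnorm_ge0// lerXn2r ?nnegrE ?rnorm_ge0.
have ly := lorentz_dom p0 (exprn_ge0 n M0) dom lx.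
exact: (lorentz_embedding s0 sp (adm_pq adm) (adm_qr adm) ly).
Qed.

(** The evaluation at a point is a multiple of an element of the polar; hence
    gauge Cauchy sequences converge uniformly on bounded sets. *)
Lemma gauge_eval n P x : nuclear n.+1 P -> rnorm (P x) <= gauge n.+1 P * rnorm x ^+ n.+1.
Proof.
move=> nP; rewrite mulrC.
apply: (summing_functional_gauge (eval_bounded n x) _ (eval_summing n x) nP).
by rewrite exprn_ge0 ?rnorm_ge0.
Qed.

End gauge.

(** * Contraction of nuclear polynomials by functionals *)

Section contraction.
Context {R : realType} (E : normedModType R[i]) (r q s p : R).
Hypothesis adm : admissible_exponents r q s p.
Local Open Scope complex_scope.
Local Notation C := R[i]^o.
Local Notation q' := (conj_exp q).
Local Notation s' := (conj_exp s).
Local Notation p' := (conj_exp p).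
Implicit Types (n m k l : nat) (P : E -> C) (S t : (E -> C) -> C) (Q : dual E -> C).
Let s0 := adm_s0 adm.
Let sp := adm_sp adm.
Let p0 : 0 < p' := lt_le_trans s0 sp.
Let q'0 : 0 < q' := lt_le_trans p0 (adm_pq adm).
Local Notation nuclear := (nuclear r q s p).
Local Notation nuclear_rep := (nuclear_rep r q s p).
Local Notation nuclear_value := (nuclear_value r q s p).
Local Notation summing := (summing r q s p).
Local Notation pairing := (pairing r q s p).
Local Notation gauge := (@bipolar_gauge R E r q s p).
Local Notation bounded_functional := (@bounded_functional R E r q s p).

Let N0 n := @nuclear0 R E r q s p adm n.
Let NP n := fun (a : R[i]) f g => @nuclear_lin R E r q s p adm n f g a.

(** For [P] of degree [l + k], [D x P] is [y |-> P' (x, .., x, y, .., y)] with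
    [l] times [x], where [P'] is the polar form; it is obtained by extracting a
    coefficient of [z |-> P (z *: x + y)], so that it makes sense for every
    function and commutes with pointwise limits. *)
Lemma polar_section_exists k l : exists D : E -> (E -> C) -> (E -> C),
  [/\ forall x (a : R[i]) f g, D x (a *: f + g) = a *: D x f + D x g,
      forall x (phi : dual E), D x (power (l + k) phi) = (phi x ^+ l) *: power k phi &
      forall x (f : nat -> E -> C) g, (forall y, cvgs (f^~ y) (g y)) ->
        forall y, cvgs (fun N => D x (f N) y) (D x g y)].
Proof.
have lN : (l < (l + k).+1)%N by rewrite ltnS leq_addr.
have [c [z [_ _ cz]]] := @coef_extraction R _ _ lN.
pose b : R[i] := 'C(l + k, l)%:R.
have b0 : b != 0 by rewrite pnatr_eq0 -lt0n bin_gt0 leq_addr.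
exists (fun x f y => b^-1 * \sum_i c i * f (z i *: x + y)); split.
- move=> x a f g; apply/funext => y.
  rewrite -[RHS]/(a * (b^-1 * \sum_i c i * f (z i *: x + y)) +
     b^-1 * \sum_i c i * g (z i *: x + y)).
  rewrite mulrCA -mulrDr; congr (_ * _); rewrite mulr_sumr -big_split /=.
  apply: eq_bigr => i _.
  by rewrite -[(a *: f + g) _]/(a * f (z i *: x + y) + g (z i *: x + y)) mulrDr mulrCA.
- move=> x phi; apply/funext => y.
  rewrite -[RHS]/(phi x ^+ l * phi y ^+ k).
  have := cz (((phi x)%:P * 'X + (phi y)%:P) ^+ (l + k)) (size_binomial _ _ _).
  rewrite coef_binomial addKn => h.
  apply: (mulfI b0); rewrite mulrA mulfV// mul1r [RHS]mulr_natl h.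
  apply: eq_bigr => i _; congr (_ * _).
  rewrite /power dualD dualZ horner_exp !hornerE; congr (_ ^+ _).
  by rewrite mulrC.
- move=> x f g fg y; apply: cvgsM; apply: cvgs_sum => i _.
  exact: cvgsM (fg _).
Qed.

(** Composition of a functional in [k] variables with one in [l] variables; on
    the level of Borel transforms this is the product of polynomials. *)
Lemma product_functional k l (A B : R) t S : 0 <= A -> 0 <= B ->
  bounded_functional k.+1 A t -> bounded_functional l.+1 B S ->
  summing l.+1 (borel l.+1 S) ->
  exists S', [/\ bounded_functional (l.+1 + k.+1) (A * B) S',
    summing (l.+1 + k.+1) (borel (l.+1 + k.+1) S') &
    forall phi : dual E, S' (power (l.+1 + k.+1) phi) =
      t (power k.+1 phi) * S (power l.+1 phi)].
Proof.
move=> A0 B0 bt bS sS.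
have [D [Dlin Dpow Dlim]] := polar_section_exists k.+1 l.+1.
have Dsum x (lam y : nat -> C) (phi : nat -> dual E) N :
    D x (\sum_(j < N) (lam j * y j) *: power (l.+1 + k.+1) (phi j)) =
    \sum_(j < N) (lam j * y j) *: (phi j x ^+ l.+1 *: power k.+1 (phi j)).
  have := linear_on_sum (A := setT) (L := D x) I (fun _ _ _ _ _ => I)
    (fun a f g _ _ => Dlin x a f g) (enum 'I_N) (fun j : 'I_N => lam j * y j)
    (fun j => I : setT (power (l.+1 + k.+1) (phi j))).
  rewrite !big_enum /= => -[_ ->]; apply: eq_bigr => j _; by rewrite Dpow.
have Drep P lam phi y : nuclear_rep (l.+1 + k.+1) P lam phi y -> forall x,
    nuclear_rep k.+1 (D x P) lam phi (fun j => y j * phi j x ^+ l.+1).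
  move=> rep x; have [lamL wphi yb Pl] := rep.
  split; [exact: lamL|exact: wphi| |].
    have [[M xM] _] : lorentz s' p' (fun j => phi j x : C) := wphi (dual_eval x).
    have M0 : 0 <= M := le_trans (rnorm_ge0 _) (xM 0%N).
    apply: (bounded_seq_le (c := M ^+ l.+1) _ _ yb); first exact: exprn_ge0.
    move=> j; rewrite rnormM mulrC ler_wpM2r ?rnorm_ge0// rnormX.
    by rewrite lerXn2r ?nnegrE ?rnorm_ge0.
  move=> y'; apply/cvgsP.
  have := Dlim x (fun N => \sum_(j < N) (lam j * y j) *: power (l.+1 + k.+1) (phi j)) P _ y'.
  have Ps z : cvgs (fun N => (\sum_(j < N) (lam j * y j) *: power (l.+1 + k.+1) (phi j)) z) (P z).
    have := proj1 (cvgsP _ _) (Pl z); congr cvgs; apply/funext => N.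
    rewrite fct_sumE; apply: eq_bigr => j _.
    by rewrite -[RHS]/(lam j * y j * phi j z ^+ _) mulrAC.
  move=> /(_ Ps); congr cvgs; apply/funext => N; rewrite Dsum fct_sumE.
  apply: eq_bigr => j _.
  rewrite -[LHS]/(lam j * y j * (phi j x ^+ l.+1 * phi j y' ^+ k.+1)).
  ring.
have dt := bounded_functional_dual adm bt.
have tpow (b : R) (phi : dual E) : 0 <= b -> rnorm phi <= b ->
    rnorm (t (power k.+1 phi)) <= A * b ^+ k.+1.
  move=> b0 pb; rewrite (le_trans (bt.2 _ _ (nuclear_power adm k phi) (power_value adm k phi)))//.
  by rewrite ler_wpM2l// lerXn2r ?nnegrE ?rnorm_ge0.
have trep P lam phi y : nuclear_rep (l.+1 + k.+1) P lam phi y ->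
    nuclear_rep l.+1 (fun x => t (D x P)) lam phi (fun j => y j * t (power k.+1 (phi j))).
  move=> rep; have [lamL wphi yb Pl] := rep.
  split; [exact: lamL|exact: wphi| |].
    have [b b0 wb] := wlorentz_norm_finite s0 sp wphi.
    apply: (bounded_seq_le (c := A * b ^+ k.+1) _ _ yb).
      by rewrite mulr_ge0// exprn_ge0.
    move=> j; rewrite rnormM mulrC ler_wpM2r ?rnorm_ge0// tpow//.
    exact: (wlorentz_norm_le adm _ b0 wphi wb).
  move=> x; apply/cvgsP.
  have := nuclear_dual_series adm (Drep _ _ _ _ rep x) dt.
  by congr cvgs; apply/funext => N; apply: eq_bigr => j _; ring.
have tval P z : nuclear_value (l.+1 + k.+1) P z ->
    nuclear_value l.+1 (fun x => t (D x P)) (A * z).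
  move=> [lam [phi [y [a [b [c [[rep [a0 b0 c0] la wb yc] le]]]]]]].
  have [lamL wphi yb Pl] := rep.
  exists lam, phi, (fun j => y j * t (power k.+1 (phi j))), a, b, (c * (A * b ^+ k.+1)).
  split.
    split; [exact: trep| |exact: la|exact: wb|].
      by split; rewrite ?mulr_ge0 ?exprn_ge0.
    apply: linfty_norm_le => j; rewrite rnormM ler_pM ?rnorm_ge0//.
      by rewrite (le_trans _ yc)// le_linfty_norm.
    rewrite tpow//; exact: (wlorentz_norm_le adm _ b0 wphi wb).
  apply: le_trans (ler_wpM2l A0 le); rewrite exprD le_eqVlt; apply/orP; left.
  by apply/eqP; ring.
have tnuc P : nuclear (l.+1 + k.+1) P -> nuclear l.+1 (fun x => t (D x P)).
  by move=> [_ [lam [phi [y rep]]]]; exact: nuclear_of_rep (trep _ _ _ _ rep).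
have Dnuc x P : nuclear (l.+1 + k.+1) P -> nuclear k.+1 (D x P).
  by move=> [_ [lam [phi [y rep]]]]; exact: nuclear_of_rep (Drep _ _ _ _ rep x).
pose S' P := S (fun x => t (D x P)).
have S'pow (phi : dual E) : S' (power (l.+1 + k.+1) phi) = t (power k.+1 phi) * S (power l.+1 phi).
  rewrite /S' [X in S X](_ : _ = t (power k.+1 phi) *: power l.+1 phi).
    by rewrite (linear_onZ (N0 l) bS.1)//; exact: nuclear_power.
  apply/funext => x; rewrite Dpow (linear_onZ (N0 k) bt.1); last exact: nuclear_power.
  by rewrite -[RHS]/(_ * phi x ^+ l.+1) mulrC.
exists S'; split; [|  |exact: S'pow].
  split.
    move=> a f g nf ng.
    have tlin : (fun x => t (D x (a *: f + g))) =
        a *: (fun x => t (D x f)) + (fun x => t (D x g)).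
      by apply/funext => x; rewrite Dlin (bt.1 _ _ _ (Dnuc x _ nf) (Dnuc x _ ng)).
    by rewrite /S' tlin; exact: (bS.1 _ _ _ (tnuc _ nf) (tnuc _ ng)).
  move=> P z nP v; rewrite [A * B]mulrC -mulrA.
  exact: bS.2 (tnuc _ nP) (tval _ _ v).
have borelE : borel (l.+1 + k.+1) S' = (fun phi => S (power l.+1 phi) * t (power k.+1 phi)).
  by apply/funext => phi; rewrite mulrC -S'pow.
have [hQ lQ] := sS; split.
  rewrite borelE; apply: hpolyM; first exact: hQ.
  apply: (hpoly_borel (N := nuclear k.+1) (A := A)).
  - exact: N0.
  - exact: NP.
  - exact: nuclear_power.
  - exact: bt.1.
  - by move=> phi; apply: tpow; rewrite ?rnorm_ge0.
move=> phi wphi; rewrite borelE.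
have [b b0 wb] := wlorentz_norm_finite s0 sp wphi.
have c0 : 0 <= A * b ^+ k.+1 by rewrite mulr_ge0// exprn_ge0.
apply: (lorentz_dom (y := fun j => borel l.+1 S (phi j)) q'0 c0 _ (lQ _ wphi)).
move=> j; rewrite rnormM mulrC ler_wpM2r ?rnorm_ge0// tpow//.
exact: (wlorentz_norm_le adm _ b0 wphi wb).
Qed.

Definition power_sum n (a : seq (R[i] * dual E)) : E -> C :=
  \sum_(c <- a) c.1 *: power n c.2.

Lemma nuclear_power_sum n a : nuclear n.+1 (power_sum n.+1 a).
Proof.
rewrite /power_sum; elim: a => [|c a IH]; first by rewrite big_nil; exact: N0.
rewrite big_cons; exact: (nuclear_lin adm c.1 (nuclear_power adm n c.2) IH).
Qed.

Lemma functional_power_sum n S a : linear_on (nuclear n.+1) S ->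
  S (power_sum n.+1 a) = \sum_(c <- a) c.1 * S (power n.+1 c.2).
Proof.
move=> lS; have := linear_on_sum (N0 n) (@NP n) lS a (fun c => c.1)
  (fun c : R[i] * dual E => nuclear_power adm n c.2).
by case.
Qed.

(** Pairing the contraction with an element of the polar amounts to evaluating on
    the polynomial itself the functional of [product_functional], whose Borel
    transform is summing since one of its factors is; so this functional is
    bounded by the gauge.  This estimate is what makes convolution operators
    continuous for the norms of the completion. *)
Lemma gauge_contract k l (A : R) t (a : seq (R[i] * dual E)) : 0 <= A ->
  bounded_functional k.+1 A t ->
  gauge l.+1 (power_sum l.+1 [seq (c.1 * t (power k.+1 c.2), c.2) | c <- a]) <=
  A * gauge (l.+1 + k.+1) (power_sum (l.+1 + k.+1) a).
Proof.
move=> A0 bt; apply: (gauge_le adm); first exact: nuclear_power_sum.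
  by rewrite mulr_ge0 ?gauge_ge0.
move=> Q hQ; have [[dS bE]|Q0] := borel_invP r q s p l Q; last first.
  by rewrite /Defs.pairing Q0 rnorm0 mulr_ge0 ?gauge_ge0.
pose S := borel_inv r q s p l.+1 Q.
have bS : bounded_functional l.+1 1 S.
  split; first exact: dS.1.
  by move=> P z nP v; rewrite mul1r; exact: (polar_pairing adm hQ nP v).
have sS : summing l.+1 (borel l.+1 S) by rewrite bE; exact: hQ.1.
have [S' [bS' sS' S'pow]] := product_functional A0 ler01 bt bS sS.
rewrite -[Defs.pairing _ _ _ _ _ _ _]/(S _).
rewrite functional_power_sum ?big_map; last exact: dS.1.
have -> : \sum_(c <- a) (c.1 * t (power k.+1 c.2), c.2).1 *
      S (power l.+1 (c.1 * t (power k.+1 c.2), c.2).2) =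
    S' (power_sum (l.+1 + k.+1) a).
  rewrite (functional_power_sum (n := l + k.+1)); last exact: bS'.1.
  by apply: eq_bigr => c _; rewrite /= S'pow mulrA.
rewrite -[A]mulr1.
apply: (summing_functional_gauge (n := l + k.+1) adm bS' _ sS').
  by rewrite mulr1.
exact: (nuclear_power_sum (l + k.+1)).
Qed.

End contraction.

(** * Taylor expansions *)

Section taylor.
Context {R : realType} {E : normedModType R[i]}.
Local Open Scope complex_scope.
Local Notation C := R[i]^o.

(** Cauchy's estimate for the difference of the two expansions, restricted to a
    complex line. *)
Lemma taylor_expansion_unique (f : E -> C) a c c' :
  taylor_expansion f a c -> taylor_expansion f a c' -> c = c'.
Proof.
move=> [hc [rho rho0 hr]] [hc' [rho' rho'0 hr']].
apply/funext => m; apply/funext => h; apply/eqP; rewrite -subr_eq0; apply/eqP/rnorm0_eq0.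
apply/le_anti; rewrite rnorm_ge0 andbT.
have h1 : 0 < rnorm h + 1 by rewrite ltr_wpDl ?rnorm_ge0.
pose r := Num.min rho rho' / (rnorm h + 1).
have mr : 0 < Num.min rho rho' by rewrite lt_min rho0.
have r0 : 0 < r by rewrite divr_gt0.
have zr (z : C) : rnorm z = r -> rnorm (z *: h) < Num.min rho rho'.
  move=> zE; rewrite rnormZc zE /r mulrAC ltr_pdivrMr// ltr_pM2l//.
  by rewrite ltrDl.
apply/ler_addgt0Pr => e e0; rewrite add0r.
have rm : 0 < r ^+ m by rewrite exprn_gt0.
have e2 : 0 < e * r ^+ m / 2 by rewrite divr_gt0// mulr_gt0.
have [N _ hN] := hr _ e2; have [N' _ hN'] := hr' _ e2.
pose K := maxn (maxn N N') m.+1.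
have NK : (N <= K)%N by rewrite !leq_max leqnn.
have N'K : (N' <= K)%N by rewrite !leq_max leqnn orbT.
pose d k := c k h - c' k h.
pose P : {poly R[i]} := \poly_(k < K) d k.
have Pm : P`_m = d m by rewrite coef_poly leq_max leqnn orbT.
suff : rnorm (d m : C) * r ^+ m <= e * r ^+ m by rewrite ler_pM2r.
rewrite -Pm; apply: (cauchy_estimate _ (ltW r0)) => z zE.
 have lt := zr _ zE; rewrite lt_min in lt; have /andP[lt1 lt2] := lt.
have PE : P.[z] = (f (a + z *: h) - \sum_(k < K) c' k (a + z *: h - a)) -
    (f (a + z *: h) - \sum_(k < K) c k (a + z *: h - a)).
  rewrite opprB addrC addrA subrK [a + _]addrC addrK -sumrB horner_poly.
  apply: eq_bigr => k _; rewrite (hpoly_scale _ _ (hc k)) (hpoly_scale _ _ (hc' k)).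
  by rewrite /d mulrC mulrBr.
rewrite PE (le_trans (rnormB _ _))// [leRHS]splitr lerD// ltW//.
  by apply: (hN' K N'K); rewrite addrAC subrr add0r.
by apply: (hN K NK); rewrite addrAC subrr add0r.
Qed.

Lemma taylor_termE (f : E -> C) a c : taylor_expansion f a c -> taylor_term f a = c.
Proof.
move=> h; rewrite /taylor_term; case: xgetP => [c' _ h'|/(_ c)//].
exact: taylor_expansion_unique h' h.
Qed.

Lemma dhatE (f : E -> C) a c m : taylor_expansion f a c -> dhat m f a = m`!%:R *: c m.
Proof. by move=> h; rewrite /dhat (taylor_termE h). Qed.

Lemma hpoly0_const (P : E -> C) x : hpoly 0 P -> P x = P 0.
Proof.
by move=> [_ [A _ PA]]; rewrite !PA; congr (A _); apply/funext => -[].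
Qed.

End taylor.

(** * Quasi-nuclear polynomials as limits of finite sums of powers *)

Section quasi_nuclear_limits.
Context {R : realType} (E : normedModType R[i]) (r q s p : R).
Hypothesis adm : admissible_exponents r q s p.
Local Open Scope complex_scope.
Local Notation C := R[i]^o.
Implicit Types (n m k l : nat) (P : E -> C) (a b : seq (R[i] * dual E)).
Local Notation gauge := (@bipolar_gauge R E r q s p).

(** The norm of a homogeneous polynomial in the completion; in degree 0 it is
    the modulus of the constant. *)
Definition ngauge n (F : E -> C) : R := if n is 0%N then rnorm (F 0) else gauge n F.

Lemma power_sum_cat n a b : power_sum n (a ++ b) = power_sum n a + power_sum n b.
Proof. by rewrite /power_sum big_cat. Qed.

Lemma power_sum_scale n (z : R[i]) a :
  power_sum n [seq (z * c.1, c.2) | c <- a] = z *: power_sum n a.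
Proof.
rewrite /power_sum big_map scaler_sumr; apply: eq_bigr => c _.
by rewrite scalerA.
Qed.

Lemma power_sumE n a x : power_sum n a x = \sum_(c <- a) c.1 * c.2 x ^+ n.
Proof. by rewrite /power_sum fct_sumE. Qed.

Lemma power_sum_lin n (z : R[i]) a b : exists c, power_sum n c = z *: power_sum n a + power_sum n b.
Proof.
by exists ([seq (z * c.1, c.2) | c <- a] ++ b); rewrite power_sum_cat power_sum_scale.
Qed.

Lemma power_sumB n a b : exists c, power_sum n c = power_sum n a - power_sum n b.
Proof.
by have [c cE] := power_sum_lin n (-1) b a; exists c; rewrite cE scaleN1r addrC.
Qed.

Lemma ngauge_ge0 n F : 0 <= ngauge n F.
Proof. by case: n => [|n]; [exact: rnorm_ge0|exact: gauge_ge0]. Qed.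

Lemma ngauge_lin n (z : R[i]) a b :
  ngauge n (z *: power_sum n a + power_sum n b) <=
  rnorm (z : C) * ngauge n (power_sum n a) + ngauge n (power_sum n b).
Proof.
case: n => [|n] /=; last by apply: (gauge_lin adm); exact: nuclear_power_sum.
by rewrite (le_trans (rnormD _ _))// rnormZc.
Qed.

Lemma ngauge_eval n a x : rnorm (power_sum n a x) <= ngauge n (power_sum n a) * rnorm x ^+ n.
Proof.
case: n => [|n] /=; last by apply: (gauge_eval adm); exact: nuclear_power_sum.
rewrite mulr1 le_eqVlt; apply/orP; left; apply/eqP; congr rnorm.
by rewrite !power_sumE; apply: eq_bigr => c _; rewrite !expr0.
Qed.

Lemma ngauge0 n : ngauge n (0 : E -> C) = 0.
Proof.
apply/le_anti; rewrite ngauge_ge0 andbT.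
case: n => [|n] /=; first by rewrite rnorm0.
apply: (gauge_value adm).
have := @nuclear_valueZ R E r q s p n.+1 _ (0 : R[i]) _ (power_value adm n 0).
by rewrite scale0r (@rnorm0 R C) mul0r.
Qed.

Lemma ngauge_power n (phi : dual E) : ngauge n (power n phi) <= rnorm phi ^+ n.
Proof.
case: n => [|n] /=; last exact: (gauge_power adm).
by rewrite /power !expr0 rnorm1.
Qed.

(** Polarization passes to the limit, so that a bounded pointwise limit of
    finite sums of powers is a continuous homogeneous polynomial. *)
Lemma power_sum_limit_hpoly n (a : nat -> seq (R[i] * dual E)) P (c : R) :
  (forall x, cvgs (fun k => power_sum n (a k) x) (P x)) ->
  (forall k, ngauge n (power_sum n (a k)) <= c) -> hpoly n P.
Proof.
move=> aP ac.
have c0 : 0 <= c := le_trans (ngauge_ge0 _ _) (ac 0%N).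
have Pc x : rnorm (P x) <= c * rnorm x ^+ n.
  apply: (cvgs_le (N := 0%N) (aP x)) => k _; apply: le_trans (ngauge_eval _ _ _) _.
  by rewrite ler_wpM2r ?exprn_ge0 ?rnorm_ge0.
pose pol (F : E -> C) (x : 'I_n -> E) : C := (n`!%:R)^-1 *
  \sum_(S : {set 'I_n}) (-1) ^+ (n - #|S|) * F (\sum_(i in S) x i).
have nf : n`!%:R != 0 :> R[i] by rewrite pnatr_eq0 -lt0n fact_gt0.
have dualsum (phi : dual E) (S : {set 'I_n}) (x : 'I_n -> E) :
    phi (\sum_(i in S) x i) = \sum_(i in S) phi (x i).
  elim/big_rec2 : _ => [|i y z _ <-]; first exact: dual_fun0.
  by rewrite dualD.
have polE k x : pol (power_sum n (a k)) x = \sum_(c <- a k) c.1 * \prod_i c.2 (x i).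
  apply: (mulfI nf); rewrite mulrA mulfV// mul1r mulr_sumr.
  under eq_bigr do rewrite power_sumE mulr_sumr.
  rewrite exchange_big /=; apply: eq_bigr => d _.
  rewrite mulrCA -(polarization (fun i => d.2 (x i))) mulr_sumr.
  by apply: eq_bigr => S _; rewrite dualsum mulrCA.
have pol_lim x : cvgs (fun k => pol (power_sum n (a k)) x) (pol P x).
  by apply: cvgsM; apply: cvgs_sum => S _; apply: cvgsM.
have mpol : multilinear (pol P).
  move=> i x z u v; apply: (cvgs_uniq (pol_lim _)).
  have := cvgsD (cvgsM z (pol_lim (fun j => if j == i then u else x j)))
    (pol_lim (fun j => if j == i then v else x j)).
  congr cvgs; apply/funext => k; rewrite !polE mulr_sumr -big_split /=.
  apply: eq_bigr => d _.
  have rest w : \prod_j d.2 (if j == i then w else x j) = d.2 w * \prod_(j | j != i) d.2 (x j).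
    by rewrite (bigD1 i)//= eqxx; congr (_ * _); apply: eq_bigr => j /negbTE ->.
  by rewrite !rest dualD dualZ -[z *: d.2 u]/(z * d.2 u); ring.
have -> : P = (fun x => pol P (fun=> x)).
  apply/funext => x; apply: (cvgs_uniq (aP x)); have := pol_lim (fun=> x).
  congr cvgs; apply/funext => k; rewrite polE power_sumE.
  by apply: eq_bigr => d _; rewrite prodr_const card_ord.
pose K := rnorm ((n`!%:R)^-1 : C) * \sum_(S : {set 'I_n}) (c * n%:R ^+ n).
apply: (hpoly_multilinear mpol (K := K)); apply: multilinear_unit_bound => // x x1.
rewrite /pol rnormM /K ler_wpM2l ?rnorm_ge0// (le_trans (rnorm_sum _ _ _))//.
apply: ler_sum => S _; rewrite rnormM rnormX rnormN rnorm1 expr1n mul1r.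
rewrite (le_trans (Pc _))// ler_wpM2l// lerXn2r ?nnegrE ?rnorm_ge0//.
rewrite (le_trans (rnorm_sum _ _ _))//.
apply: (@le_trans _ _ (\sum_(i in S) 1)); first exact: ler_sum.
by rewrite sumr_const ler_nat -[leqRHS](card_ord n) max_card.
Qed.

Definition ngauge_cauchy n (a : nat -> seq (R[i] * dual E)) : Prop :=
  forall e : R, 0 < e -> exists N, forall k l, (N <= k)%N -> (N <= l)%N ->
    ngauge n (power_sum n (a k) - power_sum n (a l)) < e.

(** Quasi-nuclear polynomials are handled as pointwise limits of Cauchy sequences
    of finite sums of powers; this lemma and [quasi_nuclear_elim] translate to and
    from the completion. *)
Lemma quasi_nuclear_intro n (a : nat -> seq (R[i] * dual E)) P (c : R) :
  (forall x, cvgs (fun k => power_sum n (a k) x) (P x)) -> ngauge_cauchy n a ->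
  (forall k, ngauge n (power_sum n (a k)) <= c) ->
  quasi_nuclear r q s p n P /\ quasi_nuclear_norm r q s p n P <= c.
Proof.
move=> aP ca ac; have hP := power_sum_limit_hpoly aP ac.
case: n aP ca ac hP => [|n] aP ca ac hP.
  split=> //=; apply: (cvgs_le (N := 0%N) (aP 0)) => k _; exact: ac.
have nuc k := nuclear_power_sum adm n (a k).
have crep : completion_rep r q s p n.+1 (fun k => power_sum n.+1 (a k)) P.
  split; [exact: nuc|exact: ca|].
  apply/cvgrPdist_le => e e0; have [N hN] := ca _ e0; exists N => // k /= Nk.
  rewrite sub0r normrN ger0_norm; last first.
    apply: le_trans (rnorm_ge0 ((power_sum n.+1 (a k) - P) 0)) _.
    apply: ub_le_sup; last by exists 0 => //=; rewrite rnorm0.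
    have [M M0 hM] := hpoly_bounded (hpolyB (nuc k).1 hP).
    exists M => _ [x x1 <-]; rewrite (le_trans (hM x))// -[leRHS]mulr1 ler_wpM2l//.
    by rewrite exprn_ile1// rnorm_ge0.
  apply: supnorm_le => x x1; rewrite -[(_ - P) x]/(power_sum n.+1 (a k) x - P x) rnormBC.
  apply: (cvgs_dist_le (N := N) (aP x)) => l Nl.
  rewrite rnormBC -[_ - _]/((power_sum n.+1 (a k) - power_sum n.+1 (a l)) x).
  have [d dE] := power_sumB n.+1 (a k) (a l).
  rewrite -dE; apply: (le_trans (ngauge_eval _ _ _)); rewrite dE.
  rewrite -[leRHS]mulr1 ler_pM ?ngauge_ge0 ?exprn_ge0 ?rnorm_ge0//; first exact/ltW/hN.
  by rewrite exprn_ile1// rnorm_ge0.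
split; first by split=> //; exists (fun k => power_sum n.+1 (a k)).
have [l gl] : exists l : R, (fun k => gauge n.+1 (power_sum n.+1 (a k))) @ \oo --> l.
  exists (lim ((fun k => gauge n.+1 (power_sum n.+1 (a k))) @ \oo)).
  apply: cauchy_cvg; apply/cauchy_ballP => e e0.
  have [N hN] := ca _ e0.
  pose A := [set gauge n.+1 (power_sum n.+1 (a k)) | k in [set k | (N <= k)%N]].
  exists (A, A); first by split; exists N => // k /= Nk; exists k.
  have gB k l : gauge n.+1 (power_sum n.+1 (a k)) <=
      gauge n.+1 (power_sum n.+1 (a l)) + gauge n.+1 (power_sum n.+1 (a k) - power_sum n.+1 (a l)).
    have [d dE] := power_sumB n.+1 (a k) (a l).
    have := @gauge_lin R E r q s p adm n 1 _ _ (nuc l) (nuclear_power_sum adm n d).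
    by rewrite dE scale1r rnorm1 mul1r addrC subrK.
  move=> [x y] /= [[k Nk <-] [m Nm <-]]; rewrite /ball /= ltr_norml.
  have := gB k m; have := gB m k; have := hN _ _ Nk Nm; have := hN _ _ Nm Nk.
  rewrite /= => h1 h2 h3 h4; apply/andP; split; lra.
have lc : l <= c.
  rewrite -(cvg_lim _ gl)//; apply: limr_le; first by apply/cvg_ex; exists l.
  by apply: nearW => k; exact: ac.
apply: le_trans lc; apply: ge_inf; last by exists (fun k => power_sum n.+1 (a k)).
exists 0 => l' [Ps _ h]; rewrite -(cvg_lim _ h)//; apply: limr_ge.
  by apply/cvg_ex; exists l'.
by apply: nearW => k; exact: gauge_ge0.
Qed.

Lemma quasi_nuclear_norm_ge0 n P : 0 <= quasi_nuclear_norm r q s p n P.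
Proof.
case: n => [|n]; first exact: rnorm_ge0.
apply: inf_ge0 => l' [Ps _ h]; rewrite -(cvg_lim _ h)//; apply: limr_ge.
  by apply/cvg_ex; exists l'.
by apply: nearW => k; exact: gauge_ge0.
Qed.

End quasi_nuclear_limits.

Section quasi_nuclear_elimination.
Context {R : realType} (E : normedModType R[i]) (r q s p : R).
Hypothesis adm : admissible_exponents r q s p.
Local Open Scope complex_scope.
Local Notation C := R[i]^o.
Implicit Types (n m k l : nat) (P : E -> C) (a b : seq (R[i] * dual E)).
Local Notation nuclear := (nuclear r q s p).
Local Notation gauge := (@bipolar_gauge R E r q s p).
Local Notation ngauge := (@ngauge R E r q s p).
Let r0 := adm_r0 adm.
Let rq := adm_rq adm.

(** Order continuity of the Lorentz norm: the tails of a representation are small. *)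
Lemma nuclear_approx n P (e : R) : nuclear n.+1 P -> 0 < e ->
  exists a, gauge n.+1 (power_sum n.+1 a - P) <= e.
Proof.
move=> [_ [lam [phi [y rep]]]] e0.
have [a [b [c [br _ _ _]]]] := nuclear_rep_bounded adm rep.
have [[lamL wphi yb Pl] [a0 b0 c0] la wb yc] := br.
pose K := b ^+ n.+1 * c + 1; have K0 : 0 < K by rewrite ltr_wpDl// mulr_ge0// exprn_ge0.
have [N hN] := lorentz_tail r0 rq lamL (divr_gt0 e0 K0).
exists [seq (lam j * y j, phi j) | j <- iota 0 N].
have -> : power_sum n.+1 [seq (lam j * y j, phi j) | j <- iota 0 N] =
    \sum_(j < N) (lam j * y j) *: power n.+1 (phi j).
  rewrite /power_sum big_map -(big_mkord xpredT (fun j => (lam j * y j) *: power n.+1 (phi j))).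
  by rewrite /index_iota subn0.
have v := partial_sum_tail adm br (ltW (divr_gt0 e0 K0)) (hN N (leqnn N)).
apply: le_trans (gauge_value adm v) _.
by rewrite -mulrA mulrAC ler_pdivrMr// ler_wpM2l ?(ltW e0)// lerDl.
Qed.

Lemma gauge_triangle n P Q S : nuclear n.+1 P -> nuclear n.+1 Q -> nuclear n.+1 S ->
  gauge n.+1 (P - S) <= gauge n.+1 (P - Q) + gauge n.+1 (Q - S).
Proof.
move=> nP nQ nS; have cl := closedB (fun (a : R[i]) f g => @nuclear_lin R E r q s p adm n f g a).
have := gauge_lin adm 1 (cl _ _ nP nQ) (cl _ _ nQ nS).
by rewrite scale1r rnorm1 mul1r addrA subrK.
Qed.

Lemma gauge_sym n P Q : nuclear n.+1 P -> nuclear n.+1 Q ->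
  gauge n.+1 (P - Q) = gauge n.+1 (Q - P).
Proof.
have cl := closedB (fun (a : R[i]) f g => @nuclear_lin R E r q s p adm n f g a).
have half f g : nuclear n.+1 f -> nuclear n.+1 g -> gauge n.+1 (f - g) <= gauge n.+1 (g - f).
  move=> nf ng; have := gauge_lin adm (-1) (cl _ _ ng nf) (nuclear0 E adm n).
  rewrite addr0 scaleN1r opprB (@rnormN R C) rnorm1 mul1r => /le_trans; apply.
  by have := @ngauge0 R E r q s p adm n.+1 => /= ->; rewrite addr0.
by move=> nP nQ; apply/le_anti; rewrite !half.
Qed.

Lemma quasi_nuclear_elim n P (d : R) (eps : nat -> R) :
  quasi_nuclear r q s p n P -> quasi_nuclear_norm r q s p n P < d ->
  (forall k, 0 < eps k) -> (forall k l, (k <= l)%N -> eps l <= eps k) ->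
  (forall e : R, 0 < e -> exists k, eps k <= e) ->
  exists a : nat -> seq (R[i] * dual E),
    [/\ forall k, ngauge n (power_sum n (a k)) <= d,
        forall k l, (k <= l)%N -> ngauge n (power_sum n (a k) - power_sum n (a l)) <= eps k &
        forall x, cvgs (fun k => power_sum n (a k) x) (P x)].
Proof.
case: n => [|n] qP Pd eps0 epsle epscv.
  have cst : power_sum 0 [:: (P 0, 0)] = P.
    apply/funext => x; rewrite power_sumE big_seq1 /= expr0 mulr1.
    by rewrite [RHS](hpoly0_const x qP).
  exists (fun=> [:: (P 0, 0)]); rewrite cst; split=> [k|k l _|x].
  - exact: ltW.
  - by rewrite subrr ngauge0// ltW.
  - exact: cvgs_cst.
have [hP _] := qP.
have [l0 [Ps [nuc ca cs] gl] ld] : exists2 l0 : R, exists2 Ps, completion_rep r q s p n.+1 Ps P &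
    (fun k => gauge n.+1 (Ps k)) @ \oo --> l0 & l0 < d.
  move: Pd => /inf_lt[|l0]; last by exists l0.
  have [_ [Ps crep]] := qP; have [nuc ca _] := crep.
  exists (lim ((fun k => gauge n.+1 (Ps k)) @ \oo)), Ps => //.
  apply: cauchy_cvg; apply/cauchy_ballP => e e0.
  have [N hN] := ca _ e0.
  pose A := [set gauge n.+1 (Ps k) | k in [set k | (N <= k)%N]].
  exists (A, A); first by split; exists N => // k /= Nk; exists k.
  have gB k l : gauge n.+1 (Ps k) <= gauge n.+1 (Ps l) + gauge n.+1 (Ps k - Ps l).
    have := gauge_triangle (nuc k) (nuc l) (nuclear0 E adm n).
    by rewrite !subr0 addrC.
  move=> [x y] /= [[k Nk <-] [m Nm <-]]; rewrite /ball /= ltr_norml.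
  have := gB k m; have := gB m k; have := hN _ _ Nk Nm; have := hN _ _ Nm Nk.
  rewrite /= => h1 h2 h3 h4; apply/andP; split; lra.
pose g := (d - l0) / 2; have g0 : 0 < g by rewrite divr_gt0// subr_gt0.
have [K0 _ hK0] := (iffLR (cvgrPdist_lt _ _) gl) _ g0.
have /choice[th hth] : forall k, exists N, forall i j, (N <= i)%N -> (N <= j)%N ->
    gauge n.+1 (Ps i - Ps j) < eps k / 3%:R.
  by move=> k; apply: ca; rewrite divr_gt0.
pose N k := (K0 + \max_(j < k.+1) th j + k)%N.
have NK k : (K0 <= N k)%N by rewrite /N -addnA leq_addr.
have Nk k : (k <= N k)%N by rewrite leq_addl.
have Nth k l : (k <= l)%N -> (th k <= N l)%N.
  move=> kl; rewrite /N addnAC; apply: (@leq_trans (\max_(j < l.+1) th j)).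
    exact: (leq_bigmax (F := fun j : 'I_l.+1 => th j) (Ordinal (kl : (k < l.+1)%N))).
  by rewrite leq_addl.
pose e k := Num.min (eps k / 3%:R) g.
have e0 k : 0 < e k by rewrite lt_min g0 divr_gt0.
have /choice[a ha] : forall k, exists a, gauge n.+1 (power_sum n.+1 a - Ps (N k)) <= e k.
  by move=> k; exact: nuclear_approx.
have nuca k := nuclear_power_sum adm n (a k).
exists a; split=> [k|k l kl|x].
- have := gauge_triangle (nuca k) (nuc (N k)) (nuclear0 E adm n); rewrite !subr0.
  have := ha k; rewrite /e le_min => /andP[_ h1].
  have := hK0 (N k) (NK k); rewrite /= ltr_norml => /andP[h2 _] h3.
  by rewrite /=; move: h1 h2 h3; rewrite /g; lra.
- have t1 := gauge_triangle (nuca k) (nuc (N k)) (nuca l).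
  have t2 := gauge_triangle (nuc (N k)) (nuc (N l)) (nuca l).
  have h1 : gauge n.+1 (power_sum n.+1 (a k) - Ps (N k)) <= eps k / 3%:R.
    by rewrite (le_trans (ha k))// ge_min lexx.
  have h2 : gauge n.+1 (Ps (N l) - power_sum n.+1 (a l)) <= eps k / 3%:R.
    rewrite gauge_sym// (le_trans (ha l))// ge_min ler_wpM2r ?epsle ?invr_ge0//.
  have h3 := hth k _ _ (Nth k k (leqnn k)) (Nth k l kl).
  by rewrite /=; move: t1 t2 h1 h2 h3; lra.
- move=> e' e'0; have x1 : 0 < rnorm x ^+ n.+1 + 1 by rewrite ltr_wpDl ?exprn_ge0 ?rnorm_ge0.
  pose d' := e' / 2 / (rnorm x ^+ n.+1 + 1); have d'0 : 0 < d' by rewrite !divr_gt0.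
  have [k0 hk0] := epscv _ d'0.
  have [M _ hM] := (iffLR (cvgrPdist_lt _ _) cs) _ d'0.
  exists (maxn k0 M) => k; rewrite geq_max => /andP[k0k Mk].
  apply: le_lt_trans (rnorm_triangle _ (Ps (N k) x) _) _; rewrite (splitr e').
  have small (z : R) : z <= d' -> z * rnorm x ^+ n.+1 < e' / 2.
    move=> zd; apply: (@le_lt_trans _ _ (d' * rnorm x ^+ n.+1)).
      by rewrite ler_wpM2r ?exprn_ge0 ?rnorm_ge0.
    by rewrite /d' mulrAC ltr_pdivrMr// ltr_pM2l ?divr_gt0// ltrDl.
  have cl := closedB (fun (a : R[i]) f g => @nuclear_lin R E r q s p adm n f g a).
  apply: ltrD.
    apply: le_lt_trans (gauge_eval adm x (cl _ _ (nuca k) (nuc (N k)))) (small _ _).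
    apply: le_trans (ha k) _; rewrite ge_min; apply/orP; left.
    rewrite (le_trans _ hk0)// ler_pdivrMr//.
    by rewrite (le_trans (epsle _ _ k0k))// ler_peMr ?(ltW (eps0 _))// ler1n.
  apply: le_lt_trans (le_supnorm x (hpolyB (nuc (N k)).1 hP)) (small _ _).
  have := hM (N k) (leq_trans Mk (Nk k)); rewrite /= sub0r normrN => h.
  exact: le_trans (ler_norm _) (ltW h).
Qed.

End quasi_nuclear_elimination.

(** * Formal polynomials of finite type *)

Section formal_polynomials.
Context {R : realType} (E : normedModType R[i]) (r q s p : R).
Hypothesis adm : admissible_exponents r q s p.
Local Open Scope complex_scope.
Local Notation C := R[i]^o.
Local Notation nuclear := (nuclear r q s p).
Local Notation gauge := (@bipolar_gauge R E r q s p).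
Local Notation ngauge := (@ngauge R E r q s p).

(** The entry [(m, (c, phi))] stands for the monomial [c *: phi ^ m].  These are
    expressions, and not functions, because contraction is defined on monomials. *)
Definition formal := seq (nat * (R[i] * dual E)).
Implicit Types (a b : formal) (m n k j : nat) (rho sigma c d e : R) (x : E).

Definition ev a : E -> C := fun x => \sum_(t <- a) t.2.1 * t.2.2 x ^+ t.1.

Definition deg m a : seq (R[i] * dual E) := [seq t.2 | t <- a & t.1 == m].

Definition hpart m a : E -> C := power_sum m (deg m a).

Definition fscale (z : R[i]) a : formal := [seq (t.1, (z * t.2.1, t.2.2)) | t <- a].

Definition fsub a b : formal := a ++ fscale (-1) b.

Definition mag m a : R := ngauge m (hpart m a).

Definition bnd rho c a : Prop := forall m, rho ^+ m * mag m a <= c.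

Lemma ev_cat a b x : ev (a ++ b) x = ev a x + ev b x.
Proof. by rewrite /ev big_cat. Qed.

Lemma ev_scale z a x : ev (fscale z a) x = z * ev a x.
Proof.
by rewrite /ev big_map mulr_sumr; apply: eq_bigr => t _; rewrite mulrA.
Qed.

Lemma ev_sub a b x : ev (fsub a b) x = ev a x - ev b x.
Proof. by rewrite ev_cat ev_scale mulN1r. Qed.

Lemma hpart_cat m a b : hpart m (a ++ b) = hpart m a + hpart m b.
Proof. by rewrite /hpart /deg filter_cat map_cat power_sum_cat. Qed.

Lemma deg_scale m z a : deg m (fscale z a) = [seq (z * v.1, v.2) | v <- deg m a].
Proof. by rewrite /deg /fscale filter_map -!map_comp. Qed.

Lemma hpart_scale m z a : hpart m (fscale z a) = z *: hpart m a.
Proof. by rewrite /hpart deg_scale power_sum_scale. Qed.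

Lemma hpart_sub m a b : hpart m (fsub a b) = hpart m a - hpart m b.
Proof. by rewrite hpart_cat hpart_scale scaleN1r. Qed.

Lemma mag_ge0 m a : 0 <= mag m a.
Proof. exact: ngauge_ge0. Qed.

Lemma mag_nil m : mag m [::] = 0.
Proof. by rewrite /mag /hpart /deg /power_sum /= big_nil ngauge0. Qed.

Lemma mag_cat m a b : mag m (a ++ b) <= mag m a + mag m b.
Proof.
rewrite /mag hpart_cat; have := ngauge_lin adm m 1 (deg m a) (deg m b).
by rewrite scale1r rnorm1 mul1r.
Qed.

Lemma mag_scale m z a : mag m (fscale z a) <= rnorm (z : C) * mag m a.
Proof.
rewrite /mag hpart_scale; have := ngauge_lin adm m z (deg m a) [::].
by rewrite {2 4}/power_sum big_nil addr0 (ngauge0 E adm) addr0.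
Qed.

Lemma mag_sub m a b : mag m (fsub a b) <= mag m a + mag m b.
Proof.
apply: le_trans (mag_cat _ _ _) _; rewrite lerD2l.
by apply: le_trans (mag_scale _ _ _) _; rewrite (@rnormN R C) rnorm1 mul1r.
Qed.

Lemma hpart_le m a x : rnorm (hpart m a x) <= mag m a * rnorm x ^+ m.
Proof. exact: ngauge_eval. Qed.

Lemma ev_hpart a M x : (forall t, t \in a -> (t.1 < M)%N) ->
  ev a x = \sum_(m < M) hpart m a x.
Proof.
elim: a => [|t a IH] h.
  rewrite /ev big_nil big1// => m _.
  by rewrite /hpart /deg /power_sum /= big_nil.
rewrite -cat1s ev_cat IH; last by move=> u ua; apply: h; rewrite inE ua orbT.
rewrite [RHS](eq_bigr (fun m : 'I_M => hpart m [:: t] x + hpart m a x)); last first.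
  by move=> m _; exact: (congr1 (@^~ x) (hpart_cat m [:: t] a)).
rewrite big_split /=; congr (_ + _).
have tM := h t (mem_head _ _); rewrite (bigD1 (Ordinal tM))//= big1 ?addr0.
  by rewrite /hpart /deg /= eqxx power_sumE !big_seq1 /ev big_seq1.
move=> m mt; rewrite /hpart /deg /= (_ : (t.1 == m) = false) /=.
  by rewrite /power_sum big_nil.
by apply/negbTE; apply: contra mt => /eqP tm; apply/eqP/val_inj.
Qed.

Lemma formal_degree a : exists M, forall N, (M <= N)%N -> forall t, t \in a -> (t.1 < N)%N.
Proof.
exists (\max_(t <- a) t.1.+1) => N MN t ta; apply: leq_trans MN.
exact: (leq_bigmax_seq (F := fun t => t.1.+1) t ta isT).
Qed.

Lemma mag_eq0 a M m : (forall t, t \in a -> (t.1 < M)%N) -> (M <= m)%N -> mag m a = 0.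
Proof.
move=> h Mm; rewrite /mag /hpart /deg (_ : [seq t <- a | t.1 == m] = [::]).
  by rewrite /= /power_sum big_nil ngauge0.
apply/eqP; rewrite -(negbK (_ == _)) -has_filter; apply/hasPn => t /h tM.
by rewrite ltn_eqF// (leq_trans tM).
Qed.

Lemma geometric_tail N M : (N <= M)%N -> \sum_(N <= m < M) 2^-1 ^+ m <= 2 * 2^-1 ^+ N :> R.
Proof.
move=> NM; suff -> : \sum_(N <= m < M) 2^-1 ^+ m = 2 * 2^-1 ^+ N - 2 * 2^-1 ^+ M :> R.
  by rewrite lerBlDr lerDl mulr_ge0// exprn_ge0// invr_ge0.
rewrite -(subnKC NM); elim: (M - N)%N => [|k IH].
  by rewrite addn0 big_geq// subrr.
by rewrite addnS big_nat_recr ?leq_addr//= IH exprS; field.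
Qed.

(** Terms bounded at the radius [2 * rho] are dominated by a geometric series at
    the radius [rho]. *)
Lemma bnd_tail a rho c x N : 0 <= rho -> bnd (2 * rho) c a -> rnorm x <= rho ->
  rnorm (ev a x - \sum_(m < N) hpart m a x) <= 2 * 2^-1 ^+ N * c.
Proof.
move=> rho0 ac xr.
have [M hM] := formal_degree a; pose K := maxn N M.
have NK : (N <= K)%N by rewrite leq_maxl.
rewrite (ev_hpart x (hM K (leq_maxr _ _))) -!(big_mkord xpredT (fun m => hpart m a x)).
rewrite (big_cat_nat (n := N) (p := K))//= addrAC subrr add0r.
apply: (le_trans (rnorm_sum _ _ _)).
have c0 : 0 <= c by have := ac 0%N; rewrite expr0 mul1r; apply: le_trans; exact: mag_ge0.
apply: (@le_trans _ _ (\sum_(N <= m < K) 2^-1 ^+ m * c)); last first.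
  by rewrite -mulr_suml ler_wpM2r// geometric_tail.
apply: ler_sum => m _; apply: le_trans (hpart_le _ _ _) _.
apply: (@le_trans _ _ (mag m a * rho ^+ m)).
  by rewrite ler_wpM2l ?mag_ge0// lerXn2r ?nnegrE ?rnorm_ge0.
have := ac m; rewrite exprMn => h.
have := ler_wpM2l (_ : 0 <= 2^-1 ^+ m :> R) h; rewrite exprn_ge0 ?invr_ge0// => /(_ isT).
by rewrite !mulrA -exprMn mulVf// expr1n mul1r mulrC.
Qed.

Lemma bnd_ge0 rho c a : bnd rho c a -> 0 <= c.
Proof.
by move=> /(_ 0%N); rewrite expr0 mul1r; apply: le_trans; exact: mag_ge0.
Qed.

Lemma bnd_le rho rho' c c' a : 0 <= rho' -> rho' <= rho -> c <= c' -> bnd rho c a -> bnd rho' c' a.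
Proof.
move=> r0 rr cc h m; apply: le_trans cc; apply: le_trans (h m).
by rewrite ler_wpM2r ?mag_ge0// lerXn2r ?nnegrE// (le_trans r0).
Qed.

Lemma bnd_cat rho c d a b : 0 <= rho -> bnd rho c a -> bnd rho d b -> bnd rho (c + d) (a ++ b).
Proof.
move=> r0 ha hb m; apply: le_trans (ler_wpM2l (exprn_ge0 _ r0) (mag_cat _ _ _)) _.
by rewrite mulrDr lerD.
Qed.

Lemma bnd_scale rho c z a : 0 <= rho -> bnd rho c a -> bnd rho (rnorm (z : C) * c) (fscale z a).
Proof.
move=> r0 ha m; apply: le_trans (ler_wpM2l (exprn_ge0 _ r0) (mag_scale _ _ _)) _.
by rewrite mulrCA ler_wpM2l ?rnorm_ge0.
Qed.

Lemma bnd_sub rho c d a b : 0 <= rho -> bnd rho c a -> bnd rho d b -> bnd rho (c + d) (fsub a b).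
Proof.
move=> r0 ha hb; apply: bnd_cat => //.
by have := bnd_scale (-1) r0 hb; rewrite (@rnormN R C) rnorm1 mul1r.
Qed.

Lemma bnd_exists rho a : 0 <= rho -> exists c, bnd rho c a.
Proof.
move=> r0; have [M /(_ M (leqnn M)) hM] := formal_degree a.
exists (\sum_(m < M) rho ^+ m * mag m a) => m.
have pos k : 0 <= rho ^+ k * mag k a by rewrite mulr_ge0 ?mag_ge0 ?exprn_ge0.
have [Mm|mM] := leqP M m.
  by rewrite (mag_eq0 hM Mm) mulr0 sumr_ge0.
by rewrite (bigD1 (Ordinal mM))//= lerDl sumr_ge0.
Qed.

Lemma bnd_ev a rho c x : 0 <= rho -> bnd (2 * rho) c a -> rnorm x <= rho ->
  rnorm (ev a x) <= 2 * c.
Proof.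
move=> r0 ac xr; have := bnd_tail 0 r0 ac xr.
by rewrite big_ord0 subr0 expr0 mulr1.
Qed.

(** * Contraction of formal polynomials *)

(** In degree 0, where all powers are the constant 1, only one value matters. *)
Definition tfun j A (t : (E -> C) -> C) : Prop :=
  if j is 0%N then rnorm (t (power 0 0)) <= A
  else linear_on (nuclear j) t /\ forall F, nuclear j F -> rnorm (t F) <= A * gauge j F.

Lemma power0 (phi psi : dual E) : power 0 phi = power 0 psi.
Proof. by apply/funext => x; rewrite /power !expr0. Qed.

Lemma ngauge_contract j k A t (s' : seq (R[i] * dual E)) : 0 <= A -> tfun j A t ->
  ngauge k (power_sum k [seq (v.1 * t (power j v.2), v.2) | v <- s']) <=
  A * ngauge (k + j) (power_sum (k + j) s').
Proof.
move=> A0; case: j => [|j] ht.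
  have -> : [seq (v.1 * t (power 0 v.2), v.2) | v <- s'] = [seq (t (power 0 0) * v.1, v.2) | v <- s'].
    by apply: eq_map => v; rewrite (power0 v.2 0) mulrC.
  rewrite power_sum_scale addn0.
  have := ngauge_lin adm k (t (power 0 0)) s' [::].
  rewrite {2 4}/power_sum big_nil addr0 (ngauge0 E adm) addr0 => /le_trans; apply.
  by rewrite ler_wpM2r ?ngauge_ge0.
have [lt bt] := ht; case: k => [|k].
  rewrite add0n /= power_sumE big_map.
  apply: le_trans (bt _ (nuclear_power_sum adm j s')).
  rewrite (functional_power_sum adm _ lt) le_eqVlt; apply/orP; left; apply/eqP.
  by congr rnorm; apply: eq_bigr => v _; rewrite expr0 mulr1.
apply: (gauge_contract adm) => //; split; first exact: lt.
move=> P z nP vz; apply: le_trans (bt _ nP) _.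
by rewrite ler_wpM2l//; exact: (gauge_value adm vz).
Qed.

(** Each monomial [phi ^ m] becomes the sum of the
    ['C(m, k) * theta (m - k) phi *: phi ^ k].  If [theta] is the evaluation of
    powers at a point, this is the translation by that point; if it is the value
    of a functional at powers, this is the convolution product. *)
Definition fcon (theta : nat -> dual E -> R[i]) a : formal :=
  flatten [seq [seq (k, (t.2.1 * 'C(t.1, k)%:R * theta (t.1 - k)%N t.2.2, t.2.2))
    | k <- iota 0 t.1.+1] | t <- a].

Lemma fcon_cat theta a b : fcon theta (a ++ b) = fcon theta a ++ fcon theta b.
Proof. by rewrite /fcon map_cat flatten_cat. Qed.

Lemma fcon_scale theta z a : fcon theta (fscale z a) = fscale z (fcon theta a).
Proof.
rewrite /fcon /fscale -map_comp map_flatten -map_comp; congr flatten.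
apply: eq_map => t; rewrite [in RHS]/comp -[in RHS]map_comp.
by apply: eq_map => k; rewrite /= !mulrA.
Qed.

Lemma fcon_sub theta a b : fcon theta (fsub a b) = fsub (fcon theta a) (fcon theta b).
Proof. by rewrite /fsub fcon_cat fcon_scale. Qed.

Lemma ev_fcon theta a x : ev (fcon theta a) x =
  \sum_(t <- a) t.2.1 * \sum_(k < t.1.+1) 'C(t.1, k)%:R * theta (t.1 - k)%N t.2.2 * t.2.2 x ^+ k.
Proof.
rewrite /ev /fcon big_flatten big_map; apply: eq_bigr => t _.
rewrite big_map mulr_sumr -(big_mkord xpredT (fun k => t.2.1 * ('C(t.1, k)%:R *
  theta (t.1 - k)%N t.2.2 * t.2.2 x ^+ k))) /index_iota subn0.
by apply: eq_bigr => k _; rewrite /= !mulrA.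
Qed.

Lemma hpart_fcon theta a k M : (forall t, t \in a -> (t.1 < M)%N) ->
  hpart k (fcon theta a) = \sum_(m < M | (k <= m)%N) 'C(m, k)%:R *:
    power_sum k [seq (v.1 * theta (m - k)%N v.2, v.2) | v <- deg m a].
Proof.
elim: a => [|t a IH] h.
  rewrite /hpart /deg /power_sum /= big_nil big1// => m _.
  by rewrite ?big_nil scaler0.
have tM := h t (mem_head _ _).
rewrite -cat1s fcon_cat hpart_cat IH; last by move=> u ua; apply: h; rewrite inE ua orbT.
pose G b m : E -> C := 'C(m, k)%:R *: power_sum k [seq (v.1 * theta (m - k)%N v.2, v.2) | v <- deg m b].
rewrite -[X in _ + X]/(\sum_(m < M | (k <= m)%N) G a m).
rewrite -[RHS]/(\sum_(m < M | (k <= m)%N) G ([:: t] ++ a) m).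
rewrite [RHS](eq_bigr (fun m : 'I_M => G [:: t] m + G a m)); last first.
  by move=> m _; rewrite /G /deg filter_cat !map_cat power_sum_cat scalerDr.
rewrite big_split /=; congr (_ + _).
have Gm (m : 'I_M) : (m : nat) != t.1 -> G [:: t] m = 0.
  move=> mt; rewrite /G /deg /= eq_sym (negbTE mt) /=.
  by rewrite /power_sum big_nil scaler0.
have hp : hpart k (fcon theta [:: t]) =
    if (k <= t.1)%N then ('C(t.1, k)%:R * (t.2.1 * theta (t.1 - k)%N t.2.2)) *: power k t.2.2 else 0.
  have -> : fcon theta [:: t] =
      [seq (i, (t.2.1 * 'C(t.1, i)%:R * theta (t.1 - i)%N t.2.2, t.2.2)) | i <- iota 0 t.1.+1].
    by rewrite /fcon /= cats0.
  rewrite /hpart /deg filter_map -map_comp /power_sum big_map.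
  rewrite big_filter big_mkcond.
  case: ifPn => [kt|kt].
    rewrite (bigD1_seq k) ?iota_uniq ?mem_iota//=; rewrite [X in _ + X]big1 ?addr0 => [|i ik].
      by rewrite eqxx; congr (_ *: _); rewrite mulrCA mulrA.
    by rewrite /= (negbTE ik).
  rewrite big_seq big1// => i; rewrite mem_iota add0n ltnS => /andP[_ it].
  by rewrite /=; case: eqP => // ik; rewrite -ik it in kt.
rewrite hp; case: ifPn => kt.
  rewrite (bigD1 (Ordinal tM))//= big1 ?addr0 => [|m /andP[_ mt]]; last first.
    by apply: Gm; apply: contra mt => /eqP mt; apply/eqP/val_inj.
  by rewrite /G /deg /= eqxx /= /power_sum big_seq1 scalerA.
rewrite big1// => m km; apply: Gm; apply/eqP => mt.
by rewrite -mt km in kt.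
Qed.

(** Each summand of the binomial formula is bounded by [gauge_contract]; the
    binomial theorem adds the two radii, and doubling the radius makes the sum
    over the degrees converge. *)
Lemma bnd_fcon (t : nat -> (E -> C) -> C) a rho sigma A c : 0 <= A -> 0 <= rho -> 0 <= sigma ->
  (forall j, tfun j (A * rho ^+ j) (t j)) -> bnd (2 * (rho + sigma)) c a ->
  bnd sigma (2 * A * c) (fcon (fun j phi => t j (power j phi)) a).
Proof.
move=> A0 rho0 sigma0 ht ac k; set theta := fun j _ => _.
have c0 := bnd_ge0 ac.
have [M hM] := formal_degree a; have {}hM := hM M (leqnn M).
rewrite /mag (hpart_fcon theta k hM).
have sum_le (I : Type) (u : seq I) (P : pred I) (z : I -> R[i]) (F : I -> seq (R[i] * dual E)) :
    ngauge k (\sum_(i <- u | P i) z i *: power_sum k (F i)) <=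
    \sum_(i <- u | P i) rnorm (z i : C) * ngauge k (power_sum k (F i)).
  have : exists b : seq (R[i] * dual E), power_sum k b = \sum_(i <- u | P i) z i *: power_sum k (F i) /\
      ngauge k (power_sum k b) <= \sum_(i <- u | P i) rnorm (z i : C) * ngauge k (power_sum k (F i)).
    elim: u => [|i u [b [bE bl]]].
      by exists [::]; rewrite !big_nil /power_sum big_nil (ngauge0 E adm).
    rewrite !big_cons; case: (P i); last by exists b.
    have [b' b'E] := power_sum_lin k (z i) (F i) b; exists b'; rewrite b'E bE; split=> //.
    rewrite -bE; apply: le_trans (ngauge_lin adm _ _ _ _) _; by rewrite lerD2l.
  by move=> [b [<-]].
apply: le_trans (ler_wpM2l (exprn_ge0 _ sigma0) (sum_le _ _ _ _ _)) _.
rewrite mulr_sumr.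
apply: (@le_trans _ _ (\sum_(m < M | (k <= m)%N) A * ((rho + sigma) ^+ m * mag m a))).
  apply: ler_sum => m km.
  have h := ngauge_contract k (deg m a) (mulr_ge0 A0 (exprn_ge0 (m - k) rho0)) (ht (m - k)%N).
  rewrite subnKC// in h.
  rewrite rnorm_nat; apply: le_trans.
    by apply: ler_wpM2l; [exact: exprn_ge0|apply: ler_wpM2l h; exact: ler0n].
  rewrite -/(hpart m a) -/(mag m a).
  rewrite [leLHS](_ : _ = A * (rho ^+ (m - k) * sigma ^+ k *+ 'C(m, k) * mag m a)); last first.
    by rewrite -mulr_natl; ring.
  rewrite ler_wpM2l// ler_wpM2r ?mag_ge0// exprDn.
  rewrite (bigD1 (Ordinal (km : (k < m.+1)%N)))//= lerDl sumr_ge0// => i _.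
  by rewrite mulrn_wge0// mulr_ge0// exprn_ge0.
apply: (@le_trans _ _ (\sum_(m < M) A * (2^-1 ^+ m * c))).
  rewrite big_mkcond /=; apply: ler_sum => m _; case: ifP => _; last first.
    by rewrite !mulr_ge0// exprn_ge0// invr_ge0.
  rewrite ler_wpM2l//; have := ac m; rewrite exprMn => h.
  have := ler_wpM2l (_ : 0 <= 2^-1 ^+ m :> R) h; rewrite exprn_ge0 ?invr_ge0// => /(_ isT).
  by rewrite !mulrA -exprMn mulVf// expr1n mul1r.
rewrite -mulr_sumr -mulr_suml -(big_mkord xpredT (fun m => 2^-1 ^+ m)).
have := geometric_tail (leq0n M); rewrite expr0 mulr1 => h.
have -> : 2 * A * c = A * (2 * c) by ring.
by rewrite ler_wpM2l// ler_wpM2r.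
Qed.

End formal_polynomials.

(** * The space of entire functions as a completion *)

Section completion.
Context {R : realType} (E : normedModType R[i]) (r q s p : R).
Hypothesis adm : admissible_exponents r q s p.
Local Open Scope complex_scope.
Local Notation C := R[i]^o.
Local Notation ngauge := (@ngauge R E r q s p).
Local Notation formal := (@formal R E).
Local Notation mag := (mag r q s p).
Local Notation bnd := (bnd r q s p).
Local Notation tfun := (tfun r q s p).
Local Notation HNb_set := (@HNb_set R E r q s p).
Local Notation HNb_seminorm := (@HNb_seminorm R E r q s p).
Implicit Types (a b : nat -> formal) (f g : E -> C) (m n k : nat) (rho sigma c d e : R) (x : E).

Definition fcauchy a : Prop := forall rho e, 0 < rho -> 0 < e ->
  exists N, forall i j, (N <= i)%N -> (N <= j)%N -> bnd rho e (fsub (a i) (a j)).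

(** The space is the set of the pointwise limits of Cauchy sequences of formal
    polynomials. *)
Definition rep f a : Prop := fcauchy a /\ forall x, cvgs (fun i => ev (a i) x) (f x).

(** The sup-type seminorm at the radius [rho], bounded by [c] on approximants.
    These seminorms define the same topology as the seminorms of the space and
    need no summation. *)
Definition hb rho c f : Prop := exists2 a, rep f a & forall i, bnd rho c (a i).

Lemma mag_le_sub m (u v : formal) : mag m u <= mag m (fsub u v) + mag m v.
Proof.
rewrite /mag hpart_sub; have [w wE] := power_sumB m (deg m u) (deg m v).
have := ngauge_lin adm m 1 w (deg m v).
by rewrite wE scale1r rnorm1 mul1r subrK.
Qed.

Lemma rep_sub f a (N : nat) : rep f a -> rep f (fun i => a (N + i)%N).
Proof.
move=> [ca fa]; split.
  move=> rho e rho0 e0; have [M hM] := ca _ _ rho0 e0; exists M => i j Mi Mj.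
  by apply: hM; rewrite (leq_trans _ (leq_addl _ _)).
by move=> x; apply: (cvgs_sub (k := addn N) _ (fa x)) => n; rewrite leq_addl.
Qed.

Lemma rep_bounded f a rho : rep f a -> 0 < rho -> exists N c, forall i, (N <= i)%N -> bnd rho c (a i).
Proof.
move=> [ca _] rho0; have [N hN] := ca _ _ rho0 ltr01.
have [c hc] := bnd_exists adm (a N) (ltW rho0).
exists N, (1 + c) => i Ni m.
apply: le_trans (ler_wpM2l (exprn_ge0 _ (ltW rho0)) (mag_le_sub m (a i) (a N))) _.
by rewrite mulrDr; apply: lerD; [exact: hN|exact: hc].
Qed.

Lemma cauchy_ev_le f a rho c x : rep f a -> 0 < rho -> (forall i, bnd (2 * rho) c (a i)) ->
  rnorm x <= rho -> rnorm (f x) <= 2 * c.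
Proof.
move=> [_ fa] rho0 ac xr; apply: (cvgs_le (N := 0%N) (fa x)) => i _.
exact: (bnd_ev adm (ltW rho0) (ac i) xr).
Qed.

(** The homogeneous parts of a Cauchy sequence converge degree by degree, and
    their tails are small uniformly on balls, so that the limit has the limits of
    the parts as its Taylor terms. *)
Lemma rep_terms f a : rep f a -> exists P : nat -> E -> C,
  [/\ forall m x, cvgs (fun i => hpart m (a i) x) (P m x),
      taylor_expansion f 0 P &
      forall m, ngauge_cauchy r q s p m (fun i => deg m (a i))].
Proof.
move=> fa; have [ca fx] := fa.
have nc m : ngauge_cauchy r q s p m (fun i => deg m (a i)).
  move=> e e0; have e2 : 0 < e / 2 by rewrite divr_gt0.
  have [N hN] := ca _ _ ltr01 e2; exists N => i j Ni Nj.
  have := hN i j Ni Nj m; rewrite expr1n mul1r /mag hpart_sub => h.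
  by rewrite (le_lt_trans h)// ltr_pdivrMr// ltr_pMr// ltr1n.
have lim m x : exists z : C, cvgs (fun i => hpart m (a i) x) z.
  apply: cauchy_cvgs => e e0.
  have x1 : 0 < rnorm x ^+ m + 1 by rewrite ltr_wpDl ?exprn_ge0 ?rnorm_ge0.
  have [N hN] := nc m _ (divr_gt0 e0 x1); exists N => i j Ni Nj.
  rewrite -[_ - _]/((hpart m (a i) - hpart m (a j)) x) -hpart_sub.
  apply: le_lt_trans (hpart_le adm _ _ _) _.
  have := hN i j Ni Nj; rewrite -/(hpart m (a i)) -/(hpart m (a j)) -hpart_sub.
  rewrite -/(mag m _) ltr_pdivlMr// => lt; apply: le_lt_trans lt.
  by rewrite ler_wpM2l ?mag_ge0// lerDl.
have /choice[P0 hP0] : forall mx : nat * E, exists z : C, cvgs (fun i => hpart mx.1 (a i) mx.2) z.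
  by move=> [m x]; exact: lim.
pose P m x := P0 (m, x); have hP m x : cvgs (fun i => hpart m (a i) x) (P m x) := hP0 (m, x).
exists P; split=> //; split.
  move=> m; have [N [c hc]] := rep_bounded fa ltr01.
  apply: (power_sum_limit_hpoly adm (a := fun i => deg m (a (N + i)%N)) (c := c)).
    by move=> x; apply: (cvgs_sub (k := addn N) _ (hP m x)) => n; rewrite leq_addl.
  by move=> k; have := hc _ (leq_addr k N) m; rewrite expr1n mul1r.
have two0 : 0 < 2 * 1 :> R by rewrite mulr1.
have [N0 [c hc]] := rep_bounded fa two0.
have c0 : 0 <= c := bnd_ge0 (hc N0 (leqnn _)).
exists 1 => // e e0.
have c2 : 0 < 2 * c + 1 by rewrite ltr_wpDl// mulr_ge0.
have cv : (fun N => 2^-1 ^+ N * (2 * c)) @ \oo --> (0 * (2 * c) : R).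
  by apply: cvgMl; apply: cvg_expr; rewrite ger0_norm ?invr_ge0// invf_lt1 ?ltr1n.
rewrite mul0r in cv.
have [M _ hM] := (iffLR (cvgrPdist_lt _ _) cv) _ e0.
exists M => // N MN x; rewrite subr0 => /ltW x1.
have := hM N MN; rewrite /= sub0r normrN => lt.
apply: le_lt_trans (lt); apply: le_trans (ler_norm _).
have cvd : cvgs (fun i => ev (a i) x - \sum_(m < N) hpart m (a i) x) (f x - \sum_(m < N) P m x).
  by apply: cvgsB (fx x) _; apply: cvgs_sum => m _; exact: hP.
apply: (cvgs_le (N := N0) cvd) => i Ni.
have -> : 2^-1 ^+ N * (2 * c) = 2 * 2^-1 ^+ N * c by ring.
exact: (bnd_tail adm N ler01 (hc i Ni) x1).
Qed.

Lemma rep_contract f g a (t : nat -> (E -> C) -> C) rho A : rep f a -> 0 <= A -> 0 <= rho ->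
  (forall j, tfun j (A * rho ^+ j) (t j)) ->
  (forall x, cvgs (fun i => ev (fcon (fun j phi => t j (power j phi)) (a i)) x) (g x)) ->
  rep g (fun i => fcon (fun j phi => t j (power j phi)) (a i)).
Proof.
move=> [ca fa] A0 rho0 ht hg; split=> // sigma e sigma0 e0.
have A1 : 0 < 2 * A + 1 by rewrite ltr_wpDl// mulr_ge0.
have rs : 0 < 2 * (rho + sigma) by rewrite mulr_gt0// ltr_wpDl.
have [N hN] := ca _ _ rs (divr_gt0 e0 A1); exists N => i j Ni Nj.
rewrite -fcon_sub.
have := bnd_fcon adm A0 rho0 (ltW sigma0) ht (hN i j Ni Nj).
apply: bnd_le => //; first exact: ltW.
by rewrite mulrA ler_pdivrMr// mulrC ler_wpM2l ?(ltW e0)// lerDl.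
Qed.

Definition evals (x : E) (j : nat) : (E -> C) -> C := fun F => F x.

Lemma tfun_eval x j : tfun j (1 * rnorm x ^+ j) (evals x j).
Proof.
case: j => [|j]; first by rewrite /= /evals /power !expr0 rnorm1 mulr1.
split=> // F nF; rewrite mul1r mulrC; exact: (gauge_eval adm x nF).
Qed.

Lemma ev_translation (u : formal) x y :
  ev (fcon (fun j phi => evals x j (power j phi)) u) y = ev u (x + y).
Proof.
rewrite ev_fcon; apply: eq_bigr => t _; congr (_ * _).
rewrite dualD exprDn; apply: eq_bigr => k _.
by rewrite /evals /power -[RHS]mulr_natl mulrA.
Qed.

Definition formal_shift x (u : formal) : formal := fcon (fun j phi => evals x j (power j phi)) u.

Lemma rep_translation f a x : rep f a -> rep (fun y => f (x + y)) (fun i => formal_shift x (a i)).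
Proof.
move=> fa; apply: (rep_contract (t := evals x) fa ler01 (rnorm_ge0 x)); first exact: tfun_eval.
move=> y; have [_ fx] := fa.
by rewrite (funext (fun i => ev_translation (a i) x y)); exact: fx.
Qed.

(** The expansion at [x] is the expansion at 0 of the translate by [x]. *)
Lemma rep_entire f a : rep f a -> entire f.
Proof.
move=> fa x; have [P [_ [hP [rho rho0 h]] _]] := rep_terms (rep_translation x fa).
exists P; split=> //; exists rho => // e /h[N _ hN]; exists N => // M NM y yx.
have := hN M NM (y - x); rewrite subr0 => /(_ yx).
by rewrite [x + _]addrC subrK.
Qed.

Lemma rep_dhat f a rho c m : rep f a -> 0 < rho -> (forall i, bnd rho c (a i)) ->
  quasi_nuclear r q s p m (dhat m f 0) /\
  rho ^+ m / m`!%:R * quasi_nuclear_norm r q s p m (dhat m f 0) <= c.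
Proof.
move=> fa rho0 ac; have [P [hP tP nc]] := rep_terms fa.
rewrite (dhatE _ tP).
have rm : 0 < rho ^+ m by rewrite exprn_gt0.
have fm : 0 < m`!%:R :> R by rewrite ltr0n fact_gt0.
pose b i := [seq (m`!%:R * v.1, v.2) | v <- deg m (a i)] : seq (R[i] * dual E).
have bE i : power_sum m (b i) = m`!%:R *: hpart m (a i) by rewrite power_sum_scale.
have bscale u v : ngauge m (m`!%:R *: power_sum m u - m`!%:R *: power_sum m v) <=
    m`!%:R * ngauge m (power_sum m u - power_sum m v).
  have [w wE] := power_sumB m u v; rewrite -scalerBr -wE.
  have := ngauge_lin adm m (m`!%:R) w [::].
  by rewrite {2 4}/power_sum big_nil addr0 (ngauge0 E adm) addr0 rnorm_nat.
have [] := @quasi_nuclear_intro R E r q s p adm m b (m`!%:R *: P m) (m`!%:R * (c / rho ^+ m)).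
- move=> x; have := cvgsM m`!%:R (hP m x); congr cvgs; apply/funext => i.
  by rewrite bE.
- move=> e e0; have [N hN] := nc m _ (divr_gt0 e0 fm); exists N => i j Ni Nj.
  rewrite !bE; apply: le_lt_trans (bscale _ _) _.
  by have := hN i j Ni Nj; rewrite ltr_pdivlMr// mulrC.
- move=> i; rewrite bE; have := bscale (deg m (a i)) [::].
  rewrite /power_sum big_nil scaler0 !subr0 => /le_trans; apply.
  rewrite ler_wpM2l ?(ltW fm)// ler_pdivlMr// mulrC; exact: ac.
move=> Q1 Q2; split=> //.
rewrite -ler_pdivlMl ?divr_gt0//; apply: le_trans Q2 _.
by rewrite invf_div le_eqVlt; apply/orP; left; apply/eqP; rewrite mulrAC mulrA.
Qed.

(** The bounds hold at every radius, which is the root condition on the terms. *)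
Lemma rep_HNb_set f a : rep f a -> HNb_set f.
Proof.
move=> fa; split; first exact: rep_entire fa.
  move=> m; have [N [c hc]] := rep_bounded fa ltr01.
  by have [] := @rep_dhat f _ 1 c m (rep_sub N fa) ltr01 (fun i => hc _ (leq_addr i N)).
apply/cvgrPdist_le => e e0.
pose rho := 2 / e; have rho0 : 0 < rho by rewrite divr_gt0.
have [N [c hc]] := rep_bounded fa rho0.
have c0 : 0 <= c := bnd_ge0 (hc N (leqnn _)).
exists (maxn 1 (Num.bound c)) => // m /=; rewrite geq_max => /andP[m1 mc].
have m0 : m%:R != 0 :> R by rewrite pnatr_eq0 -lt0n.
have [_ h] := @rep_dhat f _ rho c m (rep_sub N fa) rho0 (fun i => hc _ (leq_addr i N)).
set w := _^-1 * _; have w0 : 0 <= w.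
  by rewrite /w mulr_ge0 ?invr_ge0 ?ler0n ?quasi_nuclear_norm_ge0.
have cm : c <= 2 ^+ m.
  apply: (le_trans (ltW (archi_boundP c0))); apply: (@le_trans _ _ m%:R); first by rewrite ler_nat.
  by rewrite -natrX ler_nat ltnW// ltn_expl.
have wm : w <= e ^+ m.
  have rm : 0 < rho ^+ m by rewrite exprn_gt0.
  have hw : rho ^+ m * w <= 2 ^+ m by rewrite /w mulrA; exact: le_trans cm.
  rewrite -(ler_pM2l rm); apply: le_trans hw _.
  by rewrite -exprMn /rho divfK ?gt_eqF.
rewrite sub0r normrN ger0_norm ?powR_ge0//.
apply: (@le_trans _ _ ((e ^+ m) `^ m%:R^-1)).
  by apply: ge0_ler_powR; rewrite ?nnegrE ?invr_ge0 ?exprn_ge0// ltW.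
by rewrite -powR_mulrn ?(ltW e0)// -powRrM mulfV// powRr1// ltW.
Qed.

Lemma HNb_term_ge0 rho f m : 0 <= rho ->
  0 <= rho ^+ m / m`!%:R * quasi_nuclear_norm r q s p m (dhat m f 0).
Proof.
by move=> r0; rewrite mulr_ge0 ?quasi_nuclear_norm_ge0// divr_ge0 ?exprn_ge0.
Qed.

Lemma rep_seminorm f a rho c : rep f a -> 0 < rho -> (forall i, bnd (2 * rho) c (a i)) ->
  (HNb_seminorm rho f <= (2 * c)%:E)%E.
Proof.
move=> fa rho0 ac; have c0 : 0 <= c := bnd_ge0 (ac 0%N).
apply: lime_le.
  by apply: is_cvg_nneseries => m _ _; rewrite lee_fin; apply: HNb_term_ge0; exact: ltW.
apply: nearW => N; rewrite sumEFin lee_fin.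
apply: (@le_trans _ _ (\sum_(0 <= m < N) 2^-1 ^+ m * c)).
  apply: ler_sum => m _.
  have r2 : 0 < 2 * rho by rewrite mulr_gt0.
  have [_ h] := rep_dhat m fa r2 ac.
  have := ler_wpM2l (_ : 0 <= 2^-1 ^+ m :> R) h; rewrite exprn_ge0 ?invr_ge0// => /(_ isT).
  by rewrite exprMn !mulrA -[2^-1 ^+ m * 2 ^+ m]exprMn mulVf// expr1n mul1r.
rewrite -mulr_suml ler_wpM2r//.
by have := @geometric_tail R 0 N (leq0n N); rewrite expr0 mulr1; apply.
Qed.

End completion.

(** * The identity theorem *)

Section identity_theorem.
Context {R : realType} {E : normedModType R[i]}.
Local Open Scope complex_scope.
Local Notation C := R[i]^o.

(** A power series with zeros accumulating at the origin vanishes: its first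
    nonzero coefficient would dominate near 0. *)
Lemma power_series_zero (d : nat -> C) (r B : R) : 0 < r -> 0 <= B ->
  (forall k, rnorm (d k) * r ^+ k <= B) ->
  (forall eta : R, 0 < eta -> exists2 t : R, t != 0 /\ `|t| < eta &
     cvgs (fun N => \sum_(k < N) d k * (t%:C) ^+ k) 0) ->
  forall k, d k = 0.
Proof.
move=> r0 B0 dB h k; elim/ltn_ind: k => k IH.
apply/rnorm0_eq0/le_anti; rewrite rnorm_ge0 andbT.
have rk : 0 < r ^+ k.+1 by rewrite exprn_gt0.
rewrite -(ler_pM2r rk) mul0r; apply/ler_addgt0Pr => e e0; rewrite add0r.
have B2 : 0 < 2 * B + 1 by rewrite ltr_wpDl// mulr_ge0.
have [t [t0 te] cv] := h (Num.min (r / 2) (e / (2 * B + 1)))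
  ltac:(by rewrite lt_min !divr_gt0).
move: te; rewrite lt_min => /andP[tr te].
have tn : 0 < `|t| by rewrite normr_gt0.
pose y := `|t| / r; have y0 : 0 <= y by rewrite divr_ge0// ltW.
have y2 : y <= 2^-1 by rewrite /y ler_pdivrMr// mulrC ltW.
have tail N : (k < N)%N -> rnorm (\sum_(j < N) d j * t%:C ^+ j - d k * t%:C ^+ k) <= 2 * B * y ^+ k.+1.
  move=> kN; rewrite -(big_mkord xpredT (fun j => d j * t%:C ^+ j)).
  rewrite (big_cat_nat (n := k) (p := N))//=; last exact: ltnW.
  rewrite big_nat big1 ?add0r => [|j /andP[_ jk]]; last by rewrite IH ?mul0r.
  rewrite big_ltn// addrAC subrr add0r.
  apply: (le_trans (rnorm_sum _ _ _)).
  apply: (@le_trans _ _ (\sum_(k.+1 <= j < N) B * y ^+ k.+1 * 2^-1 ^+ (j - k.+1))).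
    rewrite !big_nat; apply: ler_sum => j /andP[kj _].
    rewrite rnormM (rnormX (t%:C : C)) rnormR.
    have -> : rnorm (d j) * `|t| ^+ j = rnorm (d j) * r ^+ j * y ^+ j.
      by rewrite /y expr_div_n -mulrA [r ^+ j * _]mulrC divfK// expf_neq0// gt_eqF.
    rewrite -[leRHS]mulrA; apply: ler_pM; rewrite ?mulr_ge0 ?exprn_ge0 ?rnorm_ge0 ?(ltW r0)//.
    have -> : y ^+ j = y ^+ k.+1 * y ^+ (j - k.+1) by rewrite -exprD subnKC.
    rewrite ler_wpM2l ?exprn_ge0//.
    by apply: lerXn2r y2; rewrite nnegrE ?invr_ge0.
  rewrite -mulr_sumr (big_addn 0 N k.+1 xpredT (fun j => 2^-1 ^+ (j - k.+1))).
  under eq_bigr do rewrite addnK.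
  have -> : 2 * B * y ^+ k.+1 = B * y ^+ k.+1 * 2 by ring.
  rewrite ler_wpM2l ?mulr_ge0 ?exprn_ge0//.
  by have := @geometric_tail R 0 (N - k.+1) (leq0n _); rewrite expr0 mulr1.
have le : rnorm (d k * t%:C ^+ k) <= 2 * B * y ^+ k.+1.
  have := @cvgs_dist_le R _ 0 (d k * t%:C ^+ k) (2 * B * y ^+ k.+1) k.+1 cv tail.
  by rewrite sub0r rnormN.
rewrite rnormM (rnormX (t%:C : C)) rnormR in le.
have tk : 0 < `|t| ^+ k by rewrite exprn_gt0.
rewrite -(ler_pM2r tk).
apply: (@le_trans _ _ (2 * B * y ^+ k.+1 * r ^+ k.+1)).
  by rewrite mulrAC ler_wpM2r// ltW.
rewrite -mulrA -exprMn /y divfK ?gt_eqF// exprS mulrA ler_wpM2r ?(ltW tk)//.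
apply: (@le_trans _ _ ((2 * B + 1) * `|t|)); first by rewrite ler_wpM2r// lerDl.
by rewrite mulrC -ler_pdivlMr// ltW.
Qed.

Lemma taylor_series_at (f : E -> C) a c : taylor_expansion f a c ->
  exists2 rho : R, 0 < rho & forall h, rnorm h < rho ->
    cvgs (fun N => \sum_(m < N) c m h) (f (a + h)).
Proof.
move=> [_ [rho rho0 hr]]; exists rho => // h hrho e e0.
have [N _ hN] := hr _ e0; exists N => n Nn; rewrite rnormBC.
have := hN n Nn (a + h); rewrite addrAC subrr add0r; exact.
Qed.

(** The terms of a convergent series are bounded. *)
Lemma taylor_coef_bounded (f : E -> C) a c h : taylor_expansion f a c ->
  exists (r B : R), [/\ 0 < r, 0 <= B & forall k, rnorm (c k h) * r ^+ k <= B].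
Proof.
move=> tc; have [hc _] := tc; have [rho rho0 hs] := taylor_series_at tc.
have h1 : 0 < rnorm h + 1 by rewrite ltr_wpDl ?rnorm_ge0.
pose r := rho / 2 / (rnorm h + 1); have r0 : 0 < r by rewrite !divr_gt0.
have rh : rnorm (r%:C *: h) < rho.
  rewrite rnormZr gtr0_norm// /r mulrAC ltr_pdivrMr//.
  rewrite (@le_lt_trans _ _ (rho / 2 * (rnorm h + 1)))//.
    by rewrite ler_wpM2l ?divr_ge0 ?(ltW rho0)// lerDl.
  by rewrite ltr_pM2r// ltr_pdivrMr// ltr_pMr// ltr1n.
have [N hN] := hs _ rh 1 ltr01.
have term k : rnorm (c k (r%:C *: h)) = rnorm (c k h) * r ^+ k.
  rewrite (hpoly_scale _ _ (hc k)) rnormM (rnormX (r%:C : C)) rnormR gtr0_norm//.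
  by rewrite mulrC.
exists r, (2 + \sum_(k < N) rnorm (c k (r%:C *: h))); split=> //.
  by rewrite addr_ge0// sumr_ge0// => *; exact: rnorm_ge0.
move=> k; rewrite -term; have [Nk|kN] := leqP N k.
  have -> : c k (r%:C *: h) = (\sum_(m < k.+1) c m (r%:C *: h) - f (a + r%:C *: h)) -
      (\sum_(m < k) c m (r%:C *: h) - f (a + r%:C *: h)).
    by rewrite big_ord_recr /=; ring.
  rewrite (le_trans (rnormB _ _))// (@le_trans _ _ (1 + 1))//.
    by rewrite lerD// ltW// hN// (leq_trans Nk).
  by rewrite -[1 + 1]/(2) lerDl sumr_ge0// => *; exact: rnorm_ge0.
rewrite (bigD1 (Ordinal kN))//= addrCA lerDl addr_ge0// sumr_ge0// => *; exact: rnorm_ge0.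
Qed.

(** Continuation along a segment: at the supremum of the parameters up to which
    the function vanishes, all the Taylor terms vanish in its direction. *)
Lemma entire_zero (D : E -> C) : entire D ->
  (exists2 rho : R, 0 < rho & forall x, rnorm x < rho -> D x = 0) -> forall x, D x = 0.
Proof.
move=> eD [rho rho0 D0] x.
apply: contrapT => Dx.
pose A := [set t : R | 0 <= t /\ forall u, 0 <= u -> u <= t -> D (u%:C *: x) = 0].
have A0 : A 0.
  split=> // u u0 u1; have -> : u = 0 by apply/le_anti; rewrite u0 u1.
  by rewrite scale0r D0// rnorm0.
have A1 t : A t -> t < 1.
  move=> [t0 ht]; rewrite ltNge; apply/negP => t1; apply: Dx.
  by have := ht 1 ler01 t1; rewrite scale1r.
have sA : has_sup A by split; [exists 0|exists 1 => t /A1/ltW].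
pose T := sup A; have T0 : 0 <= T by apply: ub_le_sup => //; exact: sA.2.
have below u : 0 <= u -> u < T -> D (u%:C *: x) = 0.
  move=> u0 uT; have uT0 : 0 < T - u by rewrite subr_gt0.
  have [t [t0 ht]] := sup_adherent uT0 sA; rewrite -/T opprB addrC subrK => /ltW.
  exact: ht.
have [c tc] := eD (T%:C *: x).
have [r [B [r0 B0 cB]]] := taylor_coef_bounded x tc.
have [eta eta0 hs] := taylor_series_at tc.
have x1 : 0 < rnorm x + 1 by rewrite ltr_wpDl ?rnorm_ge0.
have small (t : R) : `|t| < eta / (rnorm x + 1) -> rnorm (t%:C *: x) < eta.
  rewrite rnormZr ltr_pdivlMr// => lt; apply: le_lt_trans lt.
  by rewrite ler_wpM2l// lerDl.
have cser (t : R) : `|t| < eta / (rnorm x + 1) ->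
    cvgs (fun N => \sum_(k < N) c k x * t%:C ^+ k) (D ((T + t)%:C *: x)).
  move=> /small/hs; rewrite -scalerDl -rmorphD /=; congr cvgs; apply/funext => N.
  by apply: eq_bigr => k _; rewrite (hpoly_scale _ _ (tc.1 k)) mulrC.
have zero (d : R) : 0 < d -> exists2 t : R, t != 0 /\ `|t| < d & D ((T + t)%:C *: x) = 0.
  move=> d0; have [T00|Tn] := eqVneq T 0.
    pose t := Num.min (d / 2) (rho / 2 / (rnorm x + 1)).
    have t0 : 0 < t by rewrite lt_min !divr_gt0.
    exists t; first split.
    - by rewrite gt_eqF.
    - by rewrite gtr0_norm// gt_min ltr_pdivrMr// ltr_pMr// ltr1n.
    - rewrite T00 add0r D0// rnormZr gtr0_norm//.
      apply: (@le_lt_trans _ _ (rho / 2 / (rnorm x + 1) * rnorm x)).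
        by rewrite ler_wpM2r ?rnorm_ge0// ge_min lexx orbT.
      rewrite mulrAC ltr_pdivrMr//; apply: (@le_lt_trans _ _ (rho / 2 * (rnorm x + 1))).
        by rewrite ler_wpM2l ?divr_ge0 ?(ltW rho0)// lerDl.
      by rewrite ltr_pM2r// ltr_pdivrMr// ltr_pMr// ltr1n.
  have Tp : 0 < T by rewrite lt_def Tn.
  pose t := Num.min (d / 2) (T / 2).
  have t0 : 0 < t by rewrite lt_min !divr_gt0.
  have tT : t < T by rewrite gt_min [T / 2 < T]ltr_pdivrMr// ltr_pMr// ltr1n orbT.
  exists (- t); first split.
  - by rewrite oppr_eq0 gt_eqF.
  - by rewrite normrN gtr0_norm// gt_min ltr_pdivrMr// ltr_pMr// ltr1n.
  - by rewrite below ?subr_ge0 ?(ltW tT)// gtrBl.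
have c0 k : c k x = 0.
  apply: (power_series_zero (d := fun k => c k x) r0 B0 cB) => d d0.
  have m0 : 0 < Num.min d (eta / (rnorm x + 1)) by rewrite lt_min d0 divr_gt0.
  have [t [t0]] := zero _ m0; rewrite lt_min => /andP[td te] Dt.
  by exists t => //; move: (cser t te); rewrite Dt.
pose t := eta / 2 / (rnorm x + 1); have t0 : 0 < t by rewrite !divr_gt0.
have te : t < eta / (rnorm x + 1).
  by rewrite /t ltr_pM2r ?invr_gt0// ltr_pdivrMr// ltr_pMr// ltr1n.
have : A (T + t).
  split=> [|u u0 uT]; first by rewrite addr_ge0// ltW.
  have [uT'|Tu] := ltP u T; first exact: below.
  have ut : `|u - T| < eta / (rnorm x + 1).
    rewrite ger0_norm ?subr_ge0//; apply: le_lt_trans te; by rewrite lerBlDl.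
  have := cser _ ut; have -> : T + (u - T) = u by ring.
  move=> h; apply: (cvgs_uniq h); have := @cvgs_cst R 0; congr cvgs; apply/funext => N.
  by rewrite big1// => k _; rewrite c0 mul0r.
move=> /(ub_le_sup sA.2); rewrite -/T; apply/negP; rewrite -ltNge.
by rewrite ltrDl.
Qed.

End identity_theorem.

(** * From the seminorms of the space to Cauchy sequences of formal polynomials *)

Section seminorm_representation.
Context {R : realType} (E : normedModType R[i]) (r q s p : R).
Hypothesis adm : admissible_exponents r q s p.
Local Open Scope complex_scope.
Local Notation C := R[i]^o.
Local Notation ngauge := (@ngauge R E r q s p).
Local Notation formal := (@formal R E).
Local Notation mag := (mag r q s p).
Local Notation bnd := (bnd r q s p).
Local Notation HNb_set := (@HNb_set R E r q s p).
Local Notation HNb_seminorm := (@HNb_seminorm R E r q s p).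
Local Notation fcauchy := (fcauchy r q s p).
Local Notation rep := (rep r q s p).
Local Notation hb := (hb r q s p).
Implicit Types (f g : E -> C) (m n k : nat) (x : E).

Lemma ngauge_scale n (z : R[i]) (a : seq (R[i] * dual E)) :
  ngauge n (z *: power_sum n a) <= rnorm (z : C) * ngauge n (power_sum n a).
Proof.
have := ngauge_lin adm n z a [::].
by rewrite {2 4}/power_sum big_nil addr0 (ngauge0 E adm) addr0.
Qed.

Lemma ngauge_sym n (a b : seq (R[i] * dual E)) :
  ngauge n (power_sum n a - power_sum n b) <= ngauge n (power_sum n b - power_sum n a).
Proof.
have [w wE] := power_sumB n b a; have := ngauge_scale n (-1) w.
by rewrite wE scaleN1r opprB (@rnormN R C) rnorm1 mul1r.
Qed.

Lemma bnd_sub_sym (rho c : R) (u v : formal) : 0 <= rho ->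
  bnd rho c (fsub u v) -> bnd rho c (fsub v u).
Proof.
move=> r0 h m; apply: le_trans (h m); rewrite ler_wpM2l ?exprn_ge0//.
by rewrite /mag !hpart_sub; exact: ngauge_sym.
Qed.

Lemma fcauchy_rep (a : nat -> formal) : fcauchy a -> exists F, rep F a.
Proof.
move=> ca; suff /choice[F hF] : forall x, exists z : C, cvgs (fun i => ev (a i) x) z.
  by exists F.
move=> x; apply: cauchy_cvgs => e e0.
have x1 : 0 < rnorm x + 1 by rewrite ltr_wpDl ?rnorm_ge0.
have [N hN] := ca (2 * (rnorm x + 1)) (e / 3%:R) ltac:(by rewrite mulr_gt0) ltac:(by rewrite divr_gt0).
exists N => i j Ni Nj; rewrite -ev_sub.
apply: le_lt_trans (bnd_ev adm (ltW x1) (hN i j Ni Nj) _) _; first by rewrite lerDl.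
by rewrite mulrA ltr_pdivrMr// mulrC ltr_pM2l// ltr_nat.
Qed.

Lemma cvgs_eq (u v : nat -> C) z : (forall k, u k = v k) -> cvgs u z -> cvgs v z.
Proof. by move=> uv; rewrite (funext uv). Qed.

Lemma entireB (f g : E -> C) : entire f -> entire g -> entire (fun x => f x - g x).
Proof.
move=> ef eg a; have [c [hc [d1 d10 h1]]] := ef a; have [d [hd [d2 d20 h2]]] := eg a.
exists (fun m => c m - d m); split=> [m|]; first exact: hpolyB.
exists (Num.min d1 d2) => [|e e0]; first by rewrite lt_min d10.
have e2 : 0 < e / 2 by rewrite divr_gt0.
have [N1 _ hN1] := h1 _ e2; have [N2 _ hN2] := h2 _ e2.
exists (maxn N1 N2) => // N /=; rewrite geq_max => /andP[n1 n2] x.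
rewrite lt_min => /andP[x1 x2].
have -> : f x - g x - \sum_(m < N) (c m - d m) (x - a) =
  (f x - \sum_(m < N) c m (x - a)) - (g x - \sum_(m < N) d m (x - a)).
  by rewrite sumrB; ring.
apply: le_lt_trans (rnormB _ _) _; rewrite [ltRHS]splitr ltrD//.
  exact: hN1.
exact: hN2.
Qed.

(** The [i]-th approximant takes the degrees below [i] only, so that it is
    finite. *)
Definition assemble (b : nat -> nat -> seq (R[i] * dual E)) i : formal :=
  flatten [seq [seq (m, v) | v <- b m i] | m <- iota 0 i].

Lemma hpart_assemble b i m :
  hpart m (assemble b i) = if (m < i)%N then power_sum m (b m i) else 0.
Proof.
rewrite /assemble; set c := fun k => b k i.
rewrite -[power_sum m (b m i)]/(power_sum m (c m)).
have -> : [seq [seq (k, v) | v <- b k i] | k <- iota 0 i] =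
  [seq [seq (k, v) | v <- c k] | k <- iota 0 i] by [].
elim: i {c}(c) => [|i IH] c.
  by rewrite /hpart /deg /power_sum /= big_nil.
rewrite -addn1 iotaD map_cat flatten_cat hpart_cat IH /= cats0 add0n addn1.
have -> : hpart m [seq (i, v) | v <- c i] = if m == i then power_sum m (c m) else 0.
  rewrite /hpart /deg filter_map -map_comp; case: eqP => [->|mi].
    by rewrite (eq_filter (a2 := predT)) ?filter_predT ?map_id// => v /=; rewrite eqxx.
  rewrite (eq_filter (a2 := pred0)) ?filter_pred0 /power_sum ?big_nil// => v /=.
  by apply/eqP => im; apply: mi.
rewrite ltnS [(m <= i)%N]leq_eqVlt; case: eqP => [->|_] /=.
  by rewrite ltnn add0r.
by rewrite addr0.
Qed.

Lemma assemble_cauchy b (D : nat -> R) :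
  (forall m k, ngauge m (power_sum m (b m k)) <= D m) ->
  (forall m k l, (k <= l)%N ->
     ngauge m (power_sum m (b m k) - power_sum m (b m l)) <= (2^-1 ^+ k) ^+ m.+1) ->
  (forall rho e : R, 0 < rho -> 0 < e -> exists N, forall m, (N <= m)%N -> rho ^+ m * D m <= e) ->
  fcauchy (assemble b).
Proof.
move=> bD bc Dc rho e rho0 e0.
have [N1 hN1] := Dc rho (e / 2) rho0 ltac:(by rewrite divr_gt0).
have cv : (fun k => 2^-1 ^+ k) @ \oo --> (0 : R).
  by apply: cvg_expr; rewrite ger0_norm ?invr_ge0// invf_lt1 ?ltr1n.
have [N2 _ hN2] := (iffLR (cvgrPdist_lt _ _) cv) _ (ltac:(by rewrite lt_min e0 invr_gt0) : 0 < Num.min e rho^-1).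
have D0 m : 0 <= D m := le_trans (ngauge_ge0 _ _ _ _ _ _) (bD m 0%N).
suff half i j : (maxn N1 N2 <= i)%N -> (i <= j)%N -> bnd rho e (fsub (assemble b i) (assemble b j)).
  exists (maxn N1 N2) => i j Ni Nj; have [ij|/ltnW ji] := leqP i j; first exact: half.
  by apply: bnd_sub_sym; [exact: ltW|exact: half].
rewrite geq_max => /andP[Ni1 Ni2] ij m; rewrite /mag hpart_sub !hpart_assemble.
have [mi|im] := ltnP m i.
  rewrite (leq_trans mi ij).
  apply: le_trans (ler_wpM2l (exprn_ge0 _ (ltW rho0)) (bc m i j ij)) _.
  have := hN2 i Ni2; rewrite /= sub0r normrN lt_min ger0_norm ?exprn_ge0 ?invr_ge0//.
  move=> /andP[ie ir]; rewrite exprS mulrCA -exprMn -[leRHS]mulr1.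
  apply: ler_pM; rewrite ?exprn_ge0 ?mulr_ge0 ?(ltW rho0) ?exprn_ge0 ?invr_ge0//; first exact: ltW.
  rewrite exprn_ile1 ?mulr_ge0 ?(ltW rho0) ?exprn_ge0 ?invr_ge0//.
  by rewrite -ler_pdivlMl// mulr1 ltW.
have small k : (i <= m)%N -> rho ^+ m * ngauge m (power_sum m (b m k)) <= e / 2.
  move=> _; apply: le_trans (ler_wpM2l (exprn_ge0 _ (ltW rho0)) (bD m k)) _.
  by apply: hN1; exact: leq_trans im.
rewrite sub0r; case: ifP => _; last first.
  by rewrite oppr0 (ngauge0 E adm) mulr0 ltW.
have := ngauge_scale m (-1) (b m j); rewrite scaleN1r (@rnormN R C) rnorm1 mul1r => h.
apply: le_trans (ler_wpM2l (exprn_ge0 _ (ltW rho0)) h) _.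
by apply: le_trans (small j im) _; rewrite ler_pdivrMr// ler_peMr ?(ltW e0)// ler1n.
Qed.

Lemma terms_decay f (rho e : R) : HNb_set f -> 0 < rho -> 0 < e -> exists N, forall m, (N <= m)%N ->
  rho ^+ m * (m`!%:R^-1 * quasi_nuclear_norm r q s p m (dhat m f 0) + m.+1%:R^-1 ^+ m) <= e.
Proof.
move=> [_ _ root] rho0 e0.
pose d := (2 * rho)^-1; have d0 : 0 < d by rewrite invr_gt0 mulr_gt0.
have [N1 _ hN1] := (iffLR (cvgrPdist_le _ _) root) _ d0.
have cv : (fun k => 2^-1 ^+ k) @ \oo --> (0 : R).
  by apply: cvg_expr; rewrite ger0_norm ?invr_ge0// invf_lt1 ?ltr1n.
have [N2 _ hN2] := (iffLR (cvgrPdist_le _ _) cv) _ (divr_gt0 e0 (ltac:(by []) : 0 < 2)).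
exists (maxn (maxn N1 N2) (Num.bound d^-1).+1) => m.
rewrite !geq_max => /andP[/andP[m1 m2] m3].
have m0 : (0 < m)%N by apply: leq_trans m3.
set u := m`!%:R^-1 * _.
have u0 : 0 <= u by rewrite mulr_ge0 ?invr_ge0// quasi_nuclear_norm_ge0.
have ud : u <= d ^+ m.
  have := hN1 m m1; rewrite /= sub0r normrN ger0_norm ?powR_ge0// => h.
  have := ge0_ler_powR (ler0n R m) (powR_ge0 _ _) (ltW d0) h.
  by rewrite -powRrM mulVf ?pnatr_eq0 -?lt0n// powRr1// powR_mulrn// ltW.
have wd : m.+1%:R^-1 ^+ m <= d ^+ m.
  apply: lerXn2r; [by rewrite nnegrE invr_ge0|by rewrite nnegrE ltW|].
  rewrite -[d]invrK lef_pV2 ?posrE ?invr_gt0 ?mulr_gt0//.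
  have /archi_boundP/ltW h : 0 <= d^-1 by rewrite invr_ge0 ltW.
  by apply: le_trans h _; rewrite ler_nat (leq_trans (ltnW m3)).
apply: (@le_trans _ _ (rho ^+ m * (d ^+ m + d ^+ m))).
  by rewrite ler_wpM2l ?exprn_ge0 ?(ltW rho0)// lerD.
have := hN2 m m2; rewrite /= sub0r normrN ger0_norm ?exprn_ge0 ?invr_ge0// => h.
rewrite mulrDr -exprMn /d invfM mulrCA divff ?gt_eqF// mulr1.
by rewrite [leRHS]splitr lerD.
Qed.

(** Approximating each Taylor term by finite sums of powers, with its norm
    increased by an amount which decreases quickly with the degree. *)
Lemma terms_hb f (rho c : R) : HNb_set f -> 0 < rho ->
  (forall m, rho ^+ m * (m`!%:R^-1 * quasi_nuclear_norm r q s p m (dhat m f 0)) < c) ->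
  hb rho c f.
Proof.
move=> fH rho0 uc; have [ef qf _] := fH.
pose u m := m`!%:R^-1 * quasi_nuclear_norm r q s p m (dhat m f 0).
have u0 m : 0 <= u m by rewrite mulr_ge0 ?invr_ge0// quasi_nuclear_norm_ge0.
pose w m : R := m.+1%:R^-1 ^+ m; have w0 m : 0 < w m by rewrite exprn_gt0 ?invr_gt0.
pose D m := Num.min (c / rho ^+ m) (u m + w m).
have rm m : 0 < rho ^+ m by rewrite exprn_gt0.
have uD m : u m < D m by rewrite lt_min ltrDl w0 andbT ltr_pdivlMr// mulrC uc.
have fm m : 0 < m`!%:R :> R by rewrite ltr0n fact_gt0.
have fne m : m`!%:R != 0 :> R[i] by rewrite pnatr_eq0 -lt0n fact_gt0.
have elim m : exists b : nat -> seq (R[i] * dual E),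
    [/\ forall k, ngauge m (power_sum m (b k)) <= D m,
        forall k l, (k <= l)%N ->
          ngauge m (power_sum m (b k) - power_sum m (b l)) <= (2^-1 ^+ k) ^+ m.+1 &
        forall x, cvgs (fun k => power_sum m (b k) x) (m`!%:R^-1 * dhat m f 0 x)].
  have h0 k : 0 < (2^-1 ^+ k) ^+ m.+1 :> R by rewrite !exprn_gt0 ?invr_gt0.
  have [||||a [ha1 ha2 ha3]] := @quasi_nuclear_elim R E r q s p adm m (dhat m f 0) (m`!%:R * D m)
    (fun k => m`!%:R * (2^-1 ^+ k) ^+ m.+1) (qf m).
  - by rewrite -ltr_pdivrMl// uD.
  - by move=> k; rewrite mulr_gt0.
  - move=> k l kl; rewrite ler_wpM2l ?(ltW (fm m))// lerXn2r ?nnegrE ?exprn_ge0 ?invr_ge0//.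
    by rewrite ler_wiXn2l ?invr_ge0// invf_le1 ?ler1n.
  - move=> e e0.
    have cv : (fun k => 2^-1 ^+ k) @ \oo --> (0 : R).
      by apply: cvg_expr; rewrite ger0_norm ?invr_ge0// invf_lt1 ?ltr1n.
    have [N _ hN] := (iffLR (cvgrPdist_le _ _) cv) _ (divr_gt0 e0 (fm m)).
    exists N; have := hN N (leqnn N); rewrite /= sub0r normrN ger0_norm ?exprn_ge0 ?invr_ge0//.
    rewrite ler_pdivlMr// mulrC; apply: le_trans; rewrite ler_wpM2l ?(ltW (fm m))//.
    by rewrite exprS ler_piMr ?exprn_ge0 ?invr_ge0// exprn_ile1 ?exprn_ge0 ?invr_ge0// exprn_ile1 ?invr_ge0// invf_le1 ?ler1n.
  exists (fun k => [seq (m`!%:R^-1 * v.1, v.2) | v <- a k]); split=> [k|k l kl|x].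
  - rewrite power_sum_scale; apply: le_trans (ngauge_scale _ _ _) _.
    by rewrite rnormV rnorm_nat ler_pdivrMl.
  - rewrite !power_sum_scale -scalerBr; have [v vE] := power_sumB m (a k) (a l).
    rewrite -vE; apply: le_trans (ngauge_scale _ _ _) _.
    by rewrite rnormV rnorm_nat vE ler_pdivrMl// ha2.
  - have := cvgsM m`!%:R^-1 (ha3 x); apply: cvgs_eq => k.
    by rewrite power_sum_scale.
have /choice[b hb] := elim.
have b1 m k : ngauge m (power_sum m (b m k)) <= D m by have [] := hb m.
have b2 m k l : (k <= l)%N -> ngauge m (power_sum m (b m k) - power_sum m (b m l)) <= (2^-1 ^+ k) ^+ m.+1.
  by have [_ h _] := hb m; exact: h.
have b3 m x : cvgs (fun k => power_sum m (b m k) x) (m`!%:R^-1 * dhat m f 0 x).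
  by have [_ _] := hb m; exact.
have ca : fcauchy (assemble b).
  apply: (assemble_cauchy b1 b2) => sigma e s0 e0.
  have [N hN] := terms_decay fH s0 e0; exists N => m /hN; apply: le_trans.
  by rewrite ler_wpM2l ?exprn_ge0 ?(ltW s0)// ge_min lexx orbT.
have [F FA] := fcauchy_rep ca.
have [P [hP tP _]] := rep_terms adm FA.
have [c0 tc] := ef 0.
have Pc : P = c0.
  apply/funext => m; apply/funext => x; apply: (cvgs_uniq (hP m x)).
  have := b3 m x; rewrite (dhatE _ tc) -[(_ *: _) x]/(m`!%:R * c0 m x) mulKf//.
  move=> h e e0; have [N hN] := h e e0; exists (maxn N m.+1) => i.
  by rewrite geq_max hpart_assemble => /andP[Ni ->]; exact: hN.
suff -> : f = F.
  exists (assemble b) => // i m; rewrite /mag hpart_assemble; case: ifP => _; last first.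
    rewrite (ngauge0 E adm) mulr0; apply: le_trans (ltW (uc 0%N)).
    exact: mulr_ge0 (ltW (rm 0%N)) (u0 0%N).
  apply: le_trans (ler_wpM2l (ltW (rm m)) (b1 m i)) _.
  by rewrite mulrC -ler_pdivlMr// ge_min lexx.
apply/funext => x; apply/eqP; rewrite -subr_eq0; apply/eqP.
apply: (@entire_zero R E (fun x => f x - F x)) x.
  exact: entireB ef (rep_entire adm FA).
have [d1 d10 h1] := taylor_series_at tc; rewrite Pc in tP.
have [d2 d20 h2] := taylor_series_at tP.
exists (Num.min d1 d2) => [|x]; first by rewrite lt_min d10.
rewrite lt_min => /andP[/h1 l1 /h2 l2]; rewrite add0r in l1; rewrite add0r in l2.
by rewrite (cvgs_uniq l1 l2) subrr.
Qed.

Lemma seminorm_hb f (rho c : R) : HNb_set f -> 0 < rho ->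
  (HNb_seminorm rho f < c%:E)%E -> hb rho c f.
Proof.
move=> fH rho0 fc; apply: terms_hb => // m; rewrite -lte_fin; apply: le_lt_trans fc.
apply: (@le_trans _ _ (\sum_(0 <= k < m.+1) (rho ^+ k / k`!%:R *
  quasi_nuclear_norm r q s p k (dhat k f 0))%:E)%E).
  rewrite sumEFin lee_fin big_nat_recr//= mulrA lerDr sumr_ge0// => k _.
  by apply: HNb_term_ge0; exact: ltW.
by apply: nneseries_lim_ge => k _ _; rewrite lee_fin; apply: HNb_term_ge0; exact: ltW.
Qed.

Lemma HNb_hb f (rho : R) : HNb_set f -> 0 < rho -> exists c, hb rho c f.
Proof.
move=> fH rho0; have [N hN] := terms_decay fH rho0 ltr01.
pose u m := m`!%:R^-1 * quasi_nuclear_norm r q s p m (dhat m f 0).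
have u0 m : 0 <= rho ^+ m * u m.
  by rewrite mulr_ge0 ?exprn_ge0 ?(ltW rho0)// mulr_ge0 ?invr_ge0// quasi_nuclear_norm_ge0.
exists (2 + \sum_(m < N) rho ^+ m * u m); apply: terms_hb => // m.
rewrite -/(u m); have [Nm|mN] := leqP N m.
  apply: (@le_lt_trans _ _ 1); last by rewrite ltr_wpDr ?sumr_ge0// ltr1n.
  apply: le_trans (hN m Nm); rewrite ler_wpM2l ?exprn_ge0 ?(ltW rho0)//.
  by rewrite lerDl exprn_ge0// invr_ge0.
rewrite (bigD1 (Ordinal mN))//= addrCA ltrDl ltr_wpDr//; exact: sumr_ge0.
Qed.

End seminorm_representation.

(** * The vector space and its topology *)

Section space.
Context {R : realType} (E : normedModType R[i]) (r q s p : R).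
Hypothesis adm : admissible_exponents r q s p.
Local Open Scope complex_scope.
Local Notation C := R[i]^o.
Local Notation ngauge := (@ngauge R E r q s p).
Local Notation HNb_set := (@HNb_set R E r q s p).
Local Notation HNb_seminorm := (@HNb_seminorm R E r q s p).
Local Notation rep := (rep r q s p).
Local Notation hb := (hb r q s p).
Implicit Types (f g : E -> C) (m n k : nat) (x : E) (rho c d : R).

Lemma HNb_rep f : HNb_set f -> exists a, rep f a.
Proof. by move=> fH; have [c [a fa _]] := HNb_hb adm fH ltr01; exists a. Qed.

Lemma rep_lin (z : R[i]) f g a b : rep f a -> rep g b ->
  rep (z *: f + g) (fun i => fscale z (a i) ++ b i).
Proof.
move=> [ca fa] [cb gb]; split=> [rho e rho0 e0|x].
  have z1 : 0 < rnorm (z : C) + 1 by rewrite ltr_wpDl ?rnorm_ge0.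
  have [N1 h1] := ca rho (e / 2 / (rnorm (z : C) + 1)) rho0 ltac:(by rewrite !divr_gt0).
  have [N2 h2] := cb rho (e / 2) rho0 ltac:(by rewrite divr_gt0).
  exists (maxn N1 N2) => i j; rewrite !geq_max => /andP[i1 i2] /andP[j1 j2] m.
  have hE : hpart m (fsub (fscale z (a i) ++ b i) (fscale z (a j) ++ b j)) =
      hpart m (fscale z (fsub (a i) (a j)) ++ fsub (b i) (b j)).
    by rewrite !(hpart_sub, hpart_cat, hpart_scale) scalerBr addrACA opprD.
  rewrite /mag hE; have := bnd_cat adm (ltW rho0) (bnd_scale adm z (ltW rho0) (h1 i j i1 j1)) (h2 i j i2 j2).
  move=> /(_ m) /le_trans; apply; rewrite [leRHS]splitr lerD2r mulrC mulrAC ler_pdivrMr//.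
  by rewrite ler_wpM2l ?divr_ge0 ?(ltW e0)// lerDl.
apply: (cvgs_eq (fun i => esym (ev_cat (fscale z (a i)) (b i) x))).
by apply: cvgsD => //; apply: (cvgs_eq (fun i => esym (ev_scale z (a i) x))); exact: cvgsM.
Qed.

Lemma rep_subf f g a b : rep f a -> rep g b -> rep (f - g) (fun i => fsub (a i) (b i)).
Proof.
have hE u v m : hpart m (fsub u v) = hpart m (fscale (-1) v ++ u) :> (E -> C).
  by rewrite hpart_cat hpart_scale hpart_sub scaleN1r addrC.
move=> fa gb; have [h1 h2] := rep_lin (-1) gb fa; split=> [rho e rho0 e0|x].
  have [N hN] := h1 rho e rho0 e0; exists N => i j Ni Nj m; have := hN i j Ni Nj m.
  by rewrite /mag (hpart_sub m (fscale (-1) (b i) ++ a i)) (hpart_sub m (fsub (a i) (b i))) !hE.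
have -> : (f - g) x = ((-1) *: g + f) x by rewrite scaleN1r addrC.
by apply: (cvgs_eq _ (h2 x)) => j; rewrite ev_cat ev_scale ev_sub mulN1r addrC.
Qed.

Lemma hb_lin rho c d (z : R[i]) f g : 0 <= rho -> hb rho c f -> hb rho d g ->
  hb rho (rnorm (z : C) * c + d) (z *: f + g).
Proof.
move=> rho0 [a fa ac] [b gb bc]; exists (fun i => fscale z (a i) ++ b i).
  exact: rep_lin.
by move=> i; apply: bnd_cat => //; exact: bnd_scale.
Qed.

Lemma hb_le rho rho' c c' f : 0 <= rho' -> rho' <= rho -> c <= c' -> hb rho c f -> hb rho' c' f.
Proof.
by move=> r0 rr cc [a fa ac]; exists a => // i; exact: bnd_le (ac i).
Qed.

Lemma hb_ge0 rho c f : hb rho c f -> 0 <= c.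
Proof. by move=> [a _ /(_ 0%N)]; exact: bnd_ge0. Qed.

Lemma rep0 : rep (0 : E -> C) (fun=> [::]).
Proof.
split=> [rho e rho0 e0|x].
  by exists 0%N => i j _ _ m; rewrite /fsub /= (mag_nil _ adm) mulr0 ltW.
apply: (@cvgs_eq _ (fun=> 0)) => [k|]; last exact: cvgs_cst.
by rewrite /ev big_nil.
Qed.

Lemma hb0 rho : hb rho 0 (0 : E -> C).
Proof. by exists (fun=> [::]) => [|i m]; [exact: rep0|rewrite (mag_nil _ adm) mulr0]. Qed.

Lemma hbZ rho c (z : R[i]) f : 0 <= rho -> hb rho c f -> hb rho (rnorm (z : C) * c) (z *: f).
Proof. by move=> r0 h; have := hb_lin z r0 h (hb0 rho); rewrite !addr0. Qed.

Lemma hbD rho c d f g : 0 <= rho -> hb rho c f -> hb rho d g -> hb rho (c + d) (f + g).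
Proof. by move=> r0 h h'; have := hb_lin 1 r0 h h'; rewrite scale1r rnorm1 mul1r. Qed.

Lemma hbN rho c f : 0 <= rho -> hb rho c f -> hb rho c (- f).
Proof. by move=> r0 h; have := hbZ (-1) r0 h; rewrite scaleN1r (@rnormN R C) rnorm1 mul1r. Qed.

Lemma hb_HNb_set rho c f : hb rho c f -> HNb_set f.
Proof. by move=> [a fa _]; exact: rep_HNb_set fa. Qed.

Lemma HNb_set_lin (z : R[i]) f g : HNb_set f -> HNb_set g -> HNb_set (z *: f + g).
Proof.
by move=> /HNb_rep[a fa] /HNb_rep[b gb]; exact: (rep_HNb_set adm (rep_lin z fa gb)).
Qed.

Lemma hb_seminorm rho c f : 0 < rho -> hb (2 * rho) c f -> (HNb_seminorm rho f <= (2 * c)%:E)%E.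
Proof. by move=> rho0 [a fa ac]; exact: (rep_seminorm adm fa rho0 ac). Qed.

Lemma quasi_nuclear_normD n f g : quasi_nuclear r q s p n f -> quasi_nuclear r q s p n g ->
  quasi_nuclear_norm r q s p n (f + g) <=
  quasi_nuclear_norm r q s p n f + quasi_nuclear_norm r q s p n g.
Proof.
move=> qf qg; apply/ler_addgt0Pr => e e0.
have e2 : 0 < e / 2 by rewrite divr_gt0.
have two0 k : 0 < 2^-1 ^+ k :> R by rewrite exprn_gt0 ?invr_gt0.
have dec k l : (k <= l)%N -> 2^-1 ^+ l <= 2^-1 ^+ k :> R.
  by move=> kl; rewrite ler_wiXn2l ?invr_ge0// invf_le1 ?ler1n.
have lim (d : R) : 0 < d -> exists k, 2^-1 ^+ k <= d.
  move=> d0; have cv : (fun k => 2^-1 ^+ k) @ \oo --> (0 : R).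
    by apply: cvg_expr; rewrite ger0_norm ?invr_ge0// invf_lt1 ?ltr1n.
  have [N _ hN] := (iffLR (cvgrPdist_le _ _) cv) _ d0; exists N.
  by have := hN N (leqnn N); rewrite /= sub0r normrN ger0_norm ?exprn_ge0 ?invr_ge0.
have [|a [a1 a2 a3]] := quasi_nuclear_elim adm (d := quasi_nuclear_norm r q s p n f + e / 2) qf _ two0 dec lim.
  by rewrite ltrDl.
have [|b [b1 b2 b3]] := quasi_nuclear_elim adm (d := quasi_nuclear_norm r q s p n g + e / 2) qg _ two0 dec lim.
  by rewrite ltrDl.
have add (u v : seq (R[i] * dual E)) : ngauge n (power_sum n u + power_sum n v) <=
    ngauge n (power_sum n u) + ngauge n (power_sum n v).
  by have := ngauge_lin adm n 1 u v; rewrite scale1r rnorm1 mul1r.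
have [] := @quasi_nuclear_intro R E r q s p adm n (fun k => a k ++ b k) (f + g)
  (quasi_nuclear_norm r q s p n f + quasi_nuclear_norm r q s p n g + e).
- move=> x; apply: (cvgs_eq (u := fun k => power_sum n (a k) x + power_sum n (b k) x)).
    by move=> k; rewrite power_sum_cat.
  exact: cvgsD.
- move=> d d0; have [N hN] := lim _ (divr_gt0 d0 (ltac:(by []) : 0 < 3%:R)).
  exists N; suff half k l : (N <= k)%N -> (k <= l)%N ->
      ngauge n (power_sum n (a k ++ b k) - power_sum n (a l ++ b l)) < d.
    move=> k l Nk Nl; have [kl|/ltnW lk] := leqP k l; first exact: half.
    by apply: le_lt_trans (ngauge_sym adm _ _ _) _; exact: half.
  move=> Nk kl; rewrite !power_sum_cat opprD addrACA.
  have [u uE] := power_sumB n (a k) (a l); have [v vE] := power_sumB n (b k) (b l).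
  rewrite -uE -vE; apply: le_lt_trans (add u v) _; rewrite uE vE.
  have h1 := a2 k l kl; have h2 := b2 k l kl; have h3 := dec _ _ Nk.
  by move: h1 h2 h3 hN; lra.
- move=> k; rewrite power_sum_cat; apply: le_trans (add _ _) _.
  by have := a1 k; have := b1 k; lra.
by move=> _.
Qed.

Lemma entire_dhatD f g m : entire f -> entire g -> dhat m (f + g) 0 = dhat m f 0 + dhat m g 0.
Proof.
move=> ef eg; have [c tc] := ef 0; have [d td] := eg 0.
rewrite (dhatE _ tc) (dhatE _ td) -scalerDr.
have /(dhatE m) // : taylor_expansion (f + g) 0 (fun m => c m + d m).
move: tc td => [hc [d1 d10 h1]] [hd [d2 d20 h2]].
split=> [k|]; first exact: hpolyD.
exists (Num.min d1 d2) => [|e e0]; first by rewrite lt_min d10.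
have e2 : 0 < e / 2 by rewrite divr_gt0.
have [N1 _ hN1] := h1 _ e2; have [N2 _ hN2] := h2 _ e2.
exists (maxn N1 N2) => // N /=; rewrite geq_max => /andP[n1 n2] x.
rewrite lt_min => /andP[x1 x2].
have -> : (f + g) x - \sum_(m < N) (c m + d m) (x - 0) =
  (f x - \sum_(m < N) c m (x - 0)) + (g x - \sum_(m < N) d m (x - 0)).
  by rewrite big_split /= opprD addrACA.
apply: le_lt_trans (rnormD _ _) _; rewrite [ltRHS]splitr ltrD//.
  exact: hN1.
exact: hN2.
Qed.

Lemma HNb_seminormD rho f g : 0 < rho -> HNb_set f -> HNb_set g ->
  (HNb_seminorm rho (f + g)%R <= HNb_seminorm rho f + HNb_seminorm rho g)%E.
Proof.
move=> rho0 [ef qf _] [eg qg _]; rewrite /HNb_seminorm.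
have pos h m : (0 <= (rho ^+ m / m`!%:R * quasi_nuclear_norm r q s p m (dhat m h 0))%:E)%E.
  by rewrite lee_fin; apply: HNb_term_ge0; exact: ltW.
rewrite -nneseriesD; [|by move=> *; exact: pos|by move=> *; exact: pos].
apply: lee_nneseries => m _; first by move=> _; exact: pos.
rewrite -EFinD lee_fin -mulrDr; apply: ler_wpM2l.
  by rewrite divr_ge0// exprn_ge0// ltW.
by rewrite entire_dhatD//; exact: quasi_nuclear_normD.
Qed.

End space.

(** * Neighbourhoods and continuous linear maps *)

Section topology.
Context {R : realType} (E : normedModType R[i]) (r q s p : R).
Hypothesis adm : admissible_exponents r q s p.
Local Open Scope complex_scope.
Local Notation C := R[i]^o.
Local Notation H := (HNb E r q s p).
Local Notation HNb_set := (@HNb_set R E r q s p).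
Local Notation HNb_seminorm := (@HNb_seminorm R E r q s p).
Local Notation HNb_ball := (@HNb_ball R E r q s p).
Local Notation hb := (hb r q s p).
Implicit Types (f g : H) (m n : nat) (x : E) (rho c d : R).

Lemma HNb_seminorm_ge0 rho f : 0 < rho -> (0 <= HNb_seminorm rho f)%E.
Proof.
by move=> r0; apply: nneseries_ge0 => m _ _; rewrite lee_fin; apply: HNb_term_ge0; exact: ltW.
Qed.

Lemma HNb_setB f g : HNb_set f -> HNb_set g -> HNb_set (f - g : E -> C).
Proof. by move=> hf hg; rewrite addrC -scaleN1r; exact: (HNb_set_lin adm). Qed.

Lemma HNb_ball_hb (i : H * (R * R)) f : [/\ HNb_set i.1, 0 < i.2.1 & 0 < i.2.2] ->
  HNb_ball i f -> exists2 c, 0 < c & forall rho d g, 2 * i.2.1 <= rho -> d <= c ->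
    hb rho d (g - f : E -> C) -> HNb_ball i g.
Proof.
case: i => [h [sg ep]] /= [hH s0 e0] [fH] /=.
have fhH := HNb_setB fH hH.
have n0 := HNb_seminorm_ge0 (f - h : E -> C) s0.
move En : (HNb_seminorm sg (f - h : E -> C)) n0 => v n0 ve.
case: v En n0 ve => [v| |]// En; rewrite lee_fin lte_fin => v0 ve.
exists ((ep - v) / 4%:R) => [|rho d g sr dc gf]; first by rewrite divr_gt0// subr_gt0.
have s20 : 0 <= 2 * sg by rewrite mulr_ge0// ltW.
have gf' : hb (2 * sg) d (g - f : E -> C) by exact: (hb_le s20 sr (lexx d) gf).
have gfH := hb_HNb_set adm gf'.
split=> /=.
  have -> : g = 1 *: (g - f : E -> C) + f by rewrite scale1r subrK.
  exact: (HNb_set_lin adm 1 gfH fH).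
have -> : (g - h : E -> C) = (g - f : E -> C) + (f - h : E -> C) by rewrite addrA subrK.
apply: (le_lt_trans (HNb_seminormD adm s0 gfH fhH)).
rewrite En; apply: (@le_lt_trans _ _ ((2 * d)%:E + v%:E)%E).
  by apply: leeD => //; exact: (hb_seminorm adm s0 gf').
by rewrite -EFinD lte_fin; lra.
Qed.

(** A ball of the subbase may have any centre; the triangle inequality provides
    a smaller one around the given point. *)
Lemma nbhs_hb f V : nbhs f V ->
  exists rho c, [/\ 0 < rho, 0 < c & forall g, hb rho c (g - f : E -> C) -> V g].
Proof.
rewrite nbhsE => -[B [[D' sD' <-] [A DA fA]] BV].
have [F0 sF0 AE] := sD' _ DA.
pose F := finmap.enum_fset F0 : seq (H * (R * R)).
have sF (k : H * (R * R)) : k \in F -> [/\ HNb_set k.1, 0 < k.2.1 & 0 < k.2.2].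
  by move=> kF; have := sF0 k kF; rewrite inE.
have Ff (k : H * (R * R)) : k \in F -> HNb_ball k f by move=> kF; move: fA; rewrite -AE; apply.
suff [rho [c [rho0 c0 h]]] : exists rho c, [/\ 0 < rho, 0 < c &
    forall g, hb rho c (g - f : E -> C) -> forall k : H * (R * R), k \in F -> HNb_ball k g].
  exists rho, c; split; [exact: rho0|exact: c0|move=> g gf; apply: BV; exists A; first exact: DA].
  rewrite -AE; move=> k kF; exact: (h g gf k kF).
suff : forall l : seq (H * (R * R)), {subset l <= F} -> exists rho c, [/\ 0 < rho, 0 < c &
    forall rho' d g, rho <= rho' -> d <= c -> hb rho' d (g - f : E -> C) ->
      forall k : H * (R * R), k \in l -> HNb_ball k g].
  move=> /(_ F (fun k h => h)) [rho [c [r0 c0 h]]].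
  exists rho, c; split; [exact: r0|exact: c0|move=> g gf k kF].
  exact: (h rho c g (lexx _) (lexx _) gf k kF).
elim=> [_|k l IH kl].
  by exists 1, 1; split; [exact: ltr01|exact: ltr01|].
have [rho [c [r0 c0 h]]] := IH (fun z zl => kl z (mem_behead (zl : z \in behead (k :: l)))).
have kF := kl k (mem_head _ _).
have [c' c'0 h'] := HNb_ball_hb (sF k kF) (Ff k kF).
exists (Num.max rho (2 * k.2.1)), (Num.min c c'); split; [by rewrite lt_max r0|by rewrite lt_min c0|].
move=> rho' d g; rewrite ge_max le_min => /andP[r1 r2] /andP[d1 d2] gf z.
rewrite inE => /orP[/eqP ->|zl]; first exact: (h' rho' d g r2 d2 gf).
exact: (h rho' d g r1 d1 gf z zl).
Qed.

Lemma hb_nbhs f rho c : HNb_set f -> 0 < rho -> 0 < c ->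
  nbhs f [set g | HNb_set g /\ hb rho c (g - f : E -> C)].
Proof.
move=> fH r0 c0; rewrite nbhsE; exists (HNb_ball (f, (rho, c))); [split|].
- exists [set HNb_ball (f, (rho, c))]; last by rewrite bigcup_set1.
  by move=> _ ->; apply: finI_from1; rewrite /=.
- split=> //=; rewrite (_ : (f - f)%R = (0 : E -> C)); last exact: subrr.
  apply: le_lt_trans (hb_seminorm adm r0 (hb0 E adm (2 * rho))) _.
  by rewrite mulr0 lte_fin.
- move=> g [gH gf]; split; first exact: gH.
  exact: (seminorm_hb adm (HNb_setB gH fH) r0 gf).
Qed.

(** A linear functional which is bounded near 0 is bounded, by homogeneity. *)
Lemma dual_hb (T : H -> C) : HNb_dual T ->
  exists rho K, [/\ 0 < rho, 0 <= K & forall c f, hb rho c f -> rnorm (T f) <= K * c].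
Proof.
move=> [lT /subspace_continuousP cT].
have H0 : HNb_set (0 : E -> C) by exact: (hb_HNb_set adm (hb0 E adm 1)).
have T0 : T (0 : E -> C) = 0.
  have := lT (-1) 0 0 H0 H0; rewrite scaler0 addr0 => ->.
  by rewrite scaleN1r addNr.
have cT0 : T @ within HNb_set (nbhs ((0 : E -> C) : H)) --> (0 : C).
  exact: (eq_ind _ (fun z => T @ within HNb_set (nbhs ((0 : E -> C) : H)) --> z) (cT _ H0) _ T0).
have hT := iffLR (cvgrPdist_lt _ _) cT0 _ ltr01.
have {}hT := hT (within_filter _ (nbhs_filter _)).
have [rho [c [r0 c0 h]]] := nbhs_hb (hT : nbhs ((0 : E -> C) : H) [set t | HNb_set t -> `|0 - T t| < 1]).
have small g : hb rho c g -> rnorm (T g) < 1.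
  move=> gc; have := h g; rewrite subr0 => /(_ gc (hb_HNb_set adm gc)).
  by rewrite /= sub0r normrN rnormE -[1]/(1%:C) ltcR.
exists rho, c^-1; split; [exact: r0|by rewrite invr_ge0 ltW|move=> d f fd].
apply/ler_addgt0Pr => e e0.
have d0 := hb_ge0 fd.
have ce : 0 < c * e by rewrite mulr_gt0.
pose t := c / (d + c * e); have t0 : 0 < t by rewrite divr_gt0// ltr_wpDl.
have ft : hb rho c (t%:C *: f : E -> C).
  apply: (hb_le (ltW r0) (lexx rho) _ (hbZ adm t%:C (ltW r0) fd)).
  rewrite rnormR gtr0_norm// /t mulrAC ler_pdivrMr ?ltr_wpDl//.
  by rewrite ler_wpM2l ?(ltW c0)// lerDl ltW.
have fH := hb_HNb_set adm fd.
have := small _ ft; have := lT t%:C f 0 fH H0; rewrite addr0 T0 addr0 => ->.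
rewrite rnormZr gtr0_norm// mulrC -ltr_pdivlMr// => /ltW; move/le_trans; apply.
by rewrite mul1r /t invf_div mulrC mulrDr mulrA mulVf ?gt_eqF// mul1r.
Qed.

Definition hb_bounded (L : H -> H) : Prop := forall sg : R, 0 < sg ->
  exists rho K, [/\ 0 < rho, 0 < K & forall c f, hb rho c f -> hb sg (K * c) (L f)].

Lemma hb_continuous (L : H -> H) : linear_on HNb_set L ->
  (forall f, HNb_set f -> HNb_set (L f)) ->
  hb_bounded L ->
  {within HNb_set, continuous L}.
Proof.
move=> lL HL bL; apply/subspace_continuousP => f fH V /nbhs_hb [sg [c [s0 c0 hV]]].
have [rho [K [r0 K0 hK]]] := bL sg s0.
have := hb_nbhs fH r0 (divr_gt0 c0 K0); apply: filterS => g [gH gf] _.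
apply: hV.
have -> : (L g - L f : E -> C) = L (g - f : E -> C).
  have := lL (-1) f g fH gH; rewrite !scaleN1r => h.
  rewrite [RHS](_ : _ = L (- f + g)); last by rewrite addrC.
  by rewrite h addrC.
by have := hK _ _ gf; rewrite mulrC divfK// gt_eqF.
Qed.

End topology.

(** * Convolution operators *)

Section convolution.
Context {R : realType} (E : normedModType R[i]) (r q s p : R).
Hypothesis adm : admissible_exponents r q s p.
Local Open Scope complex_scope.
Local Notation C := R[i]^o.
Local Notation H := (HNb E r q s p).
Local Notation HNb_set := (@HNb_set R E r q s p).
Local Notation nuclear := (nuclear r q s p).
Local Notation gauge := (@bipolar_gauge R E r q s p).
Local Notation formal := (@formal R E).
Local Notation bnd := (bnd r q s p).
Local Notation tfun := (tfun r q s p).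
Local Notation rep := (rep r q s p).
Local Notation hb := (hb r q s p).
Implicit Types (f g : E -> C) (m n k : nat) (x : E) (rho c d e : R) (u : formal).

Definition fmono n (v : seq (R[i] * dual E)) : formal := [seq (n, w) | w <- v].

Lemma ev_fmono n v x : ev (fmono n v) x = power_sum n v x.
Proof. by rewrite power_sumE /ev /fmono big_map. Qed.

Lemma hpart_fmono m n v : hpart m (fmono n v) = if m == n then power_sum n v else 0.
Proof.
rewrite /hpart /deg filter_map -map_comp; case: eqP => [->|mn].
  by rewrite (eq_filter (a2 := predT)) ?filter_predT ?map_id// => w /=; rewrite eqxx.
rewrite (eq_filter (a2 := pred0)) ?filter_pred0 /power_sum ?big_nil// => w /=.
by apply/eqP => nm; apply: mn.
Qed.

Lemma bnd_fmono rho c n v : 0 <= rho -> ngauge r q s p n (power_sum n v) <= c ->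
  bnd rho (rho ^+ n * c) (fmono n v).
Proof.
move=> r0 vc m; rewrite /mag hpart_fmono; case: eqP => [->|_].
  by rewrite ler_wpM2l ?exprn_ge0.
by rewrite (ngauge0 E adm) mulr0 mulr_ge0 ?exprn_ge0 ?(le_trans (ngauge_ge0 _ _ _ _ _ _) vc).
Qed.

Lemma fsub_fmono n v w : fsub (fmono n v) (fmono n w) = fmono n (v ++ [seq (-1 * z.1, z.2) | z <- w]).
Proof. by rewrite /fsub /fmono /fscale map_cat -!map_comp. Qed.

Lemma rep_ev u : rep (ev u) (fun=> u).
Proof.
split=> [rho e r0 e0|x]; last exact: cvgs_cst.
exists 0%N => i j _ _ m; rewrite /mag hpart_sub subrr (ngauge0 E adm) mulr0; exact: ltW.
Qed.

Lemma hb_ev rho c u : bnd rho c u -> hb rho c (ev u).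
Proof. by move=> uc; exists (fun=> u) => //; exact: rep_ev. Qed.

Lemma evE_power n (phi : dual E) : ev [:: (n, (1, phi))] = power n phi.
Proof. by apply/funext => x; rewrite /ev big_seq1 /= mul1r. Qed.

Lemma hb_power rho n (phi : dual E) : 0 <= rho -> hb rho ((rho * rnorm phi) ^+ n) (power n phi).
Proof.
move=> r0; rewrite -evE_power exprMn; apply: hb_ev.
rewrite -[X in bnd _ _ X]/(fmono n [:: (1, phi)]); apply: bnd_fmono => //.
by rewrite /power_sum big_seq1 scale1r; exact: (ngauge_power adm).
Qed.

Lemma nuclear_hb n f rho e : nuclear n.+1 f -> 0 < rho -> 0 < e ->
  hb rho (rho ^+ n.+1 * (gauge n.+1 f + e)) f.
Proof.
move=> nf r0 e0.
have pos k : 0 < e * 2^-1 ^+ k by rewrite mulr_gt0// exprn_gt0 ?invr_gt0.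
have /choice[v hv] : forall k, exists v, gauge n.+1 (power_sum n.+1 v - f) <= e * 2^-1 ^+ k.
  by move=> k; exact: (nuclear_approx adm nf (pos k)).
have nv k := nuclear_power_sum adm n (v k).
have dec k l : (k <= l)%N -> 2^-1 ^+ l <= 2^-1 ^+ k :> R.
  by move=> kl; rewrite ler_wiXn2l ?invr_ge0// invf_le1 ?ler1n.
have lim d : 0 < d -> exists k, e * 2^-1 ^+ k <= d.
  move=> d0; have cv : (fun k => 2^-1 ^+ k) @ \oo --> (0 : R).
    by apply: cvg_expr; rewrite ger0_norm ?invr_ge0// invf_lt1 ?ltr1n.
  have [N _ hN] := (iffLR (cvgrPdist_le _ _) cv) _ (divr_gt0 d0 e0); exists N.
  have := hN N (leqnn N); rewrite /= sub0r normrN ger0_norm ?exprn_ge0 ?invr_ge0//.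
  by rewrite ler_pdivlMr// mulrC.
exists (fun k => fmono n.+1 (v k)).
  split=> [sg d s0 d0|x].
    have sd : 0 < d / 2 / sg ^+ n.+1 by rewrite !divr_gt0// exprn_gt0.
    have [N hN] := lim _ sd.
    exists N => i j Ni Nj; rewrite fsub_fmono.
    have -> : d = sg ^+ n.+1 * (d / sg ^+ n.+1) by rewrite mulrC divfK// gt_eqF// exprn_gt0.
    apply: bnd_fmono; first exact: ltW.
    rewrite power_sum_cat power_sum_scale scaleN1r /=.
    apply: le_trans (gauge_triangle adm (nv i) nf (nv j)) _.
    rewrite (gauge_sym adm nf (nv j)).
    have h k : (N <= k)%N -> gauge n.+1 (power_sum n.+1 (v k) - f) <= d / 2 / sg ^+ n.+1.
      by move=> Nk; apply: le_trans (hv k) (le_trans _ hN); rewrite ler_wpM2l ?dec// ltW.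
    have -> : d / sg ^+ n.+1 = d / 2 / sg ^+ n.+1 + d / 2 / sg ^+ n.+1.
      by rewrite -mulrDl -splitr.
    by apply: lerD; exact: h.
  have x1 : 0 < rnorm x ^+ n.+1 + 1 by rewrite ltr_wpDl ?exprn_ge0 ?rnorm_ge0.
  move=> d d0; have [N hN] := lim _ (divr_gt0 d0 x1); exists N => k Nk.
  rewrite ev_fmono; have cl := closedB (fun (a : R[i]) f g => @nuclear_lin R E r q s p adm n f g a).
  have := gauge_eval adm x (cl _ _ (nv k) nf); move/le_lt_trans; apply.
  apply: (@le_lt_trans _ _ (d / (rnorm x ^+ n.+1 + 1) * rnorm x ^+ n.+1)).
    rewrite ler_wpM2r ?exprn_ge0 ?rnorm_ge0//; apply: le_trans (hv k) (le_trans _ hN).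
    by rewrite ler_wpM2l ?dec// ltW.
  by rewrite mulrAC ltr_pdivrMr// ltr_pM2l// ltrDl.
move=> k; apply: bnd_fmono; first exact: ltW.
have := gauge_triangle adm (nv k) nf (nuclear0 E adm n); rewrite !subr0 /= => h.
apply: le_trans h _; rewrite addrC lerD2l; apply: le_trans (hv k) _.
by rewrite ler_piMr ?(ltW e0)// exprn_ile1 ?invr_ge0// invf_le1 ?ler1n.
Qed.

(** Density of the polynomials of finite type. *)
Lemma rep_tail_hb f a rho e : rep f a -> 0 < rho -> 0 < e ->
  exists N, forall i, (N <= i)%N -> hb rho e (f - ev (a i)).
Proof.
move=> fa r0 e0; have [ca _] := fa; have [N hN] := ca rho e r0 e0.
exists N => i Ni; exists (fun j => fsub (a (N + j)%N) (a i)).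
  exact: (rep_subf adm (rep_sub N fa) (rep_ev (a i))).
by move=> j; apply: hN; rewrite ?leq_addr.
Qed.

Section functional.
Variable T : H -> C.
Hypothesis T_dual : HNb_dual T.
Variables (rho K : R).
Hypotheses (rho0 : 0 < rho) (K0 : 0 <= K).
Hypothesis TK : forall c f, hb rho c f -> rnorm (T f) <= K * c.
Let lT := T_dual.1.

Lemma dual_hbB f g c : HNb_set f -> HNb_set g -> hb rho c (f - g) -> rnorm (T f - T g) <= K * c.
Proof.
move=> fH gH fg; apply: le_trans (TK fg); rewrite le_eqVlt; apply/orP; left; apply/eqP.
have -> : f - g = (-1) *: g + f by rewrite scaleN1r addrC.
have := lT (-1) gH fH => ->.
by rewrite scaleN1r [- T g + _]addrC.
Qed.

Lemma dual_rep f a : rep f a -> cvgs (fun i => T (ev (a i))) (T f).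
Proof.
move=> fa e e0; have K1 : 0 < K + 1 by rewrite ltr_wpDl.
have [N hN] := rep_tail_hb fa rho0 (divr_gt0 e0 K1); exists N => i Ni.
rewrite rnormBC.
have := dual_hbB (rep_HNb_set adm fa) (rep_HNb_set adm (rep_ev (a i))) (hN i Ni).
move/le_lt_trans; apply; rewrite mulrCA -ltr_pdivlMl// mulVf ?gt_eqF//.
by rewrite ltr_pdivrMr// mul1r ltrDl.
Qed.

Lemma dual_ev u : T (ev u) = \sum_(t <- u) t.2.1 * T (power t.1 t.2.2).
Proof.
have H0 : HNb_set (0 : E -> C) := rep_HNb_set adm (rep0 E adm).
elim: u => [|t u IH].
  rewrite big_nil; have -> : ev [::] = (0 : E -> C) by apply/funext => x; rewrite /ev big_nil.
  have := lT (-1) H0 H0; rewrite scaler0 addr0 => ->.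
  by rewrite scaleN1r addNr.
have -> : ev (t :: u) = t.2.1 *: power t.1 t.2.2 + ev u.
  by apply/funext => x; rewrite /ev big_cons.
rewrite big_cons -IH; apply: lT; last exact: rep_HNb_set (rep_ev u).
by rewrite -evE_power; exact: rep_HNb_set (rep_ev _).
Qed.

(** A nuclear polynomial of degree [j] has a single Taylor term, so that the bound
    of [T] at the radius [rho] is a bound by the gauge. *)
Lemma tfun_dual j : tfun j (K * rho ^+ j) T.
Proof.
case: j => [|n] /=.
  have := TK (hb_power 0 0 (ltW rho0)).
  by rewrite !expr0.
have nH f : nuclear n.+1 f -> HNb_set f.
  by move=> nf; exact: (hb_HNb_set adm (nuclear_hb nf rho0 ltr01)).
split=> [z f g nf ng|f nf]; first by apply: lT; exact: nH.
apply/ler_addgt0Pr => e e0.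
have B0 : 0 < K * rho ^+ n.+1 + 1 by rewrite ltr_wpDl// mulr_ge0// exprn_ge0// ltW.
have := TK (nuclear_hb nf rho0 (divr_gt0 e0 B0)); move/le_trans; apply.
rewrite mulrA mulrDr lerD2l mulrCA ler_piMr ?(ltW e0)//.
by rewrite ler_pdivrMr// mul1r lerDl.
Qed.

(** The binomial formula is symmetric in the translation and the evaluation of
    [T]. *)
Lemma conv_ev u x : ev (fcon (fun j phi => T (power j phi)) u) x = T (ev (formal_shift x u)).
Proof.
rewrite dual_ev ev_fcon /formal_shift /fcon big_flatten big_map; apply: eq_bigr => t _.
rewrite big_map mulr_sumr.
rewrite -[iota 0 t.1.+1]/(index_iota 0 t.1.+1) big_mkord.
rewrite (reindex_inj rev_ord_inj) /=; apply: eq_bigr => k _.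
have kt : (k <= t.1)%N by rewrite -ltnS.
rewrite subSS (bin_sub kt) subKn// /evals /power -!mulrA; congr (_ * (_ * _)).
exact: mulrC.
Qed.

Lemma rep_conv f a : rep f a ->
  rep (Gamma_bar T f) (fun i => fcon (fun j phi => T (power j phi)) (a i)).
Proof.
move=> fa; apply: (rep_contract adm (t := fun=> T) fa K0 (ltW rho0)) => [j|x].
  exact: tfun_dual.
apply: (cvgs_eq (fun i => esym (conv_ev (a i) x))).
have -> : Gamma_bar T f x = T (fun y => f (x + y)).
  rewrite /Gamma_bar /convolution_product /translation; congr T.
  by apply/funext => y; rewrite opprK addrC.
exact: (dual_rep (rep_translation adm x fa)).
Qed.

Lemma hb_conv sg c f : 0 < sg -> hb (2 * (rho + sg)) c f -> hb sg (2 * K * c) (Gamma_bar T f).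
Proof.
move=> s0 [a fa ac]; exists (fun i => fcon (fun j phi => T (power j phi)) (a i)).
  exact: rep_conv.
by move=> i; apply: (bnd_fcon adm (t := fun=> T) K0 (ltW rho0) (ltW s0) tfun_dual (ac i)).
Qed.

Lemma translation_HNb_set x f : HNb_set f -> HNb_set (translation x f).
Proof.
move=> /(HNb_rep adm)[a fa].
have -> : translation x f = fun y => f (- x + y) by apply/funext => y; rewrite addrC.
exact: (rep_HNb_set adm (rep_translation adm (- x) fa)).
Qed.

Lemma conv_bounded : hb_bounded (Gamma_bar T).
Proof.
move=> sg s0; exists (2 * (rho + sg)), (2 * K + 1); split.
- by rewrite mulr_gt0// addr_gt0.
- by rewrite ltr_wpDl// mulr_ge0.
- move=> c f fc; apply: (hb_le (ltW s0) (lexx sg) _ (hb_conv s0 fc)).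
  by rewrite ler_wpM2r ?(hb_ge0 fc)// lerDl.
Qed.

Lemma conv_operator : convolution_operator (Gamma_bar T).
Proof.
have LH f : HNb_set f -> HNb_set (Gamma_bar T f).
  by move=> /(HNb_rep adm)[a fa]; exact: (rep_HNb_set adm (rep_conv fa)).
have Llin : linear_on HNb_set (Gamma_bar T).
  move=> z f g fH gH; apply/funext => x.
  exact: (lT z (translation_HNb_set (- x) fH) (translation_HNb_set (- x) gH)).
split; [exact: LH|exact: Llin| |].
- exact: (hb_continuous adm Llin LH conv_bounded).
- move=> x f _; apply/funext => y.
  rewrite /Gamma_bar /convolution_product /translation; congr T.
  by apply/funext => z; rewrite !opprK addrA.
Qed.

Lemma conv_at0 f : Gamma_bar T f 0 = T f.
Proof.
rewrite /Gamma_bar /convolution_product /translation; congr T.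
by apply/funext => y; rewrite oppr0 subr0.
Qed.

End functional.

End convolution.

(** * Completeness and a hypercyclicity criterion *)

Section completeness.
Context {R : realType} (E : normedModType R[i]) (r q s p : R).
Hypothesis adm : admissible_exponents r q s p.
Local Open Scope complex_scope.
Local Notation C := R[i]^o.
Local Notation HNb_set := (@HNb_set R E r q s p).
Local Notation formal := (@formal R E).
Local Notation bnd := (bnd r q s p).
Local Notation mag := (mag r q s p).
Local Notation fcauchy := (fcauchy r q s p).
Local Notation rep := (rep r q s p).
Local Notation hb := (hb r q s p).
Implicit Types (f g : E -> C) (x : E).

Lemma half_decay (e : nat -> R) : (forall i, 0 < e i) -> (forall i, e i.+1 <= e i / 2) ->
  forall k l, (k <= l)%N -> \sum_(k <= i < l) e i <= 2 * e k.
Proof.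
move=> e0 eh k l kl; suff : \sum_(k <= i < l) e i <= 2 * e k - 2 * e l.
  by move/le_trans; apply; rewrite gerBl mulr_ge0// ltW.
rewrite -(subnKC kl); elim: (l - k)%N => [|n IH].
  by rewrite addn0 big_geq// subrr.
rewrite addnS big_nat_recr ?leq_addr//=.
by have := eh (k + n)%N; move: IH; lra.
Qed.

Definition glue (a0 : nat -> formal) (d : nat -> nat -> formal) k j : formal :=
  a0 j ++ flatten [seq d i j | i <- iota 0 k].

Lemma hpart_glue a0 d k l j m : (k <= l)%N ->
  hpart m (glue a0 d l j) = hpart m (glue a0 d k j) + hpart m (flatten [seq d i j | i <- iota k (l - k)]).
Proof.
move=> kl; rewrite /glue !hpart_cat -addrA; congr (_ + _).
by rewrite -hpart_cat -flatten_cat -map_cat -{1}(subnKC kl) iotaD add0n.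
Qed.

Lemma bnd_flatten (rho : R) (d : nat -> formal) (e : nat -> R) k n : 0 <= rho ->
  (forall i, (k <= i < k + n)%N -> bnd rho (e i) (d i)) ->
  bnd rho (\sum_(k <= i < k + n) e i) (flatten [seq d i | i <- iota k n]).
Proof.
move=> r0; elim: n => [|n IH] h.
  by rewrite addn0 big_geq// => m; rewrite (mag_nil _ adm) mulr0.
have -> : iota k n.+1 = iota k n ++ [:: (k + n)%N] by rewrite -addn1 iotaD.
rewrite map_cat flatten_cat addnS big_nat_recr ?leq_addr//= cats0.
apply: (bnd_cat adm r0).
  by apply: IH => i /andP[ki ik]; apply: h; rewrite ki addnS ltnW.
by apply: h; rewrite leq_addr addnS /=.
Qed.

(** The norms of the completion are infima over approximating sequences, so the
    estimates are made on the formal polynomials: those for [g k.+1] prolong those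
    for [g k] by a sequence for the increment, and a diagonal sequence is Cauchy. *)
Lemma hb_complete (g : nat -> E -> C) (rho e : nat -> R) : HNb_set (g 0%N) ->
  (forall i, hb (rho i) (e i) (g i.+1 - g i)) ->
  (forall i, 2 ^+ i <= rho i) -> (forall i, rho i <= rho i.+1) ->
  (forall i, 0 < e i) -> (forall i, e i.+1 <= e i / 2) ->
  exists F, forall k, hb (rho k) (2 * e k) (F - g k).
Proof.
move=> gH gd rho2 rhoS e0 eh.
have rho0 i : 0 < rho i by rewrite (lt_le_trans _ (rho2 i))// exprn_gt0.
have rho_le k l : (k <= l)%N -> rho k <= rho l.
  move=> kl; rewrite -(subnKC kl); elim: (l - k)%N => [|n IH]; first by rewrite addn0.
  by rewrite addnS (le_trans IH).
have [a0 ga] := HNb_rep adm gH.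
have /choice[d hd] : forall i, exists a, rep (g i.+1 - g i) a /\ forall j, bnd (rho i) (e i) (a j).
  by move=> i; have [a h1 h2] := gd i; exists a; split; [exact: h1|exact: h2].
pose a := glue a0 d.
have dn k j l : (k <= l)%N -> bnd (rho k) (2 * e k) (flatten [seq d i j | i <- iota k (l - k)]).
  move=> kl; apply: (@bnd_le R E r q s p (rho k) (rho k) (\sum_(k <= i < k + (l - k)) e i)) => //.
  - exact: ltW.
  - by rewrite subnKC//; exact: half_decay.
  - apply: bnd_flatten => [|i /andP[ki _]]; first exact: ltW.
    by apply: (@bnd_le R E r q s p (rho i) (rho k) (e i)) => //; [exact: ltW|exact: rho_le|exact: (hd i).2].
have arep k : rep (g k) (a k).
  elim: k => [|k IH].
    have -> : a 0%N = a0 by apply/funext => j; rewrite /a /glue /= cats0.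
    exact: ga.
  have -> : g k.+1 = 1 *: g k + (g k.+1 - g k) by rewrite scale1r addrC subrK.
  have [h1 h2] := rep_lin adm 1 IH (hd k).1.
  split=> [sg c sg0 c0|x].
    have [N hN] := h1 sg c sg0 c0; exists N => i j Ni Nj m.
    have E1 l : hpart m (a k.+1 l) = hpart m (fscale 1 (a k l) ++ d k l).
      rewrite [LHS](hpart_glue a0 d l m (leqnSn k)) subSnn /= cats0.
      by rewrite (hpart_cat m (fscale 1 (a k l))) hpart_scale scale1r.
    by have := hN i j Ni Nj m; rewrite /mag !hpart_sub !E1.
  apply: (cvgs_eq _ (h2 x)) => j; rewrite (ev_cat (fscale 1 (a k j))) ev_scale mul1r.
  have -> : a k.+1 j = a k j ++ d k j.
    have ik : iota 0 k.+1 = iota 0 k ++ [:: k] by rewrite -addn1 iotaD.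
    by rewrite /a /glue ik map_cat flatten_cat catA /= cats0.
  by rewrite (ev_cat (a k j)).
have /choice[th hth] : forall k, exists N, forall i j, (N <= i)%N -> (N <= j)%N ->
    bnd (rho k) (e k) (fsub (a k i) (a k j)).
  by move=> k; have [+ _] := arep k; apply; [exact: rho0|exact: e0].
pose N k := (\max_(j < k.+1) th j + k)%N.
have Nk k : (k <= N k)%N by rewrite leq_addl.
have Nth k l : (k <= l)%N -> (th k <= N l)%N.
  move=> kl; rewrite /N; apply: (@leq_trans (\max_(j < l.+1) th j)); last exact: leq_addr.
  exact: (leq_bigmax (F := fun j : 'I_l.+1 => th j) (Ordinal (kl : (k < l.+1)%N))).
pose A k := a k (N k).
have AB k l : (k <= l)%N -> bnd (rho k) (3%:R * e k) (fsub (A k) (A l)).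
  move=> kl m.
  have h1 := hth k _ _ (Nth k k (leqnn k)) (Nth k l kl).
  have h2 := dn k (N l) l kl.
  have := bnd_sub adm (ltW (rho0 k)) h1 h2 m.
  rewrite /mag !hpart_sub /A (hpart_glue a0 d (N l) m kl) -/(a k) opprD addrA => h.
  by apply: le_trans h _; lra.
have small (c : R) : 0 < c -> exists K, forall k, (K <= k)%N -> e k <= c.
  move=> c0; have ek k : e k <= e 0%N * 2^-1 ^+ k.
    elim: k => [|k IH]; first by rewrite expr0 mulr1.
    by rewrite (le_trans (eh k))// exprSr mulrA ler_wpM2r ?invr_ge0.
  have cv : (fun k => 2^-1 ^+ k) @ \oo --> (0 : R).
    by apply: cvg_expr; rewrite ger0_norm ?invr_ge0// invf_lt1 ?ltr1n.
  have [K _ hK] := (iffLR (cvgrPdist_le _ _) cv) _ (divr_gt0 c0 (e0 0%N)); exists K => k Kk.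
  have := hK k Kk; rewrite /= sub0r normrN ger0_norm ?exprn_ge0 ?invr_ge0// ler_pdivlMr// mulrC.
  exact: le_trans.
have large (c : R) : 0 <= c -> exists K, forall k, (K <= k)%N -> c <= rho k.
  move=> c0; exists (Num.bound c) => k ck; apply: le_trans (rho2 k).
  apply: (le_trans (ltW (archi_boundP c0))); apply: (@le_trans _ _ k%:R); first by rewrite ler_nat.
  by rewrite -natrX ler_nat ltnW// ltn_expl.
have cA : fcauchy A.
  move=> sg c sg0 c0; have [K1 hK1] := small (c / 3%:R) ltac:(by rewrite divr_gt0).
  have [K2 hK2] := large sg (ltW sg0).
  have half k l : (maxn K1 K2 <= k)%N -> (k <= l)%N -> bnd sg c (fsub (A k) (A l)).
    rewrite geq_max => /andP[k1 k2] kl.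
    apply: (@bnd_le R E r q s p (rho k) sg (3%:R * e k)) (AB k l kl); [exact: ltW|exact: hK2|].
    by rewrite mulrC -ler_pdivlMr// hK1.
  exists (maxn K1 K2) => k l Kk Kl; have [kl|/ltnW lk] := leqP k l; first exact: half.
  by apply: (bnd_sub_sym adm); [exact: ltW|exact: half].
have [F FA] := fcauchy_rep adm cA; exists F => k.
exists (fun l => fsub (A (k + l)%N) (a k (N (k + l)%N))); last first.
  move=> l m; have := dn k (N (k + l)%N) (k + l)%N (leq_addr _ _) m.
  rewrite /mag hpart_sub /A (hpart_glue a0 d _ m (leq_addr l k)) -/(a k).
  by rewrite [X in ngauge _ _ _ _ _ (X - _)]addrC addrK.
have Nle l : (l <= N (k + l))%N by rewrite (leq_trans _ (Nk _))// leq_addl.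
have krep : rep (g k) (fun l => a k (N (k + l)%N)).
  have [h1 h2] := arep k; split=> [sg c sg0 c0|x].
    have [M hM] := h1 sg c sg0 c0; exists M => i j Mi Mj.
    by apply: hM; [exact: leq_trans Mi (Nle i)|exact: leq_trans Mj (Nle j)].
  exact: (cvgs_sub (k := fun l => N (k + l)%N) Nle (h2 x)).
exact: (rep_subf adm (rep_sub k FA) krep).
Qed.

End completeness.

Section criterion.
Context {R : realType} (E : normedModType R[i]) (r q s p : R).
Hypothesis adm : admissible_exponents r q s p.
Local Open Scope complex_scope.
Local Notation C := R[i]^o.
Local Notation H := (HNb E r q s p).
Local Notation HNb_set := (@HNb_set R E r q s p).
Local Notation hb := (hb r q s p).
Implicit Types (f g F : E -> C).

Variable L : H -> H.
Hypothesis L_lin : linear_on HNb_set L.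
Hypothesis L_set : forall f, HNb_set f -> HNb_set (L f).
Hypothesis L_bounded : hb_bounded L.

Lemma iter_set n f : HNb_set f -> HNb_set (iter n L f).
Proof. by move=> fH; elim: n => [//|n IH]; exact: L_set. Qed.

Lemma iter_lin n : linear_on HNb_set (iter n L).
Proof.
elim: n => [//|n IH] z f g fH gH /=.
by rewrite IH//; apply: L_lin; exact: iter_set.
Qed.

Lemma iter_bounded n : hb_bounded (iter n L).
Proof.
elim: n => [|n IH] sg s0.
  exists sg, 1; split; [exact: s0|exact: ltr01|by move=> c f; rewrite mul1r].
have [rho [K [r0 K0 h]]] := L_bounded s0; have [rho' [K' [r'0 K'0 h']]] := IH rho r0.
exists rho', (K * K'); split; [exact: r'0|exact: mulr_gt0|move=> c f fc /=].
by rewrite -mulrA; apply: h; exact: h'.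
Qed.

Lemma HNb_shift f g (rho c : R) : HNb_set g -> hb rho c (f - g) -> HNb_set f.
Proof.
move=> gH fg; have -> : f = 1 *: (f - g) + g by rewrite scale1r subrK.
exact: (HNb_set_lin adm 1 (hb_HNb_set adm fg) gH).
Qed.

Lemma hb_trans (rho c d : R) f g F : 0 <= rho -> hb rho c (f - g) -> hb rho d (g - F) ->
  hb rho (c + d) (f - F).
Proof.
move=> r0 h1 h2; have -> : f - F = (f - g) + (g - F) by rewrite addrA subrK.
exact: (hbD adm r0 h1 h2).
Qed.

(** The orbit of the limit of suitable successive perturbations visits a
    neighbourhood of every element of a countable dense family; the radius and
    the tolerance attached to a step keep the later perturbations from spoiling
    it. *)
Lemma hypercyclic_criterion (y : nat -> E -> C) :
  (forall f (rho e : R), HNb_set f -> 0 < rho -> 0 < e -> exists k, hb rho e (f - y k)) ->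
  (forall f k (rho e : R), HNb_set f -> 0 < rho -> 0 < e ->
     exists f' n, hb rho e (f' - f) /\ hb rho e ((iter n L f' : E -> C) - y k)) ->
  hypercyclic_on HNb_set L.
Proof.
move=> dense trans.
pose pr n : nat * nat := odflt (0%N, 0%N) (unpickle n).
pose P n (t : (E -> C) * (R * R)) := [/\ HNb_set t.1, 2 ^+ n <= t.2.1, 0 < t.2.2 & t.2.2 <= 2^-1 ^+ n].
pose Q n (t t' : (E -> C) * (R * R)) := [/\ hb t.2.1 t.2.2 (t'.1 - t.1),
  t.2.1 <= t'.2.1, t'.2.2 <= t.2.2 / 2 &
  exists m, forall F, hb t'.2.1 (2 * t'.2.2) (F - t'.1) ->
    hb (2 ^+ (pr n).2) (2 * 2^-1 ^+ (pr n).2) ((iter m L F : E -> C) - y (pr n).1)].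
have H0 : HNb_set (0 : E -> C) := hb_HNb_set adm (hb0 E adm 1).
have [|n [f [rh e]] /= [fH r2 e0 e2]|t [t0 ht]] := @sequential_choice _ P Q (0, (1, 1)).
- by split; rewrite ?expr0 //=; exact: H0.
- case Ek : (pr n) => [k j].
  have rh0 : 0 < rh by rewrite (lt_le_trans _ r2)// exprn_gt0.
  have j0 : 0 < 2 ^+ j :> R by rewrite exprn_gt0.
  have j'0 : 0 < 2^-1 ^+ j :> R by rewrite exprn_gt0 ?invr_gt0.
  have m1 : 0 < Num.max rh (2 ^+ j) by rewrite lt_max rh0.
  have m2 : 0 < Num.min e (2^-1 ^+ j) by rewrite lt_min e0.
  have [f' [m [ff' Lf']]] := trans f k _ _ fH m1 m2.
  have [rho1 [K1 [r10 K10 hK]]] := iter_bounded m j0.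
  have f'H := HNb_shift fH ff'.
  pose rh' := Num.max (Num.max (2 ^+ n.+1) rh) rho1.
  pose e' := Num.min (e / 2) (Num.min (2^-1 ^+ n.+1) (2^-1 ^+ j / (2 * K1))).
  have e'0 : 0 < e'.
    by rewrite !lt_min !divr_gt0//= ?mulr_gt0// exprn_gt0 ?invr_gt0.
  exists (f', (rh', e')); split => /=.
  + exact: f'H.
  + by rewrite !le_max lexx.
  + exact: e'0.
  + by rewrite !ge_min lexx /= orbT.
  + apply: (hb_le _ _ _ ff'); [exact: ltW|by rewrite le_max lexx|by rewrite ge_min lexx].
  + by rewrite !le_max lexx /= orbT.
  + by rewrite ge_min lexx.
  + rewrite Ek /=; exists m => F FF'.
    have FH := HNb_shift f'H FF'.
    have -> : 2 * 2^-1 ^+ j = 2^-1 ^+ j + 2^-1 ^+ j :> R by ring.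
    apply: (@hb_trans _ _ _ _ (iter m L f' : E -> C)); first exact: ltW.
      have -> : ((iter m L F : E -> C) - iter m L f') = iter m L (F - f').
        have := iter_lin m (-1) f'H FH; rewrite !scaleN1r => h.
        by rewrite [F - f']addrC [RHS]h addrC.
      have F1 : hb rho1 (2 * e') (F - f').
        by apply: (hb_le _ _ _ FF'); [exact: ltW|rewrite !le_max lexx orbT|].
      apply: (hb_le _ _ _ (hK _ _ F1)); [exact: ltW|exact: lexx|].
      have e'K : e' <= 2^-1 ^+ j / (2 * K1) by rewrite /e' !ge_min lexx !orbT.
      rewrite mulrA [K1 * 2]mulrC -ler_pdivlMl ?mulr_gt0//.
      by rewrite [leRHS]mulrC.
    by apply: (hb_le _ _ _ Lf'); [exact: ltW|rewrite le_max lexx orbT|rewrite ge_min lexx orbT].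
have tP n : P n (t n) by have [] := ht n.
have tQ n : Q n (t n) (t n.+1) by have [] := ht n.
have [F hF] : exists F, forall k, hb (t k).2.1 (2 * (t k).2.2) (F - (t k).1).
  apply: (hb_complete adm (g := fun k => (t k).1) (rho := fun k => (t k).2.1) (e := fun k => (t k).2.2)).
  - by have [] := tP 0%N.
  - by move=> i; have [] := tQ i.
  - by move=> i; have [] := tP i.
  - by move=> i; have [] := tQ i.
  - by move=> i; have [] := tP i.
  - by move=> i; have [] := tQ i.
have FH : HNb_set F by apply: HNb_shift (hF 0%N); have [] := tP 0%N.
exists F => // f fH V /(nbhs_hb adm) [rho [c [r0 c0 hV]]].
have [k hk] := dense f rho (c / 2) fH r0 ltac:(by rewrite divr_gt0).
have cv : (fun k => 2^-1 ^+ k) @ \oo --> (0 : R).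
  by apply: cvg_expr; rewrite ger0_norm ?invr_ge0// invf_lt1 ?ltr1n.
have [N _ hN] := (iffLR (cvgrPdist_le _ _) cv) _ (divr_gt0 c0 (ltac:(by []) : 0 < 4%:R)).
pose j := maxn N (Num.bound rho).
have jr : rho <= 2 ^+ j.
  apply: (le_trans (ltW (archi_boundP (ltW r0)))); apply: (@le_trans _ _ j%:R).
    by rewrite ler_nat leq_maxr.
  by rewrite -natrX ler_nat ltnW// ltn_expl.
have jc : 2 * 2^-1 ^+ j <= c / 2.
  have := hN j (leq_maxl _ _); rewrite /= sub0r normrN ger0_norm ?exprn_ge0 ?invr_ge0//.
  lra.
have [_ _ _ [m hm]] := tQ (pickle (k, j)).
rewrite /pr pickleK /= in hm.
exists (iter m L F); split; first by exists m.
apply: hV; rewrite (splitr c).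
have r0' := ltW r0.
apply: (@hb_trans _ _ _ _ (y k)) => //.
  exact: (hb_le _ jr jc (hm _ (hF _))).
have -> : y k - f = - (f - y k) by rewrite opprB.
exact: (hbN adm r0' hk).
Qed.

End criterion.

(** * One complex variable: the exponential, interpolation and Liouville's theorem *)

Section one_variable.
Context {R : realType}.
Local Open Scope complex_scope.
Local Notation C := R[i]^o.
Implicit Types (z w : C).

Lemma exp_decay (B e : R) : 0 < e -> exists N, forall m, (N <= m)%N -> B ^+ m / m`!%:R <= e.
Proof.
move=> e0; have [N _ hN] := iffLR (cvgrPdist_le _ _) (cvg_exp_coeff B) _ e0.
exists N => m /hN /=; rewrite sub0r normrN; apply: le_trans; exact: ler_norm.
Qed.

Definition cexp z : C := xget 0 [set l | cvgs (fun N => \sum_(m < N) z ^+ m / m`!%:R) l].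

Lemma cexp_cvgs z : cvgs (fun N => \sum_(m < N) z ^+ m / m`!%:R) (cexp z).
Proof.
have [|l hl] := @summable_cvgs R (fun m => z ^+ m / m`!%:R) (expR (rnorm z)).
  move=> N; have -> : \sum_(j < N) rnorm (z ^+ j / j`!%:R : C) = \sum_(0 <= j < N) exp_coeff (rnorm z) j.
    by rewrite big_mkord; apply: eq_bigr => j _; rewrite rnormM rnormX rnormV rnorm_nat.
  apply: nondecreasing_cvgn_le; last exact: is_cvg_series_exp_coeff.
  apply/nondecreasing_seqP => n; rewrite /series /= big_nat_recr//= lerDl.
  exact: exp_coeff_ge0 (rnorm_ge0 z).
by rewrite /cexp; case: xgetP => // /(_ l) /(_ hl).
Qed.

Lemma cvgsM2 (u v : nat -> C) (z w : C) : cvgs u z -> cvgs v w -> cvgs (fun n => u n * v n) (z * w).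
Proof.
move=> uz vw e e0.
have z1 : 0 < rnorm z + 1 by rewrite ltr_wpDl ?rnorm_ge0.
have w1 : 0 < rnorm w + 1 by rewrite ltr_wpDl ?rnorm_ge0.
have [N1 h1] := uz (Num.min 1 (e / 2 / (rnorm w + 1))) ltac:(by rewrite lt_min ltr01 !divr_gt0).
have [N2 h2] := vw (e / 2 / (rnorm z + 1)) ltac:(by rewrite !divr_gt0).
exists (maxn N1 N2) => n; rewrite geq_max => /andP[/h1 n1 /h2 n2].
move: n1; rewrite lt_min => /andP[n11 n12].
have -> : u n * v n - z * w = u n * (v n - w) + (u n - z) * w by ring.
apply: le_lt_trans (rnormD _ _) _; rewrite !rnormM (splitr e).
have un : rnorm (u n) <= rnorm z + 1.
  have -> : u n = z + (u n - z) by ring.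
  by rewrite (le_trans (rnormD _ _))// lerD2l ltW.
apply: ler_ltD.
  apply: (@le_trans _ _ ((rnorm z + 1) * (e / 2 / (rnorm z + 1)))).
    by apply: ler_pM; rewrite ?rnorm_ge0// ltW.
  by rewrite mulrC divfK// gt_eqF.
apply: (@le_lt_trans _ _ (rnorm (u n - z) * (rnorm w + 1))).
  by rewrite ler_wpM2l ?rnorm_ge0// lerDl.
by rewrite -ltr_pdivlMr.
Qed.

(** The Cauchy product of the two series differs from the series of the sum
    only in degrees at least [N], where the terms are dominated by those of a
    convergent series. *)
Lemma cexpD z w : cexp (z + w) = cexp z * cexp w.
Proof.
pose t (x : C) m := x ^+ m / m`!%:R.
have := cvgsM2 (cexp_cvgs z) (cexp_cvgs w) => hzw.
have hD := cvgsB (cexp_cvgs (z + w)) hzw.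
apply/eqP; rewrite -subr_eq0; apply/eqP; apply: (cvgs_uniq hD).
move=> e e0; pose B := 2 * (rnorm z + rnorm w).
have [N hN] := @exp_decay B (e / 3%:R) ltac:(by rewrite divr_gt0).
exists N => n Nn; rewrite subr0.
pose P x : {poly R[i]} := \poly_(k < n) t x k.
have PE x : (P x).[1] = \sum_(m < n) t x m.
  by rewrite horner_poly; apply: eq_bigr => i _; rewrite expr1n mulr1.
have -> : (\sum_(m < n) z ^+ m / m`!%:R) * (\sum_(m < n) w ^+ m / m`!%:R) = (P z * P w).[1].
  by rewrite hornerM !PE.
have szP x : (size (P x) <= n)%N by exact: size_poly.
have szM : (size (P z * P w)%R <= n + n)%N.
  apply: leq_trans (size_mul_leq _ _) _; apply: leq_trans (leq_pred _) _.
  exact: leq_add.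
have coefP x k : (P x)`_k = if (k < n)%N then t x k else 0 by rewrite coef_poly.
have fne m : m`!%:R != 0 :> C by rewrite pnatr_eq0 -lt0n fact_gt0.
have binE (K : fieldType) (a b : K) m : (forall k, k`!%:R != 0 :> K) ->
    \sum_(k < m.+1) a ^+ k / k`!%:R * (b ^+ (m - k) / (m - k)`!%:R) = (a + b) ^+ m / m`!%:R.
  move=> f0; rewrite addrC exprDn mulr_suml; apply: eq_bigr => k _.
  have km : (k <= m)%N by rewrite -ltnS.
  have := bin_fact km => /(congr1 (fun x => x%:R : K)); rewrite !natrM => h.
  rewrite -mulr_natr -h.
  by field; rewrite !f0 /=; have := f0 m; rewrite -h !mulf_eq0 !negb_or => /and3P[].
have low m : (m < n)%N -> (P z * P w)`_m = t (z + w) m.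
  move=> mn; rewrite coefM; apply: etrans (binE _ z w m fne); apply: eq_bigr => k _.
  by rewrite !coefP (leq_ltn_trans (leq_subr _ _) mn) (leq_ltn_trans _ mn)// -ltnS.
have high m : rnorm ((P z * P w)`_m : C) <= (rnorm z + rnorm w) ^+ m / m`!%:R.
  have fR k : k`!%:R != 0 :> R by rewrite pnatr_eq0 -lt0n fact_gt0.
  rewrite coefM -(binE R (rnorm z) (rnorm w) m fR).
  apply: le_trans (rnorm_sum _ _ _) _; apply: ler_sum => k _.
  have nt x j : rnorm ((P x)`_j : C) <= rnorm x ^+ j / j`!%:R.
    rewrite coefP; case: ifP => _; last by rewrite rnorm0 divr_ge0 ?exprn_ge0 ?rnorm_ge0.
    by rewrite rnormM rnormX rnormV rnorm_nat.
  by rewrite rnormM ler_pM ?rnorm_ge0.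
rewrite (horner_coef_wide _ szM).
rewrite -(big_mkord xpredT (fun m => t (z + w) m)) -(big_mkord xpredT (fun m => (P z * P w)`_m * 1 ^+ m)).
rewrite (big_cat_nat (n := n) (p := (n + n)%N)) ?leq_addr//=.
have -> : \sum_(0 <= i < n) (P z * P w)`_i * 1 ^+ i = \sum_(0 <= i < n) t (z + w) i.
  by apply: eq_big_nat => i /andP[_ /low ->]; rewrite expr1n mulr1.
rewrite opprD addrA subrr sub0r rnormN.
apply: le_lt_trans (rnorm_sum _ _ _) _.
apply: (@le_lt_trans _ _ (\sum_(n <= i < n + n) 2^-1 ^+ i * (e / 3%:R))).
  rewrite !big_nat; apply: ler_sum => i /andP[ni _].
  rewrite expr1n mulr1; apply: le_trans (high i) _.
  have := hN i (leq_trans Nn ni); rewrite /B exprMn -mulrA => h.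
  by rewrite exprVn ler_pdivlMl ?exprn_gt0.
rewrite -mulr_suml.
apply: (@le_lt_trans _ _ (2 * (e / 3%:R))).
  rewrite ler_wpM2r ?divr_ge0 ?(ltW e0)//.
  have := @geometric_tail R n (n + n) (leq_addr _ _).
  move/le_trans; apply; rewrite ler_piMr//.
  by rewrite exprn_ile1 ?invr_ge0// invf_le1 ?ler1n.
lra.
Qed.

(** A linear combination of the coefficients of a polynomial of bounded degree
    is a linear combination of its values on a circle. *)
Lemma node_sum N (c : nat -> R[i]) (t : R) : 0 < t ->
  exists l : seq (R[i] * R[i]), [/\ forall v, v \in l -> rnorm (v.2 : C) = t,
    \sum_(v <- l) rnorm (v.1 : C) <= \sum_(j < N) rnorm (c j : C) / t ^+ j &
    forall p : {poly R[i]}, (size p <= N)%N -> \sum_(j < N) c j * p`_j = \sum_(v <- l) v.1 * p.[v.2]].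
Proof.
move=> t0.
have tC : t%:C != 0 :> R[i] by rewrite eq_complex /= gt_eqF.
suff H M : (M <= N)%N -> exists l : seq (R[i] * R[i]), [/\ forall v, v \in l -> rnorm (v.2 : C) = t,
    \sum_(v <- l) rnorm (v.1 : C) <= \sum_(j < M) rnorm (c j : C) / t ^+ j &
    forall p : {poly R[i]}, (size p <= N)%N -> \sum_(j < M) c j * p`_j = \sum_(v <- l) v.1 * p.[v.2]].
  exact: H.
elim: M => [_|M IH MN].
  by exists [::]; split=> // [|p _]; rewrite !big_ord0 !big_nil.
have [l [l1 l2 l3]] := IH (ltnW MN).
have [a [z [z1 a1 az]]] := coef_extraction (R := R) MN.
exists (l ++ [seq (c M / t%:C ^+ M * a i, t%:C * z i) | i <- index_enum 'I_N]); split.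
- move=> v; rewrite mem_cat => /orP[/l1//|/mapP[i _ ->]] /=.
  by rewrite (rnormM (t%:C : C)) z1 mulr1 rnormR gtr0_norm.
- rewrite big_cat big_map big_ord_recr /=; apply: lerD => //.
  under eq_bigr do rewrite (rnormM (c M / t%:C ^+ M : C)) a1.
  rewrite sumr_const card_ord -(mulr_natr (_ * _)) divfK ?pnatr_eq0 -?lt0n ?(leq_trans _ MN)//.
  by rewrite rnormM rnormV (rnormX (t%:C : C)) rnormR gtr0_norm.
- move=> p sp; rewrite big_ord_recr big_cat /= l3//; congr (_ + _).
  pose p' : {poly R[i]} := \poly_(k < N) (p`_k * t%:C ^+ k).
  have := az p' (size_poly _ _); rewrite coef_poly MN big_map => h.
  have -> : c M * p`_M = c M / t%:C ^+ M * (p`_M * t%:C ^+ M).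
    by rewrite [p`_M * _]mulrC mulrA divfK// expf_neq0.
  rewrite h mulr_sumr; apply: eq_bigr => i _ /=.
  rewrite -[RHS]mulrA; congr (_ * (_ * _)).
  rewrite horner_poly (horner_coef_wide _ sp); apply: eq_bigr => k _.
  by rewrite exprMn mulrA.
Qed.

(** If all the roots of a polynomial are large, its reciprocal on a disk is
    approximated by the product of the truncated geometric series of its
    linear factors. *)
Lemma truncated_inverse (s : seq R[i]) (r e : R) n : 0 < r -> 0 < e -> e <= 1 ->
  (forall w, w \in s -> r < rnorm (w : C)) ->
  exists q s' : {poly R[i]}, \prod_(w <- s) ('X - w%:P) * q = 1 + 'X^(n.+1) * s' /\
    forall z : C, rnorm z <= r -> rnorm ((\prod_(w <- s) ('X - w%:P) * q).[z] : C) <= 1 + e.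
Proof.
move=> r0; elim: s e => [|w s IH] e e0 e1 hs.
  exists 1, 0; split=> [|z _]; rewrite !big_nil; first by rewrite mul1r mulr0 addr0.
  by rewrite mul1r hornerC rnorm1 lerDl ltW.
have e30 : 0 < e / 3%:R by rewrite divr_gt0.
have [||v vs|q [s' [qE qb]]] := IH (e / 3%:R) => //; first by lra.
  by apply: hs; rewrite inE vs orbT.
have wr := hs w (mem_head _ _); have w0 : 0 < rnorm (w : C) := lt_trans r0 wr.
have wne : w != 0 :> C by rewrite -rnorm_gt0.
pose u := r / rnorm (w : C).
have u1 : `|u| < 1 by rewrite ger0_norm ?divr_ge0 ?(ltW r0) ?(ltW w0)// /u ltr_pdivrMr// mul1r.
have [L _ hL] := iffLR (cvgrPdist_le _ _) (cvg_expr u1) _ e30.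
have {hL} := hL (n.+1 + L)%N (leq_addl _ _); set K := (n.+1 + L)%N.
rewrite /= sub0r normrN ger0_norm ?exprn_ge0 ?divr_ge0 ?(ltW r0) ?(ltW w0)// => uK.
pose g : {poly R[i]} := - w^-1%:P * \sum_(l < K) (w^-1%:P * 'X) ^+ l.
have gE : ('X - w%:P) * g = 1 - w^-1%:P ^+ K * 'X^K.
  rewrite /g mulrA.
  have -> : ('X - w%:P) * - w^-1%:P = - (w^-1%:P * 'X - 1) :> {poly R[i]}.
    by rewrite mulrN mulrBl -polyCM mulfV// polyC1 [w^-1%:P * _]mulrC.
  by rewrite mulNr -subrX1 opprB exprMn.
exists (g * q), (s' - w^-1%:P ^+ K * 'X^L * (1 + 'X^(n.+1) * s')).
have PE : \prod_(v <- w :: s) ('X - v%:P) * (g * q) =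
    (1 - w^-1%:P ^+ K * 'X^K) * (1 + 'X^(n.+1) * s').
  by rewrite big_cons mulrACA gE qE.
split.
  rewrite PE /K ['X^(n.+1 + L)]exprD; ring.
move=> z zr; rewrite PE hornerM (rnormM ((1 - w^-1%:P ^+ K * 'X^K).[z] : C)).
have h1 : rnorm ((1 - w^-1%:P ^+ K * 'X^K).[z] : C) <= 1 + e / 3%:R.
  rewrite -rmorphXn /= !hornerE; apply: le_trans (rnormB _ _) _.
  rewrite rnorm1 lerD2l; apply: le_trans uK.
  rewrite rnormM !rnormX rnormV -exprMn lerXn2r ?nnegrE ?mulr_ge0 ?invr_ge0 ?rnorm_ge0 ?(ltW r0)//.
  by rewrite mulrC ler_wpM2r// invr_ge0 ltW.
have h2 := qb z zr; rewrite qE in h2.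
apply: (@le_trans _ _ ((1 + e / 3%:R) * (1 + e / 3%:R))).
  by apply: ler_pM; rewrite ?rnorm_ge0.
have : (e / 3%:R) * (e / 3%:R) <= e / 3%:R * (1 / 3%:R) by rewrite ler_wpM2l ?(ltW e30)// ler_pM2r.
lra.
Qed.

(** Uniform convergence on every disk. *)
Definition entire_series (a : nat -> R[i]) (g : C -> C) : Prop := forall r e : R, 0 < e ->
  exists N, forall n, (N <= n)%N -> forall z, rnorm z <= r ->
    rnorm (g z - \sum_(k < n) a k * z ^+ k) <= e.

Lemma eq0_of_decay (x : C) (K : R) : (forall r, 1 <= r -> rnorm x * r <= K) -> x = 0.
Proof.
move=> h; apply: rnorm0_eq0; apply/eqP; rewrite -[_ == _]negbK; apply/negP => x0.
have {}x0 : 0 < rnorm x by rewrite lt_def x0 rnorm_ge0.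
have := h (1 + `|K| / rnorm x) ltac:(by rewrite lerDl divr_ge0 ?rnorm_ge0).
rewrite mulrDr mulr1 mulrCA divff ?gt_eqF// mulr1 => h'.
have := ler_norm K; lra.
Qed.

(** Cauchy's estimate for the partial sums, on circles of increasing radius. *)
Lemma bounded_entire a g : entire_series a g -> (forall z, rnorm (g z) <= 1) ->
  forall n, (0 < n)%N -> a n = 0.
Proof.
move=> ag g1 n n0; apply: (@eq0_of_decay _ 2) => r r1.
have [N hN] := ag r 1 ltr01; pose M := maxn N n.+1.
pose P : {poly R[i]} := \poly_(k < M) a k.
have Pn : P`_n = a n by rewrite coef_poly leq_maxr.
have r0 : 0 <= r := le_trans ler01 r1.
apply: (@le_trans _ _ (rnorm (P`_n : C) * r ^+ n)).
  by rewrite Pn ler_wpM2l ?rnorm_ge0// -[leLHS]expr1 ler_weXn2l.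
apply: (cauchy_estimate _ r0) => z zr; rewrite horner_poly.
have := hN M (leq_maxl _ _) z; rewrite zr => /(_ (lexx _)) h.
set S := \sum_(_ < _) _ in h *.
have -> : S = g z - (g z - S) by ring.
by rewrite (le_trans (rnormB _ _))// -[2]/(1 + 1) lerD.
Qed.

(** On a large disk a partial sum has no zeros, so that its reciprocal is bounded
    there and Cauchy's estimate applies to the approximations of the reciprocal
    by [truncated_inverse]; comparing coefficients, the first nonzero coefficient
    of [g] after the constant one is small. *)
Lemma bounded_below_entire a g : entire_series a g -> (forall z, 1 <= rnorm (g z)) ->
  forall n, (0 < n)%N -> a n = 0.
Proof.
move=> ag g1; elim/ltn_ind => n IH n0.
apply: (@eq0_of_decay _ (4%:R * rnorm (a 0%N : C) ^+ 2)) => r r1.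
have r0 : 0 < r := lt_le_trans ltr01 r1.
have [N hN] := ag r (1 / 2) ltac:(by []); pose M := maxn N n.+1.
pose P : {poly R[i]} := \poly_(k < M) a k.
have Pk k : (k <= n)%N -> P`_k = a k.
  by move=> kn; rewrite coef_poly (leq_trans _ (leq_maxr _ _)).
have Plow z : rnorm z <= r -> 1 / 2 <= rnorm (P.[z] : C).
  move=> zr; rewrite horner_poly; have := hN M (leq_maxl _ _) z zr.
  set S := \sum_(_ < _) _ => h; have := g1 z.
  have -> : g z = (g z - S) + S by ring.
  by have := rnormD (g z - S) S; lra.
have Pne : P != 0.
  apply/eqP => P0; have := Plow 0; rewrite P0 horner0 rnorm0 => /(_ (ltW r0)); lra.
have [s Ps] := closed_field_poly_normal P.
have lne : lead_coef P != 0 by rewrite lead_coef_eq0.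
have [w ws|q [s' [qE qb]]] := @truncated_inverse s r 1 n r0 ltr01 (lexx _).
  rewrite ltNge; apply/negP => /Plow.
  have -> : P.[w] = 0.
    apply/rootP; rewrite Ps rootZ// root_prod_XsubC; exact: ws.
  by rewrite (@rnorm0 R C); lra.
pose Q := (lead_coef P)^-1 *: q.
have PQ : P * Q = 1 + 'X^(n.+1) * s'.
  by rewrite /Q Ps -scalerAr -scalerAl scalerA lead_coefZ lead_coef_prod_XsubC mulr1 mulVf// scale1r qE.
have PQb z : rnorm z <= r -> rnorm ((P * Q).[z] : C) <= 2 by rewrite PQ -qE; exact: qb.
have Qn : rnorm (Q`_n : C) * r ^+ n <= 4%:R.
  apply: (cauchy_estimate _ (ltW r0)) => z zr.
  have zr' : rnorm z <= r by rewrite zr.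
  have := PQb z zr'; have := Plow z zr'; rewrite hornerM (rnormM (P.[z] : C)) => h1 h2.
  have := ler_wpM2r (rnorm_ge0 (Q.[z] : C)) h1; lra.
have c0 : a 0%N * Q`_0 = 1.
  have : (P * Q)`_0 = 1 by rewrite PQ coefD coef1 coefXnM eqxx /= addr0.
  by rewrite coefM big_ord_recl big_ord0 addr0 Pk.
have cn : a 0%N * Q`_n + a n * Q`_0 = 0.
  have : (P * Q)`_n = 0 by rewrite PQ coefD coef1 coefXnM ltnSn addr0 gtn_eqF.
  rewrite coefM (bigD1 ord0)//= subn0 Pk// (bigD1 ord_max)/=; last by rewrite -val_eqE /= -lt0n.
  rewrite subnn Pk// big1 ?addr0// => k /andP[k0 kn].
  have kn' : (k < n)%N by rewrite ltn_neqAle -ltnS ltn_ord andbT; move: kn; rewrite -val_eqE.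
  by rewrite Pk ?(ltnW kn')// IH ?mul0r// lt0n; move: k0; rewrite -val_eqE.
have a0 : 0 < rnorm (a 0%N : C).
  rewrite rnorm_gt0; apply/eqP => a00; move: c0; rewrite a00 mul0r.
  by move/esym/eqP; rewrite oner_eq0.
have anE : a n = - (a 0%N ^+ 2 * Q`_n).
  have : a n * (a 0%N * Q`_0) = - (a 0%N * (a 0%N * Q`_n)).
    by rewrite mulrCA -mulrN; congr (_ * _); apply/eqP; rewrite -addr_eq0 addrC cn.
  by rewrite c0 mulr1 expr2 mulrA.
rewrite anE rnormN (rnormM (a 0%N ^+ 2 : C)) (rnormX (a 0%N : C)).
apply: (@le_trans _ _ (rnorm (a 0%N : C) ^+ 2 * (rnorm (Q`_n : C) * r ^+ n))).
  rewrite -mulrA ler_wpM2l ?exprn_ge0 ?rnorm_ge0// ler_wpM2l ?rnorm_ge0//.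
  by rewrite -[leLHS]expr1 ler_weXn2l.
by rewrite [leRHS]mulrC ler_wpM2l// exprn_ge0// rnorm_ge0.
Qed.

End one_variable.

(** * Exponential sums *)

Section exponential_sums.
Context {R : realType} (E : normedModType R[i]) (r q s p : R).
Hypothesis adm : admissible_exponents r q s p.
Local Open Scope complex_scope.
Local Notation C := R[i]^o.
Local Notation HNb_set := (@HNb_set R E r q s p).
Local Notation ngauge := (@ngauge R E r q s p).
Local Notation formal := (@formal R E).
Local Notation mag := (mag r q s p).
Local Notation rep := (rep r q s p).
Local Notation hb := (hb r q s p).
Local Notation elist := (seq (R[i] * dual E)).
Implicit Types (f g : E -> C) (x : E) (l : elist) (phi psi chi : dual E).

Definition expsum l : E -> C := fun x => \sum_(v <- l) v.1 * cexp (v.2 x).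

Definition expform l N : formal := assemble (fun m _ => [seq (m`!%:R^-1 * v.1, v.2) | v <- l]) N.

Definition weight l : R := \sum_(v <- l) rnorm (v.1 : C).

Definition lscale (z : R[i]) l : elist := [seq (z * v.1, v.2) | v <- l].

Lemma expsum_cat l l' : expsum (l ++ l') = expsum l + expsum l'.
Proof. by apply/funext => x; rewrite /expsum big_cat. Qed.

Lemma expsum_scale z l : expsum (lscale z l) = z *: expsum l.
Proof.
apply/funext => x; rewrite /expsum big_map -[RHS]/(z * _) mulr_sumr.
by apply: eq_bigr => v _; rewrite mulrA.
Qed.

Lemma expsum_nil : expsum [::] = 0.
Proof. by apply/funext => x; rewrite /expsum big_nil. Qed.

Lemma weight_ge0 l : 0 <= weight l.
Proof. by apply: sumr_ge0 => *; exact: rnorm_ge0. Qed.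

Lemma power_sum_bound l (B : R) m : (forall v, v \in l -> rnorm v.2 <= B) ->
  ngauge m (power_sum m l) <= weight l * B ^+ m.
Proof.
elim: l => [|v l IH] h; first by rewrite /power_sum /weight !big_nil mul0r (ngauge0 E adm).
have := ngauge_lin adm m v.1 [:: (1, v.2)] l.
have -> : v.1 *: power_sum m [:: (1, v.2)] + power_sum m l = power_sum m (v :: l).
  by rewrite /power_sum big_seq1 big_cons scale1r.
move/le_trans; apply; rewrite /weight big_cons mulrDl; apply: lerD; last first.
  by apply: IH => w wl; apply: h; rewrite inE wl orbT.
rewrite ler_wpM2l ?rnorm_ge0// /power_sum big_seq1 scale1r.
apply: le_trans (ngauge_power adm _ _) _.
have vB := h v (mem_head _ _); have v0 := rnorm_ge0 v.2.
by apply: lerXn2r (vB); rewrite nnegrE// (le_trans v0).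
Qed.

Lemma hpart_expform l N m :
  hpart m (expform l N) = if (m < N)%N then m`!%:R^-1 *: power_sum m l else 0.
Proof. by rewrite hpart_assemble power_sum_scale. Qed.

Lemma mag_expform l (B : R) m N : (forall v, v \in l -> rnorm v.2 <= B) -> 0 <= B ->
  mag m (expform l N) <= weight l * B ^+ m / m`!%:R.
Proof.
move=> lB B0; rewrite /mag hpart_expform; case: ifP => _; last first.
  by rewrite (ngauge0 E adm) divr_ge0// mulr_ge0 ?weight_ge0 ?exprn_ge0.
apply: le_trans (ngauge_scale adm _ _ _) _.
by rewrite rnormV rnorm_nat mulrC ler_wpM2r ?invr_ge0// power_sum_bound.
Qed.

Lemma lbound l : exists2 B : R, 0 <= B & forall v, v \in l -> rnorm v.2 <= B.
Proof.
elim: l => [|w l [B B0 h]]; first by exists 0.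
exists (rnorm w.2 + B) => [|v]; first by rewrite addr_ge0 ?rnorm_ge0.
rewrite inE => /orP[/eqP ->|/h vB]; first by rewrite lerDl.
by rewrite (le_trans vB)// lerDr rnorm_ge0.
Qed.

Lemma ev_expform l N x :
  ev (expform l N) x = \sum_(v <- l) v.1 * \sum_(m < N) v.2 x ^+ m / m`!%:R.
Proof.
rewrite (@ev_hpart R E _ N x) => [|t]; last first.
  by move=> /flattenP[_ /mapP[m + ->]] /mapP[v _ ->]; rewrite mem_iota.
under [RHS]eq_bigr do rewrite mulr_sumr.
rewrite [RHS]exchange_big /=; apply: eq_bigr => m _; rewrite hpart_expform ltn_ord.
rewrite -[LHS]/(m`!%:R^-1 * power_sum m l x) power_sumE mulr_sumr; apply: eq_bigr => v _.
by rewrite mulrC mulrA.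
Qed.

Lemma rep_expsum l : rep (expsum l) (expform l).
Proof.
split; last first.
  move=> x; apply: (cvgs_eq (fun N => esym (ev_expform l N x))).
  by apply: cvgs_sum => v _; apply: cvgsM; exact: cexp_cvgs.
have [B B0 lB] := lbound l.
have w1 : 0 < weight l + 1 by rewrite ltr_wpDl ?weight_ge0.
apply: (assemble_cauchy adm (D := fun m => weight l * B ^+ m / m`!%:R)).
- move=> m k; rewrite power_sum_scale; apply: le_trans (ngauge_scale adm _ _ _) _.
  by rewrite rnormV rnorm_nat mulrC ler_wpM2r ?invr_ge0// power_sum_bound.
- by move=> m k j _; rewrite subrr (ngauge0 E adm) !exprn_ge0 ?invr_ge0.
- move=> rho e r0 e0; have [N hN] := exp_decay (rho * B) (divr_gt0 e0 w1).
  exists N => m /hN; rewrite exprMn ler_pdivlMr// => h; apply: le_trans h.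
  have -> : rho ^+ m * (weight l * B ^+ m / m`!%:R) = rho ^+ m * B ^+ m / m`!%:R * weight l by ring.
  rewrite ler_wpM2l ?lerDl// divr_ge0// mulr_ge0 ?exprn_ge0//; exact: ltW.
Qed.

Lemma expsum_set l : HNb_set (expsum l).
Proof. exact: (rep_HNb_set adm (rep_expsum l)). Qed.

Lemma expsum_hb l (rho c : R) : 0 <= rho ->
  (forall m, rho ^+ m / m`!%:R * ngauge m (power_sum m l) <= c) -> hb rho c (expsum l).
Proof.
move=> r0 h; exists (expform l); first exact: rep_expsum.
move=> N m; rewrite /mag hpart_expform; case: ifP => _; last first.
  rewrite (ngauge0 E adm) mulr0; apply: le_trans (h 0%N).
  by rewrite mulr_ge0 ?ngauge_ge0// divr_ge0// exprn_ge0.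
apply: le_trans (h m); rewrite -mulrA ler_wpM2l ?exprn_ge0//.
by apply: le_trans (ngauge_scale adm _ _ _) _; rewrite rnormV rnorm_nat.
Qed.

(** An exponential sum is close to a polynomial with the same terms of low
    degree. *)
Lemma low_degree_hb (u : formal) l N (B rho c : R) :
  (forall m, (m < N)%N -> hpart m u = m`!%:R^-1 *: power_sum m l) ->
  (forall m, (N <= m)%N -> hpart m u = 0) ->
  (forall v, v \in l -> rnorm v.2 <= B) -> 0 <= B -> 0 <= rho -> 0 <= c ->
  (forall m, (N <= m)%N -> weight l * (rho * B) ^+ m / m`!%:R <= c) ->
  hb rho c (ev u - expsum l).
Proof.
move=> ul u0 lB B0 r0 c0 h.
exists (fun i => fsub u (expform l (N + i)%N)).
  exact: (rep_subf adm (rep_ev adm u) (rep_sub N (rep_expsum l))).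
move=> i m; have [Nm|mN] := leqP N m; last first.
  rewrite /mag hpart_sub hpart_expform (leq_trans mN (leq_addr _ _)) ul// subrr.
  by rewrite (ngauge0 E adm) mulr0.
apply: le_trans (h m Nm).
have hm := mag_sub adm m u (expform l (N + i)%N).
have u00 : mag m u = 0 by rewrite /mag u0// (ngauge0 E adm).
rewrite u00 add0r in hm.
apply: le_trans (ler_wpM2l (exprn_ge0 _ r0) (le_trans hm (mag_expform m _ lB B0))) _.
by rewrite exprMn le_eqVlt; apply/orP; left; apply/eqP; ring.
Qed.

Lemma ev_nil : ev ([::] : formal) = 0.
Proof. by apply/funext => x; rewrite /ev big_nil. Qed.

Lemma expsum_small l N (B rho c : R) :
  (forall m, (m < N)%N -> power_sum m l = 0) ->
  (forall v, v \in l -> rnorm v.2 <= B) -> 0 <= B -> 0 <= rho -> 0 <= c ->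
  (forall m, (N <= m)%N -> weight l * (rho * B) ^+ m / m`!%:R <= c) ->
  hb rho c (expsum l).
Proof.
move=> l0 lB B0 r0 c0 h.
have hn m : hpart m ([::] : formal) = 0 by rewrite /hpart /deg /power_sum /= big_nil.
have := @low_degree_hb [::] l N B rho c _ _ lB B0 r0 c0 h.
rewrite ev_nil sub0r => H; have := hbN adm r0 (H _ _); rewrite opprK; apply.
- by move=> m mN; rewrite hn l0// scaler0.
- by move=> m _.
Qed.

Definition nodes (l0 : seq (R[i] * R[i])) phi psi : elist :=
  [seq (v.1, psi + v.2 *: phi) | v <- l0].

Lemma power_sum_nodes (l0 : seq (R[i] * R[i])) phi psi m x :
  power_sum m (nodes l0 phi psi) x =
  \sum_(v <- l0) v.1 * (((phi x)%:P * 'X + (psi x)%:P) ^+ m).[v.2].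
Proof.
rewrite power_sumE big_map; apply: eq_bigr => v _ /=.
rewrite horner_exp !hornerE [phi x * _]mulrC; congr (_ * _ ^+ _).
exact: (addrC (psi x) (v.2 * phi x)).
Qed.

Lemma weight_nodes (l0 : seq (R[i] * R[i])) phi psi : weight (nodes l0 phi psi) = \sum_(v <- l0) rnorm (v.1 : C).
Proof. by rewrite /weight big_map. Qed.

Lemma nodes_bound (l0 : seq (R[i] * R[i])) phi psi (t : R) :
  (forall v, v \in l0 -> rnorm (v.2 : C) = t) ->
  forall w, w \in nodes l0 phi psi -> rnorm (w.2 - psi) = t * rnorm phi.
Proof.
by move=> h w /mapP[v vl ->] /=; rewrite addrC addKr rnormZc h.
Qed.

Lemma nodes_norm (l0 : seq (R[i] * R[i])) phi psi (t : R) :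
  (forall v, v \in l0 -> rnorm (v.2 : C) = t) ->
  forall w, w \in nodes l0 phi psi -> rnorm w.2 <= rnorm psi + t * rnorm phi.
Proof.
move=> h w wl; have -> : w.2 = psi + (w.2 - psi) by rewrite addrC subrK.
by apply: le_trans (rnormD _ _) _; rewrite (nodes_bound h wl).
Qed.

Definition approximable (V : set (dual E)) f : Prop := forall rho e : R, 0 < rho -> 0 < e ->
  exists2 l, (forall v, v \in l -> V v.2) & hb rho e (f - expsum l).

Lemma approximable_lin V (z : R[i]) f g : approximable V f -> approximable V g ->
  approximable V (z *: f + g).
Proof.
move=> hf hg rho e r0 e0.
have z1 : 0 < rnorm (z : C) + 1 by rewrite ltr_wpDl ?rnorm_ge0.
have [l1 V1 h1] := hf rho (e / 2 / (rnorm (z : C) + 1)) r0 ltac:(by rewrite !divr_gt0).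
have [l2 V2 h2] := hg rho (e / 2) r0 ltac:(by rewrite divr_gt0).
exists (lscale z l1 ++ l2) => [v|].
  by rewrite mem_cat => /orP[/mapP[w wl ->]|]; [exact: (V1 w wl)|exact: V2].
rewrite expsum_cat expsum_scale.
have -> : z *: f + g - (z *: expsum l1 + expsum l2) = z *: (f - expsum l1) + (g - expsum l2).
  by rewrite scalerBr opprD addrACA.
apply: (hb_le _ _ _ (hb_lin adm z (ltW r0) h1 h2)); [exact: ltW|exact: lexx|].
rewrite [leRHS]splitr lerD2r mulrCA ler_piMr ?divr_ge0 ?(ltW e0)//.
by rewrite ler_pdivrMr// mul1r lerDl.
Qed.

Lemma approximable_closed V f :
  (forall rho e : R, 0 < rho -> 0 < e -> exists2 g, approximable V g & hb rho e (f - g)) ->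
  approximable V f.
Proof.
move=> h rho e r0 e0; have e2 : 0 < e / 2 by rewrite divr_gt0.
have [g hg fg] := h rho (e / 2) r0 e2; have [l Vl gl] := hg rho (e / 2) r0 e2.
by exists l => //; rewrite [e]splitr; exact: (hb_trans adm (ltW r0) fg gl).
Qed.

Lemma approximable0 V : approximable V 0.
Proof.
move=> rho e r0 e0; exists [::] => //; rewrite expsum_nil subr0.
exact: (hb_le (ltW r0) (lexx _) (ltW e0) (hb0 E adm rho)).
Qed.

(** Interpolation of an exponential at nodes on a small circle around [psi]:
    it is exact in low degrees, and the growth of the coefficients of
    Lagrange's formula is only exponential. *)
Lemma approximable_exp V psi (d : R) chi : 0 < d -> (forall phi, rnorm (phi - psi) < d -> V phi) ->
  approximable V (expsum [:: (1, chi)]).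
Proof.
move=> d0 Vd rho e r0 e0.
pose phi := chi - psi.
have p1 : 0 < rnorm phi + 1 by rewrite ltr_wpDl ?rnorm_ge0.
pose t := Num.min (1 / 2) (d / 2 / (rnorm phi + 1)).
have t0 : 0 < t by rewrite lt_min !divr_gt0.
have t2 : t <= 1 / 2 by rewrite ge_min lexx.
have td : t * rnorm phi < d.
  apply: (@le_lt_trans _ _ (d / 2 / (rnorm phi + 1) * rnorm phi)).
    by rewrite ler_wpM2r ?rnorm_ge0// ge_min lexx orbT.
  rewrite mulrAC ltr_pdivrMr//; apply: (@le_lt_trans _ _ (d / 2 * (rnorm phi + 1))).
    by rewrite ler_wpM2l ?divr_ge0 ?(ltW d0)// lerDl.
  by rewrite ltr_pM2r// ltr_pdivrMr// ltr_pMr// ltr1n.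
pose tau := t^-1; have tau2 : 2 <= tau by rewrite /tau -[2]invrK lef_pV2 ?posrE ?invr_gt0// -[2^-1]mul1r.
have tau0 : 0 <= tau by rewrite invr_ge0 ltW.
pose B := rnorm psi + rnorm phi; have B0 : 0 <= B by rewrite addr_ge0 ?rnorm_ge0.
have [N hN] := exp_decay (tau * (rho * B)) (divr_gt0 e0 (ltac:(by []) : 0 < 2)).
have [l0 [n1 n2 n3]] := node_sum N (fun=> 1) t0.
pose l := nodes l0 phi psi.
exists l => [v vl|]; first by apply: Vd; rewrite (nodes_bound n1 vl).
have -> : expsum [:: (1, chi)] - expsum l = expsum ((1, chi) :: lscale (-1) l).
  by rewrite [RHS](expsum_cat [:: (1, chi)]) expsum_scale scaleN1r.
(* the weights of the nodes grow like [tau ^ N], which the factorials absorb *)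
have wl : weight ((1, chi) :: lscale (-1) l) <= 2 * tau ^+ N.
  rewrite /weight big_cons /= rnorm1 big_map.
  under eq_bigr do rewrite (rnormM (-1 : C)) (@rnormN R C) rnorm1 mul1r.
  rewrite -[X in 1 + X]/(weight l) weight_nodes.
  have tN : 1 <= tau ^+ N by rewrite exprn_ege1// (le_trans _ tau2)// ler1n.
  suff : \sum_(j < N) 1 / t ^+ j <= tau ^+ N by move: n2; rewrite rnorm1; lra.
  elim: (N) => [|k IH]; first by rewrite big_ord0 exprn_ge0.
  rewrite big_ord_recr /= mul1r -exprVn -/tau exprS.
  have : 2 * tau ^+ k <= tau * tau ^+ k by rewrite ler_wpM2r// exprn_ge0.
  move: IH; lra.
apply: (@expsum_small _ N B) => //; [| |exact: ltW|exact: ltW|].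
- move=> m mN; rewrite (power_sum_cat m [:: (1, chi)]) power_sum_scale scaleN1r.
  apply/funext => x; apply/eqP; rewrite -[(_ - _) x]/(_ x - _ x) subr_eq0; apply/eqP.
  have sp := leq_trans (size_binomial (phi x) (psi x) m) mN.
  rewrite power_sum_nodes -n3//.
  have -> : \sum_(j < N) 1 * (((phi x)%:P * 'X + (psi x)%:P) ^+ m)`_j =
      (((phi x)%:P * 'X + (psi x)%:P) ^+ m).[1].
    by rewrite (horner_coef_wide _ sp); apply: eq_bigr => j _; rewrite expr1n mulr1 mul1r.
  rewrite power_sumE big_seq1 /= mul1r horner_exp !hornerE; congr (_ ^+ _).
  by apply: esym; exact: (subrK (psi x) (chi x)).
- move=> v; rewrite inE => /orP[/eqP -> /=|/mapP[w wl' -> /=]].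
    by rewrite -[chi](subrK psi) addrC rnormD.
  apply: le_trans (nodes_norm n1 wl') _; rewrite lerD2l ler_piMl ?rnorm_ge0//.
  by rewrite (le_trans t2)// ler_pdivrMr// mul1r ler1n.
- move=> m Nm; have := hN m Nm; rewrite exprMn => h.
  apply: (@le_trans _ _ (2 * tau ^+ m * (rho * B) ^+ m / m`!%:R)); last by move: h; lra.
  rewrite ler_wpM2r ?invr_ge0// ler_wpM2r ?exprn_ge0 ?mulr_ge0 ?(ltW r0)//.
  apply: (le_trans wl); rewrite ler_wpM2l// ler_weXn2l//.
  by rewrite (le_trans _ tau2)// ler1n.
Qed.

Lemma approximable_expsum V psi (d : R) l : 0 < d -> (forall phi, rnorm (phi - psi) < d -> V phi) ->
  approximable V (expsum l).
Proof.
move=> d0 Vd; elim: l => [|v l IH]; first by rewrite expsum_nil; exact: approximable0.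
have -> : expsum (v :: l) = v.1 *: expsum [:: (1, v.2)] + expsum l.
  apply/funext => x; rewrite /expsum big_cons; congr (_ + _).
  by rewrite -[RHS]/(v.1 * expsum [:: (1, v.2)] x) /expsum big_seq1 mul1r.
by apply: approximable_lin => //; exact: approximable_exp Vd.
Qed.

(** The Cauchy formula for a Taylor coefficient, with the integral replaced by
    a sum over roots of unity. *)
Lemma approximable_power phi n : approximable setT (power n phi).
Proof.
move=> rho e r0 e0.
have f1 : 0 < n`!%:R + 1 :> R by rewrite ltr_wpDl.
have [N0 hN] := exp_decay (rho * rnorm phi) (divr_gt0 e0 f1).
pose N := maxn N0 n.+1.
pose c (k : nat) : R[i] := if k == n then n`!%:R else 0.
have [l0 [n1 n2 n3]] := node_sum N c (ltr01 : 0 < 1 :> R).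
pose l := nodes l0 phi 0.
exists l => //.
have -> : power n phi = ev (fmono n [:: (1, phi)]) by rewrite -evE_power.
have wl : weight l <= n`!%:R.
  rewrite weight_nodes; apply: (le_trans n2).
  rewrite (bigD1 (Ordinal (leq_maxr N0 n.+1)))//= /c eqxx expr1n divr1 rnorm_nat big1 ?addr0// => j jn.
  by rewrite ifN ?rnorm0 ?mul0r//; move: jn; rewrite -val_eqE.
apply: (@low_degree_hb _ l N (rnorm phi)).
- move=> m mN; rewrite hpart_fmono.
  apply/funext => x; rewrite -[RHS]/(m`!%:R^-1 * power_sum m l x) power_sum_nodes -n3; last first.
    exact: leq_trans (size_binomial _ _ _) mN.
  rewrite (bigD1 (Ordinal (leq_maxr N0 n.+1)))//= /c eqxx big1 ?addr0 => [|j jn]; last first.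
    by rewrite ifN ?mul0r//; move: jn; rewrite -val_eqE.
  rewrite exprMn -rmorphXn coefCM coefXn eq_sym; case: eqP => [->|_]; last by rewrite !mulr0.
  rewrite mulr1 mulrA mulVf ?mul1r ?pnatr_eq0 -?lt0n ?fact_gt0//.
  by rewrite power_sumE big_seq1 /= mul1r.
- move=> m Nm; rewrite hpart_fmono ifN//; apply: contraL Nm => /eqP ->.
  by rewrite -ltnNge leq_maxr.
- move=> v vl; apply: le_trans (nodes_norm n1 vl) _.
  by rewrite rnorm0 add0r mul1r.
- exact: rnorm_ge0.
- exact: ltW.
- exact: ltW.
- move=> m; rewrite geq_max => /andP[/hN h _].
  rewrite -mulrA; apply: (@le_trans _ _ ((n`!%:R + 1) * (e / (n`!%:R + 1)))).
    by apply: ler_pM; rewrite ?weight_ge0 ?divr_ge0 ?exprn_ge0 ?mulr_ge0 ?rnorm_ge0 ?(ltW r0)// (le_trans wl)// lerDl.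
  by rewrite mulrC divfK// gt_eqF.
Qed.

(** The exponential sums with frequencies in a given open set are dense. *)
Lemma approximable_all V psi (d : R) f : 0 < d -> (forall phi, rnorm (phi - psi) < d -> V phi) ->
  HNb_set f -> approximable V f.
Proof.
move=> d0 Vd /(HNb_rep adm)[a fa]; apply: approximable_closed => rho e r0 e0.
have [N hN] := rep_tail_hb adm fa r0 e0; exists (ev (a N)); last exact: (hN N (leqnn N)).
elim: (a N) => [|t u IH]; first by rewrite ev_nil; exact: approximable0.
have -> : ev (t :: u) = t.2.1 *: power t.1 t.2.2 + ev u.
  by apply/funext => x; rewrite /ev big_cons.
apply: approximable_lin IH; apply: approximable_closed => sg c s0 c0.
have [l _ hl] := approximable_power t.2.2 t.1 s0 c0; exists (expsum l) => //.
exact: approximable_expsum Vd.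
Qed.

Lemma exp_bound (x : R) m : 0 <= x -> x ^+ m / m`!%:R <= expR x.
Proof.
move=> x0; apply: (@le_trans _ _ (series (exp_coeff x) m.+1)).
  rewrite /series /= big_nat_recr//= lerDr; apply: sumr_ge0 => i _; exact: exp_coeff_ge0.
apply: nondecreasing_cvgn_le; last exact: is_cvg_series_exp_coeff.
by apply/nondecreasing_seqP => n; rewrite /series /= big_nat_recr//= lerDl exp_coeff_ge0.
Qed.

(** In degree [m] the difference of the powers is a sum over nodes at distance 1
    from [chi], with coefficients proportional to the distance of the functionals. *)
Lemma exp_continuous chi (rho e : R) : 0 < rho -> 0 < e -> exists2 d, 0 < d &
  forall chi', rnorm (chi' - chi) < d -> hb rho e (expsum [:: (1, chi')] - expsum [:: (1, chi)]).
Proof.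
move=> r0 e0; pose B := rnorm chi + 1; have B0 : 0 <= B by rewrite addr_ge0 ?rnorm_ge0.
pose M := expR (2 * (rho * B)); have M0 : 0 < M by exact: expR_gt0.
exists (Num.min 1 (e / M)) => [|chi' ]; first by rewrite lt_min ltr01 divr_gt0.
rewrite lt_min => /andP[d1 dM]; pose phi := chi' - chi.
have [p0|pne] := eqVneq phi 0.
  have -> : chi' = chi by apply/eqP; rewrite -subr_eq0 -/phi p0.
  by rewrite subrr; exact: (hb_le (ltW r0) (lexx _) (ltW e0) (hb0 E adm rho)).
have p0 : 0 < rnorm phi by rewrite rnorm_gt0.
have -> : expsum [:: (1, chi')] - expsum [:: (1, chi)] = expsum ([:: (1, chi')] ++ lscale (-1) [:: (1, chi)]).
  by rewrite expsum_cat expsum_scale scaleN1r.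
apply: expsum_hb => [|m]; first exact: ltW.
pose c (j : nat) : R[i] := if j is 0%N then 0 else 1.
have [l0 [n1 n2 n3]] := node_sum m.+1 c (ltac:(by rewrite invr_gt0) : 0 < (rnorm phi)^-1).
have -> : power_sum m ([:: (1, chi')] ++ lscale (-1) [:: (1, chi)]) = power_sum m (nodes l0 phi chi).
  apply/funext => x; rewrite power_sum_cat power_sum_scale scaleN1r.
  rewrite -[LHS]/(power_sum m [:: (1, chi')] x - power_sum m [:: (1, chi)] x) !power_sumE !big_seq1 [in LHS]/= !mul1r.
  rewrite -power_sumE power_sum_nodes -n3 ?size_binomial// big_ord_recl /c /= mul0r add0r.
  have -> : chi' x = phi x + chi x by apply: esym; exact: (subrK (chi x) (chi' x)).
  have sp := size_binomial (phi x) (chi x) m.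
  have : (((phi x)%:P * 'X + (chi x)%:P) ^+ m).[1] = (phi x + chi x) ^+ m.
    by rewrite horner_exp !hornerE.
  rewrite (horner_coef_wide _ sp) big_ord_recl expr0 mulr1 coef_binomial bin0 subn0 expr0 mul1r => <-.
  rewrite mulr1n addrAC subrr add0r; apply: eq_bigr => j _.
  by rewrite expr1n mulr1 mul1r.
have nB v : v \in nodes l0 phi chi -> rnorm v.2 <= B.
  by move=> vl; apply: le_trans (nodes_norm n1 vl) _; rewrite mulVf ?gt_eqF.
have w : weight (nodes l0 phi chi) <= rnorm phi * 2 ^+ m.
  rewrite weight_nodes; apply: (le_trans n2).
  rewrite big_ord_recl /c /= rnorm0 mul0r add0r.
  apply: (@le_trans _ _ (\sum_(j < m) rnorm phi)).
    apply: ler_sum => j _; rewrite /= rnorm1 mul1r exprVn invrK /bump /= add1n exprS.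
    by rewrite ler_piMr ?(ltW p0)// exprn_ile1 ?(ltW p0)// ltW.
  rewrite sumr_const card_ord -(mulr_natr (rnorm phi)) ler_wpM2l ?(ltW p0)//.
  by rewrite -natrX ler_nat ltnW// ltn_expl.
have ng := le_trans (power_sum_bound m nB) (ler_wpM2r (exprn_ge0 m B0) w).
apply: le_trans (ler_wpM2l _ ng) _; first by rewrite divr_ge0// exprn_ge0// ltW.
have -> : rho ^+ m / m`!%:R * (rnorm phi * 2 ^+ m * B ^+ m) =
    rnorm phi * ((2 * (rho * B)) ^+ m / m`!%:R) by rewrite !exprMn; ring.
apply: (@le_trans _ _ (rnorm phi * M)).
  by rewrite ler_wpM2l ?(ltW p0)// exp_bound// !mulr_ge0// ltW.
by rewrite -ler_pdivlMr// ltW.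
Qed.

End exponential_sums.

(** * Hypercyclicity *)

Section hypercyclicity.
Context {R : realType} (E : normedModType R[i]) (r q s p : R).
Hypothesis adm : admissible_exponents r q s p.
Local Open Scope complex_scope.
Local Notation C := R[i]^o.
Local Notation H := (HNb E r q s p).
Local Notation HNb_set := (@HNb_set R E r q s p).
Local Notation hb := (hb r q s p).
Local Notation elist := (seq (R[i] * dual E)).
Implicit Types (f g : E -> C) (x : E) (l : elist) (phi psi chi : dual E).

Variable T : H -> C.
Hypothesis T_dual : HNb_dual T.
Variables (rho K : R).
Hypotheses (rho0 : 0 < rho) (K0 : 0 <= K).
Hypothesis TK : forall c f, hb rho c f -> rnorm (T f) <= K * c.

Let lT := T_dual.1.

(** The eigenvalue of the convolution operator at the exponential of [phi]. *)
Definition symbol phi : C := T (expsum [:: (1, phi)]).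

Definition weigh (w : dual E -> R[i]) l : elist := [seq (v.1 * w v.2, v.2) | v <- l].

Lemma expsum_cons (v : R[i] * dual E) l : expsum (v :: l) = v.1 *: expsum [:: (1, v.2)] + expsum l.
Proof.
apply/funext => x; rewrite /expsum big_cons; congr (_ + _).
by rewrite -[RHS]/(v.1 * expsum [:: (1, v.2)] x) /expsum big_seq1 mul1r.
Qed.

Lemma dual_expsum l : T (expsum l) = \sum_(v <- l) v.1 * symbol v.2.
Proof.
elim: l => [|v l IH].
  rewrite big_nil expsum_nil.
  have H0 : HNb_set (0 : E -> C) := hb_HNb_set adm (hb0 E adm 1).
  by have := lT (-1) H0 H0; rewrite scaler0 addr0 => ->; rewrite scaleN1r addNr.
rewrite expsum_cons big_cons -IH; apply: lT; exact: (expsum_set adm).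
Qed.

Lemma conv_expsum l : Gamma_bar T (expsum l) = expsum (weigh symbol l).
Proof.
apply/funext => x; rewrite /Gamma_bar /convolution_product.
have -> : translation (- x) (expsum l) = expsum ([seq (v.1 * cexp (v.2 x) : R[i], v.2) | v : R[i] * dual E <- l] : elist).
  apply/funext => y; rewrite /translation opprK /expsum big_map; apply: eq_bigr => v _.
  rewrite /= dualD cexpD mulrA; exact: mulrAC.
rewrite [LHS]dual_expsum /expsum !big_map; apply: eq_bigr => v _.
exact: mulrAC.
Qed.

Lemma iter_conv n l :
  iter n (Gamma_bar T) (expsum l) = expsum (weigh (fun phi => symbol phi ^+ n) l).
Proof.
elim: n => [|n IH] /=.
  congr expsum; rewrite /weigh -[LHS]map_id; apply: eq_map => -[c phi] /=.
  by rewrite expr0 mulr1.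
rewrite IH conv_expsum; congr expsum; rewrite /weigh -map_comp; apply: eq_map => v /=.
by rewrite -mulrA -exprSr.
Qed.

Lemma symbol_continuous phi (e : R) : 0 < e -> exists2 d, 0 < d &
  forall psi, rnorm (psi - phi) < d -> rnorm (symbol psi - symbol phi) <= e.
Proof.
move=> e0; have K1 : 0 < K + 1 by rewrite ltr_wpDl.
have [d d0 hd] := exp_continuous adm phi rho0 (divr_gt0 e0 K1); exists d => // psi /hd h.
apply: le_trans (dual_hbB T_dual TK (expsum_set adm _) (expsum_set adm _) h) _.
by rewrite mulrCA ler_piMr ?(ltW e0)// ler_pdivrMr// mul1r lerDl.
Qed.

(** The symbol is entire on complex lines: the Taylor polynomials of the
    exponentials converge uniformly for [z] in a bounded set. *)
Lemma symbol_series phi :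
  entire_series (fun m => m`!%:R^-1 * T (power m phi)) (fun z => symbol (z *: phi)).
Proof.
move=> a e e0; have K1 : 0 < K + 1 by rewrite ltr_wpDl.
have [N hN] := exp_decay (rho * (`|a| * rnorm phi)) (divr_gt0 e0 K1).
exists N => n Nn z za.
pose l : elist := [:: (1, z *: phi)].
have wl : weight l = 1 by rewrite /weight big_seq1 rnorm1.
have lB v : v \in l -> rnorm v.2 <= `|a| * rnorm phi.
  rewrite inE => /eqP -> /=; rewrite rnormZc ler_wpM2r ?rnorm_ge0//.
  exact: le_trans za (ler_norm a).
have h : hb rho (e / (K + 1)) (ev (expform l n) - expsum l).
  apply: (low_degree_hb adm (N := n) _ _ lB).
  - by move=> m mn; rewrite hpart_expform mn.
  - by move=> m nm; rewrite hpart_expform ltnNge nm.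
  - by rewrite mulr_ge0 ?rnorm_ge0.
  - exact: ltW.
  - by rewrite divr_ge0 ?ltW.
  - by move=> m nm; rewrite wl mul1r; apply: hN; exact: leq_trans nm.
have uH : HNb_set (ev (expform l n)) := rep_HNb_set adm (rep_ev adm _).
have := dual_hbB T_dual TK uH (expsum_set adm l) h.
have power_scale m : power m (z *: phi) = z ^+ m *: power m phi.
  by apply/funext => x; rewrite /power -[(z *: phi) x]/(z * phi x) exprMn.
have powerH m : HNb_set (power m phi) := hb_HNb_set adm (hb_power adm m phi ler01).
have H0 : HNb_set (0 : E -> C) := hb_HNb_set adm (hb0 E adm 1).
have T0 : T (0 : E -> C) = 0 by have := dual_expsum [::]; rewrite expsum_nil big_nil.
have Tp m : T (power m (z *: phi)) = z ^+ m * T (power m phi).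
  by rewrite power_scale; have := lT (z ^+ m) (powerH m) H0; rewrite addr0 T0 addr0.
have -> : T (ev (expform l n)) = \sum_(k < n) k`!%:R^-1 * T (power k phi) * z ^+ k.
  rewrite (dual_ev adm T_dual) /expform /assemble big_flatten big_map.
  have -> : iota 0 n = index_iota 0 n by rewrite /index_iota subn0.
  rewrite big_mkord; apply: eq_bigr => m _; rewrite /l /= big_seq1 /= Tp mulr1.
  by rewrite -mulrA [T _ * _]mulrC.
rewrite rnormBC => /le_trans; apply.
by rewrite mulrCA ler_piMr ?(ltW e0)// ler_pdivrMr// mul1r lerDl.
Qed.

Lemma expsum_decay (w : dual E -> R[i]) l (sg e : R) : 0 < sg -> 0 < e ->
  (forall v, v \in l -> rnorm (w v.2 : C) < 1) ->
  exists N, forall n, (N <= n)%N -> hb sg e (expsum (weigh (fun phi => w phi ^+ n) l)).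
Proof.
move=> s0; elim: l e => [|v l IH] e e0 hl.
  exists 0%N => n _; rewrite expsum_nil; exact: (hb_le (ltW s0) (lexx _) (ltW e0) (hb0 E adm sg)).
have e2 : 0 < e / 2 by rewrite divr_gt0.
have [|N1 h1] := IH (e / 2) e2; first by move=> u ul; apply: hl; rewrite inE ul orbT.
have [B hB] := HNb_hb adm (expsum_set adm [:: (1, v.2)]) s0.
have B0 := hb_ge0 hB.
have v1 : `|rnorm (w v.2 : C)| < 1 by rewrite ger0_norm ?rnorm_ge0// hl// mem_head.
have D0 : 0 < rnorm (v.1 : C) * B + 1 by rewrite ltr_wpDl// mulr_ge0 ?rnorm_ge0.
have [N2 _ h2] := iffLR (cvgrPdist_le _ _) (cvg_expr v1) _ (divr_gt0 e2 D0).
exists (maxn N1 N2) => n; rewrite geq_max => /andP[n1 n2].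
rewrite /weigh map_cons expsum_cons [e]splitr.
apply: (hbD adm (ltW s0)); last exact: h1.
apply: (hb_le (ltW s0) (lexx _) _ (hbZ adm _ (ltW s0) hB)) => /=.
have := h2 n n2; rewrite /= sub0r normrN ger0_norm ?exprn_ge0 ?rnorm_ge0// => h.
rewrite (rnormM (v.1 : C)) (rnormX (w v.2 : C)) mulrAC.
apply: (@le_trans _ _ ((rnorm (v.1 : C) * B + 1) * (e / 2 / (rnorm (v.1 : C) * B + 1)))).
  by apply: ler_pM; rewrite ?mulr_ge0 ?exprn_ge0 ?rnorm_ge0// lerDl.
by rewrite mulrC divfK// gt_eqF.
Qed.

Lemma cexp0 : cexp (0 : C) = 1.
Proof.
apply: (cvgs_uniq (cexp_cvgs 0)) => e e0; exists 1%N => -[//|N] _.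
rewrite big_ord_recl expr0 fact0 divr1 big1 ?addr0 ?subrr ?(@rnorm0 R C)// => i _.
by rewrite exprS !mul0r.
Qed.

(** The two sides agree on the exponential sums, which are dense. *)
Lemma symbol_constant : (forall phi, symbol phi = symbol 0) ->
  forall f, HNb_set f -> T f = symbol 0 * f 0.
Proof.
move=> hc f fH; apply/eqP; rewrite -subr_eq0; apply/eqP/rnorm0_eq0.
apply/le_anti; rewrite rnorm_ge0 andbT; apply/ler_addgt0Pr => e e0; rewrite add0r.
have M0 : 0 < K + 2 * rnorm (symbol 0) + 1.
  by rewrite ltr_wpDl// addr_ge0// mulr_ge0 ?rnorm_ge0.
have m0 : 0 < Num.max rho 2 by rewrite lt_max rho0.
have [l _ hl] := @approximable_all _ E _ _ _ _ adm setT 0 1 f ltr01 (fun _ _ => I) fH _ _ m0 (divr_gt0 e0 M0).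
have h1 : hb rho (e / (K + 2 * rnorm (symbol 0) + 1)) (f - expsum l).
  by apply: (hb_le _ _ _ hl); [exact: ltW|rewrite le_max lexx|exact: lexx].
have h2 : hb (2 * 1) (e / (K + 2 * rnorm (symbol 0) + 1)) (f - expsum l).
  by apply: (hb_le _ _ _ hl); [rewrite mulr1|rewrite mulr1 le_max lexx orbT|exact: lexx].
have t1 := dual_hbB T_dual TK fH (expsum_set adm l) h1.
have t2 : rnorm (f 0 - expsum l 0) <= 2 * (e / (K + 2 * rnorm (symbol 0) + 1)).
  have [a fa ac] := h2; apply: (cauchy_ev_le adm fa ltr01 ac (x := 0)).
  by rewrite rnorm0.
have Tl : T (expsum l) = symbol 0 * expsum l 0.
  rewrite dual_expsum /expsum mulr_sumr; apply: eq_bigr => v _.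
  by rewrite hc dual_fun0 cexp0 mulr1 mulrC.
have -> : T f - symbol 0 * f 0 = (T f - T (expsum l)) - symbol 0 * (f 0 - expsum l 0).
  by rewrite Tl mulrBr opprB addrA subrK.
apply: le_trans (rnormB _ _) _; rewrite rnormM.
apply: (@le_trans _ _ ((K + 2 * rnorm (symbol 0) + 1) * (e / (K + 2 * rnorm (symbol 0) + 1)))); last first.
  by rewrite mulrC divfK// gt_eqF.
have t3 := ler_wpM2l (rnorm_ge0 (symbol 0)) t2.
have e'0 : 0 < e / (K + 2 * rnorm (symbol 0) + 1) by rewrite divr_gt0.
set d := e / _ in t1 t2 t3 e'0 *.
have -> : (K + 2 * rnorm (symbol 0) + 1) * d = K * d + rnorm (symbol 0) * (2 * d) + d by ring.
by rewrite -[leLHS]addr0 lerD ?(ltW e'0)// lerD.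
Qed.

Lemma symbol_line phi :
  (forall m, (0 < m)%N -> m`!%:R^-1 * T (power m phi) = 0) -> symbol phi = symbol 0.
Proof.
move=> a0; set a := fun m => m`!%:R^-1 * T (power m phi) in a0.
suff cst z : symbol (z *: phi) = a 0%N.
  by rewrite -[phi]scale1r cst -(cst 0) scale0r.
apply/eqP; rewrite -subr_eq0; apply/eqP/rnorm0_eq0.
apply/le_anti; rewrite rnorm_ge0 andbT; apply/ler_addgt0Pr => e e0; rewrite add0r.
have [N hN] := symbol_series phi (rnorm (z : C)) e0.
have := hN N.+1 (leqnSn N) z (lexx _); rewrite big_ord_recl expr0 mulr1 big1 ?addr0// => i _.
by rewrite (a0 (lift ord0 i)) ?mul0r// lift0.
Qed.

Section nonscalar.
Hypothesis T_delta0 : ~ exists c : R[i], forall f, HNb_set f -> T f = c * f 0.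

(** Liouville's theorem on a complex line on which the symbol is not constant:
    neither the symbol nor its reciprocal is bounded by 1. *)
Lemma symbol_large : exists psi, 1 < rnorm (symbol psi).
Proof.
apply: contrapT => h; apply: T_delta0; exists (symbol 0); apply: symbol_constant => phi.
apply: symbol_line; apply: (bounded_entire (symbol_series phi)) => z.
by rewrite leNgt; apply/negP => lt; apply: h; exists (z *: phi).
Qed.

Lemma symbol_small : exists psi, rnorm (symbol psi) < 1.
Proof.
apply: contrapT => h; apply: T_delta0; exists (symbol 0); apply: symbol_constant => phi.
apply: symbol_line; apply: (bounded_below_entire (symbol_series phi)) => z.
by rewrite leNgt; apply/negP => lt; apply: h; exists (z *: phi).
Qed.

Lemma symbol_large_open psi : 1 < rnorm (symbol psi) ->
  exists2 d : R, 0 < d & forall phi, rnorm (phi - psi) < d -> 1 < rnorm (symbol phi).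
Proof.
move=> h; have [|d d0 hd] := @symbol_continuous psi ((rnorm (symbol psi) - 1) / 2).
  by rewrite divr_gt0// subr_gt0.
exists d => // phi /hd; have := rnormB (symbol phi) (symbol phi - symbol psi).
by rewrite opprB addrC subrK; lra.
Qed.

Lemma symbol_small_open psi : rnorm (symbol psi) < 1 ->
  exists2 d : R, 0 < d & forall phi, rnorm (phi - psi) < d -> rnorm (symbol phi) < 1.
Proof.
move=> h; have [|d d0 hd] := @symbol_continuous psi ((1 - rnorm (symbol psi)) / 2).
  by rewrite divr_gt0// subr_gt0.
exists d => // phi /hd; have := rnormD (symbol phi - symbol psi) (symbol psi).
by rewrite subrK; lra.
Qed.

(** A perturbation of a combination of eigenvectors with eigenvalues inside the
    unit disk by a small preimage of a combination with eigenvalues outside. *)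
Lemma transitivity l f (sg e : R) : HNb_set f -> 0 < sg -> 0 < e ->
  (forall v, v \in l -> 1 < rnorm (symbol v.2)) ->
  exists f' n, hb sg e (f' - f) /\ hb sg e ((iter n (Gamma_bar T) f' : E -> C) - expsum l).
Proof.
move=> fH s0 e0 hl; have e2 : 0 < e / 2 by rewrite divr_gt0.
have [psi hpsi] := symbol_small; have [d d0 hd] := symbol_small_open hpsi.
have [l0 V0 h0] := approximable_all adm d0 hd fH s0 e2.
have [N1 h1] := expsum_decay (w := symbol) s0 e0 V0.
have [|N2 h2] := expsum_decay (w := fun phi => (symbol phi)^-1) (l := l) s0 e2.
  move=> v /hl lt; rewrite rnormV invf_lt1//; exact: lt_trans lt.
pose n := maxn N1 N2.
have {h1} := h1 n (leq_maxl _ _); have {h2} := h2 n (leq_maxr _ _).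
set u := weigh _ l; set w := weigh _ l0 => h2 h1.
exists (expsum (l0 ++ u)), n; split.
  have -> : expsum (l0 ++ u) - f = - (f - expsum l0) + expsum u.
    by rewrite expsum_cat opprB addrAC.
  by rewrite [e]splitr; apply: (hbD adm (ltW s0)) => //; exact: (hbN adm (ltW s0)).
rewrite iter_conv /weigh map_cat expsum_cat -/w.
have -> : [seq (v.1 * symbol v.2 ^+ n, v.2) | v <- u] = l.
  rewrite /u /weigh -map_comp -[RHS]map_id; apply/eq_in_map => -[c phi] /hl /= lt.
  have hne : symbol phi != 0 by rewrite -rnorm_gt0; exact: lt_trans lt.
  by rewrite exprVn divfK// expf_neq0.
by rewrite addrK.
Qed.

Section dense_family.
Variables (D : set (dual E)) (iD : dual E -> nat).
Hypothesis D_inj : {in D &, injective iD}.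
Hypothesis D_dense : dense D.

Definition enumD n : dual E := xget 0 [set phi | D phi /\ iD phi = n].

Lemma enumD_dense phi (d : R) : 0 < d -> exists n, rnorm (enumD n - phi) < d.
Proof.
move=> d0; have dC : 0 < d%:C :> R[i] by rewrite ltcR.
have [||psi [bpsi Dpsi]] := @D_dense (ball phi d%:C).
- by exists phi; exact: ballxx.
- exact: ball_open.
exists (iD psi); rewrite /enumD; case: xgetP => [chi _ [Dchi ic]|/(_ psi)]; last by case.
have -> : chi = psi by apply: D_inj ic; rewrite inE.
by move: bpsi; rewrite -ball_normE /= -normrN opprB rnormE ltcR.
Qed.

Definition gauss (a b : rat) : R[i] := (ratr a)%:C + 'i * (ratr b)%:C.

Lemma gauss_dense (z : C) (e : R) : 0 < e -> exists a b, rnorm (z - gauss a b) <= e.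
Proof.
move=> e0; have e2 : 0 < e / 2 by rewrite divr_gt0.
have [a ha] := @rat_in_itvoo R (complex.Re z - e / 2) (complex.Re z + e / 2) ltac:(by lra).
have [b hb] := @rat_in_itvoo R (complex.Im z - e / 2) (complex.Im z + e / 2) ltac:(by lra).
exists a, b; apply: le_trans (rnorm_le_ReIm _) _.
move: ha hb; rewrite !in_itv /= => /andP[a1 a2] /andP[b1 b2].
case: z a1 a2 b1 b2 => x y /= a1 a2 b1 b2.
rewrite /gauss /= !(mul0r, mul1r, mulr0, subr0, addr0, add0r, sub0r).
by rewrite [e]splitr lerD// ler_norml; apply/andP; split; lra.
Qed.

(** Exponential sums with coefficients in a countable dense set and frequencies in
    a dense sequence. *)
Definition gauss_list (t : seq (rat * rat * nat)) : elist :=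
  [seq (gauss v.1.1 v.1.2, enumD v.2) | v <- t].

Lemma gauss_list_dense l (sg e : R) : 0 < sg -> 0 < e ->
  (forall v, v \in l -> 1 < rnorm (symbol v.2)) ->
  exists t, (forall v, v \in gauss_list t -> 1 < rnorm (symbol v.2)) /\
    hb sg e (expsum l - expsum (gauss_list t)).
Proof.
move=> s0; elim: l e => [|v l IH] e e0 hl.
  exists [::]; split=> //; rewrite subrr.
  exact: (hb_le (ltW s0) (lexx _) (ltW e0) (hb0 E adm sg)).
have e2 : 0 < e / 2 by rewrite divr_gt0.
have e4 : 0 < e / 2 / 2 by rewrite divr_gt0.
have [|t [tV th]] := IH (e / 2) e2; first by move=> u ul; apply: hl; rewrite inE ul orbT.
have [d1 d10 hd1] := symbol_large_open (hl v (mem_head _ _)).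
have v1 : 0 < rnorm (v.1 : C) + 1 by rewrite ltr_wpDl ?rnorm_ge0.
have [d2 d20 hd2] := exp_continuous adm v.2 s0 (divr_gt0 e4 v1).
have [n] := @enumD_dense v.2 (Num.min d1 d2) ltac:(by rewrite lt_min d10).
rewrite lt_min => /andP[/hd1 n1 /hd2 n2].
have [B hB] := HNb_hb adm (expsum_set adm [:: (1, enumD n)]) s0.
have B0 := hb_ge0 hB; have B1 : 0 < B + 1 by rewrite ltr_wpDl.
have [a [b hab]] := gauss_dense v.1 (divr_gt0 e4 B1).
exists ((a, b, n) :: t); split.
  by move=> u; rewrite /gauss_list map_cons inE => /orP[/eqP ->|/tV].
rewrite /gauss_list map_cons -/(gauss_list t) (expsum_cons v l) (expsum_cons _ (gauss_list t)) [(_, _).1]/= [(_, _).2]/=.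
set X := expsum [:: (1, v.2)] in n2 *; set Y := expsum [:: (1, enumD n)] in n2 hB *.
have -> : v.1 *: X + expsum l - (gauss a b *: Y + expsum (gauss_list t)) =
    (v.1 *: - (Y - X) + (v.1 - gauss a b) *: Y) + (expsum l - expsum (gauss_list t)).
  rewrite opprD addrACA; congr (_ + _).
  by rewrite opprB scalerBr scalerBl addrA subrK.
rewrite [e]splitr; apply: (hbD adm (ltW s0)) => //.
rewrite [e / 2]splitr; apply: (hbD adm (ltW s0)).
  apply: (hb_le (ltW s0) (lexx _) _ (hbZ adm _ (ltW s0) (hbN adm (ltW s0) n2))).
  by rewrite mulrCA ler_piMr ?(ltW e4)// ler_pdivrMr// mul1r lerDl.
apply: (hb_le (ltW s0) (lexx _) _ (hbZ adm _ (ltW s0) hB)).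
apply: (@le_trans _ _ (e / 2 / 2 / (B + 1) * (B + 1))); last by rewrite divfK// gt_eqF.
by apply: ler_pM; rewrite ?rnorm_ge0// lerDl.
Qed.

Definition target k : elist :=
  if @unpickle (seq (rat * rat * nat)) k is Some t
  then [seq v <- gauss_list t | 1 < rnorm (symbol v.2)] else [::].

Lemma conv_hypercyclic : hypercyclic_on HNb_set (Gamma_bar T).
Proof.
have [L1 L2 _ _] := conv_operator adm T_dual rho0 K0 TK.
have L3 := conv_bounded adm T_dual rho0 K0 TK.
apply: (hypercyclic_criterion adm L2 L1 L3 (y := fun k => expsum (target k))).
- move=> f sg e fH s0 e0; have e2 : 0 < e / 2 by rewrite divr_gt0.
  have [psi hpsi] := symbol_large; have [d d0 hd] := symbol_large_open hpsi.
  have [l lV fl] := approximable_all adm d0 hd fH s0 e2.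
  have [t [tV lt]] := gauss_list_dense s0 e2 lV.
  exists (pickle t); rewrite /target pickleK.
  have -> : [seq v <- gauss_list t | 1 < rnorm (symbol v.2)] = gauss_list t.
    by apply/all_filterP/allP => v /tV.
  by rewrite [e]splitr; exact: (hb_trans adm (ltW s0) fl lt).
- move=> f k sg e fH s0 e0; apply: transitivity => // v.
  by rewrite /target; case: unpickle => [t|//]; rewrite mem_filter => /andP[].
Qed.

End dense_family.

End nonscalar.

End hypercyclicity.

Theorem theorem4p12 (R : realType) (E : completeNormedModType R[i])
    (r q s p : R) (r_gt1 : 1 < r) (q_gt1 : 1 < q) (s_ge1 : 1 <= s)
    (p_ge1 : 1 <= p) (r_le_q : r <= q)
    (s'_le_p' : (hoelder_conjugate s%:E <= hoelder_conjugate p%:E)%E)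
    (q_p' : forall n : nat, (0 < n)%N ->
      (1 <= (q%:E)^-1 + n%:R%:E / hoelder_conjugate p%:E)%E)
    (E'_BAP : bounded_approximation_property (dual E))
    (E'_separable : separable (dual E))
    (T : HNb E r q s p -> R[i]^o) (T_dual : HNb_dual T)
    (T_delta0 : ~ exists c : R[i],
      forall f, HNb_set f -> T f = c * f 0) :
  [/\ convolution_operator (Gamma_bar T),
      ~ (exists c : R[i], forall f, HNb_set f -> Gamma_bar T f = c *: f) &
      hypercyclic_on (@HNb_set R E r q s p) (Gamma_bar T)].
Proof.
have adm : admissible_exponents r q s p.
  exact: (admissible_exponentsP r_gt1 q_gt1 s_ge1 p_ge1 r_le_q s'_le_p' (q_p' 1%N isT)).
have [rho [K [rho0 K0 TK]]] := dual_hb adm T_dual.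
have [D [/countable_injP[iD D_inj]] D_dense] := E'_separable.
split.
- exact: (conv_operator adm T_dual rho0 K0 TK).
- move=> [c hc]; apply: T_delta0; exists c => f fH.
  by rewrite -conv_at0 hc.
- exact: (conv_hypercyclic adm T_dual rho0 K0 TK T_delta0 D_inj D_dense).
Qed.
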